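(* There is a universal constant $C>0$ such that the following holds. There is an algorithm running in time $2^{O(r)}\mathrm{poly}(n)$ which, given $\epsilon\in(0,1)$, a graph $G$ as in the context and an $(r,d,\lambda)$-spectral SSE flow routable in $G$ with $d\lambda\ge \frac{C}{\epsilon^2}\phi_{sparsest}$, outputs a cut of sparsity at most $(1+\epsilon)\phi_{sparsest}$.
   Context: $G=(V,E)$ is an undirected graph on $n$ vertices with capacities $c_e\ge0$, regular with normalized degree 1. Sparsity $\phi(S)=\frac{n\sum_{i\in S,j\notin S}c_{(i,j)}}{|S|(n-|S|)}$, $\phi_{sparsest}=\min_S\phi(S)$. A multicommodity flow in $G$ assigns symmetric demands $\delta_{i,j}\ge0$ and routes $\delta_{i,j}$ units between $i$ and $j$ along paths so that the total flow on each edge $e$ is at most $c_e$ (routable in $G$). Degree of $i$: $\sum_j\delta_{i,j}$. Its Laplacian is the Laplacian of the weighted graph with weights $\delta_{i,j}$. An $(r,d,\lambda)$-spectral SSE flow is a multicommodity flow whose degrees lie in $[d/2,d]$ and whose Laplacian has $r$-th smallest eigenvalue at least $d\lambda$. *)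

(* Defs.v *)
From mathcomp Require Import all_boot all_order all_algebra.
From mathcomp Require Import reals.

Set Implicit Arguments.
Unset Strict Implicit.
Unset Printing Implicit Defensive.

Import Order.TTheory GRing.Theory Num.Theory.
Local Open Scope ring_scope.

(** * Graphs and sparsity

    An undirected capacitated graph on the vertex set ['I_n] is given by its
    symmetric capacity matrix; its edges are the pairs of positive capacity. *)

Section Graphs.
Context {R : realType} {n : nat}.
Implicit Types (w c delta : 'M[R]_n) (S : {set 'I_n}).

Definition degree w (i : 'I_n) : R := \sum_j w i j.

Definition weighted_graph w : Prop :=
  [/\ w^T = w, forall i, w i i = 0 & forall i j, 0 <= w i j].

Definition regular_graph c : Prop :=
  weighted_graph c /\ forall i, degree c i = 1.

Definition is_cut S : bool := (S != set0) && (S != setT).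

Definition cut_capacity c S : R := \sum_(i in S) \sum_(j | j \notin S) c i j.

Definition sparsity c S : R :=
  n%:R * cut_capacity c S / (#|S|%:R * (n - #|S|)%:R).

Definition is_sparsest_value c (phi : R) : Prop :=
  (exists2 S, is_cut S & sparsity c S = phi) /\
  (forall S, is_cut S -> phi <= sparsity c S).

(** * Multicommodity flows *)

(* [(x, p, a)] sends [a] units of flow along the path [x :: p]. *)
Definition route : Type := ('I_n * seq 'I_n * R)%type.

Definition route_amount (f : route) : R := f.2.

Definition is_route c (f : route) : bool :=
  let: (x, p, a) := f in
  [&& path (fun u v => 0 < c u v) x p, uniq (x :: p) & 0 <= a].

Definition joins (i j : 'I_n) (f : route) : bool :=
  let: (x, p, _) := f in
  ((x == i) && (last x p == j)) || ((x == j) && (last x p == i)).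

(* [zip (x :: p) p] lists the pairs of consecutive vertices of [x :: p]. *)
Definition uses_edge (u v : 'I_n) (f : route) : bool :=
  let: (x, p, _) := f in
  ((u, v) \in zip (x :: p) p) || ((v, u) \in zip (x :: p) p).

(* The demand of the unordered pair {i, j} is [delta i j = delta j i], counted
   once. *)
Definition routable c delta : Prop :=
  exists F : seq route,
    [/\ forall f, f \in F -> is_route c f,
        forall i j, i != j ->
          \sum_(f <- F | joins i j f) route_amount f = delta i j
      & forall u v, \sum_(f <- F | uses_edge u v f) route_amount f <= c u v].

Definition multicommodity_flow c delta : Prop :=
  weighted_graph delta /\ routable c delta.

Definition laplacian w : 'M[R]_n := diag_mx (\row_i degree w i) - w.

(* [s] lists the eigenvalues of [A] in increasing order, with multiplicity. *)
Definition is_spectrum (A : 'M[R]_n) (s : seq R) : Prop :=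
  sorted <=%R s /\ char_poly A = \prod_(x <- s) ('X - x%:P).

(* Ranks are counted from 1. *)
Definition is_smallest_eigenvalue (r : nat) (A : 'M[R]_n) (mu : R) : Prop :=
  exists2 s, is_spectrum A s & (0 < r <= size s)%N /\ nth 0 s r.-1 = mu.

Definition spectral_SSE_flow (r : nat) (d lambda : R) c delta : Prop :=
  [/\ multicommodity_flow c delta,
      forall i, d / 2 <= degree delta i <= d
    & exists2 mu, is_smallest_eigenvalue r (laplacian delta) mu
                & d * lambda <= mu].

End Graphs.

(** * Algorithms over the reals

    Structured programs for a real RAM: one memory of natural numbers (used for
    indices and addresses) and one memory of real numbers.  Every instruction
    and every test costs one unit of time.  Indices only have addition and
    truncated subtraction (no unit-cost multiplication), real arithmetic has the
    field operations and comparison (no rounding to an index), and the only real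
    constants are 0 and 1, so that a program carries no real-valued advice. *)

Inductive instr : Type :=
  | IConst (a k : nat)    (* I[a] := k *)
  | IAdd (a b c : nat)    (* I[a] := I[b] + I[c] *)
  | ISub (a b c : nat)    (* I[a] := I[b] - I[c] *)
  | ILoad (a b : nat)     (* I[a] := I[I[b]] *)
  | IStore (a b : nat)    (* I[I[a]] := I[b] *)
  | RZero (a : nat)       (* R[a] := 0 *)
  | ROne (a : nat)        (* R[a] := 1 *)
  | RAdd (a b c : nat)    (* R[a] := R[b] + R[c] *)
  | RSub (a b c : nat)    (* R[a] := R[b] - R[c] *)
  | RMul (a b c : nat)    (* R[a] := R[b] * R[c] *)
  | RDiv (a b c : nat)    (* R[a] := R[b] / R[c], with x / 0 = 0 *)
  | RLoad (a b : nat)     (* R[a] := R[I[b]] *)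
  | RStore (a b : nat).   (* R[I[a]] := R[b] *)

Inductive test : Type :=
  | ILt (a b : nat)       (* I[a] < I[b] *)
  | RLt (a b : nat).      (* R[a] < R[b] *)

Inductive program : Type :=
  | Skip
  | Do (i : instr)
  | Seq (p q : program)
  | If (b : test) (p q : program)
  | While (b : test) (p : program).

Section Semantics.
Context {R : realType}.

Record state : Type := State { imem : nat -> nat; rmem : nat -> R }.

Definition set_imem (s : state) (a v : nat) : state :=
  State [eta imem s with a |-> v] (rmem s).

Definition set_rmem (s : state) (a : nat) (v : R) : state :=
  State (imem s) [eta rmem s with a |-> v].

Definition exec_instr (i : instr) (s : state) : state :=
  match i with
  | IConst a k => set_imem s a k
  | IAdd a b c => set_imem s a (imem s b + imem s c)%N
  | ISub a b c => set_imem s a (imem s b - imem s c)%N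
  | ILoad a b => set_imem s a (imem s (imem s b))
  | IStore a b => set_imem s (imem s a) (imem s b)
  | RZero a => set_rmem s a 0
  | ROne a => set_rmem s a 1
  | RAdd a b c => set_rmem s a (rmem s b + rmem s c)
  | RSub a b c => set_rmem s a (rmem s b - rmem s c)
  | RMul a b c => set_rmem s a (rmem s b * rmem s c)
  | RDiv a b c => set_rmem s a (rmem s b / rmem s c)
  | RLoad a b => set_rmem s a (rmem s (imem s b))
  | RStore a b => set_rmem s (imem s a) (rmem s b)
  end.

Definition eval_test (b : test) (s : state) : bool :=
  match b with
  | ILt a b => (imem s a < imem s b)%N
  | RLt a b => rmem s a < rmem s b
  end.

(* [exec p s t s']: started in [s], [p] halts in [s'] after [t] time units. *)
Inductive exec : program -> state -> nat -> state -> Prop :=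
  | ExecSkip s : exec Skip s 0 s
  | ExecDo i s : exec (Do i) s 1 (exec_instr i s)
  | ExecSeq p q s t s' t' s'' :
      exec p s t s' -> exec q s' t' s'' -> exec (Seq p q) s (t + t') s''
  | ExecIfTrue b p q s t s' :
      eval_test b s -> exec p s t s' -> exec (If b p q) s t.+1 s'
  | ExecIfFalse b p q s t s' :
      ~~ eval_test b s -> exec q s t s' -> exec (If b p q) s t.+1 s'
  | ExecWhileTrue b p s t s' t' s'' :
      eval_test b s -> exec p s t s' -> exec (While b p) s' t' s'' ->
      exec (While b p) s (t + t').+1 s''
  | ExecWhileFalse b p s : ~~ eval_test b s -> exec (While b p) s 1 s.

Lemma exec_det p s t1 s1 t2 s2 :
  exec p s t1 s1 -> exec p s t2 s2 -> t1 = t2 /\ s1 = s2.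
Proof.
move=> e1; elim: e1 t2 s2 => {p s t1 s1}.
- by move=> s t2 s2 e; inversion e.
- by move=> i s t2 s2 e; inversion e.
- move=> p q s t s' t' s'' _ IHp _ IHq t2 s2 e.
  inversion e as [| |? ? ? ? ? ? ? ep eq| | | |]; subst.
  have [? ?] := IHp _ _ ep; subst.
  by have [-> ->] := IHq _ _ eq.
- move=> b p q s t s' bT _ IH t2 s2 e.
  inversion e as [| | |? ? ? ? ? ? b' ep|? ? ? ? ? ? b' ep| |]; subst.
    by have [-> ->] := IH _ _ ep.
  by rewrite bT in b'.
- move=> b p q s t s' bF _ IH t2 s2 e.
  inversion e as [| | |? ? ? ? ? ? b' ep|? ? ? ? ? ? b' ep| |]; subst.
    by rewrite b' in bF.
  by have [-> ->] := IH _ _ ep.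
- move=> b p s t s' t' s'' bT _ IHp _ IHw t2 s2 e.
  inversion e as [| | | | |? ? ? ? ? ? ? b' ep ew|? ? ? b']; subst.
    have [? ?] := IHp _ _ ep; subst.
    by have [-> ->] := IHw _ _ ew.
  by rewrite bT in b'.
- move=> b p s bF t2 s2 e.
  inversion e as [| | | | |? ? ? ? ? ? ? b' ep ew|? ? ? b']; subst => //.
  by rewrite b' in bF.
Qed.

Definition entries n (A : 'M[R]_n) : seq R :=
  [seq A i j | i <- enum 'I_n, j <- enum 'I_n].

(* The input is stored at the beginning of the two memories, matrices in
   row-major order; all other cells contain 0. *)
Definition input n (r : nat) (eps : R) (c : 'M[R]_n)
    (d lambda : R) (delta : 'M[R]_n) : state :=
  State (nth 0%N [:: n; r])
        (nth 0 ([:: eps; d; lambda] ++ entries c ++ entries delta)).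

(* The output cut is read off the first [n] cells of the index memory. *)
Definition output n (s : state) : {set 'I_n} := [set i : 'I_n | imem s i != 0%N].

End Semantics.

(* Main.v *)
(* Let S be a sparsest cut with |S| <= n/2.  As the flow is routable in G, the
   indicator x of S has energy x^T L x <= phi |S| for the Laplacian L of the
   flow; as the r-th eigenvalue of L is at least h = d lambda, x is within squared
   distance O(phi |S| / h) = O(eps^2 |S| / C) of the span of the first r
   eigenvectors.  That span is approximated by 2r vectors: pivoted Gram-Schmidt on
   the columns of (1 + L/h)^(-32n), where the resolvent comes from rank-one updates.

   Boolean vectors close to the span W of these 2r vectors are searched at scales
   n, n/2, n/4, ...  Each point of a net of W at the previous scale is moved along
   all short lattice walks, and the results are kept that are close to a Boolean
   vector and whose roundings are far apart.  A random set of coordinates, drawn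
   with probability proportional to principal minors, determines most of the
   Boolean vectors close to W: hence the nets have at most 2^(8r+1) points.

   At the right scale some rounded net point T0 has |S - T0| + |T0 - S| at most
   eps^2 |S| / 800.  With b = eps |S| / 8, minimizing the ratio of the capacity of
   T to b - |T - T0| - |T0 - T| then gives a cut of sparsity at most
   (1 + eps) phi.  Newton's method takes at most n steps, each of them a minimum
   cut, found by push-relabel.

   The algorithm is a program of a structured language, compiled to the real RAM,
   in which the loop bounds n, O(r), 2^O(r) are variables that never change inside
   loops; its cost is therefore a polynomial in these bounds. *)

Require Import Defs.
From mathcomp Require Import all_boot all_order all_algebra fingroup perm.
From mathcomp Require Import boolp reals.
From mathcomp Require Import zify ring lra.
Set Implicit Arguments.
Unset Strict Implicit.
Unset Printing Implicit Defensive.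
Import Order.TTheory GRing.Theory Num.Theory.
Local Open Scope ring_scope.

(** * A structured language *)

(** The machine has no square roots, no eigenvectors and no rounding of a real to an index. Only
    rational functions of [L] are available, so the low eigenspace is approximated by more vectors
    than its dimension; and net points cannot be located by coordinates, so every word of length
    O(r) is tried as a walk, the analysis showing only that one of them succeeds. Halving the scale
    keeps the walks short, and packing caps the kept points independently of n and of the number of
    trials.

    The power 32n makes the damping of high eigenvalues beat both the growth 4^q of the elimination
    coefficients and the factor (9/8)^(32n) lost on the low ones.

    The denominator |T|(n - |T|) of the sparsity does not lead to a minimum cut. Near S it is almost
    constant, and the denominator b - |T - T0| - |T0 - T| keeps T near S while its parametric
    subproblems are minimum cuts. The size of S is unknown, so all sizes are tried for b.

    If phi = 0 the hypothesis does not make h positive; the connected component of a vertex is then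
    an optimal cut.

    The constant C = 10^9 absorbs all constant losses of the nets. *)

Inductive nexp : Type :=
  | NConst of nat
  | NVar of nat
  | NIdx of nat
  | NRow of nat
  | NPlus of nexp & nexp
  | NMinus of nexp & nexp.

Inductive binop : Type := OAdd | OSub | OMul | ODiv.

Inductive rexp : Type :=
  | EZero
  | EOne
  | ECell of nat & nexp
  | EBin of binop & rexp & rexp
  | EIfR of rexp & rexp & rexp & rexp
  | EIfN of nexp & nexp & rexp & rexp
  | ESum of nat & rexp.

Inductive cmd : Type :=
  | CSkip
  | CNat of nat & nexp
  | CReal of nat & nexp & rexp
  | CFill of nat & nexp & nat & rexp
  | CSeq of cmd & cmd
  | CIfR of rexp & rexp & cmd & cmd
  | CIfN of nexp & nexp & cmd & cmd
  | CFor of nat & nat & cmd.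

Section Language.
Context {R : realType}.

Record store : Type := Store { nv : nat -> nat; ra : nat -> nat -> R }.

Definition upd {T : Type} (f : nat -> T) (a : nat) (v : T) : nat -> T :=
  fun x => if x == a then v else f x.

Definition setn (s : store) (x v : nat) : store := Store (upd (nv s) x v) (ra s).

Definition seta (s : store) (a : nat) (f : nat -> R) : store :=
  Store (nv s) (upd (ra s) a f).

(** [NRow d] is a row offset in a matrix stored by rows. The machine cannot multiply indices in unit
    time, so this product is a separate value that compiled loops increase by the row length, kept
    in variable 0. *)
Fixpoint neval (s : store) (b : nat -> nat) (e : nexp) : nat :=
  match e with
  | NConst k => k
  | NVar x => nv s x
  | NIdx d => b d
  | NRow d => (b d * nv s 0)%N
  | NPlus e f => (neval s b e + neval s b f)%N
  | NMinus e f => (neval s b e - neval s b f)%N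
  end.

Definition beval (o : binop) (x y : R) : R :=
  match o with OAdd => x + y | OSub => x - y | OMul => x * y | ODiv => x / y end.

Fixpoint reval (s : store) (d : nat) (b : nat -> nat) (e : rexp) : R :=
  match e with
  | EZero => 0
  | EOne => 1
  | ECell a i => ra s a (neval s b i)
  | EBin o e f => beval o (reval s d b e) (reval s d b f)
  | EIfR x y e f =>
      if reval s d b x < reval s d b y then reval s d b e else reval s d b f
  | EIfN x y e f =>
      if (neval s b x < neval s b y)%N then reval s d b e else reval s d b f
  | ESum y e => \sum_(i < nv s y) reval s d.+1 (upd b d i) e
  end.

(* Environment of the bound indices when none is in scope. *)
Definition noidx : nat -> nat := fun=> 0%N.

(** A loop is an [iteri], hence every command terminates. Variable [x] counts and [x.+1] follows
    with the matching row offset; both are set afresh before each iteration and once more at the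
    end, to the values that the machine loop leaves. [CFill] computes all its cells from the old
    store. *)
Fixpoint run (c : cmd) (s : store) : store :=
  match c with
  | CSkip => s
  | CNat x e => setn s x (neval s noidx e)
  | CReal a i e =>
      seta s a (upd (ra s a) (neval s noidx i) (reval s 0 noidx e))
  | CFill a o y e =>
      let f := neval s noidx o in
      seta s a (fun m => if (f <= m < f + nv s y)%N
                         then reval s 1 (upd noidx 0 (m - f)%N) e else ra s a m)
  | CSeq c c' => run c' (run c s)
  | CIfR x y c c' =>
      if reval s 0 noidx x < reval s 0 noidx y then run c s else run c' s
  | CIfN x y c c' =>
      if (neval s noidx x < neval s noidx y)%N then run c s else run c' s
  | CFor x y c =>
      let s' := iteri (nv s y) (fun i s' =>
        run c (setn (setn s' x i) x.+1 (i * nv s' 0))) s in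
      setn (setn s' x (nv s y)) x.+1 (nv s y * nv s 0)
  end.

Fixpoint nassigned (c : cmd) : seq nat :=
  match c with
  | CNat x _ => [:: x]
  | CSeq c c' | CIfR _ _ c c' | CIfN _ _ c c' => nassigned c ++ nassigned c'
  | CFor x _ c => [:: x, x.+1 & nassigned c]
  | _ => [::]
  end.

Fixpoint rassigned (c : cmd) : seq nat :=
  match c with
  | CReal a _ _ | CFill a _ _ _ => [:: a]
  | CSeq c c' | CIfR _ _ c c' | CIfN _ _ c c' => rassigned c ++ rassigned c'
  | CFor _ _ c => rassigned c
  | _ => [::]
  end.

Fixpoint ebounds (e : rexp) : seq nat :=
  match e with
  | EBin _ e f => ebounds e ++ ebounds f
  | EIfR x y e f => ebounds x ++ ebounds y ++ ebounds e ++ ebounds f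
  | EIfN _ _ e f => ebounds e ++ ebounds f
  | ESum y e => y :: ebounds e
  | _ => [::]
  end.

Fixpoint bounds (c : cmd) : seq nat :=
  match c with
  | CReal _ _ e => ebounds e
  | CFill _ _ y e => y :: ebounds e
  | CSeq c c' => bounds c ++ bounds c'
  | CIfR x y c c' => ebounds x ++ ebounds y ++ bounds c ++ bounds c'
  | CIfN _ _ c c' => bounds c ++ bounds c'
  | CFor _ y c => y :: bounds c
  | _ => [::]
  end.

Fixpoint reads (a : nat) (e : rexp) : bool :=
  match e with
  | ECell a' _ => a' == a
  | EBin _ e f => reads a e || reads a f
  | EIfR x y e f => [|| reads a x, reads a y, reads a e | reads a f]
  | EIfN _ _ e f => reads a e || reads a f
  | ESum _ e => reads a e
  | _ => false
  end.

Fixpoint nclosed (d : nat) (e : nexp) : bool :=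
  match e with
  | NIdx k | NRow k => (k < d)%N
  | NPlus e f | NMinus e f => nclosed d e && nclosed d f
  | _ => true
  end.

Fixpoint eclosed (d : nat) (e : rexp) : bool :=
  match e with
  | ECell a i => (a < 31)%N && nclosed d i
  | EBin _ e f => eclosed d e && eclosed d f
  | EIfR x y e f => [&& eclosed d x, eclosed d y, eclosed d e & eclosed d f]
  | EIfN x y e f => [&& nclosed d x, nclosed d y, eclosed d e & eclosed d f]
  | ESum _ e => eclosed d.+1 e
  | _ => true
  end.

(** A [CFill] is simultaneous while the machine writes cell after cell, hence its expression may not
    read the array being filled. The residue 31 modulo 32 belongs to the real temporaries, hence
    arrays are numbered below 31. A loop body may not change the two counters, which the machine
    increments in place. *)
Fixpoint cclosed (c : cmd) : bool :=
  match c with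
  | CSkip => true
  | CNat _ e => nclosed 0 e
  | CReal a i e => [&& (a < 31)%N, nclosed 0 i & eclosed 0 e]
  | CFill a o _ e => [&& (a < 31)%N, nclosed 0 o, eclosed 1 e & ~~ reads a e]
  | CSeq c c' => cclosed c && cclosed c'
  | CIfR x y c c' => [&& eclosed 0 x, eclosed 0 y, cclosed c & cclosed c']
  | CIfN x y c c' => [&& nclosed 0 x, nclosed 0 y, cclosed c & cclosed c']
  | CFor x _ c => [&& cclosed c, x \notin nassigned c & x.+1 \notin nassigned c]
  end.

(* The variable 0 holds the row length, hence is never assigned either. *)
Definition wf (c : cmd) : bool :=
  cclosed c && all (fun x => x \notin nassigned c) (0%N :: bounds c).

Fixpoint ncost (e : nexp) : nat :=
  match e with
  | NConst _ => 1
  | NPlus e f | NMinus e f => (ncost e + ncost f + 1)%N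
  | _ => 2
  end.

(** An upper bound that depends only on the values [v] of the bounding variables, not on the data:
    the costs of both branches of a conditional are added. *)
Fixpoint ecost (v : nat -> nat) (e : rexp) : nat :=
  match e with
  | EZero | EOne => 1
  | ECell _ i => (ncost i + 8)%N
  | EBin _ e f => (ecost v e + ecost v f + 1)%N
  | EIfR x y e f =>
      (ecost v x + ecost v y + ecost v e + ecost v f + 1)%N
  | EIfN x y e f => (ncost x + ncost y + ecost v e + ecost v f + 1)%N
  | ESum y e => (v y * (ecost v e + 5) + 4)%N
  end.

Fixpoint ccost (v : nat -> nat) (c : cmd) : nat :=
  match c with
  | CSkip => 0
  | CNat _ e => (ncost e + 2)%N
  | CReal _ i e => (ecost v e + ncost i + 8)%N
  | CFill _ o y e => (v y * (ecost v e + ncost o + 15) + 3)%N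
  | CSeq c c' => (ccost v c + ccost v c')%N
  | CIfR x y c c' => (ecost v x + ecost v y + ccost v c + ccost v c' + 1)%N
  | CIfN x y c c' => (ncost x + ncost y + ccost v c + ccost v c' + 1)%N
  | CFor _ y c => (v y * (ccost v c + 4) + 3)%N
  end.

Lemma updE T (f : nat -> T) a v x : upd f a v x = if x == a then v else f x.
Proof. by []. Qed.

Lemma neval_ext s1 s2 b1 b2 d e : nv s1 =1 nv s2 ->
  (forall k, (k < d)%N -> b1 k = b2 k) -> nclosed d e ->
  neval s1 b1 e = neval s2 b2 e.
Proof.
move=> en eb; elim: e => //= [k|e IHe f IHf|e IHe f IHf].
- by move=> kd; rewrite eb ?en.
- by move=> /andP[/IHe -> /IHf ->].
- by move=> /andP[/IHe -> /IHf ->].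
Qed.

Lemma reval_ext s1 s2 d b1 b2 e : nv s1 =1 nv s2 ->
  (forall a, reads a e -> ra s1 a =1 ra s2 a) ->
  (forall k, (k < d)%N -> b1 k = b2 k) -> eclosed d e ->
  reval s1 d b1 e = reval s2 d b2 e.
Proof.
move=> en; elim: e d b1 b2 => //=.
- move=> a i d b1 b2 er eb /andP[_ ci].
  by rewrite (neval_ext en eb ci) er.
- move=> o e IHe f IHf d b1 b2 er eb /andP[ce cf].
  rewrite (IHe d b1 b2) ?(IHf d b1 b2) // => a ra; apply: er; rewrite ra ?orbT //.
- move=> x IHx y IHy e IHe f IHf d b1 b2 er eb /and4P[cx cy ce cf].
  rewrite (IHx d b1 b2) ?(IHy d b1 b2) ?(IHe d b1 b2) ?(IHf d b1 b2) // => a ra;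
    by apply: er; rewrite ra ?orbT.
- move=> x y e IHe f IHf d b1 b2 er eb /and4P[cx cy ce cf].
  rewrite (neval_ext en eb cx) (neval_ext en eb cy).
  by rewrite (IHe d b1 b2) ?(IHf d b1 b2) // => a ra; apply: er; rewrite ra ?orbT.
- move=> y e IHe d b1 b2 er eb ce; rewrite en; apply: eq_bigr => i _.
  apply: IHe => // k; rewrite ltnS leq_eqVlt /upd => /orP[/eqP->|kd].
    by rewrite eqxx.
  by case: eqP => // _; apply: eb.
Qed.

Lemma ecost_ext v1 v2 e :
  (forall y, y \in ebounds e -> v1 y = v2 y) -> ecost v1 e = ecost v2 e.
Proof.
elim: e => //=.
- by move=> o e IHe f IHf h; rewrite IHe ?IHf // => y yb; apply: h;
    rewrite mem_cat yb ?orbT.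
- by move=> x IHx y IHy e IHe f IHf h; rewrite IHx ?IHy ?IHe ?IHf // => z zb;
    apply: h; rewrite !mem_cat zb ?orbT.
- by move=> x y e IHe f IHf h; rewrite IHe ?IHf // => z zb; apply: h;
    rewrite mem_cat zb ?orbT.
- move=> y e IHe h; rewrite h ?mem_head // IHe // => z zb; apply: h.
  by rewrite in_cons zb orbT.
Qed.

Lemma ccost_ext v1 v2 c :
  (forall y, y \in bounds c -> v1 y = v2 y) -> ccost v1 c = ccost v2 c.
Proof.
elim: c => //=.
- by move=> a i e h; rewrite (ecost_ext h).
- move=> a o y e h; rewrite h ?mem_head // (@ecost_ext v1 v2) // => z zb.
  by apply: h; rewrite in_cons zb orbT.
- by move=> c IHc c' IHc' h; rewrite IHc ?IHc' // => z zb; apply: h;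
    rewrite mem_cat zb ?orbT.
- move=> x y c IHc c' IHc' h.
  by rewrite (@ecost_ext v1 v2 x) ?(@ecost_ext v1 v2 y) ?IHc ?IHc' // => z zb;
    apply: h; rewrite !mem_cat zb ?orbT.
- by move=> x y c IHc c' IHc' h; rewrite IHc ?IHc' // => z zb; apply: h;
    rewrite mem_cat zb ?orbT.
- move=> x y c IHc h; rewrite h ?mem_head // IHc // => z zb; apply: h.
  by rewrite in_cons zb orbT.
Qed.

Lemma iteri_ind T (I : nat -> T -> Prop) m (F : nat -> T -> T) x :
  I 0 x -> (forall i y, (i < m)%N -> I i y -> I i.+1 (F i y)) -> I m (iteri m F x).
Proof.
move=> I0 IS; have : forall k, (k <= m)%N -> I k (iteri k F x).
  by elim=> // k IH km; apply: IS => //; apply: IH; apply: ltnW.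
exact.
Qed.

Lemma run_nv c s x : x \notin nassigned c -> nv (run c s) x = nv s x.
Proof.
elim: c s => //=.
- by move=> y e s; rewrite inE /upd => /negbTE ->.
- move=> c IHc c' IHc' s; rewrite mem_cat negb_or => /andP[h h'].
  by rewrite IHc' ?IHc.
- move=> e f c IHc c' IHc' s; rewrite mem_cat negb_or => /andP[h h'].
  by case: ifP => _; rewrite ?IHc' ?IHc.
- move=> e f c IHc c' IHc' s; rewrite mem_cat negb_or => /andP[h h'].
  by case: ifP => _; rewrite ?IHc' ?IHc.
- move=> y z c IHc s; rewrite !inE !negb_or => /and3P[/negbTE h /negbTE h' h''].
  rewrite /upd h h'.
  apply: (@iteri_ind _ (fun _ s' => nv s' x = nv s x)) => // i s' _ <-.
  by rewrite IHc //= /upd h h'.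
Qed.

Lemma run_ra c s a : a \notin rassigned c -> ra (run c s) a = ra s a.
Proof.
elim: c s => //=.
- by move=> y i e s; rewrite inE /upd => /negbTE ->.
- by move=> y i e z s; rewrite inE /upd => /negbTE ->.
- move=> c IHc c' IHc' s; rewrite mem_cat negb_or => /andP[h h'].
  by rewrite IHc' ?IHc.
- move=> e f c IHc c' IHc' s; rewrite mem_cat negb_or => /andP[h h'].
  by case: ifP => _; rewrite ?IHc' ?IHc.
- move=> e f c IHc c' IHc' s; rewrite mem_cat negb_or => /andP[h h'].
  by case: ifP => _; rewrite ?IHc' ?IHc.
- move=> y z c IHc s h.
  apply: (@iteri_ind _ (fun _ s' => ra s' a = ra s a)) => // i s' _ <-.
  by rewrite IHc.
Qed.

End Language.

(** * Compilation to the real RAM *)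

(* Layout of the index memory: the variable [x] is at [3 * x], the temporaries
   at the addresses 2 modulo 3, and the bound index [d] and its multiple by the
   row length at [islot d] and [wslot d].  Real temporaries are at [rslot p]. *)
Local Notation nslot q := (3 * q + 2)%N.
Local Notation rslot p := (32 * p + 31)%N.
Local Notation islot d := (6 * d + 1)%N.
Local Notation wslot d := (6 * d + 4)%N.

Fixpoint ncomp (q : nat) (e : nexp) : program :=
  match e with
  | NConst k => Do (IConst (nslot q) k)
  | NVar x => Seq (Do (IConst (nslot q) 0)) (Do (IAdd (nslot q) (nslot q) (3 * x)))
  | NIdx d => Seq (Do (IConst (nslot q) 0)) (Do (IAdd (nslot q) (nslot q) (islot d)))
  | NRow d => Seq (Do (IConst (nslot q) 0)) (Do (IAdd (nslot q) (nslot q) (wslot d)))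
  | NPlus e f => Seq (ncomp q e) (Seq (ncomp q.+1 f)
                   (Do (IAdd (nslot q) (nslot q) (nslot q.+1))))
  | NMinus e f => Seq (ncomp q e) (Seq (ncomp q.+1 f)
                    (Do (ISub (nslot q) (nslot q) (nslot q.+1))))
  end.

(* Cell [j] of the array [a < 32] is stored at the address [32 * j + a]. *)
Definition acomp (a : nat) (e : nexp) : program :=
  Seq (ncomp 0 e) (Seq (Do (IAdd 2 2 2)) (Seq (Do (IAdd 2 2 2))
    (Seq (Do (IAdd 2 2 2)) (Seq (Do (IAdd 2 2 2)) (Seq (Do (IAdd 2 2 2))
      (Seq (Do (IConst 5 a)) (Do (IAdd 2 2 5)))))))).

Definition bcomp (o : binop) : nat -> nat -> nat -> instr :=
  match o with OAdd => RAdd | OSub => RSub | OMul => RMul | ODiv => RDiv end.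

Definition bump_idx (d : nat) : program :=
  Seq (Do (IConst 2 1)) (Seq (Do (IAdd (islot d) (islot d) 2))
    (Do (IAdd (wslot d) (wslot d) 0))).

Fixpoint rcomp (d p : nat) (e : rexp) : program :=
  match e with
  | EZero => Do (RZero (rslot p))
  | EOne => Do (ROne (rslot p))
  | ECell a i => Seq (acomp a i) (Do (RLoad (rslot p) 2))
  | EBin o e f => Seq (rcomp d p e) (Seq (rcomp d p.+1 f)
                    (Do (bcomp o (rslot p) (rslot p) (rslot p.+1))))
  | EIfR x y e f => Seq (rcomp d p x) (Seq (rcomp d p.+1 y)
                      (If (RLt (rslot p) (rslot p.+1)) (rcomp d p e) (rcomp d p f)))
  | EIfN x y e f => Seq (ncomp 0 x) (Seq (ncomp 1 y)
                      (If (ILt 2 5) (rcomp d p e) (rcomp d p f)))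
  | ESum y e =>
      Seq (Do (RZero (rslot p))) (Seq (Do (IConst (islot d) 0))
        (Seq (Do (IConst (wslot d) 0)) (While (ILt (islot d) (3 * y))
          (Seq (rcomp d.+1 p.+1 e)
            (Seq (Do (RAdd (rslot p) (rslot p) (rslot p.+1))) (bump_idx d))))))
  end.

Fixpoint ccomp (c : cmd) : program :=
  match c with
  | CSkip => Skip
  | CNat x e => Seq (ncomp 0 e) (Seq (Do (IConst 5 0)) (Do (IAdd (3 * x) 2 5)))
  | CReal a i e => Seq (rcomp 0 0 e) (Seq (acomp a i) (Do (RStore 2 31)))
  | CFill a o y e =>
      Seq (Do (IConst 1 0)) (Seq (Do (IConst 4 0)) (While (ILt 1 (3 * y))
        (Seq (rcomp 1 0 e) (Seq (acomp a (NPlus o (NIdx 0)))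
          (Seq (Do (RStore 2 31)) (bump_idx 0))))))
  | CSeq c c' => Seq (ccomp c) (ccomp c')
  | CIfR x y c c' => Seq (rcomp 0 0 x) (Seq (rcomp 0 1 y)
                       (If (RLt 31 63) (ccomp c) (ccomp c')))
  | CIfN x y c c' => Seq (ncomp 0 x) (Seq (ncomp 1 y)
                       (If (ILt 2 5) (ccomp c) (ccomp c')))
  | CFor x y c =>
      Seq (Do (IConst (3 * x) 0)) (Seq (Do (IConst (3 * x.+1) 0))
        (While (ILt (3 * x) (3 * y)) (Seq (ccomp c) (Seq (Do (IConst 2 1))
          (Seq (Do (IAdd (3 * x) (3 * x) 2))
            (Do (IAdd (3 * x.+1) (3 * x.+1) 0)))))))
  end.

Section Compiler.
Context {R : realType}.
Implicit Types (m : @state R) (s : @store R).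

Record rel s (d : nat) (b : nat -> nat) m : Prop := Rel {
  rel_nv : forall x, imem m (3 * x)%N = nv s x;
  rel_idx : forall k, (k < d)%N -> imem m (islot k) = b k;
  rel_row : forall k, (k < d)%N -> imem m (wslot k) = (b k * nv s 0)%N;
  rel_ra : forall a j, (a < 31)%N -> rmem m (32 * j + a)%N = ra s a j }.

Lemma rel_frame s d b m m' :
  (forall x, (x %% 3)%N != 2 -> imem m' x = imem m x) ->
  (forall x, (x %% 32)%N != 31 -> rmem m' x = rmem m x) ->
  rel s d b m -> rel s d b m'.
Proof.
move=> hi hr [h1 h2 h3 h4]; split.
- by move=> x; rewrite hi ?h1 //; lia.
- by move=> k kd; rewrite hi ?h2 //; lia.
- by move=> k kd; rewrite hi ?h3 //; lia.
- by move=> a j a31; rewrite hr ?h4 //; lia.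
Qed.

(** Evaluation at depth [q] writes only temporaries from [nslot q] on, so that the left operand
    survives the evaluation of the right one. *)
Lemma ncompP s d b m q e : nclosed d e -> rel s d b m ->
  exists m', [/\ exec (ncomp q e) m (ncost e) m', imem m' (nslot q) = neval s b e,
    forall x, ((x %% 3)%N != 2) || (x < nslot q)%N -> imem m' x = imem m x
    & rmem m' = rmem m].
Proof.
have frame m1 y v x : ((x %% 3)%N != 2) || (x < nslot y)%N ->
    imem (set_imem m1 (nslot y) v) x = imem m1 x.
  by move=> h /=; case: eqP => // xy; lia.
have cpy m1 y a : (a %% 3 != 2)%N -> exists m', [/\
    exec (Seq (Do (IConst (nslot y) 0)) (Do (IAdd (nslot y) (nslot y) a))) m1 2 m',
    imem m' (nslot y) = imem m1 a,
    forall x, ((x %% 3)%N != 2) || (x < nslot y)%N -> imem m' x = imem m1 x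
    & rmem m' = rmem m1].
  move=> ha; exists (exec_instr (IAdd (nslot y) (nslot y) a) (set_imem m1 (nslot y) 0)).
  split=> //.
  - by apply: (@ExecSeq _ _ _ _ 1 _ 1); exact: ExecDo.
  - by rewrite /= !eqxx; case: eqP => // h; lia.
  - by move=> x hx; rewrite (frame _ y) // frame.
elim: e q m => [k|k|k|k|e IHe f IHf|e IHe f IHf] q m /=.
- move=> _ _; exists (set_imem m (nslot q) k); split=> //.
  + exact: ExecDo.
  + by rewrite /= eqxx.
  + by move=> x /frame.
- move=> _ hr; have [|m' [h1 h2 h3 h4]] := cpy m q (3 * k)%N; first by lia.
  by exists m'; split=> //; rewrite h2 (rel_nv hr).
- move=> kd hr; have [|m' [h1 h2 h3 h4]] := cpy m q (islot k)%N; first by lia.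
  by exists m'; split=> //; rewrite h2 (rel_idx hr).
- move=> kd hr; have [|m' [h1 h2 h3 h4]] := cpy m q (wslot k)%N; first by lia.
  by exists m'; split=> //; rewrite h2 (rel_row hr).
- move=> /andP[ce cf] hr; have [m1 [e1 v1 f1 r1]] := IHe q m ce hr.
  have hr1 : rel s d b m1.
    by apply: rel_frame hr => x h; rewrite ?r1 ?f1 ?h.
  have [m2 [e2 v2 f2 r2]] := IHf q.+1 m1 cf hr1.
  exists (exec_instr (IAdd (nslot q) (nslot q) (nslot q.+1)) m2); split.
  + rewrite -addnA; apply: ExecSeq e1 _; apply: ExecSeq e2 _; exact: ExecDo.
  + by rewrite /= eqxx v2 f2 ?v1 //; lia.
  + by move=> x hx; rewrite frame // f2 ?f1 //; lia.
  + by rewrite /= r2.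
- move=> /andP[ce cf] hr; have [m1 [e1 v1 f1 r1]] := IHe q m ce hr.
  have hr1 : rel s d b m1.
    by apply: rel_frame hr => x h; rewrite ?r1 ?f1 ?h.
  have [m2 [e2 v2 f2 r2]] := IHf q.+1 m1 cf hr1.
  exists (exec_instr (ISub (nslot q) (nslot q) (nslot q.+1)) m2); split.
  + rewrite -addnA; apply: ExecSeq e1 _; apply: ExecSeq e2 _; exact: ExecDo.
  + by rewrite /= eqxx v2 f2 ?v1 //; lia.
  + by move=> x hx; rewrite frame // f2 ?f1 //; lia.
  + by rewrite /= r2.
Qed.

Lemma acompP s d b m a e : nclosed d e -> rel s d b m ->
  exists m', [/\ exec (acomp a e) m (ncost e + 7) m',
    imem m' 2 = (32 * neval s b e + a)%N,
    forall x, (x %% 3)%N != 2 -> imem m' x = imem m x & rmem m' = rmem m].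
Proof.
move=> ce hr; have [m1 [e1 v1 f1 r1]] := ncompP 0 ce hr.
eexists; split.
- apply: ExecSeq e1 _; do 6!(apply: (@ExecSeq _ _ _ _ 1 _ _); first exact: ExecDo).
  exact: ExecDo.
- by rewrite /= v1; lia.
- move=> x hx /=; rewrite -f1 ?hx //.
  by repeat (case: eqP => [xE|_]; first by exfalso; lia).
- by rewrite /= r1.
Qed.

Lemma bump_idxP d m : exists m', [/\ exec (bump_idx d) m 3 m',
  imem m' (islot d) = (imem m (islot d)).+1,
  imem m' (wslot d) = (imem m (wslot d) + imem m 0)%N,
  forall x, (x %% 3)%N != 2 -> x != islot d -> x != wslot d -> imem m' x = imem m x
  & rmem m' = rmem m].
Proof.
eexists; split.
- do 2!(apply: (@ExecSeq _ _ _ _ 1 _ _); first exact: ExecDo); exact: ExecDo.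
- rewrite /=; repeat (case: eqP => ?; try by exfalso; lia); lia.
- rewrite /=; repeat (case: eqP => ?; try by exfalso; lia); lia.
- move=> x h1 /negbTE h2 /negbTE h3 /=; rewrite h2 h3.
  by case: eqP => // xE; exfalso; lia.
- by [].
Qed.

Lemma while_exec b p (I : nat -> state -> Prop) (k T : nat) m :
  I 0 m -> (forall i m, (i < k)%N -> I i m -> eval_test b m) ->
  (forall m, I k m -> ~~ eval_test b m) ->
  (forall i m, (i < k)%N -> I i m ->
    exists t m', [/\ @exec R p m t m', I i.+1 m' & (t <= T)%N]) ->
  exists t m', [/\ exec (While b p) m t m', I k m' & (t <= k * T.+1 + 1)%N].
Proof.
move=> I0 bT bF step.
suff H : forall j i m, (i + j = k)%N -> I i m -> exists t m',
    [/\ exec (While b p) m t m', I k m' & (t <= j * T.+1 + 1)%N].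
  exact: (H k 0 m).
elim=> [|j IH] i m0 ijk Im.
  have ik : i = k by lia.
  exists 1%N, m0; rewrite -ik; split=> //; apply: ExecWhileFalse.
  by apply: bF; rewrite -ik.
have ik : (i < k)%N by lia.
have [t [m1 [e1 I1 tT]]] := step i m0 ik Im.
have [|t' [m2 [e2 I2 tT']]] := IH i.+1 m1 _ I1; first by lia.
exists (t + t').+1, m2; split=> //; last by lia.
by apply: ExecWhileTrue e1 e2; apply: bT Im.
Qed.

(** Expressions are evaluated on a stack of real temporaries: those below [p] survive, which is what
    binary operations and sums need. A nested sum takes the next bound index, and its loop invariant
    is the partial sum. *)
Lemma rcompP s d b m p e : eclosed d e -> rel s d b m ->
  exists t m', [/\ exec (rcomp d p e) m t m', (t <= ecost (nv s) e)%N,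
    rel s d b m', rmem m' (rslot p) = reval s d b e
    & forall k, (k < p)%N -> rmem m' (rslot k) = rmem m (rslot k)].
Proof.
have fr m1 d1 b1 p1 v : rel s d1 b1 m1 -> [/\ rel s d1 b1 (set_rmem m1 (rslot p1) v),
     rmem (set_rmem m1 (rslot p1) v) (rslot p1) = v &
     forall k, (k < p1)%N -> rmem (set_rmem m1 (rslot p1) v) (rslot k) = rmem m1 (rslot k)].
  move=> hr; split.
  - by apply: rel_frame hr => // x hx /=; case: eqP => // xE; exfalso; lia.
  - by rewrite /= eqxx.
  - by move=> k kp /=; case: eqP => // xE; exfalso; lia.
elim: e d b m p => [||a i|o e IHe f IHf|x IHx y IHy e IHe f IHf|x y e IHe f IHf|y e IHe]
  d b m p /=.
- move=> _ hr; exists 1%N, (set_rmem m (rslot p) 0).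
  by have [h1 h2 h3] := fr m d b p 0 hr; split=> //; exact: ExecDo.
- move=> _ hr; exists 1%N, (set_rmem m (rslot p) 1).
  by have [h1 h2 h3] := fr m d b p 1 hr; split=> //; exact: ExecDo.
- move=> /andP[a31 ci] hr; have [m1 [e1 v1 f1 r1]] := acompP a ci hr.
  have hr1 : rel s d b m1 by apply: rel_frame hr => // x _; rewrite r1.
  exists (ncost i + 7 + 1)%N, (set_rmem m1 (rslot p) (rmem m1 (imem m1 2))).
  have [h1 h2 h3] := fr m1 d b p (rmem m1 (imem m1 2)) hr1; split=> //.
  + by apply: ExecSeq e1 _; exact: (ExecDo (RLoad _ _)).
  + by lia.
  + by rewrite h2 v1 (rel_ra hr1).
  + by move=> k kp; rewrite h3 // r1.
- move=> /andP[ce cf] hr.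
  have [t1 [m1 [e1 c1 hr1 v1 f1]]] := IHe d b m p ce hr.
  have [t2 [m2 [e2 c2 hr2 v2 f2]]] := IHf d b m1 p.+1 cf hr1.
  have [h1 h2 h3] := fr m2 d b p (beval o (reval s d b e) (reval s d b f)) hr2.
  exists (t1 + (t2 + 1))%N,
    (set_rmem m2 (rslot p) (beval o (reval s d b e) (reval s d b f))); split=> //.
  + apply: ExecSeq e1 _; apply: ExecSeq e2 _.
    have -> : set_rmem m2 (rslot p) (beval o (reval s d b e) (reval s d b f)) =
        exec_instr (bcomp o (rslot p) (rslot p) (rslot p.+1)) m2.
      by case: (o); rewrite /= v2 f2 // v1.
    exact: ExecDo.
  + by lia.
  + by move=> k kp; rewrite h3 // f2 ?f1 //; lia.
- move=> /and4P[cx cy ce cf] hr.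
  have [t1 [m1 [e1 c1 hr1 v1 f1]]] := IHx d b m p cx hr.
  have [t2 [m2 [e2 c2 hr2 v2 f2]]] := IHy d b m1 p.+1 cy hr1.
  have bE : eval_test (RLt (rslot p) (rslot p.+1)) m2 = (reval s d b x < reval s d b y).
    by rewrite /= v2 f2 // v1.
  case: ifP => xy.
    have [t3 [m3 [e3 c3 hr3 v3 f3]]] := IHe d b m2 p ce hr2.
    exists (t1 + (t2 + t3.+1))%N, m3; split=> //; last first.
    + by move=> k kp; rewrite f3 // f2 ?f1 //; lia.
    + by lia.
    + apply: ExecSeq e1 _; apply: ExecSeq e2 _; apply: ExecIfTrue e3.
      by rewrite bE xy.
  have [t3 [m3 [e3 c3 hr3 v3 f3]]] := IHf d b m2 p cf hr2.
  exists (t1 + (t2 + t3.+1))%N, m3; split=> //; last first.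
  + by move=> k kp; rewrite f3 // f2 ?f1 //; lia.
  + by lia.
  + apply: ExecSeq e1 _; apply: ExecSeq e2 _; apply: ExecIfFalse e3.
    by rewrite bE xy.
- move=> /and4P[cx cy ce cf] hr.
  have [m1 [e1 v1 f1 r1]] := ncompP 0 cx hr.
  have hr1 : rel s d b m1 by apply: rel_frame hr => k h; rewrite ?r1 ?f1 ?h.
  have [m2 [e2 v2 f2 r2]] := ncompP 1 cy hr1.
  have hr2 : rel s d b m2 by apply: rel_frame hr1 => k h; rewrite ?r2 ?f2 ?h.
  have bE : eval_test (ILt 2 5) m2 = (neval s b x < neval s b y)%N.
    by rewrite /= v2 f2 // v1.
  case: ifP => xy.
    have [t3 [m3 [e3 c3 hr3 v3 f3]]] := IHe d b m2 p ce hr2.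
    exists (ncost x + (ncost y + t3.+1))%N, m3; split=> //; last first.
    + by move=> k kp; rewrite f3 // r2 r1.
    + by lia.
    + apply: ExecSeq e1 _; apply: ExecSeq e2 _; apply: ExecIfTrue e3.
      by rewrite bE xy.
  have [t3 [m3 [e3 c3 hr3 v3 f3]]] := IHf d b m2 p cf hr2.
  exists (ncost x + (ncost y + t3.+1))%N, m3; split=> //; last first.
  + by move=> k kp; rewrite f3 // r2 r1.
  + by lia.
  + apply: ExecSeq e1 _; apply: ExecSeq e2 _; apply: ExecIfFalse e3.
    by rewrite bE xy.
- move=> ce hr.
  pose m0 := set_imem (set_imem (set_rmem m (rslot p) 0) (islot d) 0) (wslot d) 0.
  pose I i m1 := [/\ rel s d.+1 (upd b d i) m1,
    rmem m1 (rslot p) = \sum_(j < i) reval s d.+1 (upd b d j) e &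
    forall k, (k < p)%N -> rmem m1 (rslot k) = rmem m (rslot k)].
  have I0 : I 0 m0.
    split; last 2 first.
    - by rewrite big_ord0 /= eqxx.
    - by move=> k kp /=; case: eqP => // xE; exfalso; lia.
    split; rewrite /m0 /=.
    - move=> z; do 2!(case: eqP => [xE|_]; first by exfalso; lia).
      by rewrite (rel_nv hr).
    - move=> k kd; case: eqP => [xE|_]; first by exfalso; lia.
      rewrite updE; case: (k =P d) => [->|kd']; first by rewrite eqxx.
      by case: eqP => [xE|_]; [exfalso; lia|rewrite (rel_idx hr) //; lia].
    - move=> k kd; rewrite updE; case: (k =P d) => [->|kd'].
        by rewrite eqxx mul0n.
      do 2!(case: eqP => [xE|_]; first by exfalso; lia).
      by rewrite (rel_row hr) //; lia.
    - move=> a j aj; case: eqP => [xE|_]; first by exfalso; lia.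
      by rewrite (rel_ra hr).
  have [||| t [m' [et [hr' v' f']] tT]] := @while_exec (ILt (islot d) (3 * y))
    (Seq (rcomp d.+1 p.+1 e)
      (Seq (Do (RAdd (rslot p) (rslot p) (rslot p.+1))) (bump_idx d))) I (nv s y)
      (ecost (nv s) e + 4) _ I0.
  + move=> i m1 iy [hr1 _ _] /=.
    by rewrite (rel_nv hr1) (rel_idx hr1) // updE eqxx.
  + by move=> m1 [hr1 _ _] /=; rewrite (rel_nv hr1) (rel_idx hr1) // updE eqxx ltnn.
  + move=> i m1 iy [hr1 v1 f1].
    have [t2 [m2 [e2 c2 hr2 v2 f2]]] := IHe d.+1 (upd b d i) m1 p.+1 ce hr1.
    pose m3 := exec_instr (RAdd (rslot p) (rslot p) (rslot p.+1)) m2.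
    have [hr3 v3 f3] : [/\ rel s d.+1 (upd b d i) m3, rmem m3 (rslot p) =
         \sum_(j < i.+1) reval s d.+1 (upd b d j) e &
       forall k, (k < p)%N -> rmem m3 (rslot k) = rmem m2 (rslot k)].
      have [h1 h2 h3] := fr m2 d.+1 (upd b d i) p (rmem m2 (rslot p) + rmem m2 (rslot p.+1)) hr2.
      by split=> //; rewrite h2 v2 f2 // v1 big_ord_recr.
    have [m4 [e4 i4 w4 f4 r4]] := bump_idxP d m3.
    exists (t2 + (1 + 3))%N, m4; split; last by lia.
    * by apply: ExecSeq e2 _; apply: ExecSeq e4; exact: (ExecDo (RAdd _ _ _)).
    * split; last 2 first.
      - by rewrite r4.
      - by move=> k kp; rewrite r4 f3 // f2 ?f1 //; lia.
      split.
      - by move=> z; rewrite f4 ?(rel_nv hr3) //; lia.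
      - move=> k kd; rewrite updE; case: (k =P d) => [->|kd'].
          by rewrite i4 (rel_idx hr3) // updE eqxx.
        rewrite f4 ?(rel_idx hr3) //; try lia.
        by rewrite updE; case: eqP.
      - move=> k kd; rewrite updE; case: (k =P d) => [->|kd'].
          by rewrite w4 (rel_row hr3) // updE eqxx -(rel_nv hr3 0) mulSn addnC.
        rewrite f4 ?(rel_row hr3) //; try lia.
        by rewrite updE; case: eqP.
      - by move=> a j aj; rewrite r4 (rel_ra hr3).
  exists (1 + (1 + (1 + t)))%N, m'; split=> //.
  + do 3!(apply: (@ExecSeq _ _ _ _ 1 _ _); first exact: ExecDo); exact: et.
  + by lia.
  + split=> [||k kd|k kd]; first exact: (rel_nv hr').
    * by move=> k kd; rewrite (rel_idx hr') ?ltnS ?(ltnW kd) // updE; case: eqP => // kE; lia.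
    * rewrite (rel_row hr') ?ltnS ?(ltnW kd) // updE; case: eqP => // kE; lia.
    * exact: (rel_ra hr').
Qed.

End Compiler.

Section Simulation.
Context {R : realType}.
Implicit Types (m : @state R) (s : @store R).

(** The bounds of a well-formed command keep their initial values while it runs. Hence the machine,
    which compares its counter with the current value of a variable, makes the expected number of
    iterations, and the cost of later parts may be evaluated in the initial store. *)
Lemma ccompP c s m : wf c -> rel s 0 noidx m ->
  exists t m', [/\ exec (ccomp c) m t m', rel (run c s) 0 noidx m'
    & (t <= ccost (nv s) c)%N].
Proof.
rewrite /wf => /andP[]; elim: c s m => /=.
- by move=> s m _ _ hr; exists 0%N, m; split=> //; exact: ExecSkip.
- move=> x e s m ce _ hr; have [m1 [e1 v1 f1 r1]] := ncompP 0 ce hr.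
  eexists _, _; split.
  + apply: ExecSeq e1 _; apply: (@ExecSeq _ _ _ _ 1 _ _); exact: ExecDo.
  + have hr1 : rel s 0 noidx m1 by apply: rel_frame hr => k h; rewrite ?r1 ?f1 ?h.
    split=> //= [z|a j aj]; last by rewrite (rel_ra hr1).
    rewrite updE; case: (z =P x) => [->|zx].
      by rewrite eqxx; rewrite v1 addn0.
    do 2!(case: eqP => [xE|_]; first by exfalso; lia).
    by rewrite (rel_nv hr1).
  + by lia.
- move=> a i e s m /and3P[a31 ci ce] _ hr.
  have [t1 [m1 [e1 c1 hr1 v1 _]]] := rcompP 0 ce hr.
  have [m2 [e2 v2 f2 r2]] := acompP a ci hr1.
  eexists _, _; split.
  + apply: ExecSeq e1 _; apply: ExecSeq e2 _; exact: ExecDo.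
  + have hr2 : rel s 0 noidx m2 by apply: rel_frame hr1 => // x _; rewrite r2.
    split=> //= [z|a' j aj]; first by rewrite (rel_nv hr2).
    rewrite v2 r2 updE; case: (a' =P a) => [->|aa].
      rewrite updE; case: (j =P neval s noidx i) => [->|ji].
        by rewrite eqxx; exact: v1.
      by case: eqP => [xE|_]; [exfalso; lia|rewrite (rel_ra hr1)].
    by case: eqP => [xE|_]; [exfalso; lia|rewrite (rel_ra hr1)].
  + by lia.
- move=> a o y e s m /and4P[a31 co ce nr] _ hr.
  pose f := neval s noidx o.
  (* The store after [i] cells have been filled; since [e] does not read [a], its value there is its
     value in [s]. *)
  pose s_ i := seta s a (fun k => if (f <= k < f + i)%N
    then reval s 1 (upd noidx 0 (k - f)%N) e else ra s a k).
  pose I i m1 := rel (s_ i) 1 (upd noidx 0 i) m1.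
  pose m0 := set_imem (set_imem m 1 0) 4 0.
  have I0 : I 0 m0.
    split=> /=.
    - move=> z; do 2!(case: eqP => [xE|_]; first by exfalso; lia).
      exact: (rel_nv hr).
    - by case.
    - by case.
    - move=> a' j aj; rewrite (rel_ra hr) // updE; case: (a' =P a) => // ->.
      by case: ifP => // h; exfalso; lia.
  have [||| t [m' [et hr' tT]]] := @while_exec _ (ILt 1 (3 * y))
    (Seq (rcomp 1 0 e) (Seq (acomp a (NPlus o (NIdx 0)))
          (Seq (Do (RStore 2 31)) (bump_idx 0)))) I (nv s y)
      (ecost (nv s) e + ncost o + 14) _ I0.
  + move=> i m1 iy hr1 /=.
    by rewrite (rel_nv hr1) /= (@rel_idx _ _ _ _ _ hr1 0).
  + by move=> m1 hr1 /=; rewrite (rel_nv hr1) /= (@rel_idx _ _ _ _ _ hr1 0) //= ltnn.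
  + move=> i m1 iy hr1.
    have [t2 [m2 [e2 c2 hr2 v2 f2]]] := rcompP 0 ce hr1.
    have co' : nclosed 1 (NPlus o (NIdx 0)).
      rewrite /= andbT; elim: (o) co => //= o1 IH1 o2 IH2 /andP[h1 h2];
      by rewrite IH1 ?IH2.
    have [m3 [e3 v3 f3 r3]] := acompP a co' hr2.
    pose m4 := exec_instr (RStore 2 31) m3.
    have [m5 [e5 i5 w5 f5 r5]] := bump_idxP 0 m4.
    have oE : neval (s_ i) (upd noidx 0 i) o = f.
      by apply: (@neval_ext _ _ _ _ _ 0) => //.
    have eE : reval (s_ i) 1 (upd noidx 0 i) e = reval s 1 (upd noidx 0 i) e.
      apply: (@reval_ext _ _ _ 1) => //= a' ra' z; rewrite updE; case: eqP => // aa.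
      by rewrite aa (negbTE nr) in ra'.
    have hr3 : rel (s_ i) 1 (upd noidx 0 i) m3.
      by apply: rel_frame hr2 => // x _; rewrite r3.
    exists (t2 + (ncost (NPlus o (NIdx 0)) + 7 + (1 + 3)))%N, m5; split.
    * apply: ExecSeq e2 _; apply: ExecSeq (e3) _.
      by apply: ExecSeq e5; exact: (ExecDo (RStore _ _)).
    * split.
      - by move=> z; rewrite f5 ?(rel_nv hr3) //; lia.
      - by case=> // _; rewrite i5 (@rel_idx _ _ _ _ _ hr3 0).
      - case=> // _; rewrite w5 (@rel_row _ _ _ _ _ hr3 0) // (rel_nv hr3 0).
        by rewrite !updE /= mulSn addnC.
      - move=> a' j aj; rewrite r5 /= v3 /= updE eqxx oE.
        case: (a' =P a) => [->|aa]; rewrite ?updE ?eqxx; last first.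
          case: eqP => [xE|_]; first by exfalso; lia.
          by rewrite (rel_ra hr3) //= updE; move/eqP/negbTE: aa => ->.
        case: eqP => [xE|xE].
          have -> : j = (f + i)%N by lia.
          have -> : (f <= f + i < f + i.+1)%N by lia.
          by rewrite r3 (v2 : rmem m2 31 = _) eE addKn.
        rewrite (rel_ra hr3) //= updE eqxx.
        have -> : (f <= j < f + i.+1)%N = (f <= j < f + i)%N.
          by apply/idP/idP => h; lia.
        by [].
    * by rewrite (_ : nv (s_ i) = nv s) // in c2; rewrite /=; lia.
  exists (1 + (1 + t))%N, m'; split.
  + do 2!(apply: (@ExecSeq _ _ _ _ 1 _ _); first exact: ExecDo); exact: et.
  + split=> //; [exact: (rel_nv hr')|exact: (rel_ra hr')].
  + by lia.
- move=> c IHc c' IHc' s m /andP[cc cc']; rewrite all_cat mem_cat negb_or.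
  move=> /andP[/andP[n0 n0'] /andP[/allP hb /allP hb']] hr.
  have hx y : y \in bounds c -> y \notin nassigned c.
    by move=> /hb; rewrite mem_cat negb_or => /andP[].
  have hx' y : y \in bounds c' -> y \notin nassigned c'.
    by move=> /hb'; rewrite mem_cat negb_or => /andP[].
  have [|t1 [m1 [e1 hr1 c1]]] := IHc s m cc _ hr; first by rewrite n0; apply/allP.
  have [|t2 [m2 [e2 hr2 c2]]] := IHc' _ m1 cc' _ hr1; first by rewrite n0'; apply/allP.
  exists (t1 + t2)%N, m2; split=> //; first by apply: ExecSeq e1 e2.
  rewrite (@ccost_ext (nv s) (nv (run c s)) c') ?leq_add // => y yb.
  by rewrite run_nv //; have := hb' _ yb; rewrite mem_cat negb_or => /andP[].
- move=> x y c IHc c' IHc' s m /and4P[cx cy cc cc']; rewrite mem_cat negb_or !all_cat.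
  move=> /andP[/andP[n0 n0'] /and4P[_ _ /allP hb /allP hb']] hr.
  have hx z : z \in bounds c -> z \notin nassigned c.
    by move=> /hb; rewrite mem_cat negb_or => /andP[].
  have hx' z : z \in bounds c' -> z \notin nassigned c'.
    by move=> /hb'; rewrite mem_cat negb_or => /andP[].
  have [t1 [m1 [e1 c1 hr1 v1 _]]] := rcompP 0 cx hr.
  have [t2 [m2 [e2 c2 hr2 v2 f2]]] := rcompP 1 cy hr1.
  have bE : eval_test (RLt 31 63) m2 = (reval s 0 noidx x < reval s 0 noidx y).
    by rewrite /= (f2 0%N) // v1 (v2 : rmem m2 63 = _).
  case: ifP => xy.
    have [|t3 [m3 [e3 hr3 c3]]] := IHc s m2 cc _ hr2; first by rewrite n0; apply/allP.
    exists (t1 + (t2 + t3.+1))%N, m3; split=> //; last by lia.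
    by apply: ExecSeq e1 _; apply: ExecSeq e2 _; apply: ExecIfTrue e3; rewrite bE xy.
  have [|t3 [m3 [e3 hr3 c3]]] := IHc' s m2 cc' _ hr2; first by rewrite n0'; apply/allP.
  exists (t1 + (t2 + t3.+1))%N, m3; split=> //; last by lia.
  by apply: ExecSeq e1 _; apply: ExecSeq e2 _; apply: ExecIfFalse e3; rewrite bE xy.
- move=> x y c IHc c' IHc' s m /and4P[cx cy cc cc']; rewrite mem_cat negb_or !all_cat.
  move=> /andP[/andP[n0 n0'] /andP[/allP hb /allP hb']] hr.
  have hx z : z \in bounds c -> z \notin nassigned c.
    by move=> /hb; rewrite mem_cat negb_or => /andP[].
  have hx' z : z \in bounds c' -> z \notin nassigned c'.
    by move=> /hb'; rewrite mem_cat negb_or => /andP[].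
  have [m1 [e1 v1 f1 r1]] := ncompP 0 cx hr.
  have hr1 : rel s 0 noidx m1 by apply: rel_frame hr => k h; rewrite ?r1 ?f1 ?h.
  have [m2 [e2 v2 f2 r2]] := ncompP 1 cy hr1.
  have hr2 : rel s 0 noidx m2 by apply: rel_frame hr1 => k h; rewrite ?r2 ?f2 ?h.
  have bE : eval_test (ILt 2 5) m2 = (neval s noidx x < neval s noidx y)%N.
    by rewrite /= v2 f2 // v1.
  case: ifP => xy.
    have [|t3 [m3 [e3 hr3 c3]]] := IHc s m2 cc _ hr2; first by rewrite n0; apply/allP.
    exists (ncost x + (ncost y + t3.+1))%N, m3; split=> //; last by lia.
    by apply: ExecSeq e1 _; apply: ExecSeq e2 _; apply: ExecIfTrue e3; rewrite bE xy.
  have [|t3 [m3 [e3 hr3 c3]]] := IHc' s m2 cc' _ hr2; first by rewrite n0'; apply/allP.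
  exists (ncost x + (ncost y + t3.+1))%N, m3; split=> //; last by lia.
  by apply: ExecSeq e1 _; apply: ExecSeq e2 _; apply: ExecIfFalse e3; rewrite bE xy.
- move=> x y c IHc s m /and3P[cc xc xc'].
  rewrite !inE !negb_or => /andP[/and3P[x0 x0' c0] /andP[/and3P[yx yx' yc] /allP hb]] hr.
  have hb' z : z \in bounds c -> [/\ z != x, z != x.+1 & z \notin nassigned c].
    by move=> /hb; rewrite !inE !negb_or => /and3P[].
  pose F i s' := run c (setn (setn s' x i) x.+1 (i * nv s' 0)).
  pose s_ i := iteri i F s.
  have s_nv i z : z != x -> z != x.+1 -> z \notin nassigned c -> nv (s_ i) z = nv s z.
    move=> zx zx' zc; elim: i => //= i IH.
    by rewrite run_nv //= /upd (negbTE zx) (negbTE zx').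
  pose I i m1 := rel (setn (setn (s_ i) x i) x.+1 (i * nv s 0)) 0 noidx m1.
  pose m0 := set_imem (set_imem m (3 * x) 0) (3 * x.+1) 0.
  have I0 : I 0 m0.
    split=> //= [z|a j aj]; last exact: (rel_ra hr).
    rewrite !updE; case: (z =P x.+1) => [->|zx']; first by rewrite eqxx.
    case: eqP => [xE|_]; first by exfalso; lia.
    case: (z =P x) => [->|zx]; first by rewrite eqxx.
    case: eqP => [xE|_]; first by exfalso; lia.
    exact: (rel_nv hr).
  have [||| t [m' [et hr' tT]]] := @while_exec _ (ILt (3 * x) (3 * y))
    (Seq (ccomp c) (Seq (Do (IConst 2 1))
          (Seq (Do (IAdd (3 * x) (3 * x) 2))
            (Do (IAdd (3 * x.+1) (3 * x.+1) 0))))) I (nv s y)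
      (ccost (nv s) c + 3) _ I0.
  + move=> i m1 iy hr1 /=; rewrite !(rel_nv hr1) /= !updE eqxx.
    by rewrite (negbTE yx) (negbTE yx') s_nv // (_ : (x == x.+1) = false) //; lia.
  + move=> m1 hr1 /=; rewrite !(rel_nv hr1) /= !updE eqxx.
    by rewrite (negbTE yx) (negbTE yx') s_nv // (_ : (x == x.+1) = false) ?ltnn //; lia.
  + move=> i m1 iy hr1.
    have [|t1 [m2 [e2 hr2 c2]]] := IHc _ m1 cc _ hr1.
      by rewrite c0; apply/allP => z /hb' [].
    have n0 : nv (s_ i) 0 = nv s 0 by apply: s_nv.
    have hr2' : rel (s_ i.+1) 0 noidx m2 by rewrite /s_ /= /F -/(s_ i) n0.
    eexists _, _; split.
    * apply: ExecSeq e2 _; do 2!(apply: (@ExecSeq _ _ _ _ 1 _ _); first exact: ExecDo).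
      exact: ExecDo.
    * have xi : nv (s_ i.+1) x = i.
        by rewrite /s_ /= /F run_nv //= !updE eqxx (_ : (x == x.+1) = false) //; lia.
      have xi' : nv (s_ i.+1) x.+1 = (i * nv s 0)%N.
        by rewrite /s_ /= /F run_nv //= !updE eqxx -/(s_ i) n0.
      have n0' : nv (s_ i.+1) 0 = nv s 0 by apply: s_nv.
      split=> //= [z|a j aj]; last by rewrite (rel_ra hr2').
      have e2E k : (k == 2) = false -> (if k == 2 then 1%N else imem m2 k) = imem m2 k.
        by move=> ->.
      rewrite !updE; case: (z =P x.+1) => [->|zx'].
        rewrite eqxx.
        repeat (case: eqP => [xE|_]; first by exfalso; lia).
        by rewrite (rel_nv hr2') (rel_nv hr2' 0) xi' n0' mulSn addnC.
      case: (3 * z =P 3 * x.+1)%N => [xE|_]; first by exfalso; lia.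
      case: (z =P x) => [->|zx].
        rewrite eqxx.
        repeat (case: eqP => [xE|_]; first by exfalso; lia).
        by rewrite (rel_nv hr2') xi addn1.
      case: (3 * z =P 3 * x)%N => [xE|_]; first by exfalso; lia.
      case: eqP => [xE|_]; first by exfalso; lia.
      by rewrite (rel_nv hr2').
    * rewrite (@ccost_ext (nv s) (nv (setn (setn (s_ i) x i) x.+1 (i * nv s 0))) c).
        by lia.
      by move=> z /hb' [zx zx' zc]; rewrite /= !updE (negbTE zx) (negbTE zx') s_nv.
  exists (1 + (1 + t))%N, m'; split.
  + do 2!(apply: (@ExecSeq _ _ _ _ 1 _ _); first exact: ExecDo); exact: et.
  + exact: hr'.
  + by lia.
Qed.

End Simulation.

(** * Input and output of the machine *)

Definition seqs : seq program -> program := foldr Seq Skip.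

(* The input is spread in place, from its last cell down to its cell 2; cell 1
   serves as a buffer, and its content is first saved beyond the input. *)
Definition prologue : program :=
  Seq (seqs [:: Do (IConst 2 0); Do (IAdd 3 1 2); Do (IConst 5 3);
    Do (IConst 8 0); Do (IConst 11 1); Do (IConst 17 2)])
  (Seq (While (ILt 8 0) (seqs [:: Do (IAdd 5 5 0); Do (IAdd 5 5 0);
    Do (IAdd 8 8 11)]))
  (Seq (seqs [:: Do (IAdd 14 5 5); Do (IAdd 14 14 14); Do (IAdd 14 14 14);
    Do (IAdd 14 14 14); Do (IAdd 14 14 14); Do (RStore 14 1); Do (IAdd 8 5 2)])
  (While (ILt 17 8) (seqs [:: Do (ISub 8 8 11); Do (RLoad 1 8);
    Do (IAdd 14 8 8); Do (IAdd 14 14 14); Do (IAdd 14 14 14);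
    Do (IAdd 14 14 14); Do (IAdd 14 14 14); Do (RStore 14 1)])))).

(* The first cells of the index memory, which serve as registers, are written
   last. *)
Definition epilogue : program :=
  Seq (seqs [:: Do (RZero 31); Do (IConst 8 24); Do (IConst 11 1);
    Do (IConst 17 0); Do (IConst 20 780); Do (IConst 23 32)])
  (Seq (While (ILt 8 0) (seqs [:: Do (RLoad 63 20);
      If (RLt 31 63) (Do (IStore 8 11)) (Do (IStore 8 17));
      Do (IAdd 8 8 11); Do (IAdd 20 20 23)]))
  (seqs [seq If (RLt 31 (32 * j + 12)) (Do (IConst j 1)) (Do (IConst j 0))
        | j <- iota 0 24])).

Section Interface.
Context {R : realType}.
Implicit Types (m : @state R) (s : @store R).

Lemma exec_seqs_do (l : seq instr) m :
  exec (seqs (map Do l)) m (size l) (foldl (fun m i => exec_instr i m) m l).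
Proof.
elim: l m => [|i l IH] m; first exact: ExecSkip.
by apply: (@ExecSeq _ _ _ _ 1 _ _ _ (ExecDo _ _)); exact: IH.
Qed.

Lemma nth_entries n (A : 'M[R]_n) (i j : 'I_n) : nth 0 (entries A) (i * n + j) = A i j.
Proof.
have gen (l : seq 'I_n) (k : nat) (kl : (k < size l)%N) :
    nth 0 [seq A i j | i <- l, j <- enum 'I_n] (k * n + j) = A (nth i l k) j.
  elim: l k kl => //= a l IH [|k] kl; rewrite nth_cat size_map size_enum_ord.
    rewrite mul0n add0n ltn_ord (nth_map j) ?size_enum_ord //.
    by rewrite nth_ord_enum.
  have -> : (k.+1 * n + j < n)%N = false by rewrite mulSn; lia.
  by rewrite mulSn -addnA addKn IH.
by rewrite /entries gen ?size_enum_ord // nth_ord_enum.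
Qed.

Lemma size_entries n (A : 'M[R]_n) : size (entries A) = (n * n)%N.
Proof. by rewrite /entries size_allpairs size_enum_ord. Qed.

(** Going downward, cell [j >= 2] is moved to [32 * j > j], so no unread cell is overwritten: [I3]
    separates the cells still in place from those already moved. The size [3 + 2 * (n * n)] comes
    from adding [n] twice in each of [n] rounds. The store is read off the final memory, so
    leftovers of the input simply become contents of other arrays. *)
Lemma prologueP n r (eps d lambda : R) (c delta : 'M[R]_n) : (0 < n)%N ->
  exists t m s, [/\ exec prologue (input r eps c d lambda delta) t m,
    (t <= 100 * (n * n))%N, rel s 0 noidx m, nv s 0 = n & nv s 1 = r] /\
    [/\ ra s 0 0 = eps, ra s 0 (3 + 2 * (n * n))%N = d, ra s 0 2 = lambda,
    forall i j : 'I_n, ra s 0 (3 + (i * n + j))%N = c i j &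
    forall i j : 'I_n, ra s 0 (3 + n * n + (i * n + j))%N = delta i j].
Proof.
move=> n0; set m0 := input r eps c d lambda delta.
pose N := (3 + 2 * (n * n))%N.
pose inp := nth 0 ([:: eps; d; lambda] ++ entries c ++ entries delta).
have n_gt0 : (0 < n * n)%N by rewrite muln_gt0 n0.
pose l1 := [:: IConst 2 0; IAdd 3 1 2; IConst 5 3; IConst 8 0; IConst 11 1; IConst 17 2].
have e1 := exec_seqs_do l1 m0; set m1 := foldl _ _ _ in e1.
pose I1 i m := [/\ imem m 0 = n, imem m 3 = r, imem m 5 = (3 + 2 * (i * n))%N,
  imem m 8 = i & [/\ imem m 11 = 1%N, imem m 17 = 2, imem m 2 = 0%N &
  rmem m = rmem m0]].
have I10 : I1 0 m1.
  by split=> //=; rewrite addn0.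
pose l2 := [:: IAdd 5 5 0; IAdd 5 5 0; IAdd 8 8 11].
have [||| t2 [m2 [e2 [a0 a3 a5 a8 [a11 a17 a2 a_r]] c2]]] := @while_exec _ (ILt 8 0)
    (seqs (map Do l2)) I1 n 3 _ I10.
- by move=> i m im [h0 _ _ h8 _] /=; rewrite h0 h8.
- by move=> m [h0 _ _ h8 _] /=; rewrite h0 h8 ltnn.
- move=> i m im [h0 h3 h5 h8 [h11 h17 h2 hr]]; exists 3%N.
  eexists; split; [exact: exec_seqs_do| |by []].
  by split; rewrite /= ?h0 ?h3 ?h5 ?h8 ?h11 //; lia.
pose l3 := [:: IAdd 14 5 5; IAdd 14 14 14; IAdd 14 14 14; IAdd 14 14 14;
  IAdd 14 14 14; RStore 14 1; IAdd 8 5 2].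
have e3 := exec_seqs_do l3 m2; set m3 := foldl _ _ _ in e3.
pose I3 i m := [/\ imem m 0 = n, imem m 3 = r, imem m 8 = (N - i)%N,
  imem m 11 = 1%N & imem m 17 = 2] /\
  [/\ rmem m 0 = eps, rmem m (32 * N) = d,
    forall j, (2 <= j < N - i)%N -> rmem m j = inp j &
    forall j, (N - i <= j < N)%N -> rmem m (32 * j)%N = inp j].
have I30 : I3 0 m3.
  split; split=> /=; rewrite ?a0 ?a3 ?a5 ?a2 ?a_r ?eqxx //.
  - by rewrite /N; lia.
  - by case: eqP => [_|h]; [|exfalso; rewrite /N in h; lia].
  - move=> j jN; case: eqP => [h|_]; first by exfalso; lia.
    by rewrite /m0 /input /= /inp.
  - by move=> j jN; exfalso; lia.
pose l4 := [:: ISub 8 8 11; RLoad 1 8; IAdd 14 8 8; IAdd 14 14 14; IAdd 14 14 14;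
    IAdd 14 14 14; IAdd 14 14 14; RStore 14 1].
have [||| t4 [m4 [e4 [[b0 b3 _ _ _] [br0 brN _ br]] c4]]] := @while_exec _ (ILt 17 8)
    (seqs (map Do l4)) I3 (N - 2) 8 _ I30.
- by move=> i m im [[h0 h3 h8 h11 h17] _] /=; rewrite h17 h8; lia.
- by move=> m [[h0 h3 h8 h11 h17] _] /=; rewrite h17 h8 -leqNgt; lia.
- move=> i m im [[h0 h3 h8 h11 h17] [r0 rN rl rh]]; exists 8%N.
  eexists; split; [exact: exec_seqs_do| |by []].
  split; split; rewrite /= ?h0 ?h3 ?h8 ?h11 ?h17 ?eqxx //.
  + by lia.
  + by case: eqP => // h; exfalso; lia.
  + by case: eqP => // h; exfalso; lia.
  + move=> j jN; case: eqP => [h|_]; first by exfalso; lia.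
    by case: eqP => [h|_]; [exfalso; lia|rewrite rl //; lia].
  + move=> j jN; case: eqP => [h|h].
      by rewrite rl; [congr inp; lia|lia].
    by case: eqP => [h'|_]; [exfalso; lia|rewrite rh //; lia].
pose s := Store (fun x => imem m4 (3 * x)) (fun a j => rmem m4 (32 * j + a)%N).
have inpc (i j : 'I_n) : (i * n + j < n * n)%N.
  have := ltn_ord i; have := ltn_ord j; nia.
have sE j : (2 <= j < N)%N -> ra s 0 j = inp j.
  by move=> jN; rewrite /s /= addn0 br //; lia.
exists (size l1 + (t2 + (size l3 + t4)))%N, m4, s; split; split=> //.
- apply: ExecSeq (e1) _; apply: ExecSeq e2 _; apply: ExecSeq (e3) _; exact: e4.
- rewrite /=; move: c2 c4; rewrite /N; have : (n <= n * n)%N by nia.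
  by lia.
- by rewrite /s /= addn0.
- by rewrite sE // /N; lia.
- move=> i j; rewrite sE; last by have := inpc i j; rewrite /N; lia.
  rewrite /inp nth_cat (_ : (_ < _)%N = false); last by rewrite /=; lia.
  rewrite nth_cat size_entries (_ : (_ < _)%N = true); last first.
    by have := inpc i j; rewrite /=; lia.
  by rewrite -nth_entries; congr nth; rewrite /=; lia.
- move=> i j; rewrite sE; last by have := inpc i j; rewrite /N; lia.
  rewrite /inp nth_cat (_ : (_ < _)%N = false); last by rewrite /=; lia.
  rewrite nth_cat size_entries (_ : (_ < _)%N = false); last by rewrite /=; lia.
  by rewrite -nth_entries; congr nth; rewrite /=; lia.
Qed.

(** Index cells below 24 contain the registers of the output loop, hence this loop starts at vertex
    24, whose entry in array 12 is at address 780 = 32 * 24 + 12. The first 24 cells are then set by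
    straight-line code that tests only the real memory. *)
Lemma epilogueP s m n : rel s 0 noidx m -> nv s 0 = n ->
  exists t m', [/\ exec epilogue m t m', (t <= 10 * n + 100)%N &
    forall j, (j < n)%N -> (imem m' j != 0%N) = (0 < ra s 12 j)].
Proof.
move=> hr n0.
pose l1 := [:: RZero 31; IConst 8 24; IConst 11 1; IConst 17 0; IConst 20 780; IConst 23 32].
have e1 := exec_seqs_do l1 m; set m1 := foldl _ _ _ in e1.
pose I1 i m1 := [/\ imem m1 0 = n, imem m1 8 = (24 + i)%N, imem m1 11 = 1%N,
    imem m1 17 = 0%N & [/\ imem m1 20 = (32 * (24 + i) + 12)%N, imem m1 23 = 32,
    rmem m1 31 = 0, forall j, rmem m1 (32 * j + 12)%N = ra s 12 j &
    forall j, (24 <= j < 24 + i)%N -> (imem m1 j != 0%N) = (0 < ra s 12 j)]].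
have I10 : I1 0 m1.
  split=> //=; first by rewrite -n0 -(rel_nv hr).
  split=> // j => [|jj]; last by exfalso; lia.
  by case: eqP => [h|_]; [exfalso; lia|rewrite (rel_ra hr)].
have [||| t2 [m2 [e2 [a0 a8 a11 a17 [a20 a23 r31 r12 fin]] c2]]] := @while_exec _ (ILt 8 0)
    (seqs [:: Do (RLoad 63 20);
      If (RLt 31 63) (Do (IStore 8 11)) (Do (IStore 8 17));
      Do (IAdd 8 8 11); Do (IAdd 20 20 23)]) I1 (n - 24) 5 _ I10.
- by move=> i m3 im [h0 h8 _ _ _] /=; rewrite h0 h8; lia.
- by move=> m3 [h0 h8 _ _ _] /=; rewrite h0 h8 -leqNgt; lia.
- move=> i m3 im [h0 h8 h11 h17 [h20 h23 h31 h12 hf]].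
  pose m4 := exec_instr (RLoad 63 20) m3.
  pose b := 0 < ra s 12 (24 + i).
  pose m5 := exec_instr (if b then IStore 8 11 else IStore 8 17) m4.
  pose m6 := exec_instr (IAdd 20 20 23) (exec_instr (IAdd 8 8 11) m5).
  have bE : eval_test (RLt 31 63) m4 = b by rewrite /= h20 h12 h31.
  have m5r : rmem m5 = rmem m4 by rewrite /m5; case: (b).
  have m5i x : imem m5 x = if x == (24 + i)%N then nat_of_bool b else imem m3 x.
    by rewrite /m5; case: (b); rewrite /= h8 ?h11 ?h17.
  exists (1 + (2 + (1 + (1 + 0))))%N, m6; split=> //.
    apply: (@ExecSeq _ _ _ _ 1 _ _ _ (ExecDo _ _)).
    apply: (@ExecSeq _ _ _ _ 2 m5); last first.
      do 2!apply: (@ExecSeq _ _ _ _ 1 _ _ _ (ExecDo _ _)); exact: ExecSkip.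
    rewrite /m5; case: ifP => hb.
      by apply: ExecIfTrue; [rewrite bE|exact: ExecDo].
    by apply: ExecIfFalse; [rewrite bE hb|exact: ExecDo].
  have nE k : (k < 24)%N -> (k == 24 + i)%N = false by move=> k24; lia.
  split.
  - by rewrite /= m5i nE.
  - by rewrite /= !m5i !nE // h8 h11; lia.
  - by rewrite /= m5i nE.
  - by rewrite /= m5i nE.
  - split=> /=.
    + by rewrite !m5i !nE // h20 h23; lia.
    + by rewrite m5i nE.
    + by rewrite m5r /= h31.
    + by move=> j; rewrite m5r /=; case: eqP => [h|_]; [exfalso; lia|].
    + move=> j ji; rewrite (_ : (j == 20) = false); last by lia.
      rewrite (_ : (j == 8) = false) ?m5i; last by lia.
      case: (j =P 24 + i)%N => [->|h]; first by rewrite -/b; case: (b).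
      by rewrite hf //; lia.
have fixed k : (k <= 24)%N -> forall m3, rmem m3 31 = 0 ->
   (forall j, rmem m3 (32 * j + 12)%N = ra s 12 j) -> exists m4,
   [/\ exec (seqs [seq If (RLt 31 (32 * j + 12)) (Do (IConst j 1)) (Do (IConst j 0))
        | j <- iota (24 - k) k]) m3 (2 * k) m4,
    forall j, (24 - k <= j < 24)%N -> (imem m4 j != 0%N) = (0 < ra s 12 j)
   & forall j, (j < 24 - k)%N || (24 <= j)%N -> imem m4 j = imem m3 j].
  elim: k => [|k IH] k24 m3 r0 rj.
    exists m3; split=> //; first exact: ExecSkip.
    by move=> j h; exfalso; lia.
  pose i := (24 - k.+1)%N.
  have iS : (24 - k = i.+1)%N by rewrite /i; lia.
  pose m5 := exec_instr (if 0 < ra s 12 i then IConst i 1 else IConst i 0) m3.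
  have [|//||m4 [e4 h1 h2]] := IH _ m5; first by lia.
  - by rewrite /m5; case: ifP.
  - by move=> j; rewrite /m5; case: ifP => _; exact: rj.
  exists m4; split.
  + rewrite /= -/i -iS (_ : (2 * k.+1 = 2 + 2 * k)%N); last by lia.
    apply: ExecSeq e4; rewrite /m5; case: ifP => hb.
      by apply: ExecIfTrue; [rewrite /= r0 rj|exact: ExecDo].
    by apply: ExecIfFalse; [rewrite /= r0 rj hb|exact: ExecDo].
  + move=> j jk; case: (j =P i) => [->|ji].
      rewrite h2; last by rewrite /i; lia.
      by rewrite /m5; case: ifP => hb /=; rewrite eqxx.
    by rewrite h1 //; lia.
  + move=> j jk; rewrite h2; last by lia.
    rewrite /m5; case: ifP => _ /=; case: eqP => // h; exfalso; rewrite /i in h; lia.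
have [m3 [e3 f1 f2]] := fixed 24 isT m2 r31 r12.
exists (size l1 + (t2 + 48))%N, m3; split.
- by apply: ExecSeq (e1) _; apply: ExecSeq e2 _.
- by rewrite /=; lia.
- move=> j jn; case: (ltnP j 24) => j24; first by rewrite f1 //; lia.
  by rewrite f2 ?fin //; lia.
Qed.

End Interface.

(** * Inner products and sampling by principal minors *)

Section InnerProduct.
Context {R : realType} {n : nat}.
Implicit Types (x y z : 'cV[R]_n) (A : 'M[R]_n).

Definition dot x y : R := \sum_i x i 0 * y i 0.

Lemma dotC x y : dot x y = dot y x.
Proof. by apply: eq_bigr => i _; rewrite mulrC. Qed.

Lemma dotDl x y z : dot (x + y) z = dot x z + dot y z.
Proof. by rewrite -big_split; apply: eq_bigr => i _; rewrite mxE mulrDl. Qed.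

Lemma dotDr x y z : dot x (y + z) = dot x y + dot x z.
Proof. by rewrite dotC dotDl !(dotC x). Qed.

Lemma dotZl a x y : dot (a *: x) y = a * dot x y.
Proof. by rewrite mulr_sumr; apply: eq_bigr => i _; rewrite mxE mulrA. Qed.

Lemma dotZr a x y : dot x (a *: y) = a * dot x y.
Proof. by rewrite dotC dotZl dotC. Qed.

Lemma dotNl x y : dot (- x) y = - dot x y.
Proof. by rewrite -scaleN1r dotZl mulN1r. Qed.

Lemma dotNr x y : dot x (- y) = - dot x y.
Proof. by rewrite dotC dotNl dotC. Qed.

Lemma dot0l y : dot 0 y = 0.
Proof. by rewrite /dot big1 // => i _; rewrite mxE mul0r. Qed.

Lemma dot0r y : dot y 0 = 0.
Proof. by rewrite dotC dot0l. Qed.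

Lemma dot_suml (I : finType) (P : pred I) (f : I -> 'cV[R]_n) y :
  dot (\sum_(i | P i) f i) y = \sum_(i | P i) dot (f i) y.
Proof.
by apply: (big_morph (fun x => dot x y)) => [x z|]; rewrite ?dotDl ?dot0l.
Qed.

Lemma dot_sumr (I : finType) (P : pred I) (f : I -> 'cV[R]_n) y :
  dot y (\sum_(i | P i) f i) = \sum_(i | P i) dot y (f i).
Proof. by rewrite dotC dot_suml; apply: eq_bigr => i _; rewrite dotC. Qed.

Lemma dot_ge0 x : 0 <= dot x x.
Proof. by apply: sumr_ge0 => i _; rewrite -expr2 sqr_ge0. Qed.

Lemma dot_eq0 x : (dot x x == 0) = (x == 0).
Proof.
apply/eqP/eqP => [/eqP|->]; last exact: dot0l.
rewrite psumr_eq0 => [/allP h|i _]; last by rewrite -expr2 sqr_ge0.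
apply/matrixP => i j; rewrite ord1 mxE.
by have /eqP/eqP := h i (mem_index_enum _); rewrite -expr2 sqrf_eq0 => /eqP.
Qed.

Lemma dot_gt0 x : (0 < dot x x) = (x != 0).
Proof. by rewrite lt_neqAle dot_ge0 andbT eq_sym dot_eq0. Qed.

Lemma dot_mull A x y : dot (A *m x) y = dot x (A^T *m y).
Proof.
rewrite /dot (eq_bigr (fun i => \sum_j A i j * x j 0 * y i 0)); last first.
  by move=> i _; rewrite mxE mulr_suml.
rewrite exchange_big; apply: eq_bigr => j _; rewrite mxE mulr_sumr.
by apply: eq_bigr => i _; rewrite mxE; ring.
Qed.

Lemma dot_sqrD x y : dot (x + y) (x + y) = dot x x + 2 * dot x y + dot y y.
Proof. by rewrite dotDl !dotDr (dotC y x); ring. Qed.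

Lemma dot_sqrD_le x y : dot (x + y) (x + y) <= 2 * (dot x x + dot y y).
Proof.
have := dot_ge0 (x - y); rewrite !dot_sqrD dotNr !dotNl dotNr opprK; lra.
Qed.

Lemma cauchy_schwarz x y : dot x y ^+ 2 <= dot x x * dot y y.
Proof.
have [->|y0] := eqVneq y 0; first by rewrite !dot0r mulr0 expr0n.
have yy : 0 < dot y y by rewrite dot_gt0.
have := dot_ge0 (dot y y *: x - dot x y *: y).
rewrite dot_sqrD !dotNr dotNl !dotZl !dotZr => h.
have : 0 <= dot y y * (dot x x * dot y y - dot x y ^+ 2) by nra.
by rewrite pmulr_rge0 // subr_ge0.
Qed.

Lemma dot_delta x i : dot x (delta_mx i 0) = x i 0.
Proof.
rewrite /dot (bigD1 i) //= mxE !eqxx mulr1 big1 ?addr0 // => j ji.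
by rewrite mxE (negbTE ji) mulr0.
Qed.

Lemma trace_dot A : \tr A = \sum_i dot (A *m delta_mx i 0) (delta_mx i 0).
Proof.
apply: eq_bigr => i _; rewrite dot_delta mxE (bigD1 i) //= mxE !eqxx mulr1.
by rewrite big1 ?addr0 // => j ji; rewrite mxE (negbTE ji) mulr0.
Qed.

End InnerProduct.

(** * Random sets of coordinates weighted by principal minors *)

Section DeterminantalMeasure.
Context {R : realType} {n : nat}.
Implicit Types (G : 'M[R]_n) (T : {set 'I_n}).

(** Outside [T] the rows are those of the identity, so the determinant is the principal minor of [G]
    on [T], without passing to a matrix of another size. *)
Definition minor_mx G T : 'M[R]_n :=
  \matrix_(i, j) if i \in T then G i j else (i == j)%:R.

(** Multilinearity in the rows: each row contributes either its part in [F] or its part in the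
    identity. *)
Lemma det_1D (F : 'I_n -> 'I_n -> R) :
  \det (\matrix_(i, j) (F i j + (i == j)%:R)) =
  \sum_(T : {set 'I_n}) \det (\matrix_(i, j) if i \in T then F i j else (i == j)%:R).
Proof.
rewrite /determinant exchange_big; apply: eq_bigr => s _ /=.
rewrite -mulr_sumr; congr (_ * _).
under eq_bigr do rewrite mxE.
rewrite bigA_distr; apply: eq_bigr => T _; apply: eq_bigr => i _; by rewrite mxE.
Qed.

(** Cramer's rule: the new matrix is [E *m M], where [E] is the identity with row [i] replaced by
    [c]. *)
Lemma det_replace_row (M : 'M[R]_n) (c : 'I_n -> R) (i : 'I_n) :
  \det (\matrix_(k, j) if k == i then \sum_l c l * M l j else M k j) = c i * \det M.
Proof.
pose E : 'M[R]_n := \matrix_(k, j) if k == i then c j else (k == j)%:R.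
have -> : \matrix_(k, j) (if k == i then \sum_l c l * M l j else M k j) = E *m M.
  apply/matrixP => k j; rewrite !mxE; case: eqP => [->|ki].
    by apply: eq_bigr => l _; rewrite mxE eqxx.
  rewrite (bigD1 k) //= mxE (introF eqP ki) eqxx mul1r big1 ?addr0 // => l lk.
  by rewrite mxE (introF eqP ki) eq_sym (negbTE lk) mul0r.
rewrite det_mulmx; congr (_ * _); rewrite /determinant (bigD1 1%g) //=.
rewrite odd_perm1 expr0 mul1r (bigD1 i) //= mxE eqxx perm1.
rewrite big1 ?mulr1 => [|k ki]; last by rewrite mxE (negbTE ki) perm1 eqxx.
rewrite big1 ?addr0 // => s s1.
have [k /andP[ki sk]] : exists k, (k != i) && (s k != k).
  apply/existsP; apply: contraNT s1; rewrite negb_exists => /forallP h.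
  have fx k : k != i -> s k = k.
    by move=> ki; have := h k; rewrite ki /= negbK => /eqP.
  apply/eqP/permP => k; rewrite perm1; have [->|/fx //] := eqVneq k i.
  have [//|si] := eqVneq (s i) i.
  by have /perm_inj/eqP := fx _ si; rewrite (negbTE si).
by rewrite (bigD1 k) //= mxE (negbTE ki) eq_sym (negbTE sk) mul0r mulr0.
Qed.

(** The quotient of the two minors is a Schur complement. With [c] the regression coefficients of
    coordinate [i] on [T], [v] is the residual functional and the quotient is the quadratic form of
    [G] at [v]: indeed [G *m v] vanishes on [T], which contains all coordinates where [v] is nonzero
    besides [i]. *)
Lemma minor_mx_U1 G T (i : 'I_n) : G^T = G -> 0 < \det (minor_mx G T) -> i \notin T ->
  exists c : 'I_n -> R, let v := \col_k (if k == i then 1 else if k \in T then - c k else 0)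
  in \det (minor_mx G (i |: T)) = dot v (G *m v) * \det (minor_mx G T).
Proof.
move=> Gs DT iT; set M := minor_mx G T in DT *.
have Mu : M \in unitmx by rewrite unitmxE unitfE gt_eqF.
pose c l := (row i G *m invmx M) 0 l.
have cM j : \sum_l c l * M l j = G i j.
  have := congr1 (fun A : 'M[R]_(1, n) => A 0 j) (mulmxKV Mu (row i G)).
  by rewrite mxE [RHS]mxE.
have sT j : \sum_l c l * M l j = \sum_(l in T) c l * G l j + (if j \in T then 0 else c j).
  rewrite (bigID (mem T)) /=; congr (_ + _).
    by apply: eq_bigr => l lT; rewrite mxE lT.
  case: ifP => jT.
    apply: big1 => l lT; rewrite mxE (negbTE lT).
    by case: eqP => [lj|_]; [rewrite lj jT in lT|rewrite mulr0].
  rewrite (bigD1 j) ?jT //= mxE jT eqxx mulr1 big1 ?addr0 // => l /andP[lT lj].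
  by rewrite mxE (negbTE lT) (negbTE lj) mulr0.
exists c => v.
have -> : \det (minor_mx G (i |: T)) = c i * \det M.
  rewrite -det_replace_row; congr (\det _); apply/matrixP => k j; rewrite !mxE !inE.
  by case: eqP => [->|_] //=; rewrite cM.
congr (_ * _).
have Gv k : (G *m v) k 0 = G k i - \sum_(l in T) c l * G l k.
  rewrite mxE (bigD1 i) //= mxE eqxx mulr1; congr (_ + _).
  rewrite (bigID (mem T)) /= addrC big1 ?add0r => [|l /andP[li lT]]; last first.
    by rewrite mxE (negbTE li) (negbTE lT) mulr0.
  rewrite -sumrN; apply: eq_big => [l|l /andP[li lT]].
    by case: eqP => [->|_]; rewrite ?(negbTE iT) //= andbT.
  by rewrite mxE (negbTE li) lT mulrN mulrC -{1}Gs mxE.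
rewrite /dot (bigD1 i) //= mxE eqxx mul1r big1 ?addr0 => [|k ki].
  by rewrite Gv -[G i i]cM sT (negbTE iT) addrAC subrr add0r.
rewrite mxE (negbTE ki) Gv; case: ifP => kT; last by rewrite mul0r.
by rewrite -{1}Gs mxE -cM sT kT addr0 subrr mulr0.
Qed.

(** The set is built one element at a time; each step multiplies by a positive value of the
    quadratic form. *)
Lemma minor_mx_gt0 G T : G^T = G -> (forall x, x != 0 -> 0 < dot x (G *m x)) ->
  0 < \det (minor_mx G T).
Proof.
move=> Gs Gp; have [k kT] := ubnP #|T|; elim: k T kT => // k IH T; rewrite ltnS => kT.
have [->|[i iT]] := set_0Vmem T.
  rewrite (_ : minor_mx G set0 = 1%:M) ?det1 //.
  by apply/matrixP => i j; rewrite !mxE inE.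
rewrite -(setD1K iT).
have D0 : 0 < \det (minor_mx G (T :\ i)).
  by apply: IH; rewrite (cardsD1 i T) iT in kT; exact: leq_trans kT.
have iT' : i \notin T :\ i by rewrite !inE eqxx.
have [c ->] := minor_mx_U1 Gs D0 iT'.
rewrite mulr_gt0 // Gp //; apply/eqP => /matrixP/(_ i 0); rewrite !mxE eqxx.
by apply/eqP; rewrite oner_eq0.
Qed.

(* The expected size of a set drawn with probability proportional to the
   principal minor is the trace of [G (1 + G)^-1]. *)
Lemma minor_mx_card G : \det (1%:M + G) != 0 ->
  \sum_(T : {set 'I_n}) #|T|%:R * \det (minor_mx G T) =
  (n%:R - \tr (invmx (1%:M + G))) * \det (1%:M + G).
Proof.
move=> D0; set A := 1%:M + G in D0 *.
have Au : A \in unitmx by rewrite unitmxE unitfE.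
have DE : \det A = \sum_T \det (minor_mx G T).
  rewrite -[RHS]det_1D; congr (\det _); apply/matrixP => i j.
  by rewrite !mxE addrC.
(* Minors of sets avoiding [i] are those of [G] with row [i] erased. Then [1 + G] gets the unit row
   [i], which is row [i] of [invmx A *m A], and Cramer's rule applies. *)
have outE i : \sum_(T : {set 'I_n} | i \notin T) \det (minor_mx G T) = invmx A i i * \det A.
  pose F k j := if k == i then 0 else G k j.
  rewrite -det_replace_row.
  transitivity (\det (\matrix_(k, j) (F k j + (k == j)%:R))); last first.
    congr (\det _); apply/matrixP => k j; rewrite [LHS]mxE [RHS]mxE /F.
    case: eqP => [->|_]; last by rewrite [RHS]mxE [in RHS]mxE addrC.
    have := congr1 (fun B : 'M[R]_n => B i j) (mulVmx Au).
    by rewrite [X in X = _]mxE [X in _ = X]mxE add0r => ->.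
  rewrite det_1D [RHS](bigID (fun T : {set 'I_n} => i \in T)) /=.
  rewrite [X in _ = X + _]big1 ?add0r => [|T iT].
    apply: eq_bigr => T iT; congr (\det _); apply/matrixP => k j; rewrite !mxE /F.
    by case: ifP => // kT; case: eqP => // ki; rewrite ki (negbTE iT) in kT.
  rewrite (expand_det_row _ i) big1 // => j _.
  by rewrite mxE iT /F eqxx mul0r.
have cE (T : {set 'I_n}) : #|T|%:R = \sum_i (1 - (i \notin T)%:R) :> R.
  rewrite -sum1_card natr_sum big_mkcond /=; apply: eq_bigr => i _.
  by case: (i \in T); rewrite /= ?subr0 ?subrr.
rewrite (eq_bigr (fun T => \sum_i (1 - (i \notin T)%:R) * \det (minor_mx G T)));
  last by move=> T _; rewrite cE mulr_suml.
rewrite exchange_big /= mulrBl mulr_suml.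
rewrite (_ : n%:R = \sum_(i < n) 1); last by rewrite sumr_const card_ord.
rewrite mulr_suml -sumrB; apply: eq_bigr => i _.
rewrite -outE DE mul1r [X in _ - X]big_mkcond -sumrB; apply: eq_bigr => T _.
by case: (i \in T); rewrite /= ?subr0 ?subrr ?mul1r ?mul0r.
Qed.

End DeterminantalMeasure.

(** * Projection on the span of an orthogonal family *)

Section Projection.
Context {R : realType} {n q : nat}.
Variable g : 'I_q -> 'cV[R]_n.
Implicit Types (x y : 'cV[R]_n) (a : 'I_q -> R).

Definition orthogonal_family := forall i j, i != j -> dot (g i) (g j) = 0.

Definition combine a : 'cV[R]_n := \sum_j a j *: g j.

(* Zero vectors are allowed in [g]: division by zero gives zero. *)
Definition pcoef x (j : 'I_q) : R := dot (g j) x / dot (g j) (g j).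

Definition proj x : 'cV[R]_n := combine (pcoef x).

Definition proj_mx : 'M[R]_n := \sum_j (dot (g j) (g j))^-1 *: (g j *m (g j)^T).

Hypothesis og : orthogonal_family.

Lemma dot_combine a j : dot (combine a) (g j) = a j * dot (g j) (g j).
Proof.
rewrite dot_suml (bigD1 j) //= dotZl big1 ?addr0 // => i ij.
by rewrite dotZl og ?mulr0.
Qed.

Lemma dot_combine2 a b : dot (combine a) (combine b) =
  \sum_j a j * b j * dot (g j) (g j).
Proof.
by rewrite dot_sumr; apply: eq_bigr => j _; rewrite dotZr dot_combine; ring.
Qed.

Lemma dot_proj x j : dot (proj x) (g j) = dot x (g j).
Proof.
rewrite dot_combine /pcoef; have [->|g0] := eqVneq (g j) 0; first by rewrite !dot0r mulr0.
by rewrite divfK ?dot_eq0 // dotC.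
Qed.

Lemma combineB a b : combine a - combine b = combine (fun j => a j - b j).
Proof. by rewrite /combine -sumrB; apply: eq_bigr => j _; rewrite scalerBl. Qed.

Lemma dot_proj_perp x a : dot (x - proj x) (combine a) = 0.
Proof.
by rewrite dot_sumr big1 // => j _; rewrite dotZr dotDl dotNl dot_proj subrr mulr0.
Qed.

Lemma proj_pythagoras x a : dot (x - combine a) (x - combine a) =
  dot (x - proj x) (x - proj x) + dot (proj x - combine a) (proj x - combine a).
Proof.
rewrite (_ : x - combine a = (x - proj x) + (proj x - combine a)); last first.
  by rewrite addrA subrK.
by rewrite dot_sqrD {3}/proj combineB dot_proj_perp mulr0 addr0.
Qed.

Lemma proj_min x a : dot (x - proj x) (x - proj x) <= dot (x - combine a) (x - combine a).
Proof. by rewrite proj_pythagoras lerDl dot_ge0. Qed.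

Lemma proj_mxE x : proj_mx *m x = proj x.
Proof.
rewrite /proj_mx mulmx_suml; apply: eq_bigr => j _; rewrite -scalemxAl -mulmxA.
rewrite (_ : (g j)^T *m x = (dot (g j) x)%:M) ?mul_mx_scalar ?scalerA 1?mulrC //.
apply/matrixP => k l; rewrite !ord1 mxE mxE eqxx mulr1n.
by apply: eq_bigr => i _; rewrite mxE.
Qed.

Lemma proj_mx_tr : proj_mx^T = proj_mx.
Proof.
rewrite /proj_mx raddf_sum; apply: eq_bigr => j _.
apply/matrixP => a b; rewrite !mxE !big_ord1 !mxE; congr (_ * _).
exact: mulrC.
Qed.

Lemma mx_col_ext (A B : 'M[R]_n) : (forall x : 'cV[R]_n, A *m x = B *m x) -> A = B.
Proof.
move=> h; apply/matrixP => i j.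
have := congr1 (fun v : 'cV[R]_n => v i 0) (h (delta_mx j 0)).
by rewrite -!colE !mxE.
Qed.

Lemma proj_mx_idem : proj_mx *m proj_mx = proj_mx.
Proof.
apply: mx_col_ext => x; rewrite -mulmxA !proj_mxE; apply: eq_bigr => j _.
by congr (_ *: _); rewrite /pcoef dotC dot_proj dotC.
Qed.

Lemma trace_proj (Y : 'M[R]_n) :
  \tr (Y *m proj_mx) = \sum_j (dot (g j) (g j))^-1 * dot (Y *m g j) (g j).
Proof.
rewrite /proj_mx mulmx_sumr raddf_sum; apply: eq_bigr => j _ /=.
rewrite -scalemxAr linearZ /= mulmxA mxtrace_mulC; congr (_ * _).
rewrite /mxtrace big_ord1 mxE; apply: eq_bigr => i _.
by rewrite mxE mulrC.
Qed.

(** For the complementary projection [Q], the trace of [Y *m Q] is that of [Q *m Y *m Q]. This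
    separates the directions of the span, few in number, from those of its complement, in which the
    vectors of interest are short. *)
Lemma trace_split (Y : 'M[R]_n) : \tr Y = \tr (Y *m proj_mx) +
  \sum_i dot (Y *m (delta_mx i 0 - proj (delta_mx i 0)))
              (delta_mx i 0 - proj (delta_mx i 0)).
Proof.
pose Q := 1%:M - proj_mx.
have Qs : Q^T = Q by rewrite /Q raddfB /= trmx1 proj_mx_tr.
have QQ : Q *m Q = Q.
  by rewrite /Q mulmxBr mulmx1 mulmxBl mul1mx proj_mx_idem subrr subr0.
have QE x : Q *m x = x - proj x by rewrite /Q mulmxBl mul1mx proj_mxE.
have -> : \tr Y = \tr (Y *m proj_mx) + \tr (Q *m Y *m Q).
  rewrite (mxtrace_mulC (Q *m Y)) mulmxA QQ (mxtrace_mulC Q) /Q mulmxBr mulmx1.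
  by rewrite raddfB addrC subrK.
congr (_ + _); rewrite trace_dot; apply: eq_bigr => i _.
by rewrite -!mulmxA dot_mull Qs !QE.
Qed.

End Projection.

(** * Packing of Boolean vectors near a subspace *)

Section Packing.
Context {R : realType}.

Lemma sqrB_le (x y : R) : (x - y) * (x - y) <= 2 * (x ^+ 2 + y ^+ 2).
Proof. by have := sqr_ge0 (x + y); nra. Qed.

(** Markov's inequality, in the form that keeps half of the family. *)
Lemma card_sat (N : nat) (f : 'I_N -> R) (a : R) : 0 < a ->
  (forall e, 0 <= f e) -> \sum_e f e <= N%:R * a ->
  (N <= 2 * #|[set e | (f e <= 2 * a)%R]|)%N.
Proof.
move=> a0 f0 fs; set A := [set e | _].
have h : #|~: A|%:R * (2 * a) <= N%:R * a.
  apply: le_trans fs; rewrite (bigID (mem A)) /=.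
  rewrite -[X in X <= _]add0r lerD ?sumr_ge0 // mulr_natl -sumr_const.
  rewrite big_mkcond [X in _ <= X]big_mkcond; apply: ler_sum => e _.
  by rewrite !inE; case: (lerP (f e) (2 * a)) => //= /ltW.
have {}h : (2 * #|~: A| <= N)%N.
  rewrite -(ler_nat R) natrM -(ler_pM2r a0); apply: le_trans h.
  by rewrite mulrCA mulrA.
by have := cardsC A; rewrite card_ord => NE; lia.
Qed.

(* [W] is spanned by [g]. Sampling [T] with probability proportional to the
   minors of (a multiple of) the empirical covariance of the [b e], one finds
   [4 q] coordinates from which most of the [b e] can be recovered, by linear
   regression, up to a constant times their distance to [W]. *)
Lemma packing (n q N : nat) (tau : R) (g : 'I_q -> 'cV[R]_n)
    (b : 'I_N -> 'cV[R]_n) : (0 < q)%N -> 0 < tau -> orthogonal_family g ->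
  (forall e i, b e i 0 = 0 \/ b e i 0 = 1) ->
  (forall e, dot (b e - proj g (b e)) (b e - proj g (b e)) <= tau) ->
  (forall e f, e != f -> 64 * tau < dot (b e - b f) (b e - b f)) ->
  (N <= 2 ^ (4 * q).+1)%N.
Proof.
move=> q0 tau0 og b01 btau bsep.
have [->//|N0] := posnP N.
have [n0|n0] := posnP n.
  have [N1|N1] := leqP N 1; first by apply: leq_trans N1 _; rewrite expn_gt0.
  have := bsep (Ordinal N0) (Ordinal N1) isT.
  rewrite /dot big1 ?ltNge ?mulr_ge0 ?ltW // => i.
  by exfalso; have := ltn_ord i; lia.
have N0R : 0 < N%:R :> R by rewrite ltr0n.
have n0R : 0 < n%:R :> R by rewrite ltr0n.
have q0R : 0 < q%:R :> R by rewrite ltr0n.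
(* This scale makes the complement of the span count for at most [t * (2 * tau) = q] in the trace,
   as much as the span itself. *)
pose t := q%:R / (2 * tau).
have t0 : 0 < t by rewrite divr_gt0 // mulr_gt0.
(* The empirical second moment of the [b e]; the ridge [tau / n] makes it positive definite and
   adds, before scaling, at most [tau] to the trace off the span. *)
pose G : 'M[R]_n := t *: (N%:R^-1 *: (\sum_e b e *m (b e)^T) + (tau / n%:R)%:M).
have Gs : G^T = G.
  apply/matrixP => i j; rewrite !mxE !summxE eq_sym; congr (_ * (_ * _ + _)).
  by apply: eq_bigr => e _; rewrite !mxE !big_ord1 !mxE mulrC.
have dotG x : dot (G *m x) x =
    t * (N%:R^-1 * (\sum_e dot (b e) x ^+ 2) + tau / n%:R * dot x x).
  rewrite -scalemxAl mulmxDl dotZl dotDl -scalemxAl dotZl mul_scalar_mx dotZl.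
  rewrite mulmx_suml dot_suml; congr (_ * (_ * _ + _)); apply: eq_bigr => e _.
  rewrite -mulmxA (_ : (b e)^T *m x = (dot (b e) x)%:M).
    by rewrite mul_mx_scalar dotZl -expr2.
  apply/matrixP => k l; rewrite !ord1 mxE mxE eqxx mulr1n.
  by apply: eq_bigr => i _; rewrite mxE.
have Gge x : t * (N%:R^-1 * (\sum_e dot (b e) x ^+ 2)) <= dot x (G *m x).
  rewrite dotC dotG ler_pM2l // lerDl mulr_ge0 ?dot_ge0 // ltW //.
  by rewrite divr_gt0.
have Gge0 x : 0 <= dot (G *m x) x.
  rewrite dotC; apply: le_trans (Gge x).
  apply: mulr_ge0; [exact: ltW|apply: mulr_ge0; first by rewrite invr_ge0 ltW].
  by apply: sumr_ge0 => e _; exact: sqr_ge0.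
have Gp x : x != 0 -> 0 < dot x (G *m x).
  move=> x0; rewrite dotC dotG; apply: mulr_gt0 => //; apply: ltr_wpDl.
    apply: mulr_ge0; first by rewrite invr_ge0 ltW.
    by apply: sumr_ge0 => e _; exact: sqr_ge0.
  by rewrite mulr_gt0 ?divr_gt0 ?dot_gt0.
pose D T := \det (minor_mx G T).
have D0 T : 0 < D T by exact: minor_mx_gt0.
pose A := 1%:M + G.
have DA : \det A = \sum_T D T.
  rewrite -[RHS]det_1D; congr (\det _); apply/matrixP => i j.
  by rewrite !mxE addrC.
have DA0 : 0 < \det A.
  rewrite DA (bigD1 setT) //= ltr_pwDl // sumr_ge0 // => T _; exact/ltW.
have Au : A \in unitmx by rewrite unitmxE unitfE gt_eqF.
(* [Y] is [G (1 + G)^-1], whose trace is the expected size of [T]. It is below the identity, which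
   is used on the span, and below [G], which is used off the span. *)
pose X := invmx A; pose Y := 1%:M - X.
have XE (x : 'cV[R]_n) : exists z, x = z + G *m z /\ X *m x = z.
  exists (X *m x); split=> //.
  by rewrite -[x in LHS](mulKVmx Au) -/X /A mulmxDl mul1mx.
have Yle1 (x : 'cV[R]_n) : dot (Y *m x) x <= dot x x.
  have [z [xE Xz]] := XE x; rewrite mulmxBl mul1mx Xz dotDl dotNl lerBlDr lerDl.
  by rewrite xE dotDr addr_ge0 ?dot_ge0 // dotC.
have YleG (x : 'cV[R]_n) : dot (Y *m x) x <= dot (G *m x) x.
  have [z [xE Xz]] := XE x; rewrite mulmxBl mul1mx Xz {1}xE addrAC subrr add0r.
  rewrite xE mulmxDr !dotDr !dotDl -addrA lerD2l.
  have h : dot (G *m (G *m z)) z = dot (G *m z) (G *m z) by rewrite dot_mull Gs.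
  rewrite h; have := Gge0 (G *m z); have := dot_ge0 (G *m z); lra.
have trY : \tr Y <= 2 * q%:R.
  rewrite (trace_split og) trace_proj mulr2n mulrDl mul1r lerD //.
    rewrite -[leRHS](_ : \sum_(j < q) 1 = _); last by rewrite sumr_const card_ord.
    apply: ler_sum => j _; have [->|gj] := eqVneq (g j) 0.
      by rewrite mulmx0 dot0l mulr0.
    by rewrite mulrC ler_pdivrMr ?dot_gt0 // mul1r.
  pose w i : 'cV[R]_n := delta_mx i 0 - proj g (delta_mx i 0).
  apply: le_trans (_ : \sum_i dot (G *m w i) (w i) <= _); first exact: ler_sum.
  have wle i : dot (w i) (w i) <= 1.
    have := proj_min og (delta_mx i 0) (fun=> 0); rewrite /combine big1 => [|j _].
      by rewrite subr0 dot_delta mxE !eqxx.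
    by rewrite scale0r.
  have bw e i : dot (b e) (w i) = (b e - proj g (b e)) i 0.
    rewrite -dot_delta dotDr dotDl dotNr dotNl; congr (_ - _).
    by rewrite -!proj_mxE // dot_mull proj_mx_tr.
  under eq_bigr do rewrite dotG.
  rewrite -mulr_sumr big_split /= -!mulr_sumr exchange_big /=.
  have h1 : \sum_e \sum_i dot (b e) (w i) ^+ 2 <= N%:R * tau.
    rewrite mulr_natl -[X in _ *+ X]card_ord -sumr_const; apply: ler_sum => e _.
    by under eq_bigr do rewrite bw expr2; exact: btau.
  have h2 : \sum_i dot (w i) (w i) <= n%:R.
    rewrite -[leRHS](_ : \sum_(i < n) 1 = _); last by rewrite sumr_const card_ord.
    exact: ler_sum.
  apply: le_trans (_ : t * (tau + tau) <= _); last first.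
    rewrite (_ : t * (tau + tau) = q%:R) //; rewrite /t; field; exact: lt0r_neq0.
  rewrite ler_pM2l // lerD //.
    by rewrite mulrC ler_pdivrMr // mulrC.
  by rewrite mulrAC ler_pdivrMr // ler_pM2l.
have ET : \sum_(T : {set 'I_n}) #|T|%:R * D T <= 2 * q%:R * \det A.
  rewrite minor_mx_card ?gt_eqF // ler_pM2r //; apply: le_trans trY.
  by rewrite /Y raddfB /= mxtrace1.
(* The weight of the one-element extensions of [T]. In the sum over [T] each set occurs once per
   element, so the total is again that of the sizes. *)
pose W (T : {set 'I_n}) := \sum_(i | i \notin T) D (i |: T).
have EW : \sum_T W T = \sum_(T : {set 'I_n}) #|T|%:R * D T.
  transitivity (\sum_i \sum_(T : {set 'I_n} | i \in T) D T).
    rewrite /W (exchange_big_dep xpredT) //=; apply: eq_bigr => i _.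
    rewrite (reindex_onto (fun T => T :\ i) (fun T => i |: T)) /=; last first.
      by move=> T iT; rewrite setU1K.
    apply: eq_big => [T|T /andP[iT /eqP TE]]; last by rewrite TE.
    rewrite !inE eqxx /=; apply/eqP/idP => [<-|iT]; first by rewrite !inE eqxx.
    by rewrite setD1K.
  rewrite (exchange_big_dep xpredT) //=; apply: eq_bigr => T _.
  by rewrite sumr_const mulr_natl.
(* A set no worse than average: its size plus the total of its Schur complements is at most
   [2 * q + 2 * q]. *)
have [T TP] : exists T : {set 'I_n}, #|T|%:R * D T + W T <= 4 * q%:R * D T.
  apply/existsP; apply: contraT; rewrite negb_exists => /forallP h.
  have : \sum_(T : {set 'I_n}) 4 * q%:R * D T < \sum_(T : {set 'I_n}) (#|T|%:R * D T + W T).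
    apply: ltr_sum => [|T _]; last by rewrite ltNge; exact: h.
    by apply/hasP; exists set0; rewrite ?mem_index_enum.
  rewrite big_split /= EW -mulr_sumr -DA; lra.
have W0 : 0 <= W T by apply: sumr_ge0 => i _; apply/ltW.
have T4 : (#|T| <= 4 * q)%N.
  rewrite -(ler_nat R) natrM -(ler_pM2r (D0 T)); lra.
have /fin_all_exists[cf cfP] i : exists c : 'I_n -> R, i \notin T ->
    let v := \col_k (if k == i then 1 else if k \in T then - c k else 0) in
    D (i |: T) = dot v (G *m v) * D T.
  have [iT|iT] := boolP (i \in T); first by exists (fun=> 0).
  by have [c cP] := minor_mx_U1 Gs (D0 T) iT; exists c.
pose v i : 'cV[R]_n := \col_k (if k == i then 1 else if k \in T then - cf i k else 0).
have vG : \sum_(i | i \notin T) dot (v i) (G *m v i) <= 4 * q%:R.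
  rewrite -(ler_pM2r (D0 T)) mulr_suml; apply: le_trans TP.
  rewrite -[leLHS]add0r; apply: lerD; first by apply: mulr_ge0 => //; exact: ltW.
  by rewrite /W le_eqVlt; apply/orP; left; apply/eqP; apply: eq_bigr => i iT; rewrite cfP.
(* The squared error of predicting the coordinates of [b e] outside [T] from those in [T]; its
   average is at most [8 * tau]. *)
pose err e := \sum_(i | i \notin T) dot (b e) (v i) ^+ 2.
have errs : \sum_e err e <= N%:R * (8 * tau).
  rewrite /err exchange_big /=.
  have h : t * (N%:R^-1 * \sum_(i | i \notin T) \sum_e dot (b e) (v i) ^+ 2) <= 4 * q%:R.
    by apply: le_trans vG; rewrite !mulr_sumr; apply: ler_sum => i _; exact: Gge.
  have t8 : 4 * q%:R = t * (8 * tau) by rewrite /t; field; exact: lt0r_neq0.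
  by move: h; rewrite t8 ler_pM2l // ler_pdivrMl.
have a0 : 0 < 8 * tau by rewrite mulr_gt0.
have := card_sat a0 (fun e => sumr_ge0 _ (fun i _ => sqr_ge0 _)) errs.
set B := [set e | _] => NB; apply: leq_trans NB _; rewrite expnS leq_pmul2l //.
(* Among vectors of error at most [16 * tau], two with the same pattern on [T] have the same
   predictions, hence squared distance at most [2 * (16 + 16) * tau], against the separation. *)
pose phi e := [set i in T | b e i 0 == 1].
have phi_inj : {in B &, injective phi}.
  move=> e f; rewrite !inE => eB fB ef; apply/eqP; apply: contraT => nef.
  have := bsep _ _ nef; rewrite ltNge => /negP[].
  have same k : k \in T -> b e k 0 = b f k 0.
    move=> kT; move/setP/(_ k): ef; rewrite !inE kT /=.
    have n01 : (0 : R) == 1 = false by rewrite eq_sym oner_eq0.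
    by case: (b01 e k) => ->; case: (b01 f k) => ->; rewrite ?eqxx ?n01.
  have dv e' i : i \notin T -> dot (b e') (v i) = b e' i 0 - \sum_(k in T) cf i k * b e' k 0.
    move=> iT; rewrite /dot (bigD1 i) //= mxE eqxx mulr1; congr (_ + _).
    rewrite (bigID (mem T)) /= addrC big1 ?add0r => [|k /andP[ki kT]]; last first.
      by rewrite mxE (negbTE ki) (negbTE kT) mulr0.
    rewrite -sumrN; apply: eq_big => [k|k /andP[ki kT]].
      by case: eqP => [->|_]; rewrite ?(negbTE iT) //= andbT.
    by rewrite mxE (negbTE ki) kT mulrN mulrC.
  apply: le_trans (_ : \sum_(i | i \notin T) 2 * (dot (b e) (v i) ^+ 2 + dot (b f) (v i) ^+ 2) <= _).
    rewrite /dot (bigID (mem T)) /= big1 ?add0r => [|i iT]; last first.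
      by rewrite !mxE same // subrr mul0r.
    apply: ler_sum => i iT; rewrite !mxE.
    have -> : b e i 0 - b f i 0 = dot (b e) (v i) - dot (b f) (v i).
      rewrite !dv // (eq_bigr (fun k => cf i k * b f k 0)); first by ring.
      by move=> k kT; rewrite same.
    exact: sqrB_le.
  rewrite -mulr_sumr big_split /=; rewrite -/(err e) -/(err f).
  have eB' : err e <= 2 * (8 * tau) := eB.
  have fB' : err f <= 2 * (8 * tau) := fB.
  lra.
rewrite -(card_in_imset phi_inj).
apply: leq_trans (_ : #|powerset T| <= _)%N; last by rewrite card_powerset leq_pexp2l.
apply: subset_leq_card; apply/subsetP => _ /imsetP[e _ ->].
by rewrite inE; apply/subsetP => i; rewrite inE => /andP[].
Qed.

End Packing.

(** * The spectral subspace *)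

Section Spectral.
Context {R : realType}.

Lemma char_poly_orthogonal n (A H : 'M[R]_n) : H *m H = 1%:M ->
  char_poly (H *m A *m H) = char_poly A.
Proof.
move=> HH; rewrite /char_poly; set M := char_poly_mx A.
have HHp : map_mx polyC H *m map_mx polyC H = 1%:M.
  by rewrite -map_mxM HH map_mx1.
have -> : char_poly_mx (H *m A *m H) = map_mx polyC H *m M *m map_mx polyC H.
  rewrite /M /char_poly_mx mulmxBr mulmxBl !map_mxM; congr (_ - _).
  by rewrite mul_mx_scalar -scalemxAl HHp scalemx1.
by rewrite !det_mulmx mulrC mulrA -det_mulmx HHp det1 mul1r.
Qed.

Lemma char_poly_block n (a : R) (A : 'M[R]_n) :
  char_poly (block_mx (a%:M : 'M_1) 0 0 A) = ('X - a%:P) * char_poly A.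
Proof.
rewrite /char_poly /char_poly_mx map_block_mx scalar_mx_block opp_block_mx.
rewrite add_block_mx !raddf0 !addr0 det_ublock; congr (_ * _).
by rewrite det_mx11 !mxE eqxx.
Qed.

(** The Householder reflection along [e - v], or the identity if the two unit vectors coincide. *)
Lemma reflection n (v : 'rV[R]_n.+1) : v *m v^T = 1%:M ->
  exists H : 'M[R]_n.+1, [/\ H^T = H, H *m H = 1%:M & delta_mx 0 0 *m H = v].
Proof.
move=> v1; pose e : 'rV[R]_n.+1 := delta_mx 0 0.
have e1 : e *m e^T = 1%:M.
  by rewrite /e trmx_delta mul_delta_mx; apply/matrixP => i j; rewrite !ord1 !mxE.
have [ev|ev] := eqVneq e v.
  by exists 1%:M; split; rewrite ?trmx1 ?mulmx1.
pose w := e - v; pose b := (e *m v^T) 0 0.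
have evb : e *m v^T = b%:M by rewrite [LHS]mx11_scalar.
have veb : v *m e^T = b%:M by rewrite -[LHS]trmxK trmx_mul trmxK evb tr_scalar_mx.
have ww : w *m w^T = (2 * (1 - b))%:M.
  rewrite /w raddfB /= mulmxBl !mulmxBr e1 v1 evb veb -!raddfB /=.
  by congr (_%:M); ring.
have b1 : 1 - b != 0.
  apply: contraNneq ev => b0; rewrite -subr_eq0 -/w; apply/eqP/matrixP => i j.
  rewrite ord1 [RHS]mxE; move: ww; rewrite b0 mulr0 => /matrixP/(_ 0 0).
  rewrite !mxE mul0rn => /eqP; rewrite psumr_eq0 => [/allP h|k _]; last first.
    by rewrite !mxE -expr2 sqr_ge0.
  have := h j (mem_index_enum _); rewrite !mxE -expr2 sqrf_eq0 => /eqP; exact.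
pose H : 'M[R]_n.+1 := 1%:M - (1 - b)^-1 *: (w^T *m w).
exists H; split.
- rewrite /H raddfB /= trmx1; congr (_ - _).
  by rewrite linearZ /= trmx_mul trmxK.
- have MM : w^T *m w *m (w^T *m w) = (2 * (1 - b)) *: (w^T *m w).
    by rewrite -mulmxA (mulmxA w) ww mul_scalar_mx -scalemxAr.
  rewrite /H; move: (w^T *m w) MM => M MM.
  rewrite mulmxBl mul1mx mulmxBr mulmx1 -scalemxAl -scalemxAr MM.
  by apply/matrixP => i j; rewrite !mxE; field.
- rewrite -/e /H mulmxBr mulmx1 -scalemxAr mulmxA.
  have -> : e *m w^T = (1 - b)%:M by rewrite /w raddfB /= mulmxBr e1 evb -raddfB.
  by rewrite mul_scalar_mx scalerA mulVf // scale1r /w subKr.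
Qed.

(** Deflation. The characteristic polynomial is given as split, so an eigenvector exists over the
    reals at once; a reflection carries the first basis vector to it, symmetry makes the conjugated
    matrix block diagonal, and the remaining block has the rest of [s] as spectrum. The order of [s]
    is kept on the diagonal. *)
Lemma symmetric_spectral n (A : 'M[R]_n) (s : seq R) : A^T = A ->
  char_poly A = \prod_(x <- s) ('X - x%:P) ->
  exists Q : 'M[R]_n, Q *m Q^T = 1%:M /\
    A = Q^T *m diag_mx (\row_i nth 0 s i) *m Q.
Proof.
elim: n A s => [|n IH] A s As As_poly.
  by exists 1%:M; split; apply/matrixP => -[].
have ss : size s = n.+1.
  by have := size_char_poly A; rewrite As_poly size_prod_XsubC => -[].
case: s ss As_poly => // x s [ss]; rewrite big_cons => As_poly.
have : eigenvalue A x.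
  by rewrite eigenvalue_root_char As_poly rootM root_XsubC eqxx.
move=> /eigenvalueP[v0 vA v0n].
pose c := (v0 *m v0^T) 0 0.
have c0 : 0 < c.
  rewrite /c lt_neqAle eq_sym mxE sumr_ge0 ?andbT => [|k _]; last first.
    by rewrite !mxE -expr2 sqr_ge0.
  apply: contra v0n; rewrite psumr_eq0 => [/allP h|k _]; last first.
    by rewrite !mxE -expr2 sqr_ge0.
  apply/eqP/matrixP => i j; rewrite ord1 [RHS]mxE.
  by have := h j (mem_index_enum _); rewrite !mxE -expr2 sqrf_eq0 => /eqP.
pose v := (Num.sqrt c)^-1 *: v0.
have v1 : v *m v^T = 1%:M.
  rewrite /v linearZ /= -scalemxAl -scalemxAr scalerA -invfM -expr2 sqr_sqrtr ?ltW //.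
  rewrite [v0 *m _]mx11_scalar -/c; apply/matrixP => i j.
  by rewrite !ord1 !mxE eqxx !mulr1n mulVf // gt_eqF.
have {}vA : v *m A = x *: v by rewrite /v -scalemxAl vA !scalerA mulrC.
have [H [Hs HH He]] := reflection v1.
pose e : 'rV[R]_n.+1 := delta_mx 0 0.
pose B := H *m A *m H.
have eB : e *m B = x *: e.
  by rewrite /B !mulmxA He vA -scalemxAl -He -mulmxA HH mulmx1.
have Bs : B^T = B by rewrite /B !trmx_mul As Hs mulmxA.
have Bp : char_poly B = char_poly A by exact: char_poly_orthogonal.
have AE : A = H *m B *m H by rewrite /B !mulmxA HH mul1mx -mulmxA HH mulmx1.
clearbody B.
have B0 j : B 0 j = if j == 0 then x else 0.
  have := congr1 (fun M : 'rV[R]_n.+1 => M 0 j) eB.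
  by rewrite -rowE !mxE eqxx /= => ->; case: eqP => _; rewrite ?mulr1 ?mulr0.
pose B' := drsubmx (B : 'M[R]_(1 + n)).
have l0 : lshift n (0 : 'I_1) = (0 : 'I_n.+1) by exact: val_inj.
have r0 (j : 'I_n) : (rshift 1 j == (0 : 'I_n.+1)) = false by [].
have BE : B = block_mx (x%:M : 'M_1) 0 0 B' :> 'M[R]_(1 + n).
  rewrite -[LHS](@submxK _ 1 n 1 n); congr block_mx; apply/matrixP => i j.
  - by rewrite !ord1 !mxE l0 B0 eqxx.
  - by rewrite !ord1 !mxE l0 B0 r0.
  - by rewrite !ord1 !mxE -Bs mxE l0 B0 r0.
have B's : B'^T = B'.
  by apply/matrixP => i j; rewrite !mxE -{1}Bs mxE.
have B'p : char_poly B' = \prod_(y <- s) ('X - y%:P).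
  move: Bp; rewrite As_poly (_ : char_poly B = char_poly (block_mx (x%:M : 'M_1) 0 0 B')); last by rewrite -BE.
  rewrite char_poly_block => /mulfI; apply.
  by rewrite polyXsubC_eq0.
have [Q' [QQ' B'E]] := IH B' s B's B'p.
pose K : 'M[R]_(1 + n) := block_mx (1%:M : 'M_1) 0 0 Q'.
have KT : K^T = block_mx (1%:M : 'M_1) 0 0 Q'^T.
  by rewrite /K tr_block_mx trmx1 !trmx0.
have KK : K *m K^T = 1%:M.
  rewrite KT /K mulmx_block !mulmx0 !mul0mx !addr0 add0r mulmx1 QQ'.
  by rewrite -scalar_mx_block.
pose D : 'M[R]_(1 + n) := diag_mx (\row_(i < n.+1) nth 0 (x :: s) i).
have DE : D = block_mx (x%:M : 'M_1) 0 0 (diag_mx (\row_i nth 0 s i)).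
  apply/matrixP => i j; rewrite mxE mxE.
  case: (@split_ordP 1 n i) => i' ->; case: (@split_ordP 1 n j) => j' ->.
  - by rewrite block_mxEul !ord1 !mxE !eqxx.
  - by rewrite block_mxEur [RHS]mxE ord1 -val_eqE.
  - by rewrite block_mxEdl [RHS]mxE ord1 -val_eqE.
  - by rewrite block_mxEdr !mxE -!val_eqE.
have BK : (B : 'M[R]_(1 + n)) = K^T *m D *m K.
  rewrite BE {1}B'E KT DE /K !mulmx_block.
  by rewrite !(mulmx0, mul0mx, addr0, add0r, mulmx1, mul1mx).
exists ((K : 'M[R]_n.+1) *m H); split.
  by rewrite trmx_mul Hs mulmxA -(mulmxA _ H H) HH mulmx1; exact: KK.
rewrite AE (BK : B = _) trmx_mul Hs -!mulmxA; congr (H *m _).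
Qed.

End Spectral.

(** * Gram-Schmidt with pivoting on the columns of a matrix *)

Section PivotedGramSchmidt.
Context {R : realType} {n q : nat}.
Variables (A : 'M[R]_n) (w : nat -> 'cV[R]_n) (B : nat -> 'M[R]_n) (thr : R).

(* [B j] holds the residuals of the columns of [A] after [j] rounds; a round is
   void, with [w j = 0], when all residuals are below the threshold. *)
Hypothesis B0 : B 0 = A.
Hypothesis BS : forall j x, (j < q)%N -> B j.+1 *m x =
  B j *m x - (dot (w j) (B j *m x) / dot (w j) (w j)) *: w j.
Hypothesis wP : forall j, (j < q)%N ->
  (w j = 0 /\ forall k, dot (B j *m delta_mx k 0) (B j *m delta_mx k 0) <= thr) \/
  (exists i, [/\ w j = B j *m delta_mx i 0, thr < dot (w j) (w j) &
    forall k, dot (B j *m delta_mx k 0) (B j *m delta_mx k 0) <= dot (w j) (w j)]).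

Lemma residual_perp_new j x : (j < q)%N -> dot (w j) (B j.+1 *m x) = 0.
Proof.
move=> jq; rewrite BS // dotDr dotNr dotZr.
have [->|w0] := eqVneq (w j) 0; first by rewrite !dot0l !mul0r subr0.
by rewrite divfK ?subrr // dot_eq0.
Qed.

Lemma residual_le j x : (j < q)%N ->
  dot (B j.+1 *m x) (B j.+1 *m x) <= dot (B j *m x) (B j *m x).
Proof.
move=> jq; pose c := dot (w j) (B j *m x) / dot (w j) (w j).
have -> : B j *m x = B j.+1 *m x + c *: w j by rewrite BS // subrK.
rewrite dot_sqrD dotZr dotC residual_perp_new // mulr0 mulr0 addr0 lerDl.
exact: dot_ge0.
Qed.

Lemma residual_le_trans i j x : (i <= j <= q)%N ->
  dot (B j *m x) (B j *m x) <= dot (B i *m x) (B i *m x).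
Proof.
elim: j => [|j IH] /andP[ij jq]; first by move: ij; rewrite leqn0 => /eqP->.
move: ij; rewrite leq_eqVlt => /orP[/eqP->//|ij].
by apply: le_trans (residual_le _ jq) (IH _); rewrite -ltnS ij ltnW.
Qed.

(** A round preserves earlier orthogonality because its pivot is itself a residual. *)
Lemma residual_perp l j x : (l < j <= q)%N -> dot (w l) (B j *m x) = 0.
Proof.
elim: j x => // j IH x /andP[lj jq]; move: lj; rewrite ltnS leq_eqVlt.
move=> /orP[/eqP->|lj]; first exact: residual_perp_new.
have h y : dot (w l) (B j *m y) = 0 by apply: IH; rewrite lj ltnW.
rewrite BS // dotDr dotNr dotZr h add0r.
suff -> : dot (w l) (w j) = 0 by rewrite mulr0 oppr0.
by case: (wP jq) => [[-> _]|[i [-> _ _]]]; rewrite ?dot0r.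
Qed.

Lemma pivots_orthogonal l j : (l < q)%N -> (j < q)%N -> l != j ->
  dot (w l) (w j) = 0.
Proof.
wlog lj : l j / (l < j)%N => [hw lq jq|lq jq _].
  rewrite neq_ltn => /orP[lj|lj]; first by apply: hw => //; rewrite ltn_eqF.
  by rewrite dotC; apply: hw => //; rewrite ltn_eqF.
case: (wP jq) => [[-> _]|[i [-> _ _]]]; rewrite ?dot0r // residual_perp //.
by rewrite lj ltnW.
Qed.

(** Since the pivot is the longest residual, each elimination coefficient is at most 1 in absolute
    value by Cauchy-Schwarz. A round thus subtracts from a preimage at most one other preimage, and
    squared lengths grow at most fourfold. *)
Lemma residual_preimage j : (j <= q)%N -> exists Y : 'M[R]_n, B j = A *m Y /\
  forall k, dot (Y *m delta_mx k 0) (Y *m delta_mx k 0) <= 4 ^+ j.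
Proof.
elim: j => [|j IH] jq.
  exists 1%:M; split=> [|k]; first by rewrite mulmx1.
  by rewrite mul1mx dot_delta mxE !eqxx.
have [Y [BY Yle]] := IH (ltnW jq).
have pow : 4 ^+ j <= 4 ^+ j.+1 :> R by rewrite exprS ler_peMl ?exprn_ge0 // ler1n.
case: (wP jq) => [[w0 _]|[i [wE wt wmax]]].
  exists Y; split=> [|k]; last exact: le_trans (Yle k) pow.
  by apply: mx_col_ext => x; rewrite BS // w0 scaler0 subr0 BY.
have [w0|wn] := eqVneq (w j) 0.
  exists Y; split=> [|k]; last exact: le_trans (Yle k) pow.
  by apply: mx_col_ext => x; rewrite BS // w0 scaler0 subr0 BY.
have ww : 0 < dot (w j) (w j) by rewrite dot_gt0.
pose y : 'cV[R]_n := Y *m delta_mx i 0.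
pose f : 'rV[R]_n := (dot (w j) (w j))^-1 *: ((w j)^T *m B j).
have fE (x : 'cV[R]_n) : f *m x = (dot (w j) (B j *m x) / dot (w j) (w j))%:M.
  rewrite -scalemxAl -mulmxA; apply/matrixP => a b; rewrite !ord1 !mxE eqxx mulr1n.
  by rewrite mulrC; congr (_ / _); apply: eq_bigr => k _; rewrite !mxE.
exists (Y - y *m f); split.
  apply: mx_col_ext => x; rewrite BS // -mulmxA mulmxBl -mulmxA fE.
  by rewrite mul_mx_scalar mulmxBr -scalemxAr /y !mulmxA -BY wE.
move=> k; rewrite mulmxBl -mulmxA fE mul_mx_scalar -scaleNr.
set c := _ / _; have c1 : c ^+ 2 <= 1.
  rewrite /c expr_div_n ler_pdivrMr ?exprn_gt0 // mul1r.
  apply: le_trans (cauchy_schwarz _ _) _.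
  by rewrite expr2 ler_pM2l.
apply: le_trans (dot_sqrD_le _ _) _; rewrite dotZl dotZr mulrA -expr2 sqrrN [4 ^+ j.+1]exprS.
have := Yle k; have := Yle i; rewrite -/y => h1 h2.
have := ler_pM (sqr_ge0 _) (dot_ge0 _) c1 h1; rewrite mul1r; lra.
Qed.

Lemma residual_span j x : (j <= q)%N -> exists a : nat -> R,
  A *m x = B j *m x + \sum_(l < j) a l *: w l.
Proof.
elim: j => [|j IH] jq; first by exists (fun=> 0); rewrite big_ord0 addr0 B0.
have [a aE] := IH (ltnW jq); pose c := dot (w j) (B j *m x) / dot (w j) (w j).
exists (upd a j c); rewrite big_ord_recr /= updE eqxx aE BS // -/c.
rewrite [X in _ = _ + (X + _)](eq_bigr (fun l : 'I_j => a l *: w l)) => [|l _].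
  by rewrite addrACA addNr addr0.
by rewrite updE ltn_eqF.
Qed.

Hypothesis A_le : forall x, dot (A *m x) (A *m x) <= dot x x.

Lemma pivots_le1 j : (j < q)%N -> dot (w j) (w j) <= 1.
Proof.
move=> jq; case: (wP jq) => [[-> _]|[i [-> _ _]]]; first by rewrite dot0l.
apply: le_trans (residual_le_trans _ (_ : 0 <= j <= q)%N) _; first exact: ltnW.
by rewrite B0; apply: le_trans (A_le _) _; rewrite dot_delta mxE !eqxx.
Qed.

(* [Q] diagonalizes [A], with eigenvalues at most [eps] beyond the first [p]. *)
Lemma residual_small (Q : 'M[R]_n) (al : 'I_n -> R) (p : nat) (eps : R) :
  Q *m Q^T = 1%:M -> A = Q^T *m diag_mx (\row_i al i) *m Q ->
  0 < thr -> (forall l : 'I_n, (p <= l)%N -> al l ^+ 2 <= eps) ->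
  0 <= eps -> eps * 4 ^+ q <= thr / 4 -> (4 * p < 3 * q)%N ->
  forall k, dot (B q *m delta_mx k 0) (B q *m delta_mx k 0) <= thr.
Proof.
move=> QQ AE t0 ale e0 eq pq k.
have [/existsP[j /eqP wj]|] := boolP [exists j : 'I_q, w j == 0].
  apply: le_trans (residual_le_trans _ (_ : j <= q <= q)%N) _.
    by rewrite leqnn andbT ltnW.
  case: (wP (ltn_ord j)) => [[_ h]|[i [_ h _]]]; first exact: h.
  by move: h; rewrite wj dot0l ltNge ltW.
(* Now all [q] pivots are nonzero and pairwise orthogonal, and each has at least 3/4 of its square
   in the first [p] eigendirections. By Bessel these shares add up to at most [p], against
   [4 * p < 3 * q]. *)
rewrite negb_exists => /forallP wn; exfalso.
pose u (l : 'I_n) (x : 'cV[R]_n) := (Q *m x) l 0.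
have Q'Q : Q^T *m Q = 1%:M by exact: mulmx1C.
have dotu x : dot x x = \sum_l u l x ^+ 2.
  rewrite -[in LHS](mul1mx x) -Q'Q -mulmxA dot_mull trmxK.
  by apply: eq_bigr => l _; rewrite expr2 /u mulmxA QQ mul1mx.
have uA l x : u l (A *m x) = al l * u l x.
  rewrite /u AE !mulmxA QQ mul1mx -mulmxA mul_diag_mx mxE.
  by rewrite !mxE.
pose N (j : 'I_q) := dot (w j) (w j).
have N0 j : 0 < N j by rewrite dot_gt0.
(* A pivot is [A *m y] with [y] of squared length at most [4 ^+ q]; beyond [p] the factor [eps]
   leaves at most [thr / 4]. *)
have high (j : 'I_q) : \sum_(l : 'I_n | (p <= l)%N) u l (w j) ^+ 2 <= N j / 4.
  have [Y [BY Yle]] := residual_preimage (ltnW (ltn_ord j)).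
  case: (wP (ltn_ord j)) => [[h _]|[i [wE wt _]]].
    by have := wn j; rewrite h eqxx.
  apply: le_trans (_ : thr / 4 <= _); last by rewrite ler_pM2r ?ltW // invr_gt0.
  apply: le_trans eq; pose y : 'cV[R]_n := Y *m delta_mx i 0.
  apply: le_trans (_ : eps * dot y y <= _); last first.
    apply: ler_wpM2l => //; apply: le_trans (Yle i) _.
    by rewrite ler_weXn2l ?ler1n // ltnW.
  rewrite dotu mulr_sumr [leRHS](bigID (fun l : 'I_n => p <= l)%N) /=.
  rewrite -[leLHS]addr0; apply: lerD; last first.
    by apply: sumr_ge0 => l _; rewrite mulr_ge0 // sqr_ge0.
  apply: ler_sum => l pl; rewrite wE BY -mulmxA -/y uA exprMn.
  by apply: ler_wpM2r; rewrite ?sqr_ge0 ?ale.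
have low (j : 'I_q) : 3 / 4 <= \sum_(l : 'I_n | (l < p)%N) u l (w j) ^+ 2 / N j.
  rewrite -mulr_suml ler_pdivlMr //.
  have := high j; have : N j = \sum_(l : 'I_n | (l < p)%N) u l (w j) ^+ 2 +
      \sum_(l : 'I_n | (p <= l)%N) u l (w j) ^+ 2.
    rewrite /N dotu (bigID (fun l : 'I_n => (l < p)%N)) /=; congr (_ + _).
    by apply: eq_bigl => l; rewrite -leqNgt.
  lra.
have bessel l : \sum_j u l (w (j : 'I_q)) ^+ 2 / N j <= 1.
  pose x : 'cV[R]_n := Q^T *m delta_mx l 0.
  have x1 : dot x x = 1 by rewrite /x dot_mull trmxK mulmxA QQ mul1mx dot_delta mxE !eqxx.
  have og : orthogonal_family (fun j : 'I_q => w j).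
    by move=> i j ij; apply: pivots_orthogonal.
  have := proj_pythagoras og x (fun=> 0).
  rewrite (_ : combine _ _ = 0); last by rewrite /combine big1 // => j _; rewrite scale0r.
  rewrite !subr0 x1 {3 4}/proj dot_combine2 // => h.
  apply: le_trans (_ : dot (x - proj (fun j : 'I_q => w j) x) (x - proj (fun j : 'I_q => w j) x) +
     \sum_j u l (w (j : 'I_q)) ^+ 2 / N j <= _); first by rewrite lerDr dot_ge0.
  rewrite h le_eqVlt; apply/orP; left; apply/eqP; congr (_ + _).
  apply: eq_bigr => j _; rewrite /pcoef -/(N j).
  have -> : dot (w j) x = u l (w j) by rewrite dotC /x dot_mull trmxK dotC dot_delta.
  by field; rewrite gt_eqF.
have : q%:R * (3 / 4) <= p%:R :> R.
  apply: le_trans (_ : \sum_(j < q) \sum_(l : 'I_n | (l < p)%N) u l (w j) ^+ 2 / N j <= _).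
    rewrite mulr_natl -[X in _ *+ X](card_ord q) -sumr_const; apply: ler_sum => j _.
    exact: low.
  rewrite exchange_big /=.
  apply: le_trans (_ : \sum_(l < n | (l < p)%N) 1 <= _); first exact: ler_sum.
  have [pn|pn] := leqP p n.
    by rewrite (big_ord_narrow pn) sumr_const card_ord.
  rewrite sumr_const ler_nat; apply: leq_trans (max_card _) _.
  by rewrite card_ord ltnW.
rewrite -(ler_pM2l (ltr0n R 4)).
have : (4 * p)%:R < (3 * q)%:R :> R by rewrite ltr_nat.
rewrite !natrM; lra.
Qed.

End PivotedGramSchmidt.

(** * Distance from a vector of low energy to the computed span *)

Section SubspaceDistance.
Context {R : realType}.

(** Cauchy-Schwarz on each row; the squared Frobenius norm is then summed by columns. *)
Lemma mulmx_dot_le n (M : 'M[R]_n) (z : 'cV[R]_n) (t : R) :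
  (forall k, dot (M *m delta_mx k 0) (M *m delta_mx k 0) <= t) ->
  dot (M *m z) (M *m z) <= n%:R * t * dot z z.
Proof.
move=> Mt; apply: le_trans (_ : \sum_i dot (row i M)^T (row i M)^T * dot z z <= _).
  apply: ler_sum => i _; rewrite -expr2.
  rewrite (_ : (M *m z) i 0 = dot (row i M)^T z); first exact: cauchy_schwarz.
  by rewrite mxE; apply: eq_bigr => k _; rewrite !mxE.
rewrite -mulr_suml; apply: ler_wpM2r; first exact: dot_ge0.
rewrite /dot exchange_big /= mulr_natl -[X in _ *+ X]card_ord -sumr_const.
apply: ler_sum => k _; apply: le_trans (Mt k); rewrite le_eqVlt; apply/orP; left.
by apply/eqP; apply: eq_bigr => i _; rewrite -colE !mxE.
Qed.

(** The condition [eps * 4 ^+ q <= thr / 4] of the pivoting argument, where [eps = 4^(-32 n)] bounds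
    the squares of the damped eigenvalues. *)
Lemma threshold_num (n q : nat) : (0 < n)%N -> (q <= 2 * n)%N ->
  4^-1 ^+ (32 * n) * 4 ^+ q <= 2^-1 ^+ (32 * n) / 4 :> R.
Proof.
move=> n0 qn; have h4 : 4 ^+ q <= 16 ^+ n :> R.
  by rewrite (_ : 16 = 4 ^+ 2) -?exprM ?ler_weXn2l ?ler1n //; ring.
apply: le_trans (_ : 4^-1 ^+ (32 * n) * 16 ^+ n <= _).
  by rewrite ler_pM2l // exprn_gt0 // invr_gt0.
rewrite !(exprM _ 32) -exprMn; set a := 2^-1 ^+ 32.
have -> : 4^-1 ^+ 32 * 16 = a * 2^-1 ^+ 28 :> R by rewrite /a; field.
rewrite exprMn ler_pM2l ?exprn_gt0 ?invr_gt0 //.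
apply: le_trans (_ : (2^-1 ^+ 28) ^+ 1 <= _).
  by rewrite ler_wiXn2l ?exprn_ge0 ?exprn_ile1 ?invr_ge0 // invf_le1 // ler1n.
lra.
Qed.

(** The residual error for a preimage of squared length [(9/8)^(64 n) * n], where 9/8 bounds
    [1 + s / h] for [s < h / 8]. Since [(9/8)^64 <= 2^13] and [n^2 <= 4^n], the threshold
    [2^(-32 n)] leaves [2^(-17 n)]. *)
Lemma accuracy_num (n : nat) : (1 < n)%N ->
  n%:R * 2^-1 ^+ (32 * n) * ((9 / 8) ^+ (32 * n) ^+ 2 * n%:R) <= 2^-1 ^+ 34 :> R.
Proof.
move=> n1; have n4 : n%:R * n%:R <= 4 ^+ n :> R.
  rewrite -natrM -natrX ler_nat; have : (n < 2 ^ n)%N by exact: ltn_expl.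
  by rewrite (_ : 4 = 2 * 2)%N // expnMn; move=> h; apply: leq_mul; exact: ltnW.
have h9 : (9 / 8) ^+ 64 <= 2 ^+ 13 :> R.
  apply: le_trans (_ : ((9 / 8) ^+ 5) ^+ 13 <= _).
    by rewrite -exprM ler_weXn2l //; lra.
  by rewrite lerXn2r ?nnegrE ?exprn_ge0 //; lra.
apply: le_trans (_ : (2^-1 ^+ 17) ^+ n <= _); last first.
  apply: le_trans (_ : (2^-1 ^+ 17) ^+ 2 <= _); last by rewrite -exprM.
  by rewrite ler_wiXn2l ?exprn_ge0 ?exprn_ile1 ?invr_ge0 // invf_le1 // ler1n.
have -> : n%:R * 2^-1 ^+ (32 * n) * ((9 / 8) ^+ (32 * n) ^+ 2 * n%:R) =
    (n%:R * n%:R) * (2^-1 ^+ 32 * (9 / 8) ^+ 64) ^+ n :> R.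
  have -> : (9 / 8) ^+ (32 * n) ^+ 2 = ((9 / 8) ^+ 64) ^+ n :> R.
    by rewrite -!exprM; congr (_ ^+ _); lia.
  rewrite (exprM _ 32); move: (2^-1 ^+ 32) ((9 / 8) ^+ 64) => a b.
  by rewrite exprMn; ring.
apply: le_trans (_ : 4 ^+ n * (2^-1 ^+ 32 * 2 ^+ 13) ^+ n <= _).
  have h0 : 0 <= 2^-1 ^+ 32 * (9 / 8) ^+ 64 :> R.
    by rewrite mulr_ge0 // exprn_ge0 //; lra.
  apply: ler_pM => //; first by rewrite mulr_ge0.
    by rewrite exprn_ge0.
  rewrite lerXn2r ?nnegrE //; last by rewrite ler_pM2l // exprn_gt0 // invr_gt0.
  by rewrite mulr_ge0 // exprn_ge0 //; lra.
by rewrite -exprMn lerXn2r ?nnegrE //; lra.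
Qed.

(** The components of [x] with eigenvalue at least [h / 8] have squared length at most [8 / h] times
    the energy. The others form [A *m z], where [z] undoes the damping at the cost of a factor
    [(9/8)^(32 n)] in length, and [A *m z] differs from the span of the pivots by [B q *m z]. Adding
    the two errors costs a factor 2. *)
Lemma subspace_distance (n r : nat) (L A : 'M[R]_n) (s al : 'I_n -> R) (Q : 'M[R]_n)
    (h : R) (w : nat -> 'cV[R]_n) (B : nat -> 'M[R]_n) (x : 'cV[R]_n) :
  let q := (2 * r)%N in let thr : R := 2^-1 ^+ (32 * n) in
  (1 < n)%N -> (0 < r <= n)%N -> 0 < h ->
  Q *m Q^T = 1%:M -> L = Q^T *m diag_mx (\row_l s l) *m Q ->
  (forall l, 0 <= s l) -> (forall l : 'I_n, (r.-1 <= l)%N -> h <= s l) ->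
  (forall l, al l = (1 + s l / h)^-1 ^+ (32 * n)) ->
  A = Q^T *m diag_mx (\row_l al l) *m Q -> B 0 = A ->
  (forall j x, (j < q)%N -> B j.+1 *m x =
    B j *m x - (dot (w j) (B j *m x) / dot (w j) (w j)) *: w j) ->
  (forall j, (j < q)%N ->
  (w j = 0 /\ forall k, dot (B j *m delta_mx k 0) (B j *m delta_mx k 0) <= thr) \/
  (exists i, [/\ w j = B j *m delta_mx i 0, thr < dot (w j) (w j) &
    forall k, dot (B j *m delta_mx k 0) (B j *m delta_mx k 0) <= dot (w j) (w j)])) ->
  dot x x <= n%:R ->
  exists a : nat -> R, dot (x - \sum_(j < q) a j *: w j) (x - \sum_(j < q) a j *: w j)
    <= 16 * dot (L *m x) x / h + 2^-1 ^+ 33.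
Proof.
move=> q thr n1 /andP[r0 rn] h0 QQ LE s0 sh alE AE B0 BS wP xn.
have n0 : (0 < n)%N by apply: ltnW.
have al_ge0 l : 0 < al l.
  by rewrite alE exprn_gt0 // invr_gt0 ltr_pwDl // divr_ge0 // ltW.
have thr0 : 0 < thr by rewrite exprn_gt0 // invr_gt0.
have al_high (l : 'I_n) : (r.-1 <= l)%N -> al l ^+ 2 <= 4^-1 ^+ (32 * n).
  move=> rl; rewrite alE -exprM (mulnC _ 2) exprM.
  have h1 : (1 + s l / h)^-1 <= 2^-1.
    rewrite lef_pV2 ?posrE // ?ltr_pwDl // ?divr_ge0 ?(ltW h0) //.
    by rewrite -[2]/(1 + 1) lerD2l ler_pdivlMr // mul1r sh.
  have h2 : 0 <= (1 + s l / h)^-1.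
    by rewrite invr_ge0 addr_ge0 // divr_ge0 // ltW.
  apply: lerXn2r; rewrite ?nnegrE ?invr_ge0 ?exprn_ge0 //.
  rewrite (_ : 4^-1 = 2^-1 ^+ 2); last by field.
  by apply: lerXn2r; rewrite ?nnegrE // invr_ge0.
have eps0 : 0 <= 4^-1 ^+ (32 * n) :> R by rewrite exprn_ge0 // invr_ge0.
(* Ranks start at 1, so only [r - 1] eigenvalues may be below [h]. *)
have cnt : (4 * r.-1 < 3 * q)%N by rewrite /q; lia.
have num := threshold_num n0 (_ : q <= 2 * n)%N.
have res := residual_small B0 BS wP QQ AE thr0 al_high eps0 (num _) cnt.
have {}res k := res ltac:(by rewrite /q; lia) k.
pose u (l : 'I_n) (y : 'cV[R]_n) := (Q *m y) l 0.
have Q'Q : Q^T *m Q = 1%:M by exact: mulmx1C.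
have dotQ (y : 'cV[R]_n) : dot (Q^T *m y) (Q^T *m y) = dot y y.
  by rewrite dot_mull trmxK mulmxA QQ mul1mx.
have uE (y : 'cV[R]_n) : dot y y = \sum_l u l y ^+ 2.
  rewrite -{1 2}(mul1mx y) -Q'Q -mulmxA dotQ.
  by apply: eq_bigr => l _; rewrite expr2.
pose low l := s l < h / 8.
pose z : 'cV[R]_n := Q^T *m \col_l (if low l then u l x / al l else 0).
have Lx : dot (L *m x) x = \sum_l s l * u l x ^+ 2.
  rewrite LE -!mulmxA dot_mull trmxK; apply: eq_bigr => l _.
  by rewrite mul_diag_mx !mxE -mulrA -expr2 /u mxE.
have Az : x - A *m z = Q^T *m \col_l (if low l then 0 else u l x).
  rewrite /z AE !mulmxA -(mulmxA _ Q Q^T) QQ mulmx1 -[x in LHS](mul1mx x) -Q'Q.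
  rewrite -!mulmxA -mulmxBr; congr (_ *m _); apply/matrixP => l j.
  rewrite ord1 mul_diag_mx !mxE; case: ifP => _; rewrite -/(u l x).
    rewrite mulrC divfK ?gt_eqF //.
    by rewrite mulmxA Q'Q mul1mx /u mxE subrr.
  by rewrite mulr0 subr0 /u mxE.
have highle : dot (x - A *m z) (x - A *m z) <= 8 * dot (L *m x) x / h.
  rewrite Az dotQ Lx mulr_sumr mulr_suml; apply: ler_sum => l _; rewrite !mxE.
  case: ifP => [_|/negbT]; first by rewrite mul0r divr_ge0 ?(ltW h0) // mulr_ge0 // mulr_ge0 // sqr_ge0.
  rewrite /low -leNgt => hl; rewrite -expr2 ler_pdivlMr // mulrA mulrC.
  by apply: ler_wpM2r; [exact: sqr_ge0|move: hl; rewrite ler_pdivrMr // mulrC].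
have zle : dot z z <= (9 / 8) ^+ (32 * n) ^+ 2 * n%:R.
  apply: le_trans (_ : (9 / 8) ^+ (32 * n) ^+ 2 * dot x x <= _); last first.
    by apply: ler_wpM2l => //; rewrite exprn_ge0 // exprn_ge0 //; lra.
  rewrite /z dotQ [dot x x]uE mulr_sumr; apply: ler_sum => l _; rewrite !mxE -expr2.
  case: ifP => [hl|_]; last first.
    by rewrite expr0n /= mulr_ge0 // sqr_ge0.
  rewrite expr_div_n mulrC; apply: ler_wpM2r; first exact: sqr_ge0.
  rewrite -exprVn; apply: lerXn2r; rewrite ?nnegrE ?invr_ge0 ?(ltW (al_ge0 l)) //.
    by rewrite exprn_ge0 //; lra.
  rewrite alE -exprVn invrK; apply: lerXn2r; rewrite ?nnegrE //.
  - by rewrite addr_ge0 // divr_ge0 // ltW.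
  - by lra.
  - have : s l / h <= 1 / 8 by rewrite ler_pdivrMr //; move: hl; rewrite /low; lra.
    lra.
have [a aE] := residual_span B0 BS z (leqnn q).
exists a; set S := \sum_(j < q) _ in aE *.
have -> : x - S = (x - A *m z) + B q *m z by rewrite aE opprD addrA addrAC subrK.
apply: le_trans (dot_sqrD_le _ _) _.
have := mulmx_dot_le z res; have := accuracy_num n1; rewrite -/thr => h1 h2.
have h3 : n%:R * thr * dot z z <= 2^-1 ^+ 34.
  by apply: le_trans h1; apply: ler_wpM2l => //; rewrite mulr_ge0 // ltW.
have h34 : 2^-1 ^+ 33 = 2 * 2^-1 ^+ 34 :> R by field.
have -> : 16 * dot (L *m x) x / h = 2 * (8 * dot (L *m x) x / h) by field; rewrite gt_eqF.
rewrite h34 -mulrDr ler_pM2l //; apply: lerD => //; exact: le_trans h2 h3.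
Qed.

End SubspaceDistance.

(** * Flows and cuts *)

Section Flows.
Context {R : realType} {n : nat}.
Implicit Types (c delta : 'M[R]_n) (S : {set 'I_n}).

Definition ind S : 'cV[R]_n := \col_i (i \in S)%:R.

Lemma path_crosses S (x : 'I_n) p : (x \in S) != (last x p \in S) ->
  exists u v, (u, v) \in zip (x :: p) p /\ (u \in S) != (v \in S).
Proof.
elim: p x => [|y p IH] x; first by rewrite eqxx.
move=> /= xl; have [xy|xy] := eqVneq (x \in S) (y \in S).
  rewrite xy in xl; have [u [v [uv h]]] := IH _ xl.
  by exists u, v; split=> //; rewrite in_cons uv orbT.
by exists x, y; rewrite mem_head.
Qed.

(** A route whose ends are separated by [S] contributes to the demand across [S] for one pair only,
    and uses at least one edge across the cut. *)
Lemma flow_cut c delta S : multicommodity_flow c delta ->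
  cut_capacity delta S <= cut_capacity c S.
Proof.
move=> [_ [F [Froute Fdelta Fcap]]].
have -> : cut_capacity delta S = \sum_(f <- F) \sum_(i in S) \sum_(j | j \notin S)
    (if joins i j f then route_amount f else 0).
  rewrite exchange_big; apply: eq_bigr => i iS; rewrite exchange_big.
  apply: eq_bigr => j jS; rewrite -big_mkcond Fdelta //.
  by apply: contraNneq jS => <-.
apply: le_trans (_ : \sum_(f <- F) \sum_(i in S) \sum_(j | j \notin S)
    (if uses_edge i j f then route_amount f else 0) <= _); last first.
  rewrite exchange_big; apply: ler_sum => i iS; rewrite exchange_big.
  by apply: ler_sum => j jS; rewrite -big_mkcond Fcap.
rewrite big_seq [X in _ <= X]big_seq; apply: ler_sum => -[[x p] a] /Froute /=.
move=> /and3P[_ _ a0]; rewrite /route_amount /=.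
have [xl|xl] := eqVneq (x \in S) (last x p \in S).
  rewrite big1 => [|i iS].
    by apply: sumr_ge0 => i _; apply: sumr_ge0 => j _; case: ifP.
  rewrite big1 // => j jS; case: ifP => // /orP[]/andP[/eqP xi /eqP lj].
    by move: jS; rewrite -lj -xl xi iS.
  by move: jS; rewrite -xi xl lj iS.
apply: le_trans (_ : a <= _).
  (* The only ordered pair across [S] that this route joins. *)
  pose e := if x \in S then (x, last x p) else (last x p, x).
  have eP (i j : 'I_n) : i \in S -> j \notin S ->
      ((x == i) && (last x p == j) || (x == j) && (last x p == i)) = ((i, j) == e).
    move=> iS jS; rewrite /e; case: ifP xl => xS xl.
      rewrite [X in _ || X](_ : _ = false); last first.
        by apply/andP => -[/eqP xj _]; rewrite -xj xS in jS.
      by rewrite orbF xpair_eqE ![_ == i]eq_sym ![_ == j]eq_sym.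
    rewrite [X in X || _](_ : _ = false); last first.
      by apply/andP => -[/eqP xi _]; rewrite xi iS in xS.
    by rewrite orFb xpair_eqE andbC ![_ == i]eq_sym ![_ == j]eq_sym.
  rewrite (eq_bigr (fun i => \sum_(j | j \notin S) if (i, j) == e then a else 0)).
    rewrite pair_big_dep big_mkcond /= (bigD1 e) //= big1 ?addr0 => [|z ze].
      by rewrite -surjective_pairing eqxx; case: ifP.
    by rewrite -surjective_pairing (negbTE ze); case: ifP.
  by move=> i iS; apply: eq_bigr => j jS; rewrite eP.
have [u [v [uv us]]] := path_crosses xl.
have [i [j [iS jS ij]]] : exists i j, [/\ i \in S, j \notin S &
    ((i, j) \in zip (x :: p) p) || ((j, i) \in zip (x :: p) p)].
  case uS: (u \in S) us => us.
    by exists u, v; rewrite uS uv; split=> //; move: us; case: (v \in S).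
  by exists v, u; rewrite uS uv orbT; split=> //; move: us; case: (v \in S).
rewrite (bigD1 i) //= (bigD1 j) //= ij -addrA lerDl addr_ge0 ?sumr_ge0 // => k _.
  by case: ifP.
by apply: sumr_ge0 => l _; case: ifP.
Qed.

Lemma dot_ind S : dot (ind S) (ind S) = #|S|%:R.
Proof.
rewrite /dot -sum1_card natr_sum [RHS]big_mkcond /=; apply: eq_bigr => i _.
by rewrite mxE; case: (i \in S); rewrite ?mulr1 ?mulr0.
Qed.

Lemma laplacian_ind delta S :
  dot (laplacian delta *m ind S) (ind S) = cut_capacity delta S.
Proof.
rewrite /cut_capacity [RHS]big_mkcond /dot /=; apply: eq_bigr => i _.
rewrite /laplacian mulmxBl mul_diag_mx !mxE; case: ifP => iS; last by rewrite mulr0.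
rewrite !mulr1 /degree (bigID (fun j => j \in S)) /= addrAC.
rewrite (_ : \sum_(j | j \in S) _ = \sum_j delta i j * ind S j 0) ?subrr ?add0r //.
rewrite big_mkcond; apply: eq_bigr => j _; rewrite mxE.
by case: (j \in S); rewrite ?mulr1 ?mulr0.
Qed.

(** Each unordered pair is counted twice, hence the halves. This sum of rank-one terms gives
    positivity and drives the updates of the resolvent. *)
Lemma laplacian_sum delta : delta^T = delta ->
  laplacian delta = \sum_i \sum_j (delta i j / 2) *:
    ((delta_mx i 0 - delta_mx j 0) *m (delta_mx i 0 - delta_mx j 0 : 'cV[R]_n)^T).
Proof.
move=> ds; apply: mx_col_ext => x; apply/matrixP => k l; rewrite ord1 {l}.
have -> : ((\sum_i \sum_j (delta i j / 2) *:
     ((delta_mx i 0 - delta_mx j 0) *m (delta_mx i 0 - delta_mx j 0 : 'cV[R]_n)^T)) *m x) k 0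
   = \sum_i \sum_j delta i j / 2 * (((k == i)%:R - (k == j)%:R) * (x i 0 - x j 0)).
  rewrite mulmx_suml summxE; apply: eq_bigr => i _.
  rewrite mulmx_suml summxE; apply: eq_bigr => j _.
  rewrite -scalemxAl mxE -mulmxA; congr (_ * _).
  rewrite [X in _ *m X](_ : _ = (x i 0 - x j 0)%:M).
    by rewrite mul_mx_scalar !mxE !eqxx !andbT mulrC.
  apply/matrixP => a b; rewrite !ord1 [RHS]mxE eqxx mulr1n.
  rewrite [LHS]mxE -[x i 0]dot_delta -[x j 0]dot_delta -dotNr -dotDr dotC.
  by apply: eq_bigr => m _; rewrite mxE.
rewrite /laplacian mulmxBl mul_diag_mx !mxE /degree.
have e1 : \sum_i \sum_j delta i j / 2 * ((k == i)%:R * (x i 0 - x j 0)) =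
    \sum_j delta k j / 2 * (x k 0 - x j 0).
  rewrite (bigD1 k) //= [X in _ + X]big1 ?addr0 => [|i ik].
    by apply: eq_bigr => j _; rewrite eqxx mul1r.
  by rewrite big1 // => j _; rewrite eq_sym (negbTE ik) mul0r mulr0.
have e2 : \sum_i \sum_j delta i j / 2 * ((k == j)%:R * (x i 0 - x j 0)) =
    - \sum_j delta k j / 2 * (x k 0 - x j 0).
  rewrite -sumrN; apply: eq_bigr => i _; rewrite (bigD1 k) //= big1 ?addr0 => [|j jk].
    by rewrite eqxx mul1r -{1}ds mxE -mulrN opprB.
  by rewrite eq_sym (negbTE jk) mul0r mulr0.
under [RHS]eq_bigr do under eq_bigr do rewrite mulrBl mulrBr.
under [RHS]eq_bigr do rewrite sumrB.
rewrite sumrB e1 e2 opprK -big_split /= mulr_suml -sumrB.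
by apply: eq_bigr => j _; field.
Qed.

Lemma laplacian_ge0 delta x : weighted_graph delta -> 0 <= dot (laplacian delta *m x) x.
Proof.
move=> [ds _ d0]; rewrite (laplacian_sum ds) mulmx_suml dot_suml.
apply: sumr_ge0 => i _; rewrite mulmx_suml dot_suml; apply: sumr_ge0 => j _.
(* Each term is half the demand times a square. *)
rewrite -scalemxAl dotZl mulr_ge0 ?divr_ge0 //.
set u : 'cV[R]_n := _ - _; rewrite -mulmxA.
rewrite (_ : u^T *m x = (dot u x)%:M); last first.
  apply/matrixP => a b; rewrite !ord1 [RHS]mxE eqxx mulr1n mxE.
  by apply: eq_bigr => m _; rewrite mxE.
by rewrite mul_mx_scalar dotZl -expr2 sqr_ge0.
Qed.

Lemma laplacian_tr delta : delta^T = delta -> (laplacian delta)^T = laplacian delta.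
Proof. by move=> ds; rewrite /laplacian raddfB /= tr_diag_mx ds. Qed.

Lemma sherman_morrison (X M : 'M[R]_n) (u : 'cV[R]_n) (a : R) :
  X^T = X -> M *m X = 1%:M -> (forall x, 0 <= dot (X *m x) x) -> 0 <= a ->
  [/\ M^T = M, 0 < 1 + a * dot u (M *m u) &
  (M - (a / (1 + a * dot u (M *m u))) *: (M *m u *m (M *m u)^T)) *m
    (X + a *: (u *m u^T)) = 1%:M].
Proof.
move=> Xs MX Xp a0; have XM : X *m M = 1%:M by exact: mulmx1C.
have Ms : M^T = M.
  have MX' : X *m M^T = 1%:M by rewrite -Xs -trmx_mul MX trmx1.
  by rewrite -[LHS]mul1mx -MX -mulmxA MX' mulmx1.
set b := dot u (M *m u).
have b0 : 0 <= b.
  by rewrite /b -[X in dot X _](mul1mx u) -XM -mulmxA; exact: Xp.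
have ab : 0 < 1 + a * b by rewrite ltr_pwDl // mulr_ge0.
split=> //; set v := M *m u.
have vX : v^T *m X = u^T by rewrite /v trmx_mul Ms -mulmxA MX mulmx1.
have vu : v^T *m u = b%:M.
  apply/matrixP => i j; rewrite !ord1 [RHS]mxE eqxx mulr1n mxE /b dotC.
  by apply: eq_bigr => k _; rewrite mxE.
rewrite mulmxBl !mulmxDr MX -scalemxAl -(mulmxA v) vX -scalemxAl -!scalemxAr.
rewrite mulmxA -/v -(mulmxA v) (mulmxA v^T) vu mul_scalar_mx -scalemxAr.
rewrite -{2}[1%:M]addr0 -addrA; congr (_ + _).
apply/matrixP => i j; rewrite !mxE; field; exact: lt0r_neq0.
Qed.

End Flows.

(** * Size of a symmetric difference *)

Section SymmetricDifference.
Context {n : nat}.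
Implicit Types S T U : {set 'I_n}.

Definition sd S T : nat := (#|S :\: T| + #|T :\: S|)%N.

Lemma sdC S T : sd S T = sd T S.
Proof. by rewrite /sd addnC. Qed.

Lemma sd_triangle S T U : (sd S U <= sd S T + sd T U)%N.
Proof.
have h (A B C : {set 'I_n}) : (#|A :\: C| <= #|A :\: B| + #|B :\: C|)%N.
  apply: leq_trans (_ : #|(A :\: B) :|: (B :\: C)| <= _)%N; last first.
    by rewrite cardsU leq_subr.
  apply: subset_leq_card; apply/subsetP => i; rewrite !inE.
  by case: (i \in A); case: (i \in B); case: (i \in C).
rewrite /sd; have := h S T U; have := h U T S; lia.
Qed.

Lemma sd_card S T : (#|S| <= #|T| + sd S T)%N.
Proof. by have := cardsID T S; have := cardsID S T; rewrite /sd setIC; lia. Qed.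

Lemma sd_le S T : (sd S T <= n)%N.
Proof.
rewrite /sd -cardsUI (_ : _ :&: _ = set0) ?cards0 ?addn0; last first.
  by apply/setP => i; rewrite !inE; case: (i \in S); case: (i \in T).
by apply: leq_trans (max_card _) _; rewrite card_ord.
Qed.

Lemma sd_eq0 S T : sd S T = 0%N -> S = T.
Proof.
rewrite /sd => /eqP; rewrite addn_eq0 !cards_eq0 !setD_eq0 => /andP[h h'].
by apply/eqP; rewrite eqEsubset h h'.
Qed.

Lemma sd_sum {R : realType} S T :
  (sd S T)%:R = \sum_i ((i \in S)%:R - (i \in T)%:R) ^+ 2 :> R.
Proof.
rewrite /sd natrD -!sum1_card !natr_sum big_mkcond [X in _ + X]big_mkcond -big_split.
apply: eq_bigr => i _; rewrite !inE.
by case: (i \in S); case: (i \in T); rewrite /= ?subrr ?subr0 ?sub0r ?sqrrN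
  ?expr1n ?expr0n ?addr0 ?add0r.
Qed.

Lemma cut_sd0 S T : (sd T S < #|S|)%N -> (#|S| + sd T S < n)%N -> is_cut T.
Proof.
move=> h1 h2; have := sd_card S T; have := sd_card T S; rewrite sdC => h3 h4.
rewrite /is_cut -card_gt0; apply/andP; split; first by rewrite sdC in h1; lia.
apply: contraTneq h2 => ->; rewrite -leqNgt.
by have := sd_card [set: 'I_n] S; rewrite cardsT card_ord.
Qed.

End SymmetricDifference.

(** * Preflows and minimum penalized cuts *)

Section PreflowMinCut.
Context {R : realType} {n : nat}.
Variables (c : 'M[R]_n) (gam : R) (T0 : {set 'I_n}).
Implicit Types (res : 'I_n -> 'I_n -> R) (rt ex : 'I_n -> R) (h : 'I_n -> nat).

(** The capacity of a cut in the network where a source feeds each vertex of [T0] and every other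
    vertex drains to a sink, all these edges having capacity [gam]. *)
Definition penalized_cut (T : {set 'I_n}) : R :=
  cut_capacity c T + gam * (sd T T0)%:R.

Let supply (u : 'I_n) : R := if u \in T0 then gam else 0.
Let demand (u : 'I_n) : R := if u \in T0 then 0 else gam.

(* A preflow: [T0] is fed by the source, its complement drains to the sink.
   [res] and [rt] are the residual capacities between vertices and to the sink,
   [ex] is the excess and [h] the height; the sink has height 0. *)
Record preflow res rt ex h : Prop := Preflow {
  pf_cap : forall u v, res u v + res v u = 2 * c u v;
  pf_res : forall u v, 0 <= res u v;
  pf_rt : forall u, 0 <= rt u;
  pf_ex0 : forall u, 0 <= ex u;
  pf_ex : forall u, ex u = supply u - \sum_v (c u v - res u v) - (demand u - rt u);
  pf_valid : forall u v, 0 < res u v -> (h u <= (h v).+1)%N;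
  pf_sink : forall u, 0 < rt u -> (h u <= 1)%N;
  pf_height : forall u, (h u <= n.+1)%N }.

Definition push_res res (u v : 'I_n) (a : R) : 'I_n -> 'I_n -> R := fun i j =>
  if (i == u) && (j == v) then res i j - a
  else if (i == v) && (j == u) then res i j + a else res i j.

Definition push_ex ex (u v : 'I_n) (a : R) : 'I_n -> R := fun i =>
  if i == v then ex i + a else if i == u then ex i - a else ex i.

Lemma preflow_init : c^T = c -> (forall i j, 0 <= c i j) -> 0 <= gam ->
  preflow (fun i j => c i j) demand supply (fun=> 0%N).
Proof.
move=> cs c0 g0; split=> // [u v|u|u|u].
- by rewrite -{2}cs mxE; ring.
- by rewrite /demand; case: ifP.
- by rewrite /supply; case: ifP.
- rewrite big1 ?subr0 ?subrr ?subr0 // => v _; exact: subrr.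
Qed.

Lemma preflow_push res rt ex h u v a : preflow res rt ex h ->
  0 < a -> a <= ex u -> a <= res u v -> h u = (h v).+1 ->
  preflow (push_res res u v a) rt (push_ex ex u v a) h.
Proof.
move=> [p1 p2 p3 p4 p5 p6 p7 p8] a0 aex ares huv.
have uv : (u == v) = false.
  by apply/eqP => uv; move: huv; rewrite uv => /eqP; rewrite eqn_leq ltnn andbF.
split=> // [i j|i j|i|i|i j].
- rewrite /push_res (andbC (j == u)) (andbC (j == v)); have := p1 i j.
  case iju: ((i == u) && (j == v)); case ijv: ((i == v) && (j == u)); try lra.
  by case/andP: iju ijv => /eqP-> _; rewrite uv.
- rewrite /push_res; case: ifP => [/andP[/eqP-> /eqP->]|_]; first by rewrite subr_ge0.
  by case: ifP => _ //; rewrite addr_ge0 // ltW.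
- rewrite /push_ex; case: ifP => _; first by rewrite addr_ge0 // ltW.
  by case: ifP => [/eqP->|_] //; rewrite subr_ge0.
- rewrite /push_ex /push_res; have [->|iv] := eqVneq i v.
    rewrite [v == u]eq_sym uv /= p5 (bigD1 u) //= [in RHS](bigD1 u) //= eqxx.
    rewrite (eq_bigr (fun j => c v j - (if j == u then res v j + a else res v j))
      (P := fun j => j != u)) => [|j /negbTE ju]; last by rewrite ju.
    ring.
  have [->|iu] := eqVneq i u; rewrite ?eqxx /=.
    rewrite p5 (bigD1 v) //= [in RHS](bigD1 v) //= eqxx.
    rewrite (eq_bigr (fun j => c u j - (if j == v then res u j - a else
      if false then res u j + a else res u j)) (P := fun j => j != v)) => [|j /negbTE jv];
      last by rewrite jv.
    ring.
  exact: p5.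
- rewrite /push_res; case: ifP => [/andP[/eqP-> /eqP->]|_] hp.
    by rewrite huv.
  move: hp; case: ifP => [/andP[/eqP-> /eqP->]|_] hp; last exact: p6.
  by rewrite huv; lia.
Qed.

Lemma preflow_push_sink res rt ex h u a : preflow res rt ex h ->
  0 <= a -> a <= ex u -> a <= rt u ->
  preflow res (fun i => if i == u then rt i - a else rt i)
    (fun i => if i == u then ex i - a else ex i) h.
Proof.
move=> [p1 p2 p3 p4 p5 p6 p7 p8] a0 aex art; split=> // i.
- by case: eqP => [->|_] //; rewrite subr_ge0.
- by case: eqP => [->|_] //; rewrite subr_ge0.
- by rewrite p5; case: eqP => [->|_] //; ring.
- case: eqP => [->|_]; last exact: p7.
  by move=> ha; apply: p7; lra.
Qed.

Lemma preflow_relabel res rt ex h u : preflow res rt ex h ->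
  (h u <= n)%N -> (forall v, 0 < res u v -> (h u <= h v)%N) ->
  (0 < rt u -> h u = 0%N) ->
  preflow res rt ex (fun i => if i == u then (h i).+1 else h i).
Proof.
move=> [p1 p2 p3 p4 p5 p6 p7 p8] hu hv ht; split=> // [i j hij|i hi|i].
- case: (i =P u) hij => [->|_] hij; last first.
    by have := p6 _ _ hij; case: eqP => _; lia.
  by have := hv _ hij; case: eqP => _; lia.
- by case: (i =P u) hi => [->|_] hi; [rewrite ht|exact: p7].
- by case: eqP => [->|_].
Qed.

(** The flow [c - res] is antisymmetric, so it cancels inside [T]; summing the excesses over [T]
    leaves the net flow across the cut and to the sink. *)
Lemma preflow_cut res rt ex h T : c^T = c -> preflow res rt ex h ->
  penalized_cut T = gam * #|T0|%:R - \sum_(u in T) ex u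
    + \sum_(u in T) \sum_(v | v \notin T) res u v + \sum_(u in T) rt u.
Proof.
move=> cs [p1 _ _ _ p5 _ _ _].
pose f u v := c u v - res u v.
have fN u v : f v u = - f u v.
  have : c v u = c u v by rewrite -{1}cs mxE.
  by have := p1 u v; rewrite /f; lra.
have f0 : \sum_(u in T) \sum_(v in T) f u v = 0.
  have : \sum_(u in T) \sum_(v in T) f u v = - \sum_(u in T) \sum_(v in T) f u v.
    rewrite {1}exchange_big -sumrN; apply: eq_bigr => u _; rewrite -sumrN.
    by apply: eq_bigr => v _; rewrite fN.
  lra.
have exT : \sum_(u in T) ex u = gam * #|T :&: T0|%:R -
    (cut_capacity c T - \sum_(u in T) \sum_(v | v \notin T) res u v) -
    (gam * #|T :\: T0|%:R - \sum_(u in T) rt u).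
  rewrite (eq_bigr (fun u => supply u - \sum_v f u v - (demand u - rt u))); last first.
    by move=> u _; exact: p5.
  rewrite !sumrB; congr (_ - _ - (_ - _)).
  - rewrite /supply -big_mkcondr /= sumr_const mulr_natr; congr (_ *+ _).
    by apply: eq_card => u; rewrite !inE.
  - rewrite /cut_capacity -sumrB -[LHS]add0r -[X in X + _ = _]subr0.
    transitivity (\sum_(u in T) (\sum_(v in T) f u v + \sum_(v | v \notin T) f u v)).
      by rewrite subr0 add0r; apply: eq_bigr => u _; rewrite (bigID (mem T)).
    rewrite big_split /= f0 add0r; apply: eq_bigr => u _; by rewrite -sumrB.
  - rewrite /demand (eq_bigr (fun u => if u \notin T0 then gam else 0)); last first.
      by move=> u _; case: (u \in T0).
    rewrite -big_mkcondr /= sumr_const mulr_natr; congr (_ *+ _).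
    by apply: eq_card => u; rewrite !inE andbC.
have := cardsID T T0; rewrite setIC => cI.
rewrite exT /penalized_cut /sd natrD -[in #|T0|]cI natrD; ring.
Qed.

(** There are [n] vertices and [n + 1] positive levels, so some level is empty. By validity of the
    heights no residual edge leaves the set above this gap, neither to a lower vertex nor to the
    sink, and all excess lies in it, at height [n + 1]; the cut identity makes this set optimal. The
    phase that would return excess to the source is therefore omitted. *)
Lemma preflow_min_cut res rt ex h : c^T = c -> preflow res rt ex h ->
  (forall u, 0 < ex u -> h u = n.+1) ->
  exists2 j, (j < n.+2)%N & forall T,
    penalized_cut [set u | (j < h u)%N] <= penalized_cut T.
Proof.
move=> cs pf done; have [p1 p2 p3 p4 p5 p6 p7 p8] := pf.
have [j /forallP gap] : exists j : 'I_n.+1, [forall u, h u != j.+1].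
  apply/existsP; apply: contraT; rewrite negb_exists => /forallP H.
  have /fin_all_exists[g gP] (j : 'I_n.+1) : exists u, h u = j.+1.
    by have := H j; rewrite negb_forall => /existsP[u]; rewrite negbK => /eqP; exists u.
  have ginj : injective g by move=> i k e; apply: val_inj; have := gP i; rewrite e gP => -[].
  by have := leq_card g ginj; rewrite !card_ord ltnn.
exists j.+1; first by have := ltn_ord j; lia.
move=> T; set Tj := [set u | _].
rewrite !(preflow_cut _ cs pf).
have exE : \sum_(u in Tj) ex u = \sum_u ex u.
  rewrite [RHS](bigID (mem Tj)) /= [X in _ = _ + X]big1 ?addr0 // => u; rewrite inE -leqNgt => hu.
  apply/eqP; rewrite eq_sym eq_le p4 /= leNgt; apply/negP => /done hE.
  by have := gap u; have := ltn_ord j; rewrite hE in hu *; lia.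
have res0 : \sum_(u in Tj) \sum_(v | v \notin Tj) res u v = 0.
  apply: big1 => u; rewrite inE => hu; apply: big1 => v; rewrite inE -leqNgt => hv.
  apply/eqP; rewrite eq_sym eq_le p2 /= leNgt; apply/negP => /p6 hE.
  by have := gap v; lia.
have rt0 : \sum_(u in Tj) rt u = 0.
  apply: big1 => u; rewrite inE => hu.
  by apply/eqP; rewrite eq_sym eq_le p3 /= leNgt; apply/negP => /p7 hE; lia.
rewrite exE res0 rt0 !addr0.
have h1 : \sum_(u in T) ex u <= \sum_u ex u.
  by rewrite [leRHS](bigID (mem T)) /= lerDl sumr_ge0.
have h2 : 0 <= \sum_(u in T) \sum_(v | v \notin T) res u v.
  by apply: sumr_ge0 => u _; apply: sumr_ge0.
have h3 : 0 <= \sum_(u in T) rt u by apply: sumr_ge0.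
lra.
Qed.

End PreflowMinCut.

(** * Newton's method for a ratio of cuts, and the sparsity of its result *)

Section RatioCut.
Context {R : realType} {n : nat}.
Variables (c : 'M[R]_n) (T0 : {set 'I_n}) (b : R).
Implicit Types T S : {set 'I_n}.

Definition slack T : R := b - (sd T T0)%:R.
Definition ratio T : R := cut_capacity c T / slack T.

Lemma cut_capacity_ge0 T : (forall i j, 0 <= c i j) -> 0 <= cut_capacity c T.
Proof. by move=> c0; apply: sumr_ge0 => i _; apply: sumr_ge0. Qed.

(* Newton's method for the minimum of [ratio]: each new minimizer of
   [cut_capacity c - ratio T * slack] is strictly farther from [T0]. *)
Lemma newton_step T T' S : (forall i j, 0 <= c i j) ->
  0 < slack T -> 0 < slack S -> ratio S < ratio T ->
  (T = T0 \/ exists2 g, ratio T < g &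
    forall U, penalized_cut c g T0 T <= penalized_cut c g T0 U) ->
  (forall U, penalized_cut c (ratio T) T0 T' <= penalized_cut c (ratio T) T0 U) ->
  [/\ 0 < slack T', ratio T' < ratio T & (sd T T0 < sd T' T0)%N].
Proof.
move=> c0 sT sS rST minT minT'.
have pE g U : penalized_cut c g T0 U = cut_capacity c U - g * slack U + g * b.
  by rewrite /penalized_cut /slack; ring.
have r0 : 0 <= ratio T by rewrite divr_ge0 ?cut_capacity_ge0 // ltW.
have cT : cut_capacity c T = ratio T * slack T by rewrite /ratio divfK // gt_eqF.
have cS : cut_capacity c S = ratio S * slack S by rewrite /ratio divfK // gt_eqF.
have lt0 : cut_capacity c T' < ratio T * slack T'.
  have := minT' S; rewrite !pE cS; have : 0 < (ratio T - ratio S) * slack S.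
    by rewrite mulr_gt0 // subr_gt0.
  nra.
have sT' : 0 < slack T'.
  rewrite ltNge; apply/negP => s0; have := cut_capacity_ge0 T' c0.
  have : ratio T * slack T' <= 0 by rewrite mulr_ge0_le0.
  lra.
split=> //; first by rewrite ltr_pdivrMr.
rewrite -(ltr_nat R); suff : slack T' < slack T by rewrite /slack; lra.
(* The start [T0] is no minimizer, but it is the only set at distance 0 and its objective is 0,
   while that of [T'] is negative. Later, minimality of [T] at [g > ratio T] and the negative
   objective of [T'] at [ratio T] conflict unless the slack decreases. *)
case: minT => [TE|[g rg minT]].
  have [T'E|T'T] := eqVneq (sd T' T0) 0%N.
    by move: lt0; rewrite (sd_eq0 T'E) -TE cT ltxx.
  rewrite /slack TE ltrD2l ltrN2 ltr_nat (_ : sd T0 T0 = 0%N) ?lt0n //.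
  by rewrite /sd setDv cards0.
have := minT T'; rewrite !pE cT => h; rewrite ltNge; apply/negP => ss.
have : 0 <= (g - ratio T) * (slack T' - slack T).
  by rewrite mulr_ge0 // subr_ge0 // ltW.
nra.
Qed.

End RatioCut.

Section FinalCut.
Context {R : realType} {n : nat}.
Variables (c : 'M[R]_n).

Lemma sparsityC S : c^T = c -> sparsity c (~: S) = sparsity c S.
Proof.
move=> cs; have := cardsC S; rewrite card_ord => nE; rewrite /sparsity.
have -> : cut_capacity c (~: S) = cut_capacity c S.
  rewrite /cut_capacity exchange_big /=; apply: eq_big => [i|i]; rewrite !inE ?negbK // => _.
  apply: eq_big => [j|j _]; first by rewrite inE.
  by rewrite -{1}cs mxE.
rewrite (_ : n - #|~: S| = #|S|)%N; last by lia.
by rewrite (_ : n - #|S| = #|~: S|)%N; [congr (_ / _); exact: mulrC|lia].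
Qed.

(** A relative error of [127 / 1000 * eps] in [k] is at most the same relative error in
    [N - k >= k], so the denominator loses at most the square of that factor, and [(1 + eps) (1 -
    eps / 100) (1 - 127 eps / 1000)^2 >= 1]. *)
Lemma ratio_arith (N k K eps cS cT : R) : 0 < eps -> eps < 1 -> 0 < k ->
  2 * k <= N -> k - eps * 127 / 1000 * k <= K -> K <= k + eps * 127 / 1000 * k ->
  0 <= cS -> 0 <= cT -> cT * (1 - eps / 100) <= cS ->
  N * cT / (K * (N - K)) <= (1 + eps) * (N * cS / (k * (N - k))).
Proof.
move=> e0 e1 k0 kn kK Kk cS0 cT0 cTS.
set m := N - k.
have m0 : k <= m by rewrite /m; lra.
have NK : m * (1 - eps * 127 / 1000) <= N - K.
  by have := ler_wpM2l (ltW e0) m0; rewrite /m; lra.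
have kK' : k * (1 - eps * 127 / 1000) <= K by lra.
set d := 1 - eps * 127 / 1000 in NK kK'.
have d0 : 0 < d by rewrite /d; lra.
have N0 : 0 < N by lra.
have prod : k * m * (d * d) <= K * (N - K).
  apply: le_trans (_ : (k * d) * (m * d) <= _); first by rewrite le_eqVlt; apply/orP; left; apply/eqP; ring.
  by apply: ler_pM => //; rewrite mulr_ge0 ?ltW //; lra.
have km : 0 < k * m by rewrite mulr_gt0 //; lra.
have pp : 0 < K * (N - K) by apply: lt_le_trans prod; rewrite mulr_gt0 // mulr_gt0.
rewrite ler_pdivrMr // mulrA mulrAC ler_pdivlMr //.
apply: le_trans (_ : (1 + eps) * (N * cS) * (k * m * (d * d)) <= _); last first.
  by apply: ler_wpM2l => //; rewrite !mulr_ge0 ?(ltW N0) //; lra.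
have num : 1 <= (1 + eps) * (1 - eps / 100) * (d * d).
  have e2 : eps * eps <= eps by rewrite ger_pMl ?(ltW e1).
  have e20 : 0 <= eps * eps by rewrite mulr_ge0 ?(ltW e0).
  have h1 : 1 + 98 / 100 * eps <= (1 + eps) * (1 - eps / 100) by lra.
  have h2 : 1 - 254 / 1000 * eps <= d * d by rewrite /d; lra.
  apply: le_trans (_ : (1 + 98 / 100 * eps) * (1 - 254 / 1000 * eps) <= _); first by lra.
  by apply: ler_pM => //; lra.
have f0 : 0 < 1 - eps / 100 by lra.
rewrite -(ler_pM2r f0).
apply: le_trans (_ : N * cS * (k * m) <= _).
  rewrite (_ : N * cT * (k * m) * (1 - eps / 100) =
    N * (k * m) * (cT * (1 - eps / 100))); last by ring.
  rewrite (_ : N * cS * (k * m) = N * (k * m) * cS); last by ring.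
  by apply: ler_wpM2l => //; rewrite mulr_ge0 ?ltW.
rewrite (_ : (1 + eps) * (N * cS) * (k * m * (d * d)) * (1 - eps / 100) =
  ((1 + eps) * (1 - eps / 100) * (d * d)) * (N * cS * (k * m))); last by ring.
by apply: ler_peMl => //; apply: mulr_ge0; [apply: mulr_ge0 => //|]; exact: ltW.
Qed.

(** Positive slack keeps [T] within [b] of [T0], hence within [127 / 1000 * eps * |S|] of [S], since
    1/8 + 1/800 < 127/1000. The distance from [S] to [T0] is at most [b * eps / 100], so the slack
    of [S] is at least [1 - eps / 100] times that of [T], and the comparison of ratios becomes one
    of capacities. *)
Lemma ratio_sparsity (eps b : R) (S T T0 : {set 'I_n}) :
  (forall i j, 0 <= c i j) -> 0 < eps < 1 -> is_cut S -> (2 * #|S| <= n)%N ->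
  b = eps * #|S|%:R / 8 ->
  (sd S T0)%:R <= eps ^+ 2 * #|S|%:R / 800 ->
  0 < slack T0 b T -> ratio c T0 b T <= ratio c T0 b S ->
  is_cut T /\ sparsity c T <= (1 + eps) * sparsity c S.
Proof.
move=> c0 /andP[e0 e1] /andP[S0 _] S2 bE sdS slT rTS.
set k : R := #|S|%:R in bE sdS *.
have k0 : 0 < k by rewrite ltr0n card_gt0.
have ek0 : 0 < eps * k by rewrite mulr_gt0.
have ek1 : eps * k < k by rewrite gtr_pMl.
have ek2 : eps ^+ 2 * k < eps * k by rewrite expr2 -mulrA gtr_pMl.
have sdTS : (sd T S)%:R <= (eps * 127 / 1000) * k.
  have : (sd T S)%:R <= (sd T T0)%:R + (sd S T0)%:R :> R.
    by rewrite -natrD ler_nat (sdC S); exact: sd_triangle.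
  move: slT; rewrite /slack bE; lra.
have sdlt : (sd T S)%:R < k by lra.
have cutT : is_cut T.
  have h : (sd T S < #|S|)%N by rewrite -(ltr_nat R).
  apply: (cut_sd0 h); apply: leq_trans S2.
  by rewrite mul2n -addnn ltn_add2l.
split=> //.
have slS : b * (1 - eps / 100) <= slack T0 b S by rewrite /slack bE; lra.
have b0 : 0 < b by rewrite bE !mulr_gt0 // invr_gt0.
have slS0 : 0 < slack T0 b S by rewrite /slack bE; lra.
have slTb : slack T0 b T <= b by rewrite /slack lerBlDr lerDl ler0n.
have cS0 := cut_capacity_ge0 S c0; have cT0 := cut_capacity_ge0 T c0.
have cTS : cut_capacity c T * (1 - eps / 100) <= cut_capacity c S.
  move: rTS; rewrite /ratio ler_pdivrMr // mulrAC ler_pdivlMr // => h.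
  rewrite -(ler_pM2l b0).
  apply: le_trans (_ : cut_capacity c T * slack T0 b S <= _).
    by rewrite mulrCA; apply: ler_wpM2l.
  apply: le_trans h _; rewrite mulrC; apply: ler_wpM2r => //.
have Sn : (#|S| <= n)%N by apply: leq_trans S2; rewrite leq_pmull.
have Tn : (#|T| <= n)%N by apply: leq_trans (max_card _) _; rewrite card_ord.
rewrite /sparsity !natrB //; set K : R := #|T|%:R.
have kK : k - (eps * 127 / 1000) * k <= K.
  by have := sd_card S T; rewrite sdC -(ler_nat R) natrD; rewrite -/k -/K; lra.
have Kk : K <= k + (eps * 127 / 1000) * k.
  by have := sd_card T S; rewrite -(ler_nat R) natrD; rewrite -/k -/K; lra.
have kn : 2 * k <= n%:R by rewrite /k -natrM ler_nat.
exact: ratio_arith.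
Qed.

End FinalCut.

(** * Nets of Boolean vectors *)

Section Rounding.
Context {R : realType} {n q : nat}.
Variable g : 'I_q -> 'cV[R]_n.
Hypothesis og : orthogonal_family g.
Implicit Types (x y : 'cV[R]_n).

Definition boolean x := forall i, x i 0 = 0 \/ x i 0 = 1.

Definition round_vec y : 'cV[R]_n := \col_i if 1 / 2 < y i 0 then 1 else 0.

Definition dist2 x y : R := dot (x - y) (x - y).

Lemma dist2C x y : dist2 x y = dist2 y x.
Proof. by rewrite /dist2 -opprB dotNl dotNr opprK. Qed.

Lemma dist2_ge0 x y : 0 <= dist2 x y.
Proof. exact: dot_ge0. Qed.

Lemma dist2_le x y z : dist2 x z <= 2 * (dist2 x y + dist2 y z).
Proof. by rewrite /dist2 -(subrKA y) dot_sqrD_le. Qed.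

Lemma round_vec_boolean y : boolean (round_vec y).
Proof. by move=> i; rewrite mxE; case: ifP => _; [right|left]. Qed.

Lemma round_vec_le x y : boolean x -> dist2 (round_vec y) y <= dist2 x y.
Proof.
move=> xb; apply: ler_sum => i _; rewrite !mxE -!expr2.
case: ifP => [|/negbT]; rewrite -?leNgt => h; case: (xb i) => ->; nra.
Qed.

Lemma dist2_span x a : dist2 x (combine g a) =
  dist2 x (proj g x) + dist2 (proj g x) (combine g a).
Proof. exact: proj_pythagoras. Qed.

(** Used in contrapositive form: a candidate far from its own rounding approximates no relevant
    Boolean vector at this scale and may be dropped. *)
Lemma candidate_close x a m : boolean x -> dist2 x (proj g x) <= m ->
  dist2 (combine g a) (proj g x) <= m ->
  dist2 (round_vec (combine g a)) (combine g a) <= 2 * m.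
Proof.
move=> xb xm am; apply: le_trans (round_vec_le _ xb) _.
by rewrite dist2_span (dist2C (proj g x)); lra.
Qed.

(** A candidate [y'] is dropped when its rounding is close to that of a kept [y]; then [y] covers in
    its place, with constant [2 * (2 * (2 + 128) + 2 * (2 + 1)) = 532]. *)
Lemma coverage_merge x y y' m : dist2 y' (proj g x) <= m ->
  dist2 (round_vec y') y' <= 2 * m -> dist2 (round_vec y) y <= 2 * m ->
  dist2 (round_vec y) (round_vec y') <= 128 * m ->
  dist2 y (proj g x) <= 600 * m.
Proof.
move=> h1 h2 h3 h4; apply: le_trans (dist2_le _ (round_vec y') _) _.
have h5 := dist2_le y (round_vec y) (round_vec y').
have h6 := dist2_le (round_vec y') y' (proj g x).
by have := dist2_ge0 y' (proj g x); rewrite (dist2C y (round_vec y)) in h5; lra.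
Qed.

(** [x - proj g x] is orthogonal to the span, so [x] is within [601 * m] of the net point, and
    [2 * (601 + 2) = 1206]. *)
Lemma covered_close x a m : dist2 (combine g a) (proj g x) <= 600 * m ->
  dist2 x (proj g x) <= m ->
  dist2 (round_vec (combine g a)) (combine g a) <= 2 * m ->
  dist2 x (round_vec (combine g a)) <= 1206 * m.
Proof.
move=> h1 h2 h3; apply: le_trans (dist2_le _ (combine g a) _) _.
by rewrite dist2_span (dist2C (proj g x)) [X in _ + X]dist2C; lra.
Qed.

(** In units of [sig], one moves by the truncated coordinates [N j] of the displacement [b].
    Integers satisfy [N <= N^2 <= b^2], and the lower bound 1/4 on the squared lengths turns the
    squared distance into the bound [4 * 2400 * q] on the number of steps; the upper bound 1 leaves
    at most [sig^2] per coordinate. *)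
Lemma lattice_target x a (sig : R) : 0 < sig ->
  (forall j, g j = 0 \/ 1 / 4 <= dot (g j) (g j) <= 1) ->
  dist2 (combine g a) (proj g x) <= 2400 * (q%:R * sig ^+ 2) ->
  exists sg : 'I_q -> bool, exists N : 'I_q -> nat,
    (\sum_j N j <= 9600 * q)%N /\
    dist2 (combine g (fun j => a j + (if sg j then - (N j)%:R else (N j)%:R) * sig))
      (proj g x) <= q%:R * sig ^+ 2.
Proof.
move=> s0 gn ax; pose b j := (pcoef g x j - a j) / sig.
pose N j := if g j == 0 then 0%N else Num.truncn `|b j|.
pose sg j := b j < 0; exists sg, N.
pose z j : R := if sg j then - (N j)%:R else (N j)%:R.
have N_le j : (N j)%:R <= `|b j|.
  rewrite /N; case: ifP => _; first by rewrite normr_ge0.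
  by have /andP[] := truncn_itv (normr_ge0 (b j)).
have bz j : g j != 0 -> (b j - z j) ^+ 2 <= 1.
  move=> gj; have /andP[h1 h2] := truncn_itv (normr_ge0 (b j)).
  rewrite /z /N (negbTE gj) /sg; move: h1 h2.
  case: (ltrP (b j) 0) => bj; [rewrite ltr0_norm //|rewrite ger0_norm //];
    rewrite -natr1; move: (_%:R) => M h1 h2; nra.
have db : dist2 (combine g a) (proj g x) = \sum_j b j ^+ 2 * sig ^+ 2 * dot (g j) (g j).
  rewrite dist2C /dist2 /proj combineB dot_combine2 //; apply: eq_bigr => j _.
  by rewrite /b; field; exact: lt0r_neq0.
split.
  rewrite -(ler_nat R) natr_sum natrM -(ler_pM2r (exprn_gt0 2 s0)).
  apply: le_trans (_ : 4 * dist2 (combine g a) (proj g x) <= _); last by lra.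
  rewrite db mulr_suml mulr_sumr; apply: ler_sum => j _.
  case: (gn j) => [gj|/andP[g4 _]].
    by rewrite /N gj eqxx mul0r dot0l !mulr0.
  have Nb : (N j)%:R <= b j ^+ 2.
    apply: le_trans (_ : (N j)%:R ^+ 2 <= _).
      by rewrite -natrX ler_nat; case: (N j) => // k; rewrite leq_pmulr.
    by rewrite -[b j ^+ 2]real_normK ?num_real // lerXn2r ?nnegrE ?N_le.
  have s2 : 0 < sig ^+ 2 by rewrite exprn_gt0.
  have b2 : 0 <= b j ^+ 2 * sig ^+ 2 by rewrite mulr_ge0 ?sqr_ge0 // ltW.
  have := ler_wpM2l b2 g4; have : (N j)%:R * sig ^+ 2 <= b j ^+ 2 * sig ^+ 2.
    by rewrite ler_pM2r.
  lra.
rewrite dist2C /dist2 /proj combineB dot_combine2 // mulr_natl.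
rewrite -[X in _ *+ X](card_ord q) -sumr_const; apply: ler_sum => j _.
case: (gn j) => [gj|/andP[_ g1]]; first by rewrite gj dot0l mulr0 sqr_ge0.
have [gj|gj] := eqVneq (g j) 0; first by rewrite gj dot0l mulr0 sqr_ge0.
rewrite -/(z j) (_ : pcoef g x j - (a j + z j * sig) = (b j - z j) * sig); last first.
  by rewrite /b; field; exact: lt0r_neq0.
rewrite -expr2 exprMn; have := bz j gj; have s2 : 0 <= sig ^+ 2 by exact: sqr_ge0.
move=> h; apply: le_trans (_ : 1 * sig ^+ 2 * 1 <= _); last by rewrite mul1r mulr1.
apply: ler_pM => //; [by rewrite mulr_ge0 ?sqr_ge0|exact: dot_ge0|].
by rewrite ler_pM2r ?exprn_gt0.
Qed.

End Rounding.

(** * Lattice walks and their encoding by reals *)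

Section Walks.
Context {R : realType}.

(* A word over {0, 1, 2} drives a walk in the lattice: 0 and 1 increment and
   decrement the current coordinate, 2 moves to the next coordinate. *)
Definition walk_step (st : nat * (nat -> R)) (d : nat) : nat * (nat -> R) :=
  let: (p, z) := st in
  if d == 0%N then (p, upd z p (z p + 1))
  else if d == 1%N then (p, upd z p (z p - 1)) else (p.+1, z).

Lemma walk_const (d : bool) k p z :
  foldl walk_step (p, z) (nseq k (nat_of_bool d)) =
  (p, upd z p (z p + (if d then - k%:R else k%:R))).
Proof.
elim: k z => [|k IH] z /=.
  congr pair; apply: funext => i; rewrite updE.
  by case: eqP => [->|//]; case: d; rewrite ?oppr0 addr0.
case: d IH => IH; rewrite /= IH; congr pair; apply: funext => i; rewrite !updE.
  by case: eqP => [_|//]; rewrite eqxx -natr1; ring.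
by case: eqP => [_|//]; rewrite eqxx -natr1; ring.
Qed.

(** The word spells out the coordinates in order, each as a run of equal steps followed by the digit
    2, and is padded with more digits 2. *)
Lemma walk_reaches (q : nat) (sg : nat -> bool) (N : nat -> nat) (len : nat) :
  (\sum_(j < q) N j + q <= len)%N ->
  exists2 w : seq nat, size w = len /\ all (fun d => d < 3)%N w &
    forall j, (j < q)%N -> (foldl walk_step (0%N, fun=> 0) w).2 j =
      if sg j then - (N j)%:R else (N j)%:R.
Proof.
move=> le.
have [w [sw aw pw zw]] : exists w : seq nat, [/\ size w = (\sum_(j < q) N j + q)%N,
    all (fun d => d < 3)%N w, (foldl walk_step (0%N, fun=> 0) w).1 = q &
    forall j, (foldl walk_step (0%N, fun=> 0) w).2 j = if (j < q)%N then
      if sg j then - (N j)%:R else (N j)%:R else 0].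
  elim: q {le} => [|q [w [sw aw pw zw]]]; first by exists [::]; rewrite big_ord0.
  exists (w ++ nseq (N q) (nat_of_bool (sg q)) ++ [:: 2]); split.
  - by rewrite !size_cat size_nseq /= sw big_ord_recr /=; lia.
  - by rewrite !all_cat aw all_nseq /= andbT; case: (sg q); rewrite orbT.
  - rewrite !foldl_cat; move: pw; case: (foldl _ _ w) => p z /= ->.
    by rewrite walk_const.
  - move=> j; rewrite !foldl_cat; move: pw zw; case: (foldl _ _ w) => p z /= -> zw.
    rewrite walk_const /= updE; case: (j =P q) => [->|jq].
      by rewrite zw ltnn ltnSn add0r.
    by rewrite zw (_ : (j < q.+1)%N = (j < q)%N) //; lia.
exists (w ++ nseq (len - size w) 2).
  rewrite size_cat size_nseq all_cat aw all_nseq orbT; split=> //.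
  by rewrite subnKC // sw.
have stay k p (z : nat -> R) : (foldl walk_step (p, z) (nseq k 2)).2 = z.
  by elim: k p => [|k IH] p //=; rewrite IH.
move=> j jq; rewrite foldl_cat; move: (zw j).
by case: (foldl _ _ w) => p z; rewrite stay jq.
Qed.

(** Words are base 4 fractions: the machine passes to the next code by adding [4^-len] and extracts
    a digit by multiplying by 4 and comparing with 1. Codes containing the digit 3 are enumerated
    too and yield further vectors of the span. *)
Fixpoint word_val (w : seq nat) : R :=
  if w is d :: w' then (d%:R + word_val w') / 4 else 0.

Fixpoint word_code (w : seq nat) : nat :=
  if w is d :: w' then (d * 4 ^ size w' + word_code w')%N else 0%N.

Lemma word_codeE w : word_val w = (word_code w)%:R / 4 ^+ size w.
Proof.
elim: w => [|d w IH] /=; first by rewrite mul0r.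
rewrite IH natrD natrM natrX exprS; field.
by rewrite expf_neq0 // pnatr_eq0.
Qed.

Lemma word_code_lt w : all (fun d => d < 3)%N w -> (word_code w < 4 ^ size w)%N.
Proof.
elim: w => //= d w IH /andP[d3 /IH h]; rewrite expnS.
have : (d * 4 ^ size w <= 2 * 4 ^ size w)%N by rewrite leq_mul2r -ltnS d3 orbT.
by lia.
Qed.

Lemma word_val_itv w : all (fun d => d < 3)%N w -> 0 <= word_val w < 1.
Proof.
move=> /word_code_lt h; rewrite word_codeE divr_ge0 ?exprn_ge0 //=.
by rewrite ltr_pdivrMr ?exprn_gt0 // mul1r -natrX ltr_nat.
Qed.

End Walks.

(** * The program *)

Section LanguageLemmas.
Context {R : realType}.
Implicit Types (s : @store R) (c : cmd).

(** Array 30 holds all real scalars, so a frame condition on whole arrays would be too coarse; a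
    write at a constant index affects that cell alone. *)
Fixpoint touches (a i : nat) (c : cmd) : bool :=
  match c with
  | CReal a' (NConst j) _ => (a' == a) && (j == i)
  | CReal a' _ _ | CFill a' _ _ _ => a' == a
  | CSeq c c' | CIfR _ _ c c' | CIfN _ _ c c' => touches a i c || touches a i c'
  | CFor _ _ c => touches a i c
  | _ => false
  end.

Lemma run_cell c s a i : ~~ touches a i c -> ra (run c s) a i = ra s a i.
Proof.
elim: c s => //=.
- move=> a' e f s; case: e => [k|?|?|?|? ?|? ?] /=;
    rewrite /upd; try by rewrite eq_sym => /negbTE ->.
  rewrite negb_and ![_ == a]eq_sym ![_ == i]eq_sym.
  by case: (a =P a') => [<-|//] /= /negbTE ->.
- by move=> a' o y e s; rewrite /upd eq_sym => /negbTE ->.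
- move=> c IHc c' IHc' s; rewrite negb_or => /andP[h h'].
  by rewrite IHc' ?IHc.
- move=> x y c IHc c' IHc' s; rewrite negb_or => /andP[h h'].
  by case: ifP => _; rewrite ?IHc' ?IHc.
- move=> x y c IHc c' IHc' s; rewrite negb_or => /andP[h h'].
  by case: ifP => _; rewrite ?IHc' ?IHc.
- move=> x y c IHc s h.
  apply: (@iteri_ind _ (fun _ s' => ra s' a i = ra s a i)) => // k s' _ <-.
  by rewrite IHc.
Qed.

Definition mask (x : nat) (f : nat -> nat) : nat -> nat :=
  fun z => if (z == x) || (z == x.+1) then 0%N else f z.

(** The invariant sees the variables through [mask], which hides the two counters: the loop resets
    them itself between iterations. *)
Lemma run_for (J : nat -> (nat -> nat -> R) -> (nat -> nat) -> Prop) x y c s :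
  0%N \notin [:: x, x.+1 & nassigned c] ->
  J 0 (ra s) (mask x (nv s)) ->
  (forall i s', (i < nv s y)%N -> J i (ra s') (mask x (nv s')) ->
    nv s' x = i -> nv s' x.+1 = (i * nv s 0)%N ->
    (forall z, z \notin [:: x, x.+1 & nassigned c] -> nv s' z = nv s z) ->
    J i.+1 (ra (run c s')) (mask x (nv (run c s')))) ->
  J (nv s y) (ra (run (CFor x y c) s)) (mask x (nv (run (CFor x y c) s))).
Proof.
move=> n0 J0 JS /=.
have mE s' v w : mask x (upd (upd (nv s') x v) x.+1 w) = mask x (nv s').
  by apply: funext => z; rewrite /mask !updE; do 2!case: (z =P _).
rewrite mE.
have [] // := @iteri_ind _ (fun i s' => J i (ra s') (mask x (nv s')) /\
  forall z, z \notin [:: x, x.+1 & nassigned c] -> nv s' z = nv s z) (nv s y)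
  (fun i s' => run c (setn (setn s' x i) x.+1 (i * nv s' 0))) s.
move=> i s' iy [Ji fr]; have fr' z : z \notin [:: x, x.+1 & nassigned c] ->
    nv (setn (setn s' x i) x.+1 (i * nv s' 0)) z = nv s z.
  move=> zc; rewrite -fr //= !updE; move: zc; rewrite !inE !negb_or.
  by move=> /and3P[/negbTE-> /negbTE-> _].
split; last first.
  move=> z zc; rewrite run_nv ?fr' //.
  by move: zc; rewrite !inE !negb_or => /and3P[].
apply: JS => //.
- by rewrite /= mE.
- by rewrite /= !updE eqxx (_ : (x == x.+1) = false) //; lia.
- by rewrite /= !updE eqxx fr.
Qed.

Lemma run_seq c c' s : run (CSeq c c') s = run c' (run c s).
Proof. by []. Qed.

Lemma eq_rowcol (n i j k l : nat) : (j < n)%N -> (l < n)%N ->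
  (i * n + j == k * n + l)%N = (i == k) && (j == l).
Proof.
move=> jn ln; apply/eqP/andP => [e|[/eqP-> /eqP->]//].
have n0 : (0 < n)%N by apply: leq_ltn_trans jn.
have := congr1 (modn^~ n) e; rewrite /= !modnMDl !modn_small // => jl.
by move: e; rewrite jl => /addIn/eqP; rewrite eqn_mul2r gtn_eqF //= => ->.
Qed.

Definition fill2 (x a : nat) (e : rexp) : cmd := CFor x 0 (CFill a (NVar x.+1) 0 e).

Lemma fill2P x a e s (n i j : nat) : nv s 0 = n -> (i < n)%N -> (j < n)%N ->
  ~~ reads a e -> eclosed 1 e -> (0 < x)%N ->
  ra (run (fill2 x a e) s) a (i * n + j)%N =
  reval (setn (setn s x i) x.+1 (i * n)%N) 1 (upd noidx 0 j) e.
Proof.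
move=> nE iN jn nr ce x0.
pose J (k : nat) (f : nat -> nat -> R) (v : nat -> nat) := (forall b, b != a -> f b = ra s b) /\
  forall i j, (i < k)%N -> (j < n)%N -> f a (i * n + j)%N =
    reval (setn (setn s x i) x.+1 (i * n)%N) 1 (upd noidx 0 j) e.
suff : J (nv s 0) (ra (run (fill2 x a e) s)) (mask x (nv (run (fill2 x a e) s))).
  by move=> [_]; apply; rewrite ?nE.
apply: run_for => //=.
- by rewrite !inE; lia.
- move=> k s' kn [fr Jk] xk xk' vE; split=> [b /negbTE ba|i' j' ik jn'] /=.
    by rewrite updE ba fr // ba.
  have v0 : nv s' 0 = n by rewrite vE ?inE ?nE //=; lia.
  rewrite updE eqxx xk' v0 nE.
  move: ik; rewrite ltnS leq_eqVlt => /orP[/eqP->|ik].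
    rewrite (_ : (_ <= _ < _)%N = true) ?addKn; last by lia.
    apply: (@reval_ext _ _ _ 1) => // [z|b rb m] /=.
      rewrite !updE; case: (z =P x.+1) => [->|z1]; first by rewrite xk' nE.
      case: (z =P x) => [->//|z2]; by rewrite vE // !inE (introF eqP z1) (introF eqP z2).
    by rewrite fr //; apply: contraNneq nr => <-.
  have -> : (k * n <= i' * n + j' < k * n + n)%N = false by nia.
  exact: Jk.
Qed.

End LanguageLemmas.

Declare Scope rexp_scope.
Delimit Scope rexp_scope with RE.
Bind Scope rexp_scope with rexp.
Notation "e + f" := (EBin OAdd e f) : rexp_scope.
Notation "e - f" := (EBin OSub e f) : rexp_scope.
Notation "e * f" := (EBin OMul e f) : rexp_scope.
Notation "e / f" := (EBin ODiv e f) : rexp_scope.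
Notation "0" := EZero : rexp_scope.
Notation "1" := EOne : rexp_scope.

(* Arrays: the input; the resolvent; its power, then the residuals; a buffer; the
   current pivot; the rows spanning the subspace; the net at the previous and at
   the current scale; a buffer, which also holds candidates; lattice
   coordinates; the center and the iterate of Newton's method; the best cut;
   residual capacities, residual capacities to the sink, excesses and heights;
   the best level set of the heights. *)
Notation aIN := 0%N (only parsing).
Notation aM := 1%N (only parsing).
Notation aA := 2 (only parsing).
Notation aTmp := 3 (only parsing).
Notation aV := 4 (only parsing).
Notation aG := 5 (only parsing).
Notation aOld := 6 (only parsing).
Notation aNew := 7 (only parsing).
Notation aY := 8 (only parsing).
Notation aZ := 9 (only parsing).
Notation aT0 := 10 (only parsing).
Notation aT := 11 (only parsing).
Notation aBest := 12 (only parsing).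
Notation aRes := 13 (only parsing).
Notation aRt := 14 (only parsing).
Notation aEx := 15 (only parsing).
Notation aHt := 16 (only parsing).
Notation aCut := 17 (only parsing).

(* The real scalars are the cells of the array 30: [eps]; [d * lambda]; the pivot
   threshold; the scale of the lattice and the accuracy of the net; the code of
   a word over {0, 1, 2} and its unread part; the sparsity of the best cut; the
   multiplier and the offset of Newton's method; a buffer; the best objective; a
   flag; the increment of the codes; the current level; [n]; the guessed size. *)
Notation sEps := 0%N (only parsing).
Notation sH := 1%N (only parsing).
Notation sThr := 3 (only parsing).
Notation sSig := 4 (only parsing).
Notation sM := 5 (only parsing).
Notation sCode := 6 (only parsing).
Notation sX := 7 (only parsing).
Notation sBest := 8 (only parsing).
Notation sGam := 9 (only parsing).
Notation sB := 10 (only parsing).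
Notation sA := 11 (only parsing).
Notation sObj := 12 (only parsing).
Notation sFlag := 13 (only parsing).
Notation sInv := 14 (only parsing).
Notation sTh := 15 (only parsing).
Notation sN := 16 (only parsing).
Notation sK := 17 (only parsing).

Definition sc (i : nat) : rexp := ECell 30 (NConst i).
Definition set_sc (i : nat) (e : rexp) : cmd := CReal 30 (NConst i) e.
Definition at1 (a : nat) (i : nexp) : rexp := ECell a i.
Definition at2 (a : nat) (i j : nexp) : rexp := ECell a (NPlus i j).
Definition cap_e (i j : nexp) : rexp := ECell aIN (NPlus (NConst 3) (NPlus i j)).
Definition dem_e (i j : nexp) : rexp := ECell aIN (NPlus (NVar 7) (NPlus i j)).
Definition e2 : rexp := (1 + 1)%RE.
Definition e4 : rexp := (e2 * e2)%RE.
Definition e8 : rexp := (e4 * e2)%RE.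
Definition e128 : rexp := (e8 * e8 * e2)%RE.
Definition sq (e : rexp) : rexp := (e * e)%RE.
Definition round_e (e : rexp) : rexp := EIfR (1 / e2) e 1 0.
Definition fill (a : nat) (e : rexp) : cmd := CFill a (NConst 0) 0 e.

Fixpoint cseq (l : seq cmd) : cmd :=
  if l is c :: l' then (if l' is [::] then c else CSeq c (cseq l')) else CSkip.

(* [d] is the first free bound index. *)
Definition card_e (d a : nat) : rexp := ESum 0 (at1 a (NIdx d)).
Definition cut_e (d a : nat) : rexp := ESum 0 (ESum 0
  (at1 a (NIdx d) * (1 - at1 a (NIdx d.+1)) * cap_e (NRow d) (NIdx d.+1))%RE).
Definition sd_e (d a b : nat) : rexp := ESum 0 (sq (at1 a (NIdx d) - at1 b (NIdx d))%RE).
Definition sparsity_e (a : nat) : rexp :=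
  (sc sN * cut_e 0 a / (card_e 0 a * (sc sN - card_e 0 a)))%RE.

Definition eval_cut : cmd :=
  CIfR 0 (card_e 0 aT) (CIfR (card_e 0 aT) (sc sN)
    (CIfR (sparsity_e aT) (sc sBest)
      (CSeq (set_sc sBest (sparsity_e aT)) (fill aBest (at1 aT (NIdx 0))))
      CSkip) CSkip) CSkip.

Definition init_scalars : cmd := cseq
  [:: set_sc sEps (at1 aIN (NConst 0));
      set_sc sH (at1 aIN (NVar 8) * at1 aIN (NConst 2))%RE;
      set_sc sN (ESum 0 1);
      set_sc sInv 1; CFor 20 5 (set_sc sInv (sc sInv / e4)%RE);
      set_sc sThr 1; CFor 20 3 (set_sc sThr (sc sThr / e2)%RE)].

Definition init_best : cmd := cseq
  [:: fill aBest (EIfN (NIdx 0) (NConst 1) 1 0); set_sc sBest (sparsity_e aBest)].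

(** Grows the set of vertices reachable from vertex 0. It serves the case of a cut of capacity 0,
    where [h] may fail to be positive. *)
Definition component : cmd := cseq
  [:: fill aT (EIfN (NIdx 0) (NConst 1) 1 0);
      CFor 20 3 (cseq [::
        fill aTmp (EIfR 0 (at1 aT (NIdx 0) + ESum 0 (at1 aT (NIdx 1) *
                    EIfR 0 (cap_e (NRow 1) (NIdx 0)) 1 0))%RE 1 0);
        fill aT (at1 aTmp (NIdx 0))]);
      eval_cut].

(** [aM] holds the inverse of [1 + L / h] restricted to the pairs treated so far. Both orders of a
    pair occur, hence the weight [delta / (2 h)]. [aV] is [M u] for [u = e_i - e_j]; the update is a
    multiple of [V V^T] because [M] is symmetric. *)
Definition resolvent : cmd := cseq
  [:: fill2 20 aM (EIfN (NVar 20) (NIdx 0) 0 (EIfN (NIdx 0) (NVar 20) 0 1));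
      CFor 20 0 (CFor 22 0 (cseq [::
        fill aV (at2 aM (NRow 0) (NVar 20) - at2 aM (NRow 0) (NVar 22))%RE;
        set_sc sA (dem_e (NVar 21) (NVar 22) / (e2 * sc sH))%RE;
        fill2 24 aTmp (at2 aM (NVar 25) (NIdx 0) -
          sc sA * at1 aV (NVar 24) * at1 aV (NIdx 0) /
            (1 + sc sA * (at1 aV (NVar 20) - at1 aV (NVar 22))))%RE;
        fill2 24 aM (at2 aTmp (NVar 25) (NIdx 0))]))].

Definition power : cmd := cseq
  [:: fill2 20 aA (EIfN (NVar 20) (NIdx 0) 0 (EIfN (NIdx 0) (NVar 20) 0 1));
      CFor 20 3 (cseq [::
        fill2 22 aTmp (ESum 0 (at2 aA (NVar 23) (NIdx 1) * at2 aM (NRow 1) (NIdx 0)))%RE;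
        fill2 22 aA (at2 aTmp (NVar 23) (NIdx 0))])].

Definition normV : rexp := ESum 0 (sq (at1 aV (NIdx 0))).

(** The running maximum starts at -1, below every squared length, so that some column is chosen
    before the threshold is tested. *)
Definition pick_pivot : cmd := cseq
  [:: set_sc sA (0 - 1)%RE;
      CFor 22 0 (CIfR (sc sA) (ESum 0 (sq (at2 aA (NRow 0) (NVar 22))))
        (cseq [:: set_sc sA (ESum 0 (sq (at2 aA (NRow 0) (NVar 22))));
                  fill aV (at2 aA (NRow 0) (NVar 22))])
        CSkip);
      CIfR (sc sThr) (sc sA) CSkip (fill aV 0%RE)].

Definition eliminate : cmd := cseq
  [:: fill2 22 aTmp (at2 aA (NVar 23) (NIdx 0) - at1 aV (NVar 22) *
        ESum 0 (at1 aV (NIdx 1) * at2 aA (NRow 1) (NIdx 0)) /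
          ESum 0 (sq (at1 aV (NIdx 1))))%RE;
      fill2 22 aA (at2 aTmp (NVar 23) (NIdx 0))].

(** Doubling replaces division by the length, which would take a square root. *)
Definition normalize : cmd :=
  CFor 22 3 (CIfR normV (1 / e4) (cseq
    [:: fill aY (at1 aV (NIdx 0) + at1 aV (NIdx 0))%RE;
        fill aV (at1 aY (NIdx 0))]) CSkip).

Definition subspace : cmd := CFor 20 2 (cseq
  [:: pick_pivot; eliminate; normalize;
      CFill aG (NVar 21) 0 (at1 aV (NIdx 0))]).

Definition decode : cmd := cseq
  [:: CFill aZ (NConst 0) 2 0%RE; CNat 63 (NConst 0); set_sc sX (sc sCode);
      CFor 26 5 (CSeq (set_sc sX (e4 * sc sX)%RE)
        (CIfR (sc sX) 1 (CReal aZ (NVar 63) (at1 aZ (NVar 63) + 1)%RE)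
        (CSeq (set_sc sX (sc sX - 1)%RE)
        (CIfR (sc sX) 1 (CReal aZ (NVar 63) (at1 aZ (NVar 63) - 1)%RE)
        (CSeq (set_sc sX (sc sX - 1)%RE) (CNat 63 (NPlus (NVar 63) (NConst 1))))))))].

(** The scan runs over the fixed capacity, variable 4, and skips rows beyond the current length: the
    list grows, but a loop bound may not. *)
Definition append : cmd := cseq
  [:: set_sc sFlag 1;
      CFor 26 4 (CIfN (NVar 26) (NVar 60)
        (CIfR (e128 * sc sM)%RE (ESum 0 (sq (round_e (at2 aNew (NVar 27) (NIdx 0)) -
            round_e (at1 aY (NIdx 0)))%RE)) CSkip (set_sc sFlag 0%RE)) CSkip);
      CIfR 0 (sc sFlag) (cseq
        [:: CFill aNew (NVar 61) 0 (at1 aY (NIdx 0));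
            CNat 60 (NPlus (NVar 60) (NConst 1));
            CNat 61 (NPlus (NVar 61) (NVar 0))]) CSkip].

Definition candidate : cmd := cseq
  [:: decode;
      fill aY (at2 aOld (NVar 23) (NIdx 0) +
        ESum 2 (at1 aZ (NIdx 1) * sc sSig * at2 aG (NRow 1) (NIdx 0)))%RE;
      CIfR (e2 * sc sM)%RE (ESum 0 (sq (round_e (at1 aY (NIdx 0)) - at1 aY (NIdx 0))%RE))
        CSkip append;
      set_sc sCode (sc sCode + sc sInv)%RE].

Definition build : cmd := cseq
  [:: CNat 60 (NConst 0); CNat 61 (NConst 0);
      CFor 22 4 (CIfN (NVar 22) (NVar 62)
        (CSeq (set_sc sCode 0%RE) (CFor 24 6 candidate)) CSkip)].

Definition copy_list : cmd := cseq
  [:: CFor 22 4 (CFill aOld (NVar 23) 0 (at2 aNew (NVar 23) (NIdx 0)));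
      CNat 62 (NVar 60)].

Definition push : cmd := cseq
  [:: set_sc sA (EIfR (at1 aEx (NVar 36)) (at2 aRes (NVar 37) (NVar 38))
        (at1 aEx (NVar 36)) (at2 aRes (NVar 37) (NVar 38)));
      CReal aRes (NPlus (NVar 37) (NVar 38)) (at2 aRes (NVar 37) (NVar 38) - sc sA)%RE;
      CReal aRes (NPlus (NVar 39) (NVar 36)) (at2 aRes (NVar 39) (NVar 36) + sc sA)%RE;
      CReal aEx (NVar 36) (at1 aEx (NVar 36) - sc sA)%RE;
      CReal aEx (NVar 38) (at1 aEx (NVar 38) + sc sA)%RE].

Definition push_sink : cmd := CIfR 0 (at1 aHt (NVar 36)) (cseq
  [:: set_sc sA (EIfR (at1 aEx (NVar 36)) (at1 aRt (NVar 36))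
        (at1 aEx (NVar 36)) (at1 aRt (NVar 36)));
      CReal aEx (NVar 36) (at1 aEx (NVar 36) - sc sA)%RE;
      CReal aRt (NVar 36) (at1 aRt (NVar 36) - sc sA)%RE]) CSkip.

Definition if_active (c : cmd) : cmd :=
  CIfR (at1 aHt (NVar 36)) (sc sN + 1)%RE (CIfR 0 (at1 aEx (NVar 36)) c CSkip) CSkip.

Definition pass : cmd := CFor 36 0 (cseq
  [:: push_sink;
      CFor 38 0 (if_active (CIfR 0 (at2 aRes (NVar 37) (NVar 38))
        (CIfR (at1 aHt (NVar 36)) (at1 aHt (NVar 38) + 1)%RE CSkip push) CSkip));
      if_active (CReal aHt (NVar 36) (at1 aHt (NVar 36) + 1)%RE)]).

Definition objective_e (a : nat) : rexp := (cut_e 0 a + sc sGam * sd_e 0 a aT0)%RE.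

(** The position of the gap in the heights is not known, so the objective is evaluated on all level
    sets. *)
Definition min_cut : cmd := cseq
  [:: fill2 28 aRes (cap_e (NVar 29) (NIdx 0));
      fill aRt (sc sGam * (1 - at1 aT0 (NIdx 0)))%RE;
      fill aEx (sc sGam * at1 aT0 (NIdx 0))%RE;
      fill aHt 0%RE;
      CFor 30 3 (CFor 32 3 pass);
      fill aCut 0%RE; set_sc sObj (objective_e aCut); set_sc sTh 0%RE;
      CFor 34 3 (cseq
        [:: fill aY (EIfR (sc sTh) (at1 aHt (NIdx 0)) 1 0);
            CIfR (objective_e aY) (sc sObj)
              (CSeq (set_sc sObj (objective_e aY)) (fill aCut (at1 aY (NIdx 0)))) CSkip;
            set_sc sTh (sc sTh + 1)%RE]);
      fill aT (at1 aCut (NIdx 0))].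

Definition newton : cmd := CSeq (fill aT (at1 aT0 (NIdx 0)))
  (CFor 26 3 (cseq
    [:: eval_cut;
        set_sc sGam (cut_e 0 aT / (sc sB - sd_e 0 aT aT0))%RE;
        min_cut])).

Definition explore : cmd :=
  CFor 22 4 (CIfN (NVar 22) (NVar 62) (cseq
    [:: fill aT0 (round_e (at2 aOld (NVar 23) (NIdx 0)));
        set_sc sK 0%RE;
        CFor 24 0 (cseq
          [:: set_sc sK (sc sK + 1)%RE; set_sc sB (sc sEps * sc sK / e8)%RE; newton])])
    CSkip).

Definition levels : cmd := cseq
  [:: CNat 62 (NConst 1); fill aOld 0%RE; set_sc sSig (sc sN + sc sN)%RE;
      CFor 20 3 (cseq
        [:: set_sc sSig (sc sSig / e2)%RE;
            set_sc sM (ESum 2 1 * sq (sc sSig))%RE;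
            build; copy_list; explore])].

Definition main : cmd := cseq
  [:: init_scalars; init_best; component; resolvent; power; subspace; levels].

Definition double (x : nat) : cmd := CNat x (NPlus (NVar x) (NVar x)).

(** Separate commands, because a single well-formed command never assigns a variable that bounds one
    of its loops. Products and powers are obtained by repeated addition and doubling. *)
Definition setup : seq cmd :=
  [:: CNat 2 (NPlus (NVar 1) (NVar 1));
      cseq (CNat 3 (NVar 0) :: nseq 5 (double 3));
      CSeq (CNat 4 (NConst 2)) (CFor 20 1 (cseq (nseq 8 (double 4))));
      cseq (CNat 5 (NVar 2) :: nseq 14 (double 5));
      CSeq (CNat 6 (NConst 1)) (CFor 20 5 (cseq (nseq 2 (double 6))));
      CSeq (CNat 7 (NConst 3)) (CFor 20 0 (CNat 7 (NPlus (NVar 7) (NVar 0))));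
      CSeq (CNat 8 (NVar 7)) (CFor 20 0 (CNat 8 (NPlus (NVar 8) (NVar 0))))].

Lemma main_wf : wf main.
Proof. by vm_compute. Qed.

Lemma setup_wf : all wf setup.
Proof. by vm_compute. Qed.

(** * Facts kept by all phases of the program *)

Section Context_.
Context {R : realType} (n r : nat) (eps d lambda : R) (c delta : 'M[R]_n).
Implicit Types (s : @store R).

Let len := (2 ^ 14 * (2 * r))%N.

Record sized (v : nat -> nat) : Prop := Sized {
  sz_n : v 0%N = n;
  sz_q : v 2 = (2 * r)%N;
  sz_t : v 3 = (32 * n)%N;
  sz_cap : v 4 = (2 ^ (8 * r).+1)%N;
  sz_len : v 5 = len;
  sz_codes : v 6 = (4 ^ len)%N;
  sz_off : v 7 = (3 + n * n)%N;
  sz_pos : v 8 = (3 + 2 * (n * n))%N }.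

Record inputs (f : nat -> nat -> R) : Prop := Inputs {
  in_eps : f 0%N 0%N = eps;
  in_d : f 0%N (3 + 2 * (n * n))%N = d;
  in_lambda : f 0%N 2 = lambda;
  in_c : forall i j : 'I_n, f 0%N (3 + (i * n + j))%N = c i j;
  in_delta : forall i j : 'I_n, f 0%N (3 + n * n + (i * n + j))%N = delta i j }.

Record context s : Prop := Ctx {
  ctx_sized : sized (nv s);
  ctx_inputs : inputs (ra s);
  ctx_eps : ra s 30 sEps = eps;
  ctx_h : ra s 30 sH = d * lambda;
  ctx_n : ra s 30 sN = n%:R;
  ctx_inv : ra s 30 sInv = 4^-1 ^+ len;
  ctx_thr : ra s 30 sThr = 2^-1 ^+ (32 * n) }.

(* [c'] leaves the sizes, the input and the fixed scalars unchanged. *)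
Definition safe (c' : cmd) : bool :=
  [&& all (fun x => 20 <= x)%N (nassigned c'), aIN \notin rassigned c' &
      all (fun i => ~~ touches 30 i c') [:: sEps; sH; sN; sInv; sThr]].

Lemma sized_run c' s : all (fun x => 20 <= x)%N (nassigned c') ->
  sized (nv s) -> sized (nv (run c' s)).
Proof.
move=> h [h0 h2 h3 h4 h5 h6 h7 h8]; have nx x : (x < 20)%N -> x \notin nassigned c'.
  by move=> x20; apply/negP => /(allP h); rewrite leqNgt x20.
by split; rewrite run_nv ?nx.
Qed.

Lemma context_run c' s : safe c' -> context s -> context (run c' s).
Proof.
move=> /and3P[h0 h1 /allP h2] [k0 [a1 a2 a3 a4 a5] k2 k3 k4 k5 k6].
have cell i : i \in [:: sEps; sH; sN; sInv; sThr] -> ra (run c' s) 30 i = ra s 30 i.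
  by move=> /h2 h; rewrite run_cell.
split; rewrite ?cell //; first exact: sized_run.
by split; rewrite ?run_ra // => i j; rewrite run_ra.
Qed.

(** The counters hidden by the mask are from 20 on, beyond all variables in the context, so the
    context can be carried along with any invariant. *)
Lemma run_for_ctx (J : nat -> (nat -> nat -> R) -> (nat -> nat) -> Prop) x y c' s :
  (20 <= x)%N -> safe c' -> context s -> J 0 (ra s) (mask x (nv s)) ->
  (forall i s', (i < nv s y)%N -> context s' -> J i (ra s') (mask x (nv s')) ->
    nv s' x = i -> nv s' x.+1 = (i * n)%N ->
    (forall z, z \notin [:: x, x.+1 & nassigned c'] -> nv s' z = nv s z) ->
    J i.+1 (ra (run c' s')) (mask x (nv (run c' s')))) ->
  J (nv s y) (ra (run (CFor x y c') s)) (mask x (nv (run (CFor x y c') s))).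
Proof.
move=> x20 sf cs J0 JS.
have sfor : safe (CFor x y c').
  by case/and3P: sf => h0 h1 h2; apply/and3P; split=> //; rewrite /= x20 leqW.
have ctxm s1 s2 : ra s1 = ra s2 -> mask x (nv s1) = mask x (nv s2) -> context s1 -> context s2.
  move=> re ne [[h0 h2 h3 h4 h5 h6 h7 h8] k1 k2 k3 k4 k5 k6].
  have nE z : (z < 20)%N -> nv s2 z = nv s1 z.
    move=> z20; have := congr1 (fun f => f z) ne; rewrite /mask.
    by rewrite (_ : (z == x) || (z == x.+1) = false) //; lia.
  by split; rewrite -?re //; split; rewrite nE.
pose J' i f v := (exists2 s', context s' & ra s' = f /\ mask x (nv s') = v) /\ J i f v.
suff [] : J' (nv s y) (ra (run (CFor x y c') s)) (mask x (nv (run (CFor x y c') s))) by [].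
apply: (@run_for _ J').
- rewrite !inE !negb_or; apply/and3P; split; try lia.
  by case/and3P: sf => h0 _ _; apply/negP => /(allP h0).
- by split=> //; exists s.
- move=> i s' iy [[s1 cs1 [re ne]] Ji] xi xi' vE.
  have cs' : context s' by apply: ctxm cs1.
  split; first by exists (run c' s') => //; apply: context_run.
  by apply: JS => //; rewrite xi' (sz_n (ctx_sized cs)).
Qed.

Definition is_ind (f : nat -> R) (T : {set 'I_n}) : Prop :=
  forall i : 'I_n, f i = (i \in T)%:R.

Lemma fillE s a e i : (i < nv s 0)%N ->
  ra (run (fill a e) s) a i = reval s 1 (upd noidx 0 i) e.
Proof. by move=> i0; rewrite /= updE eqxx /= add0n i0 subn0. Qed.

Lemma card_eE s dd b a T : sized (nv s) -> is_ind (ra s a) T ->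
  reval s dd b (card_e dd a) = #|T|%:R.
Proof.
move=> sz h; rewrite /= (sz_n sz) -sum1_card natr_sum [RHS]big_mkcond /=.
by apply: eq_bigr => i _; rewrite updE eqxx h; case: (i \in T).
Qed.

Lemma sd_eE s dd b a a' T T' : sized (nv s) -> is_ind (ra s a) T ->
  is_ind (ra s a') T' -> reval s dd b (sd_e dd a a') = (sd T T')%:R.
Proof.
move=> sz h h'; rewrite /= (sz_n sz) sd_sum; apply: eq_bigr => i _.
by rewrite updE eqxx h h' expr2.
Qed.

Lemma cut_eE s dd b a T : sized (nv s) -> inputs (ra s) -> is_ind (ra s a) T ->
  reval s dd b (cut_e dd a) = cut_capacity c T.
Proof.
move=> sz inp h; rewrite /= (sz_n sz) /cut_capacity [RHS]big_mkcond /=.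
apply: eq_bigr => i _.
rewrite (eq_bigr (fun j : 'I_n => (i \in T)%:R * (1 - (j \in T)%:R) * c i j)).
  case: (i \in T); last by rewrite big1 // => j _; rewrite !mul0r.
  rewrite [RHS]big_mkcond; apply: eq_bigr => j _; rewrite mul1r.
  by case: (j \in T); rewrite /= ?subrr ?subr0 ?mul0r ?mul1r.
move=> j _; rewrite !updE !eqxx (_ : (dd == dd.+1) = false); last by lia.
by rewrite !h (in_c inp).
Qed.

Lemma sparsity_eE s a T : context s -> is_ind (ra s a) T ->
  reval s 0 noidx (sparsity_e a) = sparsity c T.
Proof.
move=> [sz inp _ _ nE _ _] h; rewrite /sparsity_e.
have -> : forall e f g : rexp, reval s 0 noidx (sc sN * e / (f * (sc sN - g)))%RE =
  n%:R * reval s 0 noidx e / (reval s 0 noidx f * (n%:R - reval s 0 noidx g)).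
  by move=> e f g; rewrite /= nE.
rewrite (cut_eE _ _ sz inp h) (card_eE _ _ sz h) /sparsity natrB //.
by apply: leq_trans (max_card _) _; rewrite card_ord.
Qed.

(** The bound [v] is separate from the stored cut: any genuine cut may be stored, and a phase only
    has to lower [v]. *)
Record best s (v : R) : Prop := Best {
  best_set : exists S : {set 'I_n}, [/\ is_cut S, is_ind (ra s aBest) S &
    ra s 30 sBest = sparsity c S];
  best_le : ra s 30 sBest <= v }.

Definition spares (c' : cmd) : bool := (aBest \notin rassigned c') && ~~ touches 30 sBest c'.

Lemma best_run c' s v : spares c' -> best s v -> best (run c' s) v.
Proof.
move=> /andP[h1 h2] [[S [S1 S2 S3]] lv]; split; last by rewrite run_cell.
by exists S; split=> //; [move=> i; rewrite run_ra|rewrite run_cell].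
Qed.

Lemma best_weaken s v v' : v <= v' -> best s v -> best s v'.
Proof. by move=> vv [h1 h2]; split=> //; apply: le_trans vv. Qed.

Lemma is_cut_card (T : {set 'I_n}) : is_cut T = (0 < #|T| < n)%N.
Proof.
by rewrite /is_cut -card_gt0 eqEcard subsetT cardsT card_ord -ltnNge.
Qed.

Lemma eval_cutP s v T : context s -> best s v -> is_ind (ra s aT) T ->
  let s' := run eval_cut s in
  best s' v /\ (is_cut T -> best s' (sparsity c T)).
Proof.
move=> cs [[S [S1 S2 S3]] lv] hT; have sz := ctx_sized cs.
have bS v' : ra s 30 sBest <= v' -> best s v' by move=> h; split=> //; exists S.
have cE := card_eE 0 noidx sz hT; have sE := sparsity_eE cs hT.
pose s1 := run (CSeq (set_sc sBest (sparsity_e aT)) (fill aBest (at1 aT (NIdx 0)))) s.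
have -> : run eval_cut s = if 0 < #|T|%:R :> R then if #|T|%:R < n%:R :> R then
    if sparsity c T < ra s 30 sBest then s1 else s else s else s.
  rewrite -cE -(ctx_n cs) -sE; by [].
rewrite ltr0n ltr_nat is_cut_card.
case: (0 < #|T|)%N (is_cut_card T) => /=; last by move=> _; split=> //; exact: bS.
case: (#|T| < n)%N => /= cT; last by split=> //; exact: bS.
case: ifP => [lt|/negbT]; last first.
  by rewrite -leNgt => le; split=> [|_]; exact: bS.
have b1 v' : sparsity c T <= v' -> best s1 v'.
  have e30 : ra s1 30 sBest = sparsity c T.
    by rewrite /s1 run_seq run_cell //= updE eqxx updE eqxx -sE.
  move=> h; split; last by rewrite e30.
  exists T; split=> // i; rewrite /s1 run_seq fillE ?run_nv ?(sz_n sz) // /= /upd /=.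
  exact: hT.
split=> [|_]; apply: b1 => //; exact: le_trans (ltW lt) lv.
Qed.

End Context_.

Section Initialization.
Context {R : realType} (n r : nat) (eps d lambda : R) (c delta : 'M[R]_n).
Implicit Types (s : @store R).
Local Notation context := (context r eps d lambda c delta).
Local Notation best := (best c).

Lemma geometric_loop y i e (w : R) s : (forall s' : @store R, reval s' 0 noidx e = w) ->
  ra (run (CFor 20 y (set_sc i (sc i / e)%RE)) s) 30 i = ra s 30 i * w^-1 ^+ nv s y.
Proof.
move=> ew; pose J k (f : nat -> nat -> R) (v : nat -> nat) := f 30 i = ra s 30 i * w^-1 ^+ k.
suff : J (nv s y) (ra (run (CFor 20 y (set_sc i (sc i / e)%RE)) s))
  (mask 20 (nv (run (CFor 20 y (set_sc i (sc i / e)%RE)) s))) by [].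
apply: (@run_for _ J) => //; first by rewrite /J expr0 mulr1.
by move=> k s' ky Jk _ _ _; rewrite /J /= updE eqxx updE eqxx ew Jk exprSr mulrA.
Qed.

Lemma init_scalarsP s : sized n r (nv s) -> inputs eps d lambda c delta (ra s) ->
  context (run init_scalars s).
Proof.
move=> sz inp; split.
- exact: sized_run.
- case: inp => h0 h1 h2 h3 h4.
  by split; rewrite ?run_ra // => i j; rewrite run_ra.
- rewrite /init_scalars /cseq !run_seq; do 6!(rewrite run_cell //).
  rewrite /=.
  by rewrite updE /= updE /= (in_eps inp).
- rewrite /init_scalars /cseq !run_seq; do 5!(rewrite run_cell //).
  rewrite /=.
  rewrite updE /= updE /= updE /= (sz_pos sz).
  by rewrite (in_d inp) (in_lambda inp).
- rewrite /init_scalars /cseq !run_seq; do 4!(rewrite run_cell //).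
  rewrite /=.
  by rewrite updE /= updE /= (sz_n sz) sumr_const card_ord.
- rewrite /init_scalars /cseq !run_seq; do 2!(rewrite run_cell //).
  rewrite (@geometric_loop _ _ _ 4) => [|s']; last by rewrite /=; ring.
  by rewrite [in X in X * _]/= updE /= updE /= mul1r (sz_len sz).
- rewrite /init_scalars /cseq !run_seq.
  rewrite (@geometric_loop _ _ _ 2) => [|s']; last by rewrite /=; ring.
  by rewrite run_nv // run_nv // [in X in X * _]/= updE /= updE /= mul1r (sz_t sz).
Qed.

Lemma init_bestP s : (1 < n)%N -> context s ->
  exists v, best (run init_best s) v.
Proof.
move=> n1 cs; have sz := ctx_sized cs.
have n0 : (0 < n)%N by apply: ltnW.
pose S : {set 'I_n} := [set Ordinal n0].
pose s1 := run (fill aBest (EIfN (NIdx 0) (NConst 1) 1%RE 0%RE)) s.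
have cs1 : context s1 by apply: context_run.
have iS : is_ind (ra s1 aBest) S.
  move=> i; rewrite /s1 fillE ?(sz_n sz) //= updE eqxx ltnS leqn0 inE -val_eqE /=.
  by case: eqP.
exists (sparsity c S); split; rewrite /init_best /cseq run_seq -/s1.
  exists S; split.
  - by rewrite is_cut_card cards1 n1.
  - by move=> i; rewrite run_ra // iS.
  - by rewrite -(sparsity_eE cs1 iS) /= updE eqxx updE eqxx.
by rewrite -(sparsity_eE cs1 iS) [X in X <= _]/= updE eqxx updE eqxx.
Qed.

(** The grown set [K] gains a vertex in each round until it is closed under edges, so [32 n] rounds
    suffice. A closed set has capacity 0, and [K] lies in every set of capacity 0 that contains
    vertex 0; if [S] is a cut of capacity 0, then [S] or its complement is such a set, so [K] is not
    everything. *)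
Lemma componentP s v : (1 < n)%N -> regular_graph c -> context s -> best s v ->
  best (run component s) v /\
  forall S, is_cut S -> cut_capacity c S = 0 -> best (run component s) 0.
Proof.
move=> n1 [[csym _ c0] _] cs bs; have sz := ctx_sized cs.
have n0 : (0 < n)%N by apply: ltnW.
pose o := Ordinal n0.
pose grow (K : {set 'I_n}) := K :|: [set j | [exists i in K, 0 < c i j]].
pose J k (f : nat -> nat -> R) (_ : nat -> nat) := exists K : {set 'I_n},
  [/\ is_ind (f aT) K, o \in K, grow K = K \/ (k < #|K|)%N &
   forall S : {set 'I_n}, cut_capacity c S = 0 -> o \in S -> K \subset S].
pose s1 := run (fill aT (EIfN (NIdx 0) (NConst 1) 1%RE 0%RE)) s.
have cs1 : context s1 by apply: context_run.
pose body := cseq [:: fill aTmp (EIfR 0 (at1 aT (NIdx 0) + ESum 0 (at1 aT (NIdx 1) *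
    EIfR 0 (cap_e (NRow 1) (NIdx 0)) 1 0))%RE 1 0); fill aT (at1 aTmp (NIdx 0))].
have J0 : J 0 (ra s1) (mask 20 (nv s1)).
  exists [set o]; split; rewrite ?inE ?cards1 //; first last.
  - by move=> S _ oS; rewrite sub1set.
  - by right.
  - move=> i; rewrite /s1 fillE ?(sz_n sz) //= updE eqxx ltnS leqn0 inE -val_eqE /=.
    by case: eqP.
have JS i s' : (i < nv s1 3)%N -> context s' -> J i (ra s') (mask 20 (nv s')) ->
    J i.+1 (ra (run body s')) (mask 20 (nv (run body s'))).
  move=> _ cs' [K [iK oK gK SK]]; have sz' := ctx_sized cs'; exists (grow K); split.
  - have iT : forall j : 'I_n, ra (run body s') aT j =
        ra (run (fill aTmp (EIfR 0 (at1 aT (NIdx 0) + ESum 0 (at1 aT (NIdx 1) *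
          EIfR 0 (cap_e (NRow 1) (NIdx 0)) 1 0))%RE 1 0)%RE) s') aTmp j.
      by move=> j; rewrite /body /cseq run_seq fillE ?run_nv ?(sz_n sz').
    move=> j; rewrite iT fillE ?(sz_n sz') //= updE eqxx (sz_n sz').
    have sE : \sum_(i0 < n) ra s' aT (upd (upd noidx 0 j) 1 i0 1%N) *
       (if 0 < ra s' 0 (3 + (upd (upd noidx 0 j) 1 i0 1%N * n +
          upd (upd noidx 0 j) 1 i0 0%N))%N then 1 else 0) =
       \sum_(a | a \in K) (if 0 < c a j then 1 else 0) :> R.
      rewrite [RHS]big_mkcond; apply: eq_bigr => a _; rewrite !updE /= (in_c (ctx_inputs cs')).
      by rewrite iK; case: (a \in K); rewrite ?mul1r ?mul0r.
    rewrite sE iK !inE; case jK: (j \in K) => /=.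
      rewrite ltr_pwDl // sumr_ge0 // => a _; by case: ifP.
    rewrite add0r; case: ifPn => [lt|]; last first.
      rewrite -leNgt => le; case: existsP => // -[a /andP[aK ca]].
      move: le; rewrite (bigD1 a) //= ca => le.
      have : 0 <= \sum_(i1 in K | i1 != a) (if 0 < c i1 j then 1 else 0) :> R.
        by apply: sumr_ge0 => b _; case: ifP.
      move=> h; exfalso; move: le; rewrite leNgt => /negP; apply; lra.
    case: existsP => // h; exfalso; move: lt; rewrite big1 ?ltxx // => a aK.
    by case: ifP => // ca; case: h; exists a; rewrite aK.
  - by rewrite /grow inE oK.
  - case: gK => [gE|gK]; first by left; rewrite !gE.
    have [gE|gE] := eqVneq (grow K) K; first by left; rewrite !gE.
    right; apply: leq_ltn_trans gK _; apply: proper_card.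
    by rewrite properEneq eq_sym gE /grow subsetUl.
  - move=> S S0 oS; have KS := SK S S0 oS; rewrite /grow subUset KS /=.
    apply/subsetP => j; rewrite inE => /existsP[a /andP[aK ca]].
    apply: contraT => jS; move: S0 => /eqP.
    rewrite /cut_capacity psumr_eq0 => [/allP h|b _]; last by apply: sumr_ge0.
    have aS := subsetP KS a aK.
    have := h a (mem_index_enum _); rewrite aS /= psumr_eq0 // => /allP h2.
    have := h2 j (mem_index_enum _); rewrite jS /= => /eqP cE.
    by rewrite cE ltxx in ca.
pose s2 := run (CFor 20 3 body) s1.
have cs2 : context s2 by apply: context_run.
have bs2 : best s2 v by apply: best_run => //; apply: best_run.
have [K [iK oK gK SK]] : J (nv s1 3) (ra s2) (mask 20 (nv s2)).
  apply: (run_for_ctx (J := J)) cs1 J0 _ => // i s' iy cs' Ji _ _ _.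
  exact: JS.
have -> : run component s = run eval_cut s2 by [].
have [b1 b2] := eval_cutP cs2 bs2 iK; split=> // S cutS S0.
have gKK : grow K = K.
  case: gK => //; rewrite (sz_t (ctx_sized cs1)) => h; exfalso.
  have : (#|K| <= n)%N by apply: leq_trans (max_card _) _; rewrite card_ord.
  by lia.
have K0 : cut_capacity c K = 0.
  apply: big1 => i iK'; apply: big1 => j jK; apply/eqP; rewrite eq_le c0 andbT leNgt.
  apply: contraNN jK => cij; rewrite -gKK /grow !inE; apply/orP; right.
  by apply/existsP; exists i; rewrite iK'.
have KT : is_cut K.
  apply/andP; split; first by apply/set0Pn; exists o.
  apply: contraTneq cutS => KE.
  have [oS|oS] := boolP (o \in S).
    by have := SK S S0 oS; rewrite KE subTset => /eqP->; rewrite /is_cut eqxx andbF.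
  have cS0 : cut_capacity c (~: S) = 0.
    rewrite -[RHS]S0 /cut_capacity exchange_big /=.
    apply: eq_big => [i|i]; rewrite ?inE ?negbK // => _.
    by apply: eq_big => [j|j _]; rewrite ?inE //; rewrite -{1}csym mxE.
  have := SK _ cS0; rewrite inE oS => /(_ isT); rewrite KE subTset => /eqP SE.
  by rewrite /is_cut -[S]setCK SE setCT eqxx.
by have := b2 KT; rewrite /sparsity K0 mulr0 mul0r.
Qed.

End Initialization.

(** * The subspace phase *)

Section SubspacePhase.
Context {R : realType} (n r : nat) (eps d lambda : R) (c delta : 'M[R]_n).
Implicit Types (s : @store R).
Local Notation context := (context r eps d lambda c delta).
Local Notation h := (d * lambda).

Definition mat (f : nat -> R) : 'M[R]_n := \matrix_(i, j) f (i * n + j)%N.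
Definition vec (f : nat -> R) : 'cV[R]_n := \col_i f i.
Definition rowvec (f : nat -> R) (k : nat) : 'cV[R]_n := \col_i f (k * n + i)%N.

Lemma fill2_mat x a e s : nv s 0 = n -> ~~ reads a e -> eclosed 1 e -> (0 < x)%N ->
  mat (ra (run (fill2 x a e) s) a) = \matrix_(i, j)
    reval (setn (setn s x i) x.+1 (i * n)%N) 1 (upd noidx 0 j) e.
Proof. by move=> *; apply/matrixP => i j; rewrite !mxE (@fill2P _ _ _ _ _ n). Qed.

Lemma fill_vec a e s : nv s 0 = n ->
  vec (ra (run (fill a e) s) a) = \col_i reval s 1 (upd noidx 0 i) e.
Proof. by move=> nE; apply/matrixP => i j; rewrite !mxE fillE ?nE. Qed.

Lemma mat_copy x a b s : nv s 0 = n -> a != b -> (0 < x)%N ->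
  (b < 31)%N ->
  mat (ra (run (fill2 x a (at2 b (NVar x.+1) (NIdx 0))) s) a) = mat (ra s b).
Proof.
move=> nE ab x0 b31; rewrite fill2_mat //= ?andbT ?b31 1?eq_sym //.
by apply/matrixP => i j; rewrite !mxE !updE !eqxx.
Qed.

Lemma mat_id s x a : nv s 0 = n -> (0 < x)%N ->
  mat (ra (run (fill2 x a (EIfN (NVar x) (NIdx 0) 0
    (EIfN (NIdx 0) (NVar x) 0 1)))%RE s) a) = 1%:M.
Proof.
move=> nE x0; rewrite fill2_mat //; apply/matrixP => i j; rewrite !mxE /= !updE eqxx.
rewrite (_ : (x == x.+1) = false); last by lia.
by rewrite -val_eqE /=; case: (ltngtP i j).
Qed.

Let W (p : 'I_n * 'I_n) : 'M[R]_n := (delta p.1 p.2 / (2 * h)) *: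
  ((delta_mx p.1 0 - delta_mx p.2 0) *m (delta_mx p.1 0 - delta_mx p.2 0 : 'cV[R]_n)^T).
Let X (P : pred ('I_n * 'I_n)) : 'M[R]_n := 1%:M + \sum_(p | P p) W p.

(** The stored matrix inverts [X P] for the set [P] of pairs already treated, in lexicographic
    order; each step is one Sherman-Morrison update. *)
Lemma resolventP s : weighted_graph delta -> 0 < h -> context s ->
  mat (ra (run resolvent s) aM) *m (1%:M + h^-1 *: laplacian delta) = 1%:M.
Proof.
move=> [ds _ d0] h0 cs; have sz := ctx_sized cs.
have h20 : 0 <= 2 * h by apply: mulr_ge0 => //; exact: ltW.
have Xs P : (X P)^T = X P.
  rewrite /X raddfD /= trmx1; congr (_ + _); rewrite raddf_sum; apply: eq_bigr => p _.
  apply/matrixP => a b; rewrite !mxE !big_ord1 !mxE; congr (_ * _).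
  exact: mulrC.
have Xp P x : 0 <= dot (X P *m x) x.
  rewrite /X mulmxDl mul1mx dotDl addr_ge0 ?dot_ge0 // mulmx_suml dot_suml.
  apply: sumr_ge0 => p _; rewrite /W -scalemxAl dotZl mulr_ge0 ?divr_ge0 //.
  set u : 'cV[R]_n := _ - _; rewrite -mulmxA (_ : u^T *m x = (dot u x)%:M).
    by rewrite mul_mx_scalar dotZl -expr2 sqr_ge0.
  apply/matrixP => a b; rewrite !ord1 [RHS]mxE eqxx mulr1n mxE.
  by apply: eq_bigr => m _; rewrite mxE.
have step s' (i j : 'I_n) (P : pred ('I_n * 'I_n)) : context s' -> ~~ P (i, j) ->
    nv s' 20 = i -> nv s' 21 = (i * n)%N -> nv s' 22 = j ->
    mat (ra s' aM) *m X P = 1%:M ->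
    mat (ra (run (cseq [::
        fill aV (at2 aM (NRow 0) (NVar 20) - at2 aM (NRow 0) (NVar 22))%RE;
        set_sc sA (dem_e (NVar 21) (NVar 22) / (e2 * sc sH))%RE;
        fill2 24 aTmp (at2 aM (NVar 25) (NIdx 0) -
          sc sA * at1 aV (NVar 24) * at1 aV (NIdx 0) /
            (1 + sc sA * (at1 aV (NVar 20) - at1 aV (NVar 22))))%RE;
        fill2 24 aM (at2 aTmp (NVar 25) (NIdx 0))]) s') aM) *m
      X [pred p | P p || (p == (i, j))] = 1%:M.
  move=> cs' Pij v20 v21 v22 MX; have sz' := ctx_sized cs'.
  rewrite /cseq !run_seq mat_copy ?run_nv ?(sz_n sz') //.
  set s1 := run (fill _ _) s'; set s2 := run (set_sc _ _) s1.
  have n2 : nv s2 0 = n by rewrite !run_nv ?(sz_n sz').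
  pose u : 'cV[R]_n := delta_mx i 0 - delta_mx j 0.
  pose M := mat (ra s' aM).
  have V1 : vec (ra s1 aV) = M *m u.
    rewrite /s1 fill_vec ?(sz_n sz') //; apply/matrixP => l k; rewrite ord1 [LHS]mxE /=.
    by rewrite v20 v22 (sz_n sz') /u mulmxBr -!colE !mxE.
  have V2 (l : 'I_n) : ra s2 aV l = (M *m u) l 0.
    by rewrite -V1 !mxE /s2 run_ra.
  have A2 : ra s2 30 sA = delta i j / (2 * h).
    have cs1 : context s1 by apply: context_run.
    rewrite /s2 [LHS]/= updE /= updE /= v21 v22 (sz_off sz') /upd /=.
    by rewrite (in_delta (ctx_inputs cs')) (ctx_h cs').
  have a0 : 0 <= delta i j / (2 * h) by rewrite divr_ge0.
  have [Ms ab0 SM] := sherman_morrison u (Xs P) MX (Xp P) a0.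
  have XE : X [pred p | P p || (p == (i, j))] = X P + (delta i j / (2 * h)) *: (u *m u^T).
    rewrite /X -addrA; congr (_ + _); rewrite (bigD1 (i, j)) /= ?eqxx ?orbT //.
    rewrite addrC; congr (_ + _); apply: eq_bigl => p /=.
    by case: (p =P (i, j)) => [->|_]; rewrite ?(negbTE Pij) ?orbF ?andbT.
  rewrite XE -[RHS]SM; congr (_ *m _).
  have w20 : nv s2 20 = i by rewrite run_nv // run_nv.
  have w22 : nv s2 22 = j by rewrite run_nv // run_nv.
  have M2 : ra s2 aM = ra s' aM by rewrite run_ra // run_ra.
  clearbody s2; rewrite fill2_mat //; apply/matrixP => l m.
  rewrite [LHS]mxE [LHS]/= /upd /= A2 w20 w22 !V2 M2.
  have uM : dot u (M *m u) = (M *m u) i 0 - (M *m u) j 0.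
    by rewrite dotC /u dotDr dotNr !dot_delta.
  rewrite -/M uM; set v := M *m u; clearbody v.
  by rewrite !mxE big_ord1 mxE; ring.
have XE P Q : P =1 Q -> X P = X Q by move=> PQ; rewrite /X (eq_bigl _ _ PQ).
(* The pairs treated before row [i], respectively before the pair [(i, j)]. *)
pose P1 (i : nat) : pred ('I_n * 'I_n) := fun p => (p.1 < i)%N.
pose P2 (i j : nat) : pred ('I_n * 'I_n) := fun p => (p.1 < i)%N || ((p.1 == i :> nat) && (p.2 < j)%N).
set body := cseq _ in step.
pose J2 i j (f : nat -> nat -> R) (v : nat -> nat) := v 20 = i /\ v 21 = (i * n)%N /\
  mat (f aM) *m X (P2 i j) = 1%:M.
pose J1 i (f : nat -> nat -> R) (_ : nat -> nat) := mat (f aM) *m X (P1 i) = 1%:M.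
rewrite /resolvent [cseq _]/= run_seq -/body; set s0 := run (fill2 _ _ _) s.
have cs0 : context s0 by apply: context_run.
suff : J1 (nv s0 0) (ra (run (CFor 20 0 (CFor 22 0 body)) s0))
    (mask 20 (nv (run (CFor 20 0 (CFor 22 0 body)) s0))).
  rewrite /J1 (sz_n (ctx_sized cs0)) (XE _ xpredT) => [|p]; last by rewrite /P1 ltn_ord.
  move=> e; rewrite -[RHS]e; congr (_ *m (_ + _)).
  rewrite (laplacian_sum ds) pair_big scaler_sumr /=; apply: eq_bigr => p _.
  rewrite /W scalerA; congr (_ *: _); field.
  by move: h0; case: (eqVneq d 0) => [->|]; case: (eqVneq lambda 0) => [->|]; rewrite ?mul0r ?mulr0 ?ltxx.
apply: (run_for_ctx (J := J1) _ _ cs0) => //.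
  rewrite /J1 (XE _ xpred0) /X ?big_pred0 // addr0 mulmx1.
  by rewrite /s0 mat_id // (sz_n sz).
move=> i s1 iN cs1 Ji s1i s1i' _; have sz1 := ctx_sized cs1.
rewrite (sz_n (ctx_sized cs0)) in iN.
suff : J2 i (nv s1 0) (ra (run (CFor 22 0 body) s1)) (mask 22 (nv (run (CFor 22 0 body) s1))).
  move=> [_ [_]]; rewrite /J1 (sz_n sz1) => e; rewrite -[RHS]e; congr (_ *m _).
  by apply: XE => p; rewrite /P1 /P2 ltn_ord andbT ltnS leq_eqVlt orbC.
apply: (run_for_ctx (J := J2 i) _ _ cs1) => //.
  rewrite /J2 /mask /= s1i s1i'; split=> //; split=> //.
  rewrite -Ji; congr (_ *m _); apply: XE => p.
  by rewrite /P1 /P2 ltn0 andbF orbF.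
move=> j s2 jN cs2 [v20 [v21 MX]] s2j _ _; rewrite (sz_n sz1) in jN.
have v20' : nv s2 20 = i by move: v20; rewrite /mask.
have v21' : nv s2 21 = (i * n)%N by move: v21; rewrite /mask.
have mE z : (z < 22)%N -> mask 22 (nv (run body s2)) z = nv (run body s2) z.
  by move=> z22; rewrite /mask (_ : (z == 22) || (z == 23) = false) //; lia.
split; first by rewrite mE // run_nv.
split; first by rewrite mE // run_nv.
rewrite -(step s2 (Ordinal iN) (Ordinal jN) (P2 i j)) //=; last by rewrite /P2 /= !ltnn eqxx.
congr (_ *m _); apply: XE => -[a b]; rewrite /P2 /= xpair_eqE -!val_eqE /= ltnS.
rewrite (leq_eqVlt b); case: (a < i)%N; case: (a == i :> nat) => //=.
exact: orbC.
Qed.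

Lemma powerP s : context s -> mat (ra (run power s) aA) =
  iter (32 * n) (fun P : 'M[R]_n => P *m mat (ra s aM)) 1%:M.
Proof.
move=> cs; have sz := ctx_sized cs; rewrite /power [cseq _]/= run_seq.
set s0 := run (fill2 _ _ _) s; have cs0 : context s0 by apply: context_run.
set body := CSeq _ _.
pose J k (f : nat -> nat -> R) (_ : nat -> nat) := f aM = ra s aM /\
  mat (f aA) = iter k (fun P : 'M[R]_n => P *m mat (ra s aM)) 1%:M.
suff [_] : J (nv s0 3) (ra (run (CFor 20 3 body) s0)) (mask 20 (nv (run (CFor 20 3 body) s0))).
  by rewrite (sz_t (ctx_sized cs0)).
apply: (run_for_ctx (J := J) _ _ cs0) => //.
  by rewrite /J /s0 mat_id ?(sz_n sz) // run_ra.
move=> k s1 _ cs1 [M1 A1] _ _ _; have n1 := sz_n (ctx_sized cs1).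
rewrite /J run_ra //; split=> //; rewrite /body run_seq mat_copy ?run_nv //.
rewrite fill2_mat //; apply/matrixP => i j; rewrite mxE /= /upd /= n1 -A1 [RHS]mxE.
by apply: eq_bigr => l _; rewrite !mxE M1.
Qed.

End SubspacePhase.

Section SubspaceLoop.
Context {R : realType} (n r : nat) (eps d lambda : R) (c delta : 'M[R]_n).
Implicit Types (s : @store R).
Local Notation context := (context r eps d lambda c delta).
Local Notation mat := (@mat R n).
Local Notation vec := (@vec R n).
Local Notation rowvec := (@rowvec R n).
Local Notation thr := (2^-1 ^+ (32 * n) : R).

Definition pivot (B : 'M[R]_n) (V : 'cV[R]_n) : Prop :=
  (V = 0 /\ forall k, dot (B *m delta_mx k 0) (B *m delta_mx k 0) <= thr) \/
  (exists i, [/\ V = B *m delta_mx i 0, thr < dot V V &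
    forall k, dot (B *m delta_mx k 0) (B *m delta_mx k 0) <= dot V V]).

Lemma dotE (x y : 'cV[R]_n) (f g : nat -> R) : (forall i : 'I_n, x i 0 = f i) ->
  (forall i : 'I_n, y i 0 = g i) -> dot x y = \sum_(i < n) f i * g i.
Proof. by move=> fE gE; apply: eq_bigr => i _; rewrite fE gE. Qed.

Lemma pick_pivotP s : context s -> pivot (mat (ra s aA)) (vec (ra (run pick_pivot s) aV)).
Proof.
move=> cs; have sz := ctx_sized cs; set B := mat _.
pose N (k : 'I_n) := dot (B *m delta_mx k 0) (B *m delta_mx k 0).
rewrite /pick_pivot /cseq run_seq run_seq; set s0 := run (set_sc _ _) s.
have cs0 : context s0 by apply: context_run.
set body := CIfR (sc sA) _ _ _.
pose J k (f : nat -> nat -> R) (_ : nat -> nat) := [/\ f aA = ra s aA,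
  forall j : 'I_n, (j < k)%N -> N j <= f 30 sA &
  (k = 0%N /\ f 30 sA = -1) \/ exists i, f 30 sA = N i /\ vec (f aV) = B *m delta_mx i 0].
set s1 := run (CFor 22 0 body) s0.
have cs1 : context s1 by apply: context_run.
have [A1 N1 V1] : J (nv s0 0) (ra s1) (mask 22 (nv s1)).
  apply: (run_for_ctx (J := J) _ _ cs0) => //.
    split=> //; left; split=> //; rewrite /s0 /= updE /= updE /=; ring.
  move=> k s' kn cs' [A' N' V'] k' _ _; have sz' := ctx_sized cs'.
  rewrite (sz_n (ctx_sized cs0)) in kn; pose o := Ordinal kn.
  have NE s2 : ra s2 aA = ra s' aA -> nv s2 0 = n -> nv s2 22 = k ->
      reval s2 0 noidx (ESum 0 (sq (at2 aA (NRow 0) (NVar 22)))) = N o.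
    move=> A2 n2 k2; rewrite /= n2 k2 A2.
    by apply: eq_bigr => i _; rewrite -colE !mxE A'.
  pose t := cseq [:: set_sc sA (ESum 0 (sq (at2 aA (NRow 0) (NVar 22))));
                  fill aV (at2 aA (NRow 0) (NVar 22))].
  have -> : run body s' = if ra s' 30 sA < N o then run t s' else s'.
    by rewrite -(NE s') ?(sz_n sz').
  have NjE (j : 'I_n) : (j < k.+1)%N -> j = o \/ (j < k)%N.
    by rewrite ltnS leq_eqVlt => /orP[/eqP jk|]; [left; apply: val_inj|right].
  case: ifP => [lt|/negbT]; last first.
    rewrite -leNgt => le; split=> //; first by move=> j /NjE[->//|]; exact: N'.
    right; case: V' => // -[_ e1]; exfalso; move: le; rewrite e1 => le.
    have := dot_ge0 (B *m delta_mx o 0); rewrite -/(N o); lra.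
  have tA : ra (run t s') 30 sA = N o.
    by rewrite /t /cseq run_seq run_cell // -(NE s') ?(sz_n sz') //= updE /= updE.
  split.
  - by rewrite run_ra.
  - by move=> j; rewrite tA => /NjE[->//|/N' h]; apply: le_trans h (ltW lt).
  - right; exists o; split=> //; apply/matrixP => i j; rewrite ord1 -colE !mxE -A'.
    by rewrite /t /cseq run_seq fillE ?run_nv ?(sz_n sz') //= updE /= k' (sz_n sz').
pose s2 := run (fill aV 0%RE) s1.
have -> : run (CIfR (sc sThr) (sc sA) CSkip (fill aV 0%RE)) s1 =
    if thr < ra s1 30 sA then s1 else s2 by rewrite -(ctx_thr cs1).
have n1 j : N j <= ra s1 30 sA by apply: N1; rewrite (sz_n (ctx_sized cs0)).
case: ifP => [lt|/negbT]; last first.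
  rewrite -leNgt => le; left; split; last by move=> k; apply: le_trans (n1 k) le.
  apply/matrixP => i j; rewrite [LHS]mxE [RHS]mxE /s2 fillE ?(sz_n (ctx_sized cs1)) //.
have t0 : 0 < thr by rewrite exprn_gt0 // invr_gt0 ltr0n.
case: V1 => [[_ e]|[i [iE VE]]]; first by exfalso; have := lt_trans t0 lt; rewrite e; lra.
by right; exists i; rewrite VE -/(N i) -iE.
Qed.

Lemma eliminateP s V B x : context s -> vec (ra s aV) = V -> mat (ra s aA) = B ->
  mat (ra (run eliminate s) aA) *m x = B *m x - (dot V (B *m x) / dot V V) *: V.
Proof.
move=> cs Ve Be; have sz := ctx_sized cs.
rewrite /eliminate /cseq run_seq mat_copy ?run_nv ?(sz_n sz) //.
rewrite (_ : mat _ = B - (dot V V)^-1 *: (V *m (V^T *m B))).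
  rewrite mulmxBl -scalemxAl -!mulmxA (_ : V^T *m (B *m x) = (dot V (B *m x))%:M).
    by rewrite mul_mx_scalar scalerA mulrC.
  apply/matrixP => a b; rewrite !ord1 [RHS]mxE eqxx mulr1n mxE.
  by apply: eq_bigr => m _; rewrite mxE.
have VE (i : 'I_n) : V i 0 = ra s aV i by rewrite -Ve mxE.
rewrite fill2_mat ?(sz_n sz) //; apply/matrixP => i j.
rewrite [LHS]mxE /= /upd /= (sz_n sz) -(dotE VE VE).
have -> : \sum_(i0 < n) ra s aV i0 * ra s aA (i0 * n + j)%N = (V^T *m B) 0 j.
  by rewrite mxE -Ve -Be; apply: eq_bigr => l _; rewrite !mxE.
set W := V^T *m B; set D := dot V V; clearbody W D.
by rewrite -Ve -Be !mxE big_ord1 !mxE; ring.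
Qed.

(** Doubling takes place only below 1/4, so the squared length stays at most 1. A nonzero pivot
    exceeds [2^(-32 n)], hence [32 n] doublings, each a factor 4, are enough to reach 1/4. *)
Lemma normalizeP s V : context s -> vec (ra s aV) = V ->
  dot V V <= 1 -> (V = 0 \/ thr < dot V V) ->
  exists2 k : R, k != 0 & let V' := vec (ra (run normalize s) aV) in
    V' = k *: V /\ (V' = 0 \/ 1 / 4 <= dot V' V' <= 1).
Proof.
move=> cs Ve V1 VP; have sz := ctx_sized cs.
rewrite /normalize; set body := CIfR normV _ _ _.
pose J k (f : nat -> nat -> R) (_ : nat -> nat) := exists2 a : R, a != 0 &
  [/\ vec (f aV) = a *: V, dot (vec (f aV)) (vec (f aV)) <= 1 &
   1 / 4 <= dot (vec (f aV)) (vec (f aV)) \/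
   4 ^+ k * dot V V <= dot (vec (f aV)) (vec (f aV))].
set s1 := run (CFor 22 3 body) s.
have [a a0 [VE le1 ge]] : J (nv s 3) (ra s1) (mask 22 (nv s1)).
  apply: (run_for_ctx (J := J) _ _ cs) => //.
    by exists 1; rewrite ?oner_eq0 ?Ve ?scale1r //; split=> //; right; rewrite expr0 mul1r.
  move=> k s' _ cs' [a a0 [VE le1 ge]] _ _ _; have sz' := ctx_sized cs'.
  set W := vec (ra s' aV) in VE le1 ge.
  have WE (i : 'I_n) : W i 0 = ra s' aV i by rewrite mxE.
  pose t := cseq [:: fill aY (at1 aV (NIdx 0) + at1 aV (NIdx 0))%RE; fill aV (at1 aY (NIdx 0))].
  have -> : run body s' = if dot W W < 1 / 4 then run t s' else s'.
    have <- : reval s' 0 noidx normV = dot W W.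
      rewrite (dotE WE WE) /= (sz_n sz').
      by apply: eq_bigr => i _; rewrite !updE.
    rewrite (_ : 1 / 4 = reval s' 0 noidx (1 / e4)%RE) //=.
    by congr (_ / _); ring.
  case: ifP => [lt|/negbT]; last by rewrite -leNgt => le; exists a => //; split=> //; left.
  have tE : vec (ra (run t s') aV) = 2 *: W.
    rewrite /t /cseq run_seq fill_vec ?run_nv ?(sz_n sz') //.
    apply/matrixP => i j; rewrite !mxE [LHS]/= !updE /=.
    by rewrite (sz_n sz') ltn_ord subn0; ring.
  exists (2 * a); first by rewrite mulf_neq0 // pnatr_eq0.
  rewrite tE -scalerA -VE dotZl dotZr; split=> //; first by clear VE tE Ve VP; lra.
  case: ge => [h|h]; first by move: lt; rewrite ltNge h.
  by right; rewrite exprS; clear VE tE Ve VP; lra.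
exists a => //=; split=> //; case: VP => [V0|Vt].
  by left; rewrite VE V0 scaler0.
right; rewrite le1 andbT; case: ge => // ge; apply: le_trans ge.
have : 1 <= 4 ^+ (32 * n) * dot V V; last by rewrite (sz_t sz); lra.
have -> : 4 = 2 * 2 :> R by ring.
have tt : 2 ^+ (32 * n) * thr = 1 by rewrite -exprMn divff ?pnatr_eq0 // expr1n.
have t1 : 1 <= 2 ^+ (32 * n) :> R by rewrite exprn_ege1 // ler1n.
rewrite exprMn -mulrA -[X in X <= _]mul1r; apply: ler_pM => //.
by rewrite -[X in X <= _]tt; apply: ler_wpM2l; [exact: le_trans t1|exact: ltW].
Qed.

(** The stored rows are nonzero multiples of the pivots: same span, still orthogonal, but with
    lengths suited to a lattice. *)
Record rounds (A0 : 'M[R]_n) (k : nat) (w : nat -> 'cV[R]_n) (B : nat -> 'M[R]_n)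
    (f : nat -> nat -> R) : Prop := Rounds {
  rd_start : B 0 = A0;
  rd_end : B k = mat (f aA);
  rd_step : forall j x, (j < k)%N -> B j.+1 *m x =
    B j *m x - (dot (w j) (B j *m x) / dot (w j) (w j)) *: w j;
  rd_pivot : forall j, (j < k)%N -> pivot (B j) (w j);
  rd_row : forall j, (j < k)%N -> exists2 a : R, a != 0 & rowvec (f aG) j = a *: w j /\
    (rowvec (f aG) j = 0 \/ 1 / 4 <= dot (rowvec (f aG) j) (rowvec (f aG) j) <= 1) }.

Lemma roundsP s : context s ->
  (forall x, dot (mat (ra s aA) *m x) (mat (ra s aA) *m x) <= dot x x) ->
  exists w B, rounds (mat (ra s aA)) (2 * r) w B (ra (run subspace s)).
Proof.
move=> cs Ale; have sz := ctx_sized cs; set A0 := mat _ in Ale *.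
rewrite /subspace; set body := cseq _.
pose J k (f : nat -> nat -> R) (_ : nat -> nat) := exists w B, rounds A0 k w B f.
suff : J (nv s 2) (ra (run (CFor 20 2 body) s)) (mask 20 (nv (run (CFor 20 2 body) s))).
  by rewrite (sz_q sz).
apply: (run_for_ctx (J := J) _ _ cs) => //.
  by exists (fun=> 0), (fun=> A0); split.
move=> k s0 kq cs0 [w [B [h1 h2 h3 h4 h5]]] k20 k21 _; rewrite (sz_q sz) in kq.
rewrite /body /cseq !run_seq.
have := pick_pivotP cs0; set s1 := run pick_pivot s0.
have cs1 : context s1 by apply: context_run.
have A1 : ra s1 aA = ra s0 aA by rewrite run_ra.
set V := vec (ra s1 aV); rewrite -h2 => pV.
have A2 : mat (ra s1 aA) = B k by rewrite A1.
have el x := eliminateP x cs1 (erefl V) A2; set s2 := run eliminate s1 in el.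
have cs2 : context s2 by apply: context_run.
pose w' := upd w k V; pose B' := upd B k.+1 (mat (ra s2 aA)).
have wE j : (j < k)%N -> w' j = w j by move=> jk; rewrite /w' updE ltn_eqF.
have wk : w' k = V by rewrite /w' updE eqxx.
have BE j : (j <= k)%N -> B' j = B j by move=> jk; rewrite /B' updE ltn_eqF.
have Bk : B' k.+1 = mat (ra s2 aA) by rewrite /B' updE eqxx.
have S' j x : (j < k.+1)%N -> B' j.+1 *m x =
    B' j *m x - (dot (w' j) (B' j *m x) / dot (w' j) (w' j)) *: w' j.
  rewrite ltnS leq_eqVlt => /orP[/eqP->|jk]; first by rewrite Bk BE // wk el.
  by rewrite !BE ?(ltnW jk) // wE // h3.
have P' j : (j < k.+1)%N -> pivot (B' j) (w' j).
  rewrite ltnS leq_eqVlt => /orP[/eqP->|jk]; first by rewrite wk BE.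
  by rewrite BE ?(ltnW jk) // wE //; exact: h4.
have B0' : B' 0 = A0 by rewrite BE.
have V1 : dot V V <= 1.
  by have := pivots_le1 B0' S' P' Ale (ltnSn k); rewrite wk.
have V2 : vec (ra s2 aV) = V by rewrite /s2 run_ra.
have Vt : V = 0 \/ thr < dot V V by case: pV => [[->]|[i [_ ? _]]]; [left|right].
have := normalizeP cs2 V2 V1 Vt; set s3 := run normalize s2.
move=> [a a0 [V3 V3P]]; have cs3 : context s3 by apply: context_run.
have k3 : nv s3 21 = (k * n)%N by do 3!(rewrite run_nv //).
have G3 : ra s3 aG = ra s0 aG by do 3!(rewrite run_ra //).
have A3 : ra s3 aA = ra s2 aA by rewrite /s3 run_ra.
clearbody s3; set s4 := run _ s3; have G4 (j i : nat) : ra s4 aG (j * n + i)%N =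
    if (k * n <= j * n + i < k * n + n)%N then ra s3 aV (j * n + i - k * n)%N
    else ra s0 aG (j * n + i)%N.
  rewrite /s4 /= updE /= k3 (sz_n (ctx_sized cs3)); case: ifP => // _.
  by rewrite G3.
exists w', B'; split=> //.
- by rewrite Bk /s4 run_ra // A3.
- move=> j; rewrite ltnS leq_eqVlt => /orP[/eqP->|jk].
    rewrite wk (_ : rowvec _ k = vec (ra s3 aV)); first by exists a.
    apply/matrixP => i j'; rewrite [LHS]mxE [RHS]mxE G4 addKn.
    by rewrite leq_addr ltn_add2l ltn_ord.
  rewrite wE // (_ : rowvec _ j = rowvec (ra s0 aG) j); first exact: h5.
  apply/matrixP => i j'; rewrite [LHS]mxE [RHS]mxE G4.
  by rewrite (_ : (_ <= _ < _)%N = false) //; have := ltn_ord i; nia.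
Qed.

End SubspaceLoop.

Section SubspaceSpec.
Context {R : realType} (n r : nat) (eps d lambda : R) (c delta : 'M[R]_n).
Implicit Types (s : @store R).
Local Notation context := (context r eps d lambda c delta).
Local Notation h := (d * lambda).

Definition rows (f : nat -> nat -> R) (j : 'I_(2 * r)) : 'cV[R]_n := rowvec n (f aG) j.

Record good_rows (f : nat -> nat -> R) : Prop := GoodRows {
  gr_orth : orthogonal_family (rows f);
  gr_norm : forall j, rows f j = 0 \/ 1 / 4 <= dot (rows f j) (rows f j) <= 1;
  gr_close : forall x, dot x x <= n%:R ->
    dist2 x (proj (rows f) x) <= 16 * dot (laplacian delta *m x) x / h + 2^-1 ^+ 33 }.

(** [D a] is the function of [L] with eigenvalues [a]. Products are pointwise, so the computed
    resolvent and its power are identified by their eigenvalues, while the basis [Q] exists in the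
    analysis only. *)
Lemma subspaceP s mu : (1 < n)%N -> weighted_graph delta -> 0 < h ->
  is_smallest_eigenvalue r (laplacian delta) mu -> h <= mu -> context s ->
  good_rows (ra (run subspace (run power (run resolvent s)))).
Proof.
move=> n1 wd h0 [sp [ssort schar] [/andP[r0 rs] smu]] hmu cs.
have [dT _ _] := wd; set L := laplacian delta in schar *.
have [Q [QQ LE]] := symmetric_spectral (laplacian_tr dT) schar.
have QQ' : Q^T *m Q = 1%:M by exact: mulmx1C.
have sn : size sp = n.
  have := congr1 (fun p : {poly R} => size p) schar.
  by rewrite size_char_poly size_prod_XsubC => -[].
pose sl (l : 'I_n) := sp`_l.
pose D (a : 'I_n -> R) : 'M[R]_n := Q^T *m diag_mx (\row_l a l) *m Q.
have DM a b : D a *m D b = D (fun l => a l * b l).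
  rewrite /D !mulmxA -(mulmxA _ Q Q^T) QQ mulmx1; congr (_ *m _).
  rewrite -mulmxA mulmx_diag; congr (_ *m diag_mx _); apply/matrixP => i j; by rewrite !mxE.
have D1 : D (fun=> 1) = 1%:M.
  rewrite /D (_ : \row_l 1 = const_mx 1); last by apply/matrixP => i j; rewrite !mxE.
  by rewrite diag_const_mx mulmx1.
have Dext a b : a =1 b -> D a = D b.
  by move=> e; rewrite /D; congr (_ *m diag_mx _ *m _); apply/matrixP => i j; rewrite !mxE.
have dotD a (x : 'cV[R]_n) : dot (D a *m x) x = \sum_l a l * (Q *m x) l 0 ^+ 2.
  rewrite /D -!mulmxA dot_mull trmxK; apply: eq_bigr => l _.
  by rewrite mul_diag_mx !mxE; set y := \sum_j _; ring.
have dotQ (x : 'cV[R]_n) : dot x x = \sum_l (Q *m x) l 0 ^+ 2.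
  by rewrite -[in X in dot X _](mul1mx x) -D1 dotD; apply: eq_bigr => l _; rewrite mul1r.
have LD : L = D sl by [].
have sl0 l : 0 <= sl l.
  have := laplacian_ge0 (Q^T *m delta_mx l 0) wd; rewrite -/L LD dotD mulmxA QQ mul1mx.
  rewrite (bigD1 l) //= mxE !eqxx expr1n mulr1 big1 ?addr0 // => i il.
  by rewrite mxE (negbTE il) expr0n mulr0.
have slh (l : 'I_n) : (r.-1 <= l)%N -> h <= sl l.
  move=> rl; apply: le_trans hmu _; rewrite -smu /sl.
  by apply: (sorted_leq_nth le_trans le_refl 0 ssort); rewrite ?inE ?sn //; rewrite -sn prednK.
set s1 := run resolvent s; have cs1 : context s1 by apply: context_run.
set s2 := run power s1; have cs2 : context s2 by apply: context_run.
have MX := resolventP wd h0 cs; rewrite -/s1 -/L in MX.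
have XE : 1%:M + h^-1 *: L = D (fun l => 1 + sl l / h).
  rewrite LD -D1 /D scalemxAl scalemxAr -mulmxDl -mulmxDr; congr (_ *m _ *m _).
  apply/matrixP => i j; rewrite !mxE; case: (i == j); rewrite /= ?mulr1n ?mulr0n ?mulr0 ?addr0 //.
  by rewrite mulrC.
have p0 l : 0 < 1 + sl l / h by rewrite ltr_wpDr // divr_ge0 // ltW.
have ME : mat n (ra s1 aM) = D (fun l => (1 + sl l / h)^-1).
  have XD : D (fun l => 1 + sl l / h) *m D (fun l => (1 + sl l / h)^-1) = 1%:M.
    by rewrite DM -D1; apply: Dext => l; rewrite divff // gt_eqF.
  by rewrite -[LHS]mulmx1 -XD mulmxA -XE MX mul1mx.
have AE : mat n (ra s2 aA) = D (fun l => (1 + sl l / h)^-1 ^+ (32 * n)).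
  rewrite (powerP cs1) ME; elim: (32 * n)%N => [|k IH] /=.
    by rewrite -D1; apply: Dext => l; rewrite expr0.
  by rewrite IH DM; apply: Dext => l; rewrite exprSr.
pose al (l : 'I_n) := (1 + sl l / h)^-1 ^+ (32 * n).
have al01 l : 0 <= al l <= 1.
  have i0 : 0 <= (1 + sl l / h)^-1 by rewrite invr_ge0 ltW.
  rewrite exprn_ge0 //= exprn_ile1 // invf_le1 // lerDl divr_ge0 //; exact: ltW.
have Ale x : dot (mat n (ra s2 aA) *m x) (mat n (ra s2 aA) *m x) <= dot x x.
  rewrite dotQ dotQ AE; apply: ler_sum => l _.
  rewrite /D !mulmxA QQ mul1mx -mulmxA mul_diag_mx [X in X ^+ 2]mxE [X in X * _]mxE exprMn.
  have /andP[a0 a1] := al01 l; apply: ler_piMl; first exact: sqr_ge0.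
  exact: exprn_ile1.
have [w [B [w1 w2 w3 w4 w5]]] := roundsP cs2 Ale.
set s3 := run subspace s2 in w5 *.
have rE j : exists2 a : R, a != 0 & rows (ra s3) j = a *: w j /\
    (rows (ra s3) j = 0 \/ 1 / 4 <= dot (rows (ra s3) j) (rows (ra s3) j) <= 1).
  exact: w5.
have og : orthogonal_family (rows (ra s3)).
  move=> i j ij; have [a a0 [-> _]] := rE i; have [b b0 [-> _]] := rE j.
  by rewrite dotZl dotZr (pivots_orthogonal w3 w4) // !mulr0.
split=> // [j|x xn]; first by have [a _ []] := rE j.
have rn : (0 < r <= n)%N by rewrite r0 -sn.
have [a aE] := subspace_distance n1 rn h0 QQ LE sl0 slh (fun l => erefl) AE w1 w3 w4 xn.
apply: le_trans aE; rewrite /dist2.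
have /choice[e eP] : forall j, exists b : R, b != 0 /\ rows (ra s3) j = b *: w j.
  by move=> j; have [b b0 []] := rE j; exists b.
rewrite (_ : \sum_(j < _) _ = combine (rows (ra s3)) (fun j => a j / e j)); first exact: proj_min.
apply: eq_bigr => j _; have [e0 ->] := eP j.
by rewrite scalerA divfK.
Qed.

End SubspaceSpec.

(** * The construction of the nets *)

Section NetConstruction.
Context {R : realType} (n r : nat) (eps d lambda : R) (c delta : 'M[R]_n).
Implicit Types (s : @store R).
Local Notation context := (context r eps d lambda c delta).
Local Notation vec := (@vec R n).
Local Notation rowvec := (@rowvec R n).
Variables (G old : nat -> R) (m sig : R).
Let g (j : 'I_(2 * r)) : 'cV[R]_n := rowvec G j.
Hypotheses (r0 : (0 < r)%N) (m0 : 0 < m) (og : orthogonal_family g).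

Record building (f : nat -> nat -> R) (v : nat -> nat) (N : nat) : Prop := Building {
  bd_G : f aG = G;
  bd_old : f aOld = old;
  bd_m : f 30 sM = m;
  bd_sig : f 30 sSig = sig;
  bd_size : v 60 = N;
  bd_offset : v 61 = (N * n)%N;
  bd_span : forall i, (i < N)%N -> exists a, rowvec (f aNew) i = combine g a;
  bd_round : forall i, (i < N)%N ->
    dist2 (round_vec (rowvec (f aNew) i)) (rowvec (f aNew) i) <= 2 * m;
  bd_apart : forall i j, (i < N)%N -> (j < N)%N -> i != j ->
    128 * m < dist2 (round_vec (rowvec (f aNew) i)) (round_vec (rowvec (f aNew) j)) }.

Definition covered (f : nat -> nat -> R) (N : nat) (x : 'cV[R]_n) : Prop :=
  exists2 i, (i < N)%N & dist2 (rowvec (f aNew) i) (proj g x) <= 600 * m.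

(** The kept roundings are Boolean, within [2 * m] of the span and more than [64 * (2 * m)] apart:
    the packing bound applies with [q = 2 * r]. Hence the capacity that bounds the scans is never
    exceeded. *)
Lemma building_le f v N : building f v N -> (N <= 2 ^ (8 * r).+1)%N.
Proof.
move=> b; rewrite (_ : (8 * r = 4 * (2 * r))%N); last by lia.
have q0 : (0 < 2 * r)%N by lia.
have t0 : 0 < 2 * m by rewrite mulr_gt0 // ltr0n.
apply: (packing q0 t0 og (b := fun i : 'I_N => round_vec (rowvec (f aNew) i))).
- by move=> e i; apply: round_vec_boolean.
- move=> e; have [a aE] := bd_span b (ltn_ord e).
  apply: le_trans (proj_min og _ a) _; rewrite -aE.
  exact: (bd_round b (ltn_ord e)).
- move=> e e' ee; rewrite mulrA (_ : 64 * 2 = 128); last by ring.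
  exact: (bd_apart b (ltn_ord e) (ltn_ord e') ee).
Qed.

Definition keeps_net (c' : cmd) : bool :=
  [&& 60 \notin nassigned c', 61 \notin nassigned c', aG \notin rassigned c',
      aOld \notin rassigned c', aNew \notin rassigned c', ~~ touches 30 sM c' &
      ~~ touches 30 sSig c'].

Lemma building_run c' s N : keeps_net c' -> building (ra s) (nv s) N ->
  building (ra (run c' s)) (nv (run c' s)) N.
Proof.
case/and5P=> k1 k2 k3 k4 /and3P[k5 k6 k7] [h1 h2 h3 h4 h5 h6 h7 h8 h9].
by split; rewrite ?(run_ra _ k3) ?(run_ra _ k4) ?(run_ra _ k5) ?(run_cell _ k6)
  ?(run_cell _ k7) ?(run_nv _ k1) ?(run_nv _ k2).
Qed.

(** Either the candidate joins the list or a kept row covers for it; rows are only added, so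
    coverage persists. *)
Lemma appendP s a N : context s -> building (ra s) (nv s) N ->
  vec (ra s aY) = combine g a ->
  dist2 (round_vec (vec (ra s aY))) (vec (ra s aY)) <= 2 * m ->
  exists N', let s' := run append s in
  [/\ building (ra s') (nv s') N',
      forall x, covered (ra s) N x -> covered (ra s') N' x &
      forall x, boolean x -> dist2 x (proj g x) <= m -> dist2 (vec (ra s aY)) (proj g x) <= m ->
      covered (ra s') N' x].
Proof.
move=> cs b YE Yr; have sz := ctx_sized cs; set Y := vec _ in YE Yr *.
rewrite /append [cseq [:: _; _ ; _]]/= !run_seq; set s0 := run (set_sc _ _) s.
have cs0 : context s0 by apply: context_run.
set body := CIfN _ _ _ _.
pose far i := 128 * m < dist2 (round_vec (rowvec (ra s aNew) i)) (round_vec Y).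
pose J k (f : nat -> nat -> R) (v : nat -> nat) := [/\ f aNew = ra s aNew, f aY = ra s aY,
  f 30 sM = m, v 60 = N &
  (f 30 sFlag = 1 /\ forall i, (i < k)%N -> (i < N)%N -> far i) \/
  (f 30 sFlag = 0 /\ exists2 i, (i < N)%N & ~~ far i)].
set s1 := run (CFor 26 4 body) s0.
have cs1 : context s1 by apply: context_run.
have [_ _ _ _ F1] : J (nv s0 4) (ra s1) (mask 26 (nv s1)).
  apply: (run_for_ctx (J := J) _ _ cs0) => //.
    split=> //; first by rewrite -(bd_m b) /s0 run_cell.
      by rewrite /mask /= (bd_size b).
    by left; split=> //; rewrite /s0 /= updE /= updE.
  move=> k s' kc cs' [N' Y' M' V' F'] k26 k27 _; have sz' := ctx_sized cs'.
  have v60 : nv s' 60 = N by move: V'; rewrite /mask.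
  have -> : run body s' = if (k < N)%N then if far k then s' else run (set_sc sFlag 0%RE) s' else s'.
    rewrite -k26 -v60 /far.
    rewrite (_ : 128 * m = reval s' 0 noidx (e128 * sc sM)%RE); last first.
      by rewrite /= M'; congr (_ * _); ring.
    rewrite (_ : dist2 _ _ = reval s' 0 noidx (ESum 0 (sq (round_e (at2 aNew (NVar 27) (NIdx 0)) -
            round_e (at1 aY (NIdx 0)))%RE))) //.
    rewrite /= (sz_n sz') k26 k27; apply: eq_bigr => i _.
    by rewrite !mxE !updE /= N' Y'.
  case: ifP => [kN|/negbT kN]; last first.
    split=> //; case: F' => [[f1 h]|]; [left|by right]; split=> // i ik iN.
    by apply: h => //; move: ik; rewrite ltnS leq_eqVlt => /orP[/eqP ik|//]; lia.
  case: ifP => [fk|/negbT fk].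
    split=> //; case: F' => [[f1 h]|]; [left|by right]; split=> // i.
    by rewrite ltnS leq_eqVlt => /orP[/eqP->|ik] // iN; apply: h.
  split=> //; right; split; last by exists k.
  by rewrite /= updE /= updE.
have bs1 : building (ra s1) (nv s1) N.
  by apply: building_run => //; apply: building_run.
have cov1 x : covered (ra s) N x -> covered (ra s1) N x.
  by move=> [i iN h]; exists i => //; rewrite run_ra.
have Y1 : ra s1 aY = ra s aY by rewrite run_ra.
have A1 : ra s1 aNew = ra s aNew by rewrite run_ra.
rewrite (sz_cap (ctx_sized cs0)) in F1.
case: F1 => [[f1 F]|[f0 [k kN nfar]]]; last first.
  have -> : run (CIfR 0 (sc sFlag) (cseq [:: CFill aNew (NVar 61) 0 (at1 aY (NIdx 0));
      CNat 60 (NPlus (NVar 60) (NConst 1)); CNat 61 (NPlus (NVar 61) (NVar 0))]) CSkip) s1 = s1.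
    by rewrite [LHS]/= f0 ltxx.
  exists N; split=> // x xb xm Ym; exists k => //; rewrite A1.
  have := bd_round b kN; have := @coverage_merge _ _ _ g x (rowvec (ra s aNew) k) Y m.
  by move: nfar; rewrite /far -leNgt; auto.
have {}F i : (i < N)%N -> far i.
  by move=> iN; apply: F => //; apply: leq_trans iN (building_le b).
set t := (X in CIfR _ _ X _).
have -> : run (CIfR 0 (sc sFlag) t CSkip) s1 = run t s1.
  by rewrite [LHS]/= f1 ltr01.
have v60 := bd_size bs1; have v61 := bd_offset bs1.
have n1 := sz_n (ctx_sized cs1); clearbody s1; set s2 := run t s1.
have t60 : nv s2 60 = N.+1.
  by rewrite /s2 /t /= /upd /= v60 addn1.
have t61 : nv s2 61 = (N.+1 * n)%N.
  by rewrite /s2 /t /= /upd /= v61 n1; lia.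
have tN i : (i < N)%N -> rowvec (ra s2 aNew) i = rowvec (ra s aNew) i.
  move=> iN; apply/matrixP => a' b'; rewrite [LHS]mxE [RHS]mxE /s2 /t /= updE /=.
  by rewrite v61 (_ : (_ <= _ < _)%N = false) ?A1 //; have := ltn_ord a'; nia.
have tY : rowvec (ra s2 aNew) N = Y.
  apply/matrixP => a' b'; rewrite [LHS]mxE [RHS]mxE /s2 /t /= updE /=.
  by rewrite v61 n1 leq_addr ltn_add2l ltn_ord /= addKn Y1.
have lt i : (i < N.+1)%N -> i = N \/ (i < N)%N.
  by rewrite ltnS leq_eqVlt => /orP[/eqP|]; [left|right].
have cov2 x : covered (ra s) N x -> covered (ra s2) N.+1 x.
  by move=> [i iN h]; exists i; rewrite ?tN //; exact: ltnW.
exists N.+1; split=> //.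
- have [h1 h2 h3 h4 _ _ h5 h6 h7] := b; have [h1' h2' h3' h4' _ _ _ _ _] := bs1; split=> //.
  + by move=> i /lt[->|iN]; [exists a; rewrite tY|rewrite tN //; exact: h5].
  + by move=> i /lt[->|iN]; [rewrite tY|rewrite tN //; exact: h6].
  + move=> i j /lt[->|iN] /lt[->|jN] ij; rewrite ?eqxx // in ij *; rewrite ?tY ?tN //.
    * by rewrite dist2C; apply: F.
    * exact: F.
    * exact: h7.
- move=> x xb xm Ym; exists N => //; rewrite tY; apply: le_trans Ym _.
  by rewrite ler_peMl ?(ltW m0) // ler1n.
Qed.

End NetConstruction.

Section NetSearch.
Context {R : realType} (n r : nat) (eps d lambda : R) (c delta : 'M[R]_n).
Implicit Types (s : @store R).
Local Notation context := (context r eps d lambda c delta).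
Local Notation vec := (@vec R n).
Local Notation rowvec := (@rowvec R n).
Local Notation len := (2 ^ 14 * (2 * r))%N.
Local Notation walk w := (foldl walk_step (0%N, fun=> 0 : R) w).

(** After [k] digits, [sX] holds the value of the unread suffix, in [[0, 1)]; the integer part of 4
    times this value is the next digit. *)
Lemma decodeP s w : context s -> size w = len -> all (fun x => x < 3)%N w ->
  ra s 30 sCode = word_val w ->
  forall j, (j < 2 * r)%N -> ra (run decode s) aZ j = (walk w).2 j.
Proof.
move=> cs ws w3 wE; have sz := ctx_sized cs.
rewrite /decode [cseq _]/= 3!run_seq.
set s0 := run (set_sc _ _) _.
have cs0 : context s0 by do 3!(apply: context_run => //).
set body := CSeq _ _.
pose J k (f : nat -> nat -> R) (v : nat -> nat) := [/\ f 30 sX = word_val (drop k w),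
  v 63 = (walk (take k w)).1 & forall j, (j < 2 * r)%N -> f aZ j = (walk (take k w)).2 j].
set s1 := run (CFor 26 5 body) s0.
suff [_ _] : J (nv s0 5) (ra s1) (mask 26 (nv s1)).
  by rewrite (sz_len (ctx_sized cs0)) -ws take_size.
apply: (run_for_ctx (J := J) _ _ cs0) => //.
  rewrite /J take0 drop0; split=> //.
  move=> j jr; rewrite /s0 /= updE /= updE /= (sz_q sz).
  by rewrite add0n jr.
move=> k s' kl cs' [X' P' Z'] _ _ _; have sz' := ctx_sized cs'.
rewrite (sz_len (ctx_sized cs0)) -ws in kl.
have p63 : nv s' 63 = (walk (take k w)).1 by rewrite -P' /mask.
move: X'; rewrite (drop_nth 0%N kl) => X'; rewrite /J (take_nth 0%N kl) foldl_rcons.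
have d3 : (nth 0%N w k < 3)%N by apply: (allP w3); apply: mem_nth.
have W01 : 0 <= (word_val (drop k.+1 w) : R) < 1.
  by apply: word_val_itv; apply/allP => x /mem_drop /(allP w3).
move: d3 X'; set dd := nth 0%N w k => d3 X'.
case: (walk (take k w)) p63 Z' {P'} => p z p63 Z'; rewrite /= in p63 Z'.
set s2 := run (set_sc sX (e4 * sc sX)%RE) s'.
have X2 : ra s2 30 sX = dd%:R + word_val (drop k.+1 w).
  rewrite /s2 /= updE /= updE /= X' (_ : (1 + 1) * (1 + 1) = 4 :> R); last by ring.
  by rewrite mulrC divfK ?pnatr_eq0.
have Z2 : ra s2 aZ = ra s' aZ by rewrite run_ra.
have V2 : nv s2 = nv s' by [].
pose c0 := CReal aZ (NVar 63) (at1 aZ (NVar 63) + 1)%RE.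
pose c1 := CReal aZ (NVar 63) (at1 aZ (NVar 63) - 1)%RE.
pose b2 := CSeq (set_sc sX (sc sX - 1)%RE) (CNat 63 (NPlus (NVar 63) (NConst 1))).
pose b1 := CSeq (set_sc sX (sc sX - 1)%RE) (CIfR (sc sX) 1%RE c1 b2).
have -> : run body s' = if ra s2 30 sX < 1 then run c0 s2 else run b1 s2 by [].
clearbody s2.
rewrite X2 /walk_step; case: eqP => [d0|/eqP d0].
  rewrite (_ : _ < 1); last by rewrite d0 add0r; case/andP: W01.
  split.
  - by rewrite run_cell // X2 d0 add0r.
  - by rewrite /mask /= V2.
  - move=> j jr; rewrite /c0 /= updE /= V2 p63 Z2 !updE.
    by case: eqP => [<-|_]; rewrite Z'.
have d1 : 1 <= dd%:R :> R by rewrite ler1n lt0n.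
rewrite (_ : (_ < 1) = false); last first.
  by apply: le_gtF; rewrite -[X in X <= _]addr0; apply: lerD => //; case/andP: W01.
set s3 := run (set_sc sX (sc sX - 1)%RE) s2.
have X3 : ra s3 30 sX = dd%:R + word_val (drop k.+1 w) - 1.
  by rewrite /s3 /= updE /= updE /= X2.
have Z3 : ra s3 aZ = ra s' aZ by rewrite run_ra.
have V3 : nv s3 = nv s' by rewrite /s3 /= V2.
have -> : run b1 s2 = if ra s3 30 sX < 1 then run c1 s3 else run b2 s3 by [].
clearbody s3.
rewrite X3; case: eqP => [dE|/eqP dE].
  rewrite (_ : _ < 1); last by rewrite dE addrAC subrr add0r; case/andP: W01.
  split.
  - by rewrite run_cell // X3 dE addrAC subrr add0r.
  - by rewrite /mask /= V3.
  - move=> j jr; rewrite /c1 /= updE /= V3 p63 Z3 !updE.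
    by case: eqP => [<-|_]; rewrite Z'.
have d2 : dd = 2 by lia.
rewrite (_ : (_ < 1) = false); last first.
  by apply: le_gtF; move: W01 => /andP[W0 _]; rewrite d2; lra.
split.
- rewrite /b2 run_seq /= updE /= updE /= X3 d2; ring.
- by rewrite /mask /b2 /= updE /= V3 p63 addn1.
- by move=> j jr; rewrite run_ra // Z3 Z'.
Qed.

End NetSearch.

Section NetLoop.
Context {R : realType} (n r : nat) (eps d lambda : R) (c delta : 'M[R]_n).
Implicit Types (s : @store R).
Local Notation context := (context r eps d lambda c delta).
Local Notation vec := (@vec R n).
Local Notation rowvec := (@rowvec R n).
Local Notation len := (2 ^ 14 * (2 * r))%N.
Local Notation walk w := (foldl walk_step (0%N, fun=> 0 : R) w).
Variables (G old : nat -> R) (m sig : R).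
Let g (j : 'I_(2 * r)) : 'cV[R]_n := rowvec G j.
Hypotheses (r0 : (0 < r)%N) (m0 : 0 < m) (og : orthogonal_family g).
Local Notation building := (@building R n r G old m sig).
Local Notation covered := (@covered R n r G m).

Definition reaches (a : 'I_(2 * r) -> R) (w : seq nat) (x : 'cV[R]_n) : Prop :=
  [/\ size w = len, all (fun x => x < 3)%N w &
    dist2 (combine g (fun j => a j + (walk w).2 j * sig)) (proj g x) <= m].

(** Whatever real is in [sCode], the candidate lies in the span and the list stays valid; coverage
    of [x] is claimed only for the code of a word that reaches [x]. *)
Lemma candidateP s N i a : context s -> building (ra s) (nv s) N ->
  nv s 23 = (i * n)%N -> rowvec old i = combine g a ->
  exists N', let s' := run candidate s in
  [/\ building (ra s') (nv s') N',
      forall x, covered (ra s) N x -> covered (ra s') N' x,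
      ra s' 30 sCode = ra s 30 sCode + 4^-1 ^+ len &
      forall w x, ra s 30 sCode = word_val w -> boolean x -> dist2 x (proj g x) <= m ->
        reaches a w x -> covered (ra s') N' x].
Proof.
move=> cs b i23 aE; have sz := ctx_sized cs.
rewrite /candidate [cseq _]/= 3!run_seq; set s0 := run decode s.
have cs0 : context s0 by apply: context_run.
have b0 : building (ra s0) (nv s0) N by apply: building_run.
have A0 : ra s0 aNew = ra s aNew by rewrite run_ra.
have i0 : nv s0 23 = (i * n)%N by rewrite run_nv.
have C0 : ra s0 30 sCode = ra s 30 sCode by rewrite run_cell.
have Z0 w : ra s 30 sCode = word_val w -> size w = len -> all (fun x => x < 3)%N w ->
    forall j, (j < 2 * r)%N -> ra s0 aZ j = (walk w).2 j.
  by move=> wE ws w3 j; exact: (decodeP cs ws w3 wE).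
clearbody s0; set s1 := run (fill _ _) s0.
have cs1 : context s1 by apply: context_run.
have b1 : building (ra s1) (nv s1) N by apply: building_run.
have A1 : ra s1 aNew = ra s aNew by rewrite run_ra.
have C1 : ra s1 30 sCode = ra s 30 sCode by rewrite run_cell.
set Y := vec (ra s1 aY).
have YE : Y = combine g (fun j => a j + ra s0 aZ j * sig).
  rewrite /Y /s1 fill_vec ?(sz_n (ctx_sized cs0)) //; apply/matrixP => k l.
  rewrite [LHS]mxE /= i0 (bd_old b0) (bd_sig b0) (bd_G b0) (sz_q (ctx_sized cs0)).
  rewrite (sz_n (ctx_sized cs0)) !updE /=.
  have -> : old (i * n + k)%N = rowvec old i k l by rewrite mxE.
  rewrite aE !summxE -big_split; apply: eq_bigr => j _ /=.
  by rewrite !mxE !updE /=; ring.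
clearbody s1; set t := CIfR _ _ _ _.
have E : run t s1 = if 2 * m < dist2 (round_vec Y) Y then s1 else run append s1.
  rewrite (_ : 2 * m = reval s1 0 noidx (e2 * sc sM)%RE); last by rewrite /= (bd_m b1).
  rewrite (_ : dist2 _ _ = reval s1 0 noidx
      (ESum 0 (sq (round_e (at1 aY (NIdx 0)) - at1 aY (NIdx 0))%RE))) //.
  by rewrite /= (sz_n (ctx_sized cs1)); apply: eq_bigr => k _; rewrite !mxE !updE.
have [N' [b2 cov2 hit2]] : exists N', [/\ building (ra (run t s1)) (nv (run t s1)) N',
    forall x, covered (ra s) N x -> covered (ra (run t s1)) N' x &
    forall x, boolean x -> dist2 x (proj g x) <= m -> dist2 Y (proj g x) <= m ->
      covered (ra (run t s1)) N' x].
  have cov1 x : covered (ra s) N x -> covered (ra s1) N x.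
    by move=> [k kN h]; exists k => //; rewrite A1.
  rewrite E; case: ifP => [far|/negbT].
    exists N; split=> [//|x /cov1 //|x xb xm Ym]; exfalso.
    by move: Ym far; rewrite ltNge YE => /(candidate_close og xb xm) ->.
  rewrite -leNgt => near.
  have [N' [h1 h2 h3]] := appendP r0 m0 og cs1 b1 YE near.
  by exists N'; split=> // x /cov1; apply: h2.
have cs2 : context (run t s1) by apply: context_run.
have C2 : ra (run t s1) 30 sCode = ra s 30 sCode by rewrite run_cell.
move: (run t s1) cs2 C2 b2 cov2 hit2 => s2 cs2 C2 b2 cov2 hit2 {E}.
have A3 : ra (run (set_sc sCode (sc sCode + sc sInv)%RE) s2) aNew = ra s2 aNew by rewrite run_ra.
exists N'; split.
- exact: building_run.
- by move=> x /cov2 [k kN h]; exists k => //; rewrite A3.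
- by rewrite /= updE /= updE /= C2 (ctx_inv cs2).
- move=> w x wE xb xm [ws w3 wm]; have [//|//||k kN h] := hit2 x; last by exists k; rewrite ?A3.
  rewrite YE; apply: le_trans wm; rewrite le_eqVlt; apply/orP; left; apply/eqP.
  by congr dist2; apply: eq_bigr => j _; rewrite (Z0 w).
Qed.

Hypothesis sig0 : 0 < sig.
Hypothesis mE : m = (2 * r)%:R * sig ^+ 2.
Hypothesis gn : forall j, g j = 0 \/ 1 / 4 <= dot (g j) (g j) <= 1.

(** The length [2^14 * (2 r)] leaves room for [9600 * (2 r)] unit steps and [2 r] changes of
    coordinate. *)
Lemma reachable x a : dist2 (combine g a) (proj g x) <= 2400 * m -> exists w, reaches a w x.
Proof.
rewrite mE => /(lattice_target og sig0 gn)[sg [N [Nle close]]].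
pose sg' j := if insub j is Some o then sg o else false.
pose N' j := if insub j is Some o then N o else 0%N.
have [] := @walk_reaches R (2 * r) sg' N' len.
  apply: leq_trans (_ : 9600 * (2 * r) + 2 * r <= _)%N; last by rewrite -mulSnr leq_mul2r orbC; apply/orP; left; vm_compute.
  by rewrite leq_add2r (eq_bigr N) // => j _; rewrite /N' valK.
move=> w [ws w3] wE; exists w; split=> //; rewrite mE; apply: le_trans close.
rewrite le_eqVlt; apply/orP; left; apply/eqP; congr dist2.
apply: eq_bigr => j _; rewrite wE // /sg' /N' !valK; by [].
Qed.

Lemma building_nv f v v' N : v 60 = v' 60 -> v 61 = v' 61 -> building f v N -> building f v' N.
Proof. by move=> e e' [*]; split; rewrite -?e -?e'. Qed.

(** The outer invariant concerns the old net points already treated, the inner one the words whose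
    code is below [e]; all codes are below [4^len], so a reaching word is met. *)
Lemma buildP s No : context s -> ra s aG = G -> ra s aOld = old -> ra s 30 sM = m ->
  ra s 30 sSig = sig -> nv s 62 = No -> (No <= 2 ^ (8 * r).+1)%N ->
  (forall i, (i < No)%N -> exists a, rowvec old i = combine g a) ->
  exists N, let s' := run build s in building (ra s') (nv s') N /\
    forall x, boolean x -> dist2 x (proj g x) <= m ->
      (exists2 i, (i < No)%N & dist2 (rowvec old i) (proj g x) <= 2400 * m) ->
      covered (ra s') N x.
Proof.
move=> cs GE oldE ME sE NoE Nocap span; rewrite /build [cseq _]/= 2!run_seq.
set s0 := run _ (run _ s); have cs0 : context s0 by do 2!(apply: context_run => //).
have b0 : building (ra s0) (nv s0) 0 by split.
have No0 : nv s0 62 = No by [].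
clearbody s0; set body := CIfN _ _ _ _.
pose done_ i f N := forall i' x, (i' < i)%N -> (i' < No)%N -> boolean x ->
  dist2 x (proj g x) <= m -> dist2 (rowvec old i') (proj g x) <= 2400 * m -> covered f N x.
pose J i (f : nat -> nat -> R) (v : nat -> nat) := v 62 = No /\
  exists N, building f v N /\ done_ i f N.
set s1 := run (CFor 22 4 body) s0.
suff [_ [N [b D]]] : J (nv s0 4) (ra s1) (mask 22 (nv s1)).
  exists N; split; first exact: building_nv b.
  move=> x xb xm [i iN h]; apply: (D i) => //.
  by rewrite (sz_cap (ctx_sized cs0)); apply: leq_trans Nocap.
apply: (run_for_ctx (J := J) _ _ cs0) => //.
  by split=> //; exists 0%N; split=> //; exact: building_nv b0.
move=> i s2 icap cs2 [No2 [N [b2 D2]]] i22 i23 _.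
have {}b2 : building (ra s2) (nv s2) N by apply: building_nv b2.
have {}No2 : nv s2 62 = No by move: No2; rewrite /mask.
split; first by rewrite [LHS](_ : _ = nv (run body s2) 62) // run_nv.
have -> : run body s2 = if (i < No)%N then
    run (CSeq (set_sc sCode 0%RE) (CFor 24 6 candidate)) s2 else s2.
  by rewrite -i22 -No2.
case: ifP => [iNo|/negbT iNo]; last first.
  exists N; split; first exact: building_nv b2.
  by move=> i' x ii iN'; apply: D2 => //; lia.
rewrite run_seq; set s3 := run (set_sc _ _) s2.
have cs3 : context s3 by apply: context_run.
have b3 : building (ra s3) (nv s3) N by apply: building_run.
have D3 : done_ i (ra s3) N.
  by move=> i' x h1 h2 h3 h4 /(D2 i' x h1 h2 h3 h4)[k kN h]; exists k => //; rewrite run_ra.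
have C3 : ra s3 30 sCode = 0 by rewrite /s3 /= updE /= updE.
have i3 : nv s3 23 = (i * n)%N by [].
clearbody s3; have [a aE] := span i iNo.
pose J2 e (f : nat -> nat -> R) (v : nat -> nat) := v 23 = (i * n)%N /\
  exists N', [/\ building f v N', done_ i f N', f 30 sCode = e%:R * 4^-1 ^+ len &
    forall w x, (word_code w < e)%N -> boolean x -> dist2 x (proj g x) <= m ->
      reaches a w x -> covered f N' x].
set s4 := run (CFor 24 6 candidate) s3.
suff [_ [N' [b4 D4 _ H4]]] : J2 (nv s3 6) (ra s4) (mask 24 (nv s4)).
  exists N'; split; first exact: building_nv b4.
  move=> i' x; rewrite ltnS leq_eqVlt => /orP[/eqP->|ii]; last exact: D4.
  move=> _ xb xm; rewrite aE => /reachable[w rw]; apply: (H4 w) => //.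
  by rewrite (sz_codes (ctx_sized cs3)); case: rw => <- /word_code_lt.
apply: (run_for_ctx (J := J2) _ _ cs3) => //.
  split=> //; exists N; split=> //; [exact: building_nv b3|by rewrite C3 mul0r].
move=> e s5 ecap cs5 [i5 [N5 [b5 D5 C5 H5]]] _ _ _.
have {}b5 : building (ra s5) (nv s5) N5 by apply: building_nv b5.
have {}i5 : nv s5 23 = (i * n)%N by move: i5; rewrite /mask.
split; first by rewrite [LHS](_ : _ = nv (run candidate s5) 23) // run_nv.
have [N6 [b6 cov6 C6 H6]] := candidateP cs5 b5 i5 aE.
exists N6; split.
- exact: building_nv b6.
- by move=> i' x h1 h2 h3 h4 /(D5 i' x h1 h2 h3 h4) /cov6.
- by rewrite C6 C5 -[e.+1]addn1 natrD mulrDl mul1r.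
- move=> w x; rewrite ltnS leq_eqVlt => /orP[/eqP we|we] xb xm rw; last first.
    by apply: cov6; apply: (H5 w).
  apply: (H6 w x) => //; rewrite C5 word_codeE we; case: rw => -> _ _.
  by rewrite exprVn.
Qed.

End NetLoop.

Section Nets.
Context {R : realType} (n r : nat) (eps d lambda : R) (c delta : 'M[R]_n).
Implicit Types (s : @store R).
Local Notation context := (context r eps d lambda c delta).
Local Notation rowvec := (@rowvec R n).
Local Notation rows := (@rows R n r).

Record net (m : R) (f : nat -> nat -> R) (v : nat -> nat) (N : nat) : Prop := Net {
  net_size : v 62 = N;
  net_cap : (N <= 2 ^ (8 * r).+1)%N;
  net_span : forall i, (i < N)%N -> exists a, rowvec (f aOld) i = combine (rows f) a;
  net_cover : forall x, boolean x -> dist2 x (proj (rows f) x) <= m ->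
    exists2 i, (i < N)%N & dist2 (rowvec (f aOld) i) (proj (rows f) x) <= 600 * m }.

Definition rounded (m : R) (f : nat -> nat -> R) (N : nat) : Prop := forall i, (i < N)%N ->
  dist2 (round_vec (rowvec (f aOld) i)) (rowvec (f aOld) i) <= 2 * m.

Lemma copy_listP s i (j : 'I_n) : context s -> (i < 2 ^ (8 * r).+1)%N ->
  ra (run copy_list s) aOld (i * n + j)%N = ra s aNew (i * n + j)%N.
Proof.
move=> cs icap; rewrite /copy_list [cseq _]/= run_seq.
set body := CFill _ _ _ _; set s1 := run (CFor 22 4 body) s.
pose J k (f : nat -> nat -> R) (_ : nat -> nat) := f aNew = ra s aNew /\
  forall i (j : 'I_n), (i < k)%N -> f aOld (i * n + j)%N = ra s aNew (i * n + j)%N.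
suff [_ h] : J (nv s 4) (ra s1) (mask 22 (nv s1)).
  by rewrite run_ra // h // (sz_cap (ctx_sized cs)).
apply: (run_for_ctx (J := J) _ _ cs) => //.
move=> k s' _ cs' [N' O'] _ k23 _; split=> [|i' j' ik]; first by rewrite run_ra.
rewrite /body /= updE /= k23 (sz_n (ctx_sized cs')).
move: ik; rewrite ltnS leq_eqVlt => /orP[/eqP->|ik].
  by rewrite leq_addr ltn_add2l ltn_ord /= addKn updE /= N'.
by rewrite (_ : (_ <= _ < _)%N = false) ?O' //; have := ltn_ord j'; nia.
Qed.

(** Halving [sig] divides [m] by 4: the radius [600 * (4 * m)] of the previous net is the [2400 * m]
    from which walks start, and the new net restores the constant 600. *)
Lemma netP s sig N0 : (0 < r)%N -> 0 < sig -> let m := (2 * r)%:R * sig ^+ 2 in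
  context s -> orthogonal_family (rows (ra s)) ->
  (forall j, rows (ra s) j = 0 \/ 1 / 4 <= dot (rows (ra s) j) (rows (ra s) j) <= 1) ->
  ra s 30 sSig = sig -> ra s 30 sM = m -> net (4 * m) (ra s) (nv s) N0 ->
  exists N, let s' := run copy_list (run build s) in
    net m (ra s') (nv s') N /\ rounded m (ra s') N.
Proof.
move=> r0 sig0 m cs og gn sigE mE [h1 h2 h3 h4].
have m0 : 0 < m by rewrite mulr_gt0 ?exprn_gt0 // ltr0n muln_gt0.
have [N] := buildP (old := ra s aOld) r0 m0 og sig0 erefl gn cs erefl erefl mE sigE h1 h2 h3.
set s1 := run build s; move=> [b cov]; have cs1 : context s1 by apply: context_run.
have Ncap := building_le r0 m0 og b.
have G2 : ra (run copy_list s1) aG = ra s aG by rewrite !run_ra.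
have rE : rows (ra (run copy_list s1)) = rows (ra s).
  by apply: funext => j; rewrite /rows G2.
have O2 i : (i < N)%N -> rowvec (ra (run copy_list s1) aOld) i = rowvec (ra s1 aNew) i.
  move=> iN; apply/matrixP => a b'; rewrite [LHS]mxE [RHS]mxE copy_listP //.
  exact: leq_trans Ncap.
have V2 : nv (run copy_list s1) 62 = N.
  rewrite /copy_list /cseq run_seq -(bd_size b).
  set s2 := run (CFor _ _ _) s1; have <- : nv s2 60 = nv s1 60 by rewrite run_nv.
  by [].
exists N; split; first split=> //; rewrite ?rE.
- by move=> i iN; rewrite O2 //; exact: (bd_span b).
- move=> x xb xm.
  have [|i iN0 hi] := h4 x xb; first by apply: le_trans xm _; rewrite ler_peMl ?(ltW m0) // ler1n.
  have [|k kN hk] := cov x xb xm; last by exists k; rewrite ?O2.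
  by exists i => //; rewrite (_ : 2400 * m = 600 * (4 * m)) //; ring.
- by move=> i iN; rewrite O2 //; exact: (bd_round b).
Qed.

End Nets.

(** * Minimum cuts and Newton's method *)

Section PushRelabel.
Context {R : realType} (n r : nat) (eps d lambda : R) (c delta : 'M[R]_n).
Implicit Types (s : @store R) (f : nat -> nat -> R).
Local Notation context := (context r eps d lambda c delta).
Variables (gam : R) (T0 : {set 'I_n}).

Definition res_of f (u v : 'I_n) : R := f aRes (u * n + v)%N.
Definition vec_of (f : nat -> R) (u : 'I_n) : R := f u.

Record encodes f (h : 'I_n -> nat) : Prop := Encodes {
  enc_preflow : preflow c gam T0 (res_of f) (vec_of (f aRt)) (vec_of (f aEx)) h;
  enc_height : forall u : 'I_n, f aHt u = (h u)%:R }.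

Definition active f h (u : 'I_n) : Prop := 0 < f aEx u /\ (h u <= n)%N.

Lemma pushP s (u v : 'I_n) : nv s 36 = u -> nv s 37 = (u * n)%N ->
  nv s 38 = v -> nv s 39 = (v * n)%N -> u != v ->
  let a := if ra s aEx u < res_of (ra s) u v then ra s aEx u else res_of (ra s) u v in
  let s' := run push s in
  [/\ res_of (ra s') = push_res (res_of (ra s)) u v a,
      vec_of (ra s' aEx) = push_ex (vec_of (ra s aEx)) u v a,
      ra s' aRt = ra s aRt & ra s' aHt = ra s aHt].
Proof.
move=> k36 k37 k38 k39 uv a s'; rewrite /s'.
have uvn : (u == v :> nat) = false by apply/negbTE; move: uv; rewrite -val_eqE.
have uvi : (v * n + u == u * n + v)%N = false.
  by rewrite eq_rowcol // eq_sym uvn.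
split; [| |by rewrite run_ra|by rewrite run_ra]; rewrite /push /cseq !run_seq.
- do 2!(rewrite /res_of run_ra //).
  apply: funext => i; apply: funext => j; rewrite /res_of /push_res /=.
  rewrite /upd /= !k36 !k37 !k38 !k39 uvi -/(res_of (ra s) u v) -/a.
  rewrite !eq_rowcol // -!val_eqE /=.
  case: (i =P v :> nat) => [iv|_]; case: (j =P u :> nat) => [ju|_]; case: (i =P u :> nat) => [iu|_];
    case: (j =P v :> nat) => [jv|_] //=; try lia.
  + by rewrite iv ju.
  + by rewrite iu jv.
- apply: funext => i; rewrite /vec_of /push_ex /=.
  rewrite /upd /= !k36 !k37 !k38 -!val_eqE /= [v == u :> nat]eq_sym uvn.
  rewrite -/(res_of (ra s) u v) -/a.
  by case: (i =P v :> nat) => [->//|_]; case: (i =P u :> nat) => [->//|_].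
Qed.

(* The progress measure of a pass that started with total height [S0], after [p]
   passes: each relabelling pays for the two levels by which the bound on the
   heights of the active vertices may grow, and the other ones lose a level. *)
Definition bound f h p S0 (i : nat) : Prop := forall u : 'I_n, active f h u ->
  if (u < i)%N then (h u + p < 2 * (\sum_v h v) + n.+1)%N
  else (h u + p <= \sum_v h v + S0 + n.+1)%N.

Lemma if_activeP s h cc (u : 'I_n) : context s -> nv s 36 = u -> ra s aHt u = (h u)%:R ->
  (active (ra s) h u /\ run (if_active cc) s = run cc s) \/
  (~ active (ra s) h u /\ run (if_active cc) s = s).
Proof.
move=> cs k36 hE.
have -> : run (if_active cc) s = if ra s aHt u < n%:R + 1 then
    if 0 < ra s aEx u then run cc s else s else s.
  by rewrite /if_active [LHS]/= k36 (ctx_n cs).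
rewrite hE natr1 ltr_nat ltnS /active; case: ifP => [h1|/negP h1].
  by case: ifP => [h2|/negP h2]; [left|right; split=> // -[h3 _]; exact: h2].
by right; split=> // -[_ h2]; exact: h1.
Qed.

(** Heights are fixed during the scan. A push that leaves [u] active saturates its edge, and later
    pushes, which also leave from [u], do not reopen it; so at the end an active [u] has no lower
    residual neighbour and may be relabelled. *)
Lemma scanP s (u : 'I_n) h p S0 : context s -> nv s 36 = u -> nv s 37 = (u * n)%N ->
  (S0 <= \sum_v h v)%N -> encodes (ra s) h -> bound (ra s) h p S0 u ->
  (0 < ra s aEx u -> 0 < ra s aRt u -> h u = 0%N) ->
  let s' := run (CFor 38 0 (if_active (CIfR 0 (at2 aRes (NVar 37) (NVar 38))
        (CIfR (at1 aHt (NVar 36)) (at1 aHt (NVar 38) + 1)%RE CSkip push) CSkip))) s in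
  [/\ encodes (ra s') h, bound (ra s') h p S0 u,
      0 < ra s' aEx u -> 0 < ra s' aRt u -> h u = 0%N &
      active (ra s') h u -> forall v : 'I_n, 0 < res_of (ra s') u v -> (h u <= h v)%N].
Proof.
move=> cs k36 k37 S0S enc0 b0 sink0; set body := if_active _; cbv zeta.
pose J j f (nvs : nat -> nat) := [/\ nvs 36 = u, nvs 37 = (u * n)%N, encodes f h, bound f h p S0 u &
  (0 < f aEx u -> 0 < f aRt u -> h u = 0%N) /\
  (active f h u -> forall v : 'I_n, (v < j)%N -> 0 < res_of f u v -> (h u <= h v)%N)].
set s1 := run (CFor 38 0 body) s.
suff [_ _ e1 b1 [sink1 H1]] : J (nv s 0) (ra s1) (mask 38 (nv s1)).
  by split=> // act v; apply: H1 => //; rewrite (sz_n (ctx_sized cs)).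
apply: (run_for_ctx (J := J) _ _ cs) => //.
move=> j s2 jn cs2 [u36 u37 enc b [sink H]] v38 v39 _.
rewrite (sz_n (ctx_sized cs)) in jn; pose v := Ordinal jn.
have {}u36 : nv s2 36 = u by move: u36; rewrite /mask.
have {}u37 : nv s2 37 = (u * n)%N by move: u37; rewrite /mask.
have mE z : (z < 38)%N -> z \notin nassigned body -> mask 38 (nv (run body s2)) z = nv s2 z.
  by move=> z38 nz; rewrite /mask (_ : (z == 38) || (z == 39) = false) ?run_nv //; lia.
rewrite /J !mE // u36 u37.
have vE (w : 'I_n) : (w < j.+1)%N -> w = v \/ (w < j)%N.
  by rewrite ltnS leq_eqVlt => /orP[/eqP wj|]; [left; apply: val_inj|right].
have hE := enc_height enc; have pf := enc_preflow enc.
case: (if_activeP (CIfR 0 (at2 aRes (NVar 37) (NVar 38)) (CIfR (at1 aHt (NVar 36))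
    (at1 aHt (NVar 38) + 1)%RE CSkip push) CSkip) cs2 u36 (hE u)); rewrite -/body => -[act ->]; last first.
  by split.
have -> : run (CIfR 0 (at2 aRes (NVar 37) (NVar 38)) (CIfR (at1 aHt (NVar 36))
    (at1 aHt (NVar 38) + 1)%RE CSkip push) CSkip) s2 = if 0 < ra s2 aRes (nv s2 37 + nv s2 38)%N then
    if ra s2 aHt (nv s2 36) < ra s2 aHt (nv s2 38) + 1 then s2 else run push s2 else s2 by [].
rewrite u36 u37 v38 -[ra s2 aRes _]/(res_of (ra s2) u v) -[ra s2 aHt j]/(ra s2 aHt v).
case: ifP => [res0|/negbT res0]; last first.
  split=> //; split=> // act' w /vE[->|wj]; last exact: H.
  by rewrite (negbTE res0).
rewrite !hE natr1 ltr_nat ltnS; case: ifP => [huv|/negbT].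
  by split=> //; split=> // act' w /vE[->|wj] //; exact: H.
rewrite -ltnNge => hvu.
have huv : h u = (h v).+1 by apply/eqP; rewrite eqn_leq hvu (pf_valid pf).
have uv : u != v by apply: contraTneq hvu => ->; rewrite ltnn.
have [] := @pushP s2 u v u36 u37 v38 v39 uv.
set a := (if _ then _ else _); move=> resE exE rtE htE.
have [exu hun] := act.
have a0 : 0 < a by rewrite /a; case: ifP.
have aex : a <= ra s2 aEx u by rewrite /a; case: ifP => // /negbT; rewrite -leNgt.
have ares : a <= res_of (ra s2) u v by rewrite /a; case: ifP => // /ltW.
have exE' w : ra (run push s2) aEx (nat_of_ord w) = push_ex (vec_of (ra s2 aEx)) u v a w.
  by rewrite -exE.
have exu' : 0 < ra (run push s2) aEx u -> ra s2 aEx u < res_of (ra s2) u v = false.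
  rewrite exE' /push_ex (negbTE uv) eqxx /vec_of /a; case: ifP => // _.
  by rewrite subrr ltxx.
split=> //.
- split; last by move=> w; rewrite htE.
  by rewrite resE exE rtE; exact: preflow_push.
(* A vertex activated by the push is one level below [u], so the bound for [u] yields the one for
   [v], whether [v] comes before or after [u] in the pass. *)
- move=> w [exw hw]; case: (eqVneq w v) => [wv|wv].
    have bu := b u act; rewrite ltnn in bu; rewrite wv.
    case: ifP => _; move: bu S0S huv; clear; lia.
  apply: b; split=> //; case: (eqVneq w u) => [->//|wu].
  by move: exw; rewrite exE' /push_ex (negbTE wv) (negbTE wu).
split; first by rewrite rtE => _; exact: sink.
move=> [ex' _] w /vE[->|wj].
  by rewrite resE /push_res !eqxx /= /a exu' // subrr ltxx.
have wv : (w == v) = false by apply/eqP => wv; move: wj; rewrite wv ltnn.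
rewrite resE /push_res eqxx wv (negbTE uv) /=; exact: H.
Qed.

End PushRelabel.

Section MinCut.
Context {R : realType} (n r : nat) (eps d lambda : R) (c delta : 'M[R]_n).
Implicit Types (s : @store R) (f : nat -> nat -> R).
Local Notation context := (context r eps d lambda c delta).
Variables (gam : R) (T0 : {set 'I_n}).
Local Notation encodes := (encodes c gam T0).

Lemma push_sinkP s (u : 'I_n) h : context s -> nv s 36 = u -> encodes (ra s) h ->
  let s' := run push_sink s in
  [/\ encodes (ra s') h, forall v : 'I_n, 0 < ra s' aEx v -> 0 < ra s aEx v &
      0 < ra s' aEx u -> 0 < ra s' aRt u -> h u = 0%N].
Proof.
move=> cs k36 enc; have [pf hE] := enc; cbv zeta.
pose t := cseq [:: set_sc sA (EIfR (at1 aEx (NVar 36)) (at1 aRt (NVar 36))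
        (at1 aEx (NVar 36)) (at1 aRt (NVar 36)));
      CReal aEx (NVar 36) (at1 aEx (NVar 36) - sc sA)%RE;
      CReal aRt (NVar 36) (at1 aRt (NVar 36) - sc sA)%RE].
have -> : run push_sink s = if 0 < ra s aHt (nv s 36) then run t s else s by [].
rewrite k36 hE ltr0n; case: ifP => [h0|/negbT]; last first.
  by rewrite lt0n negbK => /eqP hu; split.
pose a := if ra s aEx u < ra s aRt u then ra s aEx u else ra s aRt u.
have exE (v : 'I_n) : ra (run t s) aEx v = if v == u then ra s aEx v - a else ra s aEx v.
  rewrite /t /cseq /= /upd /= k36 -val_eqE /= -/a.
  by case: eqP => [->|].
have rtE (v : 'I_n) : ra (run t s) aRt v = if v == u then ra s aRt v - a else ra s aRt v.
  rewrite /t /cseq /= /upd /= k36 -val_eqE /= -/a.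
  by case: eqP => [->|].
have aex : a <= ra s aEx u by rewrite /a; case: ifP => // /negbT; rewrite -leNgt.
have art : a <= ra s aRt u by rewrite /a; case: ifP => // /ltW.
have a0 : 0 <= a by rewrite /a; case: ifP => _; [exact: (pf_ex0 pf)|exact: (pf_rt pf)].
split.
- split; last by move=> v; rewrite run_ra.
  have -> : res_of (ra (run t s)) = res_of (ra s) :> ('I_n -> 'I_n -> R).
    by apply: funext => i; apply: funext => j; rewrite /res_of run_ra.
  have -> : vec_of (ra (run t s) aRt) =
      fun v : 'I_n => if v == u then vec_of (ra s aRt) v - a else vec_of (ra s aRt) v.
    by apply: funext => v; rewrite /vec_of rtE.
  have -> : vec_of (ra (run t s) aEx) =
      fun v : 'I_n => if v == u then vec_of (ra s aEx) v - a else vec_of (ra s aEx) v.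
    by apply: funext => v; rewrite /vec_of exE.
  exact: preflow_push_sink.
- by move=> v; rewrite exE; case: eqP => // _; lra.
- rewrite exE rtE eqxx !subr_gt0 /a; case: ifP => [|/negbT]; rewrite ?ltxx //.
Qed.

Lemma passP s h p : context s -> encodes (ra s) h ->
  (forall u, active (ra s) h u -> (h u + p <= 2 * (\sum_v h v) + n.+1)%N) ->
  exists h', let s' := run pass s in encodes (ra s') h' /\
    forall u, active (ra s') h' u -> (h' u + p.+1 <= 2 * (\sum_v h' v) + n.+1)%N.
Proof.
move=> cs enc b; set S0 := (\sum_v h v)%N.
rewrite /pass; set body := cseq _.
pose J i f (_ : nat -> nat) := exists h, [/\ (S0 <= \sum_v h v)%N, encodes f h & bound f h p S0 i].
set s1 := run (CFor 36 0 body) s.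
suff [h' [_ e1 b1]] : J (nv s 0) (ra s1) (mask 36 (nv s1)).
  exists h'; split=> // u /b1; rewrite (sz_n (ctx_sized cs)) ltn_ord.
  by clear; lia.
apply: (run_for_ctx (J := J) _ _ cs) => //.
  by exists h; split=> // u /b; rewrite ltn0 /S0; clear; lia.
move=> i s2 iN cs2 [h2 [Sh2 e2 b2]] k36 k37 _; rewrite (sz_n (ctx_sized cs)) in iN.
pose u := Ordinal iN; rewrite /body /cseq !run_seq.
have [e3 ex3 sink3] := @push_sinkP s2 u h2 cs2 k36 e2; set s3 := run push_sink s2 in e3 ex3 sink3 *.
have cs3 : context s3 by apply: context_run.
have b3 : bound (ra s3) h2 p S0 u by move=> v [exv hv]; apply: b2; split=> //; exact: ex3.
have u36 : nv s3 36 = u by rewrite run_nv.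
have u37 : nv s3 37 = (u * n)%N by rewrite run_nv.
have [e4 b4 sink4 low4] := scanP cs3 u36 u37 Sh2 e3 b3 sink3.
set s4 := run (CFor _ _ _) s3 in e4 b4 sink4 low4 *.
have cs4 : context s4 by apply: context_run.
have v36 : nv s4 36 = u by rewrite run_nv.
have hE := enc_height e4; clearbody s4.
case: (if_activeP (CReal aHt (NVar 36) (at1 aHt (NVar 36) + 1)%RE) cs4 v36 (hE u)) => -[act ->].
- pose h' (v : 'I_n) := if v == u then (h2 v).+1 else h2 v.
  have sumE : (\sum_v h' v = (\sum_v h2 v).+1)%N.
    rewrite (bigD1 u) //= [in RHS](bigD1 u) //= /h' eqxx addSn; congr (_ + _).+1.
    by apply: eq_bigr => v /negbTE ->.
  have [exu hu] := act; exists h'; rewrite sumE; split.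
  + by apply: leq_trans Sh2 _.
  + split; last first.
      move=> v; rewrite /= updE /= updE v36 /h' -val_eqE /=.
      case: eqP => [vi|_]; last exact: hE.
      by rewrite (_ : v = u) -?natr1 -?hE //; apply: val_inj.
    exact: (preflow_relabel (enc_preflow e4) hu (low4 act) (sink4 exu)).
  + move=> v [exv hv]; have av : active (ra s4) h2 v.
      split; first by move: exv; rewrite run_ra.
      by apply: leq_trans hv; rewrite /h'; case: ifP.
    have key (S a k : nat) : (S0 <= S)%N ->
        (if (k < i)%N then (a + p < 2 * S + n.+1)%N else (a + p <= S + S0 + n.+1)%N) ->
        if (k < i.+1)%N then ((if k == i then a.+1 else a) + p < 2 * S.+1 + n.+1)%N
        else ((if k == i then a.+1 else a) + p <= S.+1 + S0 + n.+1)%N.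
      by rewrite ltnS; clear; case: (ltngtP k i) => /= _; lia.
    by rewrite sumE; exact: (key _ _ _ Sh2 (b4 v av)).
- exists h2; split=> // v av; have := b4 v av.
  have -> : (v < i.+1)%N = (v < u)%N; last by [].
  rewrite ltnS leq_eqVlt orbC; case: (v =P i :> nat) => [vi|]; rewrite ?orbF //.
  by case: act; rewrite (_ : u = v) //; apply: val_inj.
Qed.

(** The total height is at most [n (n + 1)], so after [(32 n)^2] passes the bound leaves no active
    vertex. *)
Lemma passesP s h : context s -> encodes (ra s) h -> exists2 h',
  encodes (ra (run (CFor 30 3 (CFor 32 3 pass)) s)) h' &
  forall u : 'I_n, 0 < ra (run (CFor 30 3 (CFor 32 3 pass)) s) aEx u -> h' u = n.+1.
Proof.
move=> cs enc; have sz := ctx_sized cs.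
pose I p f := exists h, encodes f h /\
  forall u, active f h u -> (h u + p <= 2 * (\sum_v h v) + n.+1)%N.
pose J1 k f (_ : nat -> nat) := I (k * (32 * n))%N f.
pose J2 k l f (_ : nat -> nat) := I (k * (32 * n) + l)%N f.
set s1 := run _ s.
have [h' [e b]] : J1 (nv s 3) (ra s1) (mask 30 (nv s1)).
  apply: (run_for_ctx (J := J1) _ _ cs) => //.
    exists h; split=> // u _; rewrite mul0n addn0.
    have := pf_height (enc_preflow enc) u; clear; lia.
  move=> k s2 _ cs2 I2 _ _ _; set s3 := run _ s2.
  suff : J2 k (nv s2 3) (ra s3) (mask 32 (nv s3)).
    by rewrite /J2 /J1 (sz_t (ctx_sized cs2)) -mulSnr.
  apply: (run_for_ctx (J := J2 k) _ _ cs2) => //; first by rewrite /J2 addn0.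
  move=> l s4 _ cs4 [h4 [e4 b4]] _ _ _; have [h5 [e5 b5]] := passP cs4 e4 b4.
  by exists h5; split=> //; rewrite addnS.
exists h' => // u exu; have hh := pf_height (enc_preflow e).
apply/eqP; rewrite eqn_leq hh ltnNge; apply/negP => hu.
have := b u (conj exu hu).
have : (\sum_v h' v <= n * n.+1)%N.
  apply: leq_trans (_ : \sum_(v < n) n.+1 <= _)%N; first by apply: leq_sum.
  by rewrite sum_nat_const card_ord.
rewrite (sz_t sz); have := ltn_ord u; clear; nia.
Qed.

Lemma set_scE s i e : ra (run (set_sc i e) s) 30 i = reval s 0 noidx e.
Proof. by rewrite /= updE eqxx updE eqxx. Qed.

Lemma objective_eE s dd b a T : context s -> ra s 30 sGam = gam -> is_ind (ra s aT0) T0 ->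
  is_ind (ra s a) T -> dd = 0%N -> reval s dd b (objective_e a) = penalized_cut c gam T0 T.
Proof.
move=> cs gE h0 h ->; have sz := ctx_sized cs.
rewrite -[LHS]/(reval s 0 b (cut_e 0 a) + ra s 30 sGam * reval s 0 b (sd_e 0 a aT0)).
by rewrite (cut_eE _ _ sz (ctx_inputs cs) h) (sd_eE _ _ sz h h0) gE.
Qed.

(** The gap argument supplies an optimal level below [n + 2], and the search visits all levels below
    [32 n]. *)
Lemma min_cutP s : (0 < n)%N -> c^T = c -> (forall i j, 0 <= c i j) -> 0 <= gam -> context s ->
  ra s 30 sGam = gam -> is_ind (ra s aT0) T0 ->
  exists T, is_ind (ra (run min_cut s) aT) T /\
    forall U, penalized_cut c gam T0 T <= penalized_cut c gam T0 U.
Proof.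
move=> n0 csym c0 g0 cs gE T0E; have sz := ctx_sized cs.
rewrite /min_cut [cseq _]/= !run_seq.
set s1 := run (fill2 _ _ _) s; have cs1 : context s1 by apply: context_run.
set s2 := run (fill _ _) s1; have cs2 : context s2 by apply: context_run.
set s3 := run (fill _ _) s2; have cs3 : context s3 by apply: context_run.
set s4 := run (fill _ _) s3; have cs4 : context s4 by apply: context_run.
have T1 : ra s1 aT0 = ra s aT0 by rewrite run_ra.
have G1 : ra s1 30 sGam = gam by rewrite run_cell.
have T2 : ra s2 aT0 = ra s aT0 by do 2!(rewrite run_ra //).
have G2 : ra s2 30 sGam = gam by do 2!(rewrite run_cell //).
have res1 : res_of (ra s1) = fun u v : 'I_n => c u v.
  apply: funext => u; apply: funext => v; rewrite /res_of (@fill2P _ _ _ _ _ n) ?(sz_n sz) //=.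
  by rewrite !updE /= (in_c (ctx_inputs cs)).
have enc4 : encodes (ra s4) (fun=> 0%N).
  split; last by move=> u; rewrite /s4 fillE ?(sz_n (ctx_sized cs3)).
  have -> : res_of (ra s4) = fun u v : 'I_n => c u v.
    by rewrite -res1; apply: funext => u; apply: funext => v; rewrite /res_of; do 3!(rewrite run_ra //).
  have -> : vec_of (ra s4 aRt) = fun u : 'I_n => if u \in T0 then 0 else gam.
    apply: funext => u; rewrite /vec_of run_ra // run_ra // fillE ?(sz_n (ctx_sized cs1)) //.
    clearbody s1; rewrite /= G1 T1 T0E.
    by case: (u \in T0); rewrite /= ?subrr ?subr0 ?mulr0 ?mulr1.
  have -> : vec_of (ra s4 aEx) = fun u : 'I_n => if u \in T0 then gam else 0.
    apply: funext => u; rewrite /vec_of run_ra // fillE ?(sz_n (ctx_sized cs2)) //.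
    rewrite -[LHS]/(ra s2 30 sGam * ra s2 aT0 u) G2 T2 T0E.
    by case: (u \in T0); rewrite /= ?mulr0 ?mulr1.
  exact: preflow_init.
have [h5] := passesP cs4 enc4.
set s5 := run (CFor 30 _ _) s4; move=> enc5 done5.
have cs5 : context s5 by apply: context_run.
have T5 : ra s5 aT0 = ra s aT0 by do 5!(rewrite run_ra //).
have G5 : ra s5 30 sGam = gam by do 5!(rewrite run_cell //).
have [j jn jmin] := preflow_min_cut csym (enc_preflow enc5) done5.
clearbody s5; clear s1 s2 s3 s4 cs1 cs2 cs3 cs4 T1 G1 T2 G2 res1 enc4.
set s6 := run (fill _ _) s5; have cs6 : context s6 by apply: context_run.
have T6 : is_ind (ra s6 aT0) T0 by move=> i; rewrite run_ra // T5.
have C6 : is_ind (ra s6 aCut) (set0 : {set 'I_n}).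
  by move=> i; rewrite /s6 fillE ?(sz_n (ctx_sized cs5)) // inE.
have G6 : ra s6 30 sGam = gam by rewrite run_cell.
set s7 := run (set_sc sObj _) s6; have cs7 : context s7 by apply: context_run.
have O7 : ra s7 30 sObj = penalized_cut c gam T0 set0.
  by rewrite set_scE (objective_eE noidx cs6 G6 T6 C6).
have C7 : is_ind (ra s7 aCut) (set0 : {set 'I_n}) by move=> i; rewrite run_ra.
have H7 : ra s7 aHt = ra s5 aHt by do 2!(rewrite run_ra //).
have T7 : is_ind (ra s7 aT0) T0 by move=> i; rewrite run_ra.
have G7 : ra s7 30 sGam = gam by rewrite run_cell.
clearbody s7; clear s6 cs6 T6 C6 G6.
set s8 := run (set_sc sTh 0%RE) s7; have cs8 : context s8 by apply: context_run.
set body := CSeq _ _.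
pose pc := penalized_cut c gam T0.
pose J k f (_ : nat -> nat) := [/\ f aHt = ra s5 aHt, is_ind (f aT0) T0, f 30 sGam = gam,
  f 30 sTh = k%:R & exists T, [/\ is_ind (f aCut) T, f 30 sObj = pc T &
    forall i, (i < k)%N -> pc T <= pc [set u | (i < h5 u)%N]]].
set s9 := run (CFor 34 3 body) s8; have cs9 : context s9 by apply: context_run.
have [_ _ _ _ [T [TC _ Tmin]]] : J (nv s8 3) (ra s9) (mask 34 (nv s9)).
  apply: (run_for_ctx (J := J) _ _ cs8); [by []|by []| |].
    split; [by rewrite run_ra|by move=> i; rewrite run_ra|by rewrite run_cell| |].
      by rewrite set_scE.
    by exists set0; split.
  move=> k s10 _ cs10 [H10 T10 G10 Th10 [T [C10 O10 min10]]] _ _ _.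
  pose Tk := [set u | (k < h5 u)%N].
  rewrite /body !run_seq; set s11 := run (fill aY _) s10.
  have cs11 : context s11 by apply: context_run.
  have Y11 : is_ind (ra s11 aY) Tk.
    move=> i; rewrite /s11 fillE ?(sz_n (ctx_sized cs10)) // inE.
    rewrite -[LHS]/(if ra s10 30 sTh < ra s10 aHt i then 1 else 0) Th10 H10.
    by rewrite (enc_height enc5) ltr_nat; case: (k < h5 i)%N.
  have H11 : ra s11 aHt = ra s5 aHt by rewrite run_ra.
  have T11 : is_ind (ra s11 aT0) T0 by move=> i; rewrite run_ra.
  have G11 : ra s11 30 sGam = gam by rewrite run_cell.
  have Th11 : ra s11 30 sTh = k%:R by rewrite run_cell.
  have C11 : is_ind (ra s11 aCut) T by move=> i; rewrite run_ra.
  have O11 : ra s11 30 sObj = pc T by rewrite run_cell.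
  clearbody s11; pose t := CSeq (set_sc sObj (objective_e aY)) (fill aCut (at1 aY (NIdx 0))).
  have YE := objective_eE noidx cs11 G11 T11 Y11 erefl.
  have -> : run (CIfR (objective_e aY) (sc sObj) t CSkip) s11 =
      if pc Tk < pc T then run t s11 else s11 by rewrite -[pc Tk]YE -O11.
  have kE T' : pc T' <= pc T -> pc T' <= pc Tk ->
      forall i, (i < k.+1)%N -> pc T' <= pc [set u | (i < h5 u)%N].
    move=> T'T T'k i; rewrite ltnS leq_eqVlt => /orP[/eqP->//|ik].
    by apply: le_trans T'T _; exact: min10.
  case: ifP => [lt|/negbT]; last first.
    rewrite -leNgt => le; split=> //.
      by rewrite set_scE -[LHS]/(ra s11 30 sTh + 1) Th11 natr1.
    by exists T; split=> //; exact: kE.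
  have O12 : ra (run t s11) 30 sObj = pc Tk by rewrite /t run_seq run_cell // set_scE YE.
  have C12 : is_ind (ra (run t s11) aCut) Tk.
    move=> i; rewrite /t run_seq fillE; last by rewrite run_nv // (sz_n (ctx_sized cs11)).
    by rewrite -[LHS]/(ra s11 aY i).
  have Th12 : ra (run t s11) 30 sTh = k%:R by rewrite run_cell.
  split.
  - by do 2!(rewrite run_ra //).
  - by move=> i; do 2!(rewrite run_ra //).
  - by do 2!(rewrite run_cell //).
  - by rewrite set_scE -[LHS]/(ra (run t s11) 30 sTh + 1) Th12 natr1.
  - exists Tk; split; first by move=> i; rewrite run_ra.
      by rewrite run_cell.
    by apply: kE => //; exact: ltW.
exists T; split.
  move=> i; rewrite fillE; last by rewrite (sz_n (ctx_sized cs9)).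
  by rewrite -[LHS]/(ra s9 aCut i).
move=> U; apply: le_trans (jmin U); apply: Tmin; rewrite (sz_t (ctx_sized cs8)).
by move: jn n0; clear; lia.
Qed.

End MinCut.

(** * Newton's method in the program *)

Section NewtonIteration.
Context {R : realType} (n r : nat) (eps d lambda : R) (c delta : 'M[R]_n).
Implicit Types (s : @store R) (f : nat -> nat -> R) (S T : {set 'I_n}).
Local Notation context := (context r eps d lambda c delta).
Local Notation best := (best c).

(** [best] depends on the arrays only; an arbitrary choice of variables makes it usable in loop
    invariants. *)
Definition bestf f (v : R) : Prop := best (Store (fun=> 0%N) f) v.

Lemma bestE s v : best s v <-> bestf (ra s) v.
Proof. by split=> -[h1 h2]; split. Qed.

(** Minimum cuts require a multiplier that is not negative, also for wrong guesses of the size,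
    where the slack may vanish and the ratio is 0 by convention. The minimizer is compared with [T],
    or with the empty set if [gam = 0]. *)
Lemma ratio_step T0 b gam T T' : (forall i j, 0 <= c i j) -> gam = ratio c T0 b T ->
  0 <= gam -> (forall U, penalized_cut c gam T0 T' <= penalized_cut c gam T0 U) ->
  0 <= ratio c T0 b T'.
Proof.
move=> c0 gE g0 minT; have pE U : penalized_cut c gam T0 U =
    cut_capacity c U - gam * slack T0 b U + gam * b by rewrite /penalized_cut /slack; ring.
have cT0 := cut_capacity_ge0 T' c0.
have [g00|gn0] := eqVneq gam 0.
  suff e0 : cut_capacity c T' = 0 by rewrite /ratio e0 mul0r.
  apply/eqP; rewrite eq_le cT0 andbT; have := minT set0; rewrite !pE g00 !mul0r !subr0 !addr0.
  by rewrite /cut_capacity [X in _ <= X]big1 // => i; rewrite inE.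
have s0 : slack T0 b T != 0 by apply: contraNneq gn0 => h; rewrite gE /ratio h invr0 mulr0.
have cT : cut_capacity c T = gam * slack T0 b T by rewrite gE /ratio divfK.
have gp : 0 < gam by rewrite lt_neqAle eq_sym gn0.
have : cut_capacity c T' <= gam * slack T0 b T' by have := minT T; rewrite !pE cT; lra.
move=> le; rewrite /ratio divr_ge0 //.
by rewrite -(pmulr_rge0 _ gp); apply: le_trans le.
Qed.

Definition near T0 (b : R) S : Prop :=
  [/\ is_cut S, (2 * #|S| <= n)%N, b = eps * #|S|%:R / 8 &
    (sd S T0)%:R <= eps ^+ 2 * #|S|%:R / 800].

(** While the ratio exceeds that of [S], each step increases the distance to [T0], an integer at
    most [n]. So within [32 n] steps some iterate has ratio at most that of [S], and its cut is
    recorded before the next minimization. *)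
Lemma newtonP s T0 b v : 0 < eps < 1 -> (0 < n)%N -> c^T = c -> (forall i j, 0 <= c i j) ->
  0 < b -> context s -> ra s 30 sB = b -> is_ind (ra s aT0) T0 -> best s v ->
  best (run newton s) v /\ forall S, near T0 b S -> best (run newton s) ((1 + eps) * sparsity c S).
Proof.
move=> e01 n0 csym c0 b0 cs bE T0E bs.
rewrite /newton run_seq; set s0 := run (fill _ _) s; set body := cseq _.
have cs0 : context s0 by apply: context_run.
have bs0 : bestf (ra s0) v by apply/(bestE s0 v); apply: best_run.
have T0T : is_ind (ra s0 aT) T0.
  by move=> i; rewrite /s0 fillE ?(sz_n (ctx_sized cs)) // -[LHS]/(ra s aT0 i).
suff H S : bestf (ra (run (CFor 26 3 body) s0)) v /\ (near T0 b S ->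
    bestf (ra (run (CFor 26 3 body) s0)) ((1 + eps) * sparsity c S)).
  split; first by apply/(bestE (run (CFor 26 3 body) s0) v); have [] := H set0.
  by move=> S nS; apply/(bestE (run (CFor 26 3 body) s0) _); have [_] := H S; apply.
pose good f := bestf f ((1 + eps) * sparsity c S).
pose J i f (_ : nat -> nat) := [/\ bestf f v, is_ind (f aT0) T0, f 30 sB = b &
  exists T, [/\ is_ind (f aT) T, 0 <= ratio c T0 b T & near T0 b S -> good f \/
    [/\ 0 < slack T0 b T, (i <= sd T T0)%N & T = T0 \/ exists2 g, ratio c T0 b T < g &
      forall U, penalized_cut c g T0 T <= penalized_cut c g T0 U]]].
have sd00 : sd T0 T0 = 0%N by rewrite /sd setDv cards0.
set s1 := run (CFor 26 3 body) s0.
have [bs1 _ _ [T [_ _ H]]] : J (nv s0 3) (ra s1) (mask 26 (nv s1)); last first.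
  split=> // /H[//|[_]]; rewrite (sz_t (ctx_sized cs0)) => h _; exfalso.
  by have := sd_le T T0; move: h n0; clear; lia.
apply: (run_for_ctx (J := J) _ _ cs0); [by []|by []| |].
  have s00 : slack T0 b T0 = b by rewrite /slack sd00 subr0.
  split=> //; exists T0; split=> //.
    by rewrite /ratio s00 divr_ge0 ?cut_capacity_ge0 // ltW.
  by move=> _; right; split; rewrite ?s00 //; left.
move=> i s2 _ cs2 [b2 T02 B2 [T [T2 r2 H2]]] _ _ _.
rewrite /body /cseq run_seq run_seq; set s3 := run eval_cut s2.
have cs3 : context s3 by apply: context_run.
have e3 w : best s2 w -> best s3 w by move=> bw; have [] := eval_cutP cs2 bw T2.
have cut3 : is_cut T -> best s3 (sparsity c T).
  by have [_] := eval_cutP cs2 ((bestE s2 v).2 b2) T2; apply.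
have b3 : best s3 v by apply/e3/(bestE s2 v).
have T03 : is_ind (ra s3 aT0) T0 by move=> u; rewrite run_ra.
have T3 : is_ind (ra s3 aT) T by move=> u; rewrite run_ra.
have B3 : ra s3 30 sB = b by rewrite run_cell.
clearbody s3; set s4 := run (set_sc sGam _) s3.
have cs4 : context s4 by apply: context_run.
have T04 : is_ind (ra s4 aT0) T0 by move=> u; rewrite run_ra.
have G4 : ra s4 30 sGam = ratio c T0 b T.
  rewrite set_scE -[LHS]/(reval s3 0 noidx (cut_e 0 aT) / (ra s3 30 sB -
    reval s3 0 noidx (sd_e 0 aT aT0))).
  by rewrite (cut_eE _ _ (ctx_sized cs3) (ctx_inputs cs3) T3) (sd_eE _ _ (ctx_sized cs3) T3 T03) B3.
have b4 w : best s3 w -> best s4 w by apply: best_run.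
have [T' [T5 min5]] := min_cutP n0 csym c0 r2 cs4 G4 T04.
have b5 w : best s3 w -> bestf (ra (run min_cut s4)) w by move=> /b4 h; apply/(bestE (run min_cut s4) w); apply: best_run.
have T05 : is_ind (ra (run min_cut s4) aT0) T0 by move=> u; rewrite run_ra //; exact: T04.
have B4 : ra s4 30 sB = b by rewrite run_cell.
have B5 : ra (run min_cut s4) 30 sB = b by rewrite run_cell.
move: (run min_cut s4) T5 b5 T05 B5 => s5 T5 b5 T05 B5.
split; [exact: b5 b3|exact: T05|exact: B5|].
exists T'; split=> //; first exact: (ratio_step c0 erefl r2 min5).
move=> nS; case: (H2 nS) => [g2|[sl2 sd2 min2]]; first by left; apply/b5/e3/(bestE s2 _).
have [cutS S2 bS sdS] := nS; have [le|lt] := leP (ratio c T0 b T) (ratio c T0 b S).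
  left; have [cutT sp] := ratio_sparsity c0 e01 cutS S2 bS sdS sl2 le.
  by apply: b5; apply: best_weaken sp _; exact: cut3.
have slS : 0 < slack T0 b S.
  have S0 : 0 < #|S|%:R :> R by rewrite ltr0n; move: cutS; rewrite is_cut_card => /andP[].
  have /andP[e0 e1] := e01; rewrite /slack subr_gt0; apply: le_lt_trans sdS _.
  rewrite bS; set k : R := #|S|%:R in S0 *; have ek : 0 < eps * k by rewrite mulr_gt0.
  have : eps ^+ 2 * k <= eps * k by rewrite expr2 -mulrA ger_pMl // ltW.
  by move: ek; set x := eps ^+ 2 * k; set y := eps * k; lra.
have [sl' r' sd'] := newton_step c0 sl2 slS lt min2 min5.
right; split=> //; first by apply: leq_ltn_trans sd'.
by right; exists (ratio c T0 b T).
Qed.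

End NewtonIteration.

(** * Correctness of the program *)

Section Exploration.
Context {R : realType} (n r : nat) (eps d lambda : R) (c delta : 'M[R]_n).
Implicit Types (s : @store R) (f : nat -> nat -> R) (S T : {set 'I_n}).
Local Notation context := (context r eps d lambda c delta).
Local Notation best := (best c).
Local Notation bestf := (bestf c).
Local Notation rowvec := (@rowvec R n).
Local Notation rows := (@rows R n r).
Local Notation net := (@net R n r).
Hypotheses (e01 : 0 < eps < 1) (n1 : (1 < n)%N) (csym : c^T = c).
Hypothesis c0 : forall i j, 0 <= c i j.

Definition rounded_set f (i : nat) : {set 'I_n} := [set j : 'I_n | 1 / 2 < f aOld (i * n + j)%N].

(** One of the guesses is the size of [S], for which the offset is the one that the ratio argument
    requires; the other guesses never worsen the best cut. *)
Lemma exploreP s v : context s -> best s v -> best (run explore s) v /\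
  forall S i, (i < nv s 62)%N -> (i < 2 ^ (8 * r).+1)%N -> is_cut S -> (2 * #|S| <= n)%N ->
    (sd S (rounded_set (ra s) i))%:R <= eps ^+ 2 * #|S|%:R / 800 ->
    best (run explore s) ((1 + eps) * sparsity c S).
Proof.
move=> cs bs; have /andP[e0 e1] := e01; have n0 : (0 < n)%N by apply: ltnW.
rewrite /explore; set body := CIfN _ _ _ _.
pose close S i := [/\ (i < nv s 62)%N, is_cut S, (2 * #|S| <= n)%N &
  (sd S (rounded_set (ra s) i))%:R <= eps ^+ 2 * #|S|%:R / 800].
pose J S i f (nvs : nat -> nat) := [/\ bestf f v, f aOld = ra s aOld, nvs 62 = nv s 62 &
  forall i', (i' < i)%N -> close S i' -> bestf f ((1 + eps) * sparsity c S)].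
set s1 := run (CFor 22 4 body) s.
suff H S : J S (nv s 4) (ra s1) (mask 22 (nv s1)).
  split; first by apply/(bestE _ s1); case: (H set0).
  move=> S i i62 icap cutS S2 sdS; apply/(bestE _ s1); have [_ _ _ h] := H S.
  by apply: (h i) => //; rewrite (sz_cap (ctx_sized cs)).
apply: (run_for_ctx (J := J S) _ _ cs); [by []|by []| |].
  by split=> //; apply/(bestE _ s).
move=> i s2 _ cs2 [b2 O2 V2 H2] k22 k23 _.
have {}V2 : nv s2 62 = nv s 62 by move: V2; rewrite /mask.
have mE : mask 22 (nv (run body s2)) 62 = nv s 62.
  by rewrite [LHS](_ : _ = nv (run body s2) 62) // run_nv.
pose t := CFor 24 0 (cseq
          [:: set_sc sK (sc sK + 1)%RE; set_sc sB (sc sEps * sc sK / e8)%RE; newton]).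
pose s3 := run (fill aT0 (round_e (at2 aOld (NVar 23) (NIdx 0)))) s2.
pose s4 := run (set_sc sK 0%RE) s3.
have bE : run body s2 = if (i < nv s 62)%N then run t s4 else s2.
  by rewrite -V2 -k22.
rewrite /J mE bE; case: ifP => [i62|/negbT i62]; last first.
  split=> // i' ii cl; apply: (H2 i') => //; case: cl => h _ _ _.
  by move: ii h i62; clear; lia.
have cs3 : context s3 by apply: context_run.
have cs4 : context s4 by apply: context_run.
pose T0 := rounded_set (ra s) i.
have T03 : is_ind (ra s3 aT0) T0.
  move=> j; rewrite /s3 fillE ?(sz_n (ctx_sized cs2)) // inE.
  rewrite -[LHS]/(if 1 / 2 < ra s2 aOld (nv s2 23 + j)%N then 1 else 0) O2 k23.
  by case: (_ < _).
have T04 : is_ind (ra s4 aT0) T0 by move=> j; rewrite run_ra //; exact: T03.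
have b4 w : bestf (ra s2) w -> best s4 w.
  by move=> /(bestE _ s2) h; apply: best_run => //; apply: best_run.
have K4 : ra s4 30 sK = 0 by rewrite set_scE.
have O4 : ra s4 aOld = ra s aOld by rewrite run_ra // run_ra.
clearbody s4.
pose J2 k f (_ : nat -> nat) := [/\ forall w, bestf (ra s2) w -> bestf f w,
  is_ind (f aT0) T0, f 30 sK = k%:R, f aOld = ra s aOld &
  (#|S| <= k)%N -> close S i -> bestf f ((1 + eps) * sparsity c S)].
have [b5 _ _ O5 H5] : J2 (nv s4 0) (ra (run t s4)) (mask 24 (nv (run t s4))); last first.
  split=> //; first exact: b5.
  move=> i'; rewrite ltnS leq_eqVlt => /orP[/eqP->|ii] cl.
    apply: H5 => //; rewrite (sz_n (ctx_sized cs4)).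
    by apply: leq_trans (max_card _) _; rewrite card_ord.
  by apply: b5; exact: (H2 i').
apply: (run_for_ctx (J := J2) _ _ cs4); [by []|by []| |].
  split=> //; first by move=> w /b4 h; apply/(bestE _ s4).
  rewrite leqn0 cards_eq0 => /eqP S0 [_ cutS _ _]; move: cutS.
  by rewrite S0 /is_cut eqxx.
move=> k s5 _ cs5 [b5 T05 K5 O5 H5] _ _ _.
rewrite /cseq run_seq run_seq; set s6 := run (set_sc sK _) s5.
have K6 : ra s6 30 sK = k.+1%:R by rewrite set_scE -[LHS]/(ra s5 30 sK + 1) K5 natr1.
have cs6 : context s6 by apply: context_run.
have b6 w : bestf (ra s5) w -> best s6 w by move=> /(bestE _ s5) h; apply: best_run.
have T06 : is_ind (ra s6 aT0) T0 by move=> j; rewrite run_ra //; exact: T05.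
have O6 : ra s6 aOld = ra s aOld by rewrite run_ra //; exact: O5.
clearbody s6; set s7 := run (set_sc sB _) s6.
have B7 : ra s7 30 sB = eps * k.+1%:R / 8.
  rewrite set_scE -[LHS]/(ra s6 30 sEps * ra s6 30 sK / ((1 + 1) * (1 + 1) * (1 + 1))).
  by rewrite K6 (ctx_eps cs6); congr (_ / _); ring.
have cs7 : context s7 by apply: context_run.
have b7 w : bestf (ra s5) w -> best s7 w by move=> /b6 h; apply: best_run.
have T07 : is_ind (ra s7 aT0) T0 by move=> j; rewrite run_ra //; exact: T06.
have K7 : ra s7 30 sK = k.+1%:R by rewrite run_cell.
have O7 : ra s7 aOld = ra s aOld by rewrite run_ra //; exact: O6.
clearbody s7.
have B0 : 0 < eps * k.+1%:R / 8 by rewrite divr_gt0 // mulr_gt0 // ltr0n.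
have nw w (bw : bestf (ra s5) w) := newtonP e01 n0 csym c0 B0 cs7 B7 T07 (b7 w bw).
split.
- by move=> w /b5 bw; apply/(bestE _ (run newton s7)); have [] := nw w bw.
- by move=> j; rewrite run_ra //; exact: T07.
- by rewrite run_cell.
- by rewrite run_ra.
- rewrite leq_eqVlt => /orP[/eqP Sk|Sk] cl; apply/(bestE _ (run newton s7)); last first.
    by have [] := nw _ (H5 Sk cl).
  have [_ h] := nw _ (b5 _ b2); apply: h; case: cl => _ cutS S2 sdS.
  by split=> //; rewrite Sk.
Qed.

Lemma dist2_ind S f i : dist2 (ind S) (round_vec (rowvec (f aOld) i)) =
  (sd S (rounded_set f i))%:R :> R.
Proof. by rewrite sd_sum; apply: eq_bigr => j _; rewrite !mxE inE -expr2; case: ifP. Qed.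

(** At the initial scale [2 n] the single point 0 is a net, because a Boolean vector has squared
    length at most [n]. From there each scale provides the net that the next one refines, down to
    the scale suited to [S]. *)
Lemma levelsP s v : (0 < r)%N -> context s -> best s v ->
  orthogonal_family (rows (ra s)) ->
  (forall j, rows (ra s) j = 0 \/ 1 / 4 <= dot (rows (ra s) j) (rows (ra s) j) <= 1) ->
  best (run levels s) v /\ forall S l, (l < 32 * n)%N -> is_cut S -> (2 * #|S| <= n)%N ->
    let m := (2 * r)%:R * (2 * n%:R * 2^-1 ^+ l.+1) ^+ 2 in
    dist2 (ind S) (proj (rows (ra s)) (ind S)) <= m ->
    (forall T, (sd S T)%:R <= 1206 * m -> (sd S T)%:R <= eps ^+ 2 * #|S|%:R / 800) ->
    best (run levels s) ((1 + eps) * sparsity c S).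
Proof.
move=> r0 cs bs og gn; have n0 : 0 < n%:R :> R by rewrite ltr0n ltnW.
pose sig l : R := 2 * n%:R * 2^-1 ^+ l; pose m l : R := (2 * r)%:R * sig l ^+ 2.
have sig0 l : 0 < sig l by rewrite mulr_gt0 ?exprn_gt0 ?invr_gt0 ?ltr0n // mulr_gt0.
have mS l : m l = 4 * m l.+1.
  by rewrite /m /sig [2^-1 ^+ l.+1]exprS; set a := 2^-1 ^+ l; field.
rewrite /levels [cseq _]/= !run_seq.
set s0 := run (set_sc _ _) _; set body := CSeq _ _.
have cs0 : context s0 by do 3!(apply: context_run => //).
have G0 : ra s0 aG = ra s aG by [].
have S0 : ra s0 30 sSig = sig 0.
  rewrite set_scE -[LHS]/(ra s 30 sN + ra s 30 sN) (ctx_n cs) /sig expr0; ring.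
have V0 : nv s0 62 = 1%N by [].
have O0 : rowvec (ra s0 aOld) 0 = 0.
  apply/matrixP => i j; rewrite [LHS]mxE [RHS]mxE -[LHS]/(ra (run (fill aOld 0%RE) (run (CNat 62 (NConst 1)) s)) aOld i).
  by rewrite fillE // -[nv _ 0]/(nv s 0) (sz_n (ctx_sized cs)).
have b0 : best s0 v by do 3!(apply: best_run => //).
clearbody s0.
pose J S l0 l f (nvs : nat -> nat) := [/\ bestf f v, f aG = ra s aG, f 30 sSig = sig l,
  exists N, net (m l) f nvs N &
  (l0 < l)%N -> is_cut S -> (2 * #|S| <= n)%N ->
    dist2 (ind S) (proj (rows (ra s)) (ind S)) <= m l0.+1 ->
    (forall T, (sd S T)%:R <= 1206 * m l0.+1 -> (sd S T)%:R <= eps ^+ 2 * #|S|%:R / 800) ->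
    bestf f ((1 + eps) * sparsity c S)].
set s1 := run (CFor 20 3 body) s0.
suff H S l0 : J S l0 (nv s0 3) (ra s1) (mask 20 (nv s1)).
  split; first by apply/(bestE _ s1); case: (H set0 0%N).
  move=> S l0 l0n cutS S2 h1 h2; apply/(bestE _ s1 _); have [_ _ _ _ h] := H S l0.
  by apply: h => //; rewrite (sz_t (ctx_sized cs0)).
have rowsE f : f aG = ra s aG -> rows f = rows (ra s).
  by move=> e; apply: funext => j; rewrite /rows e.
apply: (run_for_ctx (J := J S l0) _ _ cs0); [by []|by []| |].
  split=> //; first by apply/(bestE _ s0).
  exists 1%N; split=> //.
  - by rewrite expn_gt0.
  - move=> i; rewrite ltnS leqn0 => /eqP->; exists (fun=> 0); rewrite O0.
    by rewrite /combine big1 // => j _; rewrite scale0r.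
  - move=> x xb _; exists 0%N => //; rewrite O0 (rowsE _ G0) dist2C /dist2 subr0.
    have pp : dot (proj (rows (ra s)) x) (proj (rows (ra s)) x) <= dot x x.
      have := proj_pythagoras og x (fun=> 0).
      rewrite /combine big1 => [|j _]; last by rewrite scale0r.
      by rewrite !subr0 => ->; rewrite lerDr dot_ge0.
    apply: le_trans pp _; apply: le_trans (_ : n%:R <= _).
      rewrite -[n in n%:R]card_ord -sumr_const; apply: ler_sum => j _.
      by case: (xb j) => ->; rewrite ?mul0r ?mulr1 ?ler01.
    rewrite /m /sig expr0 mulr1 exprMn.
    have r1 : 1 <= (2 * r)%:R :> R by rewrite ler1n muln_gt0.
    have nn : n%:R <= n%:R ^+ 2 :> R by rewrite expr2 ler_peMl ?(ltW n0) // ler1n ltnW.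
    have : n%:R ^+ 2 <= (2 * r)%:R * n%:R ^+ 2 :> R by rewrite ler_peMl ?exprn_ge0 ?(ltW n0).
    have := exprn_ge0 2 (ltW n0); move: nn; set x2 := n%:R ^+ 2.
    rewrite (_ : 600 * _ = 2400 * ((2 * r)%:R * x2)); last by ring.
    set y := _ * x2; lra.
move=> l s2 _ cs2 [b2 G2 S2 [N2 net2] H2] _ _ _.
rewrite /body run_seq run_seq run_seq run_seq.
set s3 := run (set_sc sSig _) s2; have cs3 : context s3 by apply: context_run.
have S3 : ra s3 30 sSig = sig l.+1.
  by rewrite set_scE -[LHS]/(ra s2 30 sSig / (1 + 1)) S2 /sig exprSr mulrA.
have G3 : ra s3 aG = ra s aG by rewrite run_ra.
have O3 : ra s3 aOld = ra s2 aOld by rewrite run_ra.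
have V3 : nv s3 62 = nv s2 62 by [].
have b3 w : bestf (ra s2) w -> best s3 w by move=> /(bestE _ s2) h; apply: best_run.
clearbody s3; set s4 := run (set_sc sM _) s3; have cs4 : context s4 by apply: context_run.
have S4 : ra s4 30 sSig = sig l.+1 by rewrite run_cell.
have M4 : ra s4 30 sM = m l.+1.
  rewrite set_scE -[LHS]/((\sum_(i < nv s3 2) 1) * (ra s3 30 sSig * ra s3 30 sSig)) S3.
  by rewrite sumr_const card_ord (sz_q (ctx_sized cs3)).
have G4 : ra s4 aG = ra s aG by rewrite run_ra.
have O4 : ra s4 aOld = ra s2 aOld by rewrite run_ra.
have V4 : nv s4 62 = nv s2 62 by rewrite -V3.
have b4 w : bestf (ra s2) w -> best s4 w by move=> /b3 h; apply: best_run.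
clearbody s4.
have net4 : net (4 * m l.+1) (ra s4) (nv s4) N2.
  rewrite -mS; case: net2 => h1 h2 h3 h4; split=> //; rewrite ?V4 // ?O4 ?(rowsE _ G4) -?(rowsE _ G2) //.
have og4 : orthogonal_family (rows (ra s4)) by rewrite (rowsE _ G4).
have gn4 j : rows (ra s4) j = 0 \/ 1 / 4 <= dot (rows (ra s4) j) (rows (ra s4) j) <= 1.
  by rewrite (rowsE _ G4).
have [N5] := netP r0 (sig0 l.+1) cs4 og4 gn4 S4 M4 net4.
set s5 := run copy_list (run build s4); move=> [net5 rd5].
have cs5 : context s5 by do 2!(apply: context_run => //).
have G5 : ra s5 aG = ra s aG by do 2!(rewrite run_ra //).
have S5 : ra s5 30 sSig = sig l.+1 by do 2!(rewrite run_cell //).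
have b5 w : bestf (ra s2) w -> best s5 w.
  by move=> /b4 h; do 2!(apply: best_run => //).
clearbody s5; have ex w (bw : bestf (ra s2) w) := exploreP cs5 (b5 w bw).
have b6 w : bestf (ra s2) w -> bestf (ra (run explore s5)) w.
  by move=> bw; apply/(bestE _ (run explore s5)); have [] := ex w bw.
have G6 : ra (run explore s5) aG = ra s aG by rewrite run_ra.
split.
- exact: b6.
- exact: G6.
- by rewrite run_cell.
- exists N5; case: net5 => h1 h2 h3 h4.
  have O6 : ra (run explore s5) aOld = ra s5 aOld by rewrite run_ra.
  split=> //; rewrite ?O6 ?(rowsE _ G6) -?(rowsE _ G5) //.
  by rewrite [LHS](_ : _ = nv (run explore s5) 62) // run_nv.
- rewrite ltnS leq_eqVlt => /orP[/eqP->|ll] cutS Sn px hT; last by apply: b6; exact: H2.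
  have sb : boolean (ind S : 'cV[R]_n).
    by move=> i; rewrite mxE; case: (i \in S); [right|left].
  have rE := rowsE _ G5; have px' : dist2 (ind S) (proj (rows (ra s5)) (ind S)) <= m l.+1.
    by rewrite rE.
  have [i iN ci] := net_cover net5 sb px'.
  have og5 : orthogonal_family (rows (ra s5)) by rewrite rE.
  have [a aE] := net_span net5 iN; have ri := rd5 i iN; rewrite aE in ci ri.
  have := covered_close og5 ci px' ri; rewrite -aE dist2_ind => close.
  apply/(bestE _ (run explore s5)); have [_ ep] := ex _ b2.
  apply: (ep S i) => //; first by rewrite (net_size net5).
    by apply: leq_trans (net_cap net5).
  exact: hT.
Qed.

End Exploration.

Section Correctness.
Context {R : realType} (n r : nat) (eps d lambda : R) (c delta : 'M[R]_n).
Implicit Types (s : @store R) (f : nat -> nat -> R) (S T : {set 'I_n}).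
Local Notation context := (context r eps d lambda c delta).
Local Notation best := (best c).
Local Notation bestf := (bestf c).

(** For the case of sparsity 0, where nothing is known about the subspace: the search still never
    loses the best cut. *)
Lemma levels_best s v : 0 < eps < 1 -> (1 < n)%N -> c^T = c -> (forall i j, 0 <= c i j) ->
  context s -> best s v -> best (run levels s) v.
Proof.
move=> e01 n1 csym c0 cs bs; rewrite /levels [cseq _]/= !run_seq.
set s0 := run (set_sc _ _) _; set body := CSeq _ _.
have cs0 : context s0 by do 3!(apply: context_run => //).
have b0 : best s0 v by do 3!(apply: best_run => //).
clearbody s0; pose J (i : nat) f (_ : nat -> nat) := bestf f v.
apply/(bestE _ (run (CFor 20 3 body) s0)).
suff : J (nv s0 3) (ra (run (CFor 20 3 body) s0)) (mask 20 (nv (run (CFor 20 3 body) s0))) by [].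
apply: (run_for_ctx (J := J) _ _ cs0); [by []|by []|by apply/(bestE _ s0)|].
move=> i s1 _ cs1 /(bestE _ s1) b1 _ _ _; rewrite /body run_seq run_seq run_seq run_seq.
set s2 := run copy_list _; have cs2 : context s2 by do 4!(apply: context_run => //).
have b2 : best s2 v by do 4!(apply: best_run => //).
by apply/(bestE _ (run explore s2)); have [] := exploreP e01 n1 csym c0 cs2 b2.
Qed.

Lemma pick_level (m : nat -> R) (M : R) N : (forall l, m l = 4 * m l.+1) ->
  M <= m 0%N -> m N < M -> exists l, [/\ (l < N)%N, M <= m l & m l <= 4 * M].
Proof.
move=> mS m0; elim: N => [|N IH] mN; first by rewrite ltNge m0 in mN.
have [lt|le] := ltP (m N) M; first by have [l [lN h1 h2]] := IH lt; exists l; split=> //; exact: ltnW.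
by exists N; split=> //; rewrite mS ler_pM2l // ltW.
Qed.

(** At the last scale the accuracy is below the floor 1/12000; the factors [2 r] and [n^2] are
    absorbed by powers of 2. *)
Lemma finest_level : (0 < n)%N -> (r <= n)%N ->
  (2 * r)%:R * (2 * n%:R * 2^-1 ^+ (32 * n).+1) ^+ 2 < 12000^-1 :> R.
Proof.
move=> n0 rn; rewrite [2^-1 ^+ _.+1]exprS mulrACA divff ?pnatr_eq0 // mul1r.
have n2 : n%:R <= 2 ^+ n :> R by rewrite -natrX ler_nat ltnW // ltn_expl.
have r2 : (2 * r)%:R <= 2 * 2 ^+ n :> R.
  by rewrite natrM ler_pM2l //; apply: le_trans n2; rewrite ler_nat.
set a : R := 2^-1 ^+ n; have a1 : a <= 2^-1.
  by rewrite -[leRHS]expr1 ler_wiXn2l // ?invr_ge0 // invf_le1 // ler1n.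
have a0 : 0 < a by rewrite exprn_gt0 // invr_gt0.
have an : a * 2 ^+ n = 1 by rewrite -exprMn mulVf ?pnatr_eq0 // expr1n.
have -> : 2^-1 ^+ (32 * n) = a ^+ 32 :> R by rewrite mulnC exprM.
have N0 : 0 <= 2 ^+ n :> R by rewrite exprn_ge0.
apply: (@le_lt_trans _ _ (2 * 2 ^+ n * (2 ^+ n * a ^+ 32) ^+ 2)).
  have a32 : 0 <= a ^+ 32 by rewrite exprn_ge0 // ltW.
  apply: ler_pM => //; first exact: sqr_ge0.
  by apply: lerXn2r; rewrite ?nnegrE ?(mulr_ge0 _ a32) //; exact: ler_wpM2r.
have -> : 2 * 2 ^+ n * (2 ^+ n * a ^+ 32) ^+ 2 = 2 * (a * 2 ^+ n) ^+ 3 * a ^+ 61 by ring.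
rewrite an expr1n mulr1; apply: le_lt_trans (_ : 2 * a ^+ 61 <= 2 * 2^-1 ^+ 61) _.
  by rewrite ler_pM2l //; apply: lerXn2r; rewrite ?nnegrE ?(ltW a0) ?invr_ge0.
by lra.
Qed.

Lemma level_numeric (E k N : R) : E <= k / 10 ^+ 9 -> 0 < k -> k <= N -> 1 <= N ->
  16 * E + 12000^-1 <= 2 * N.
Proof. lra. Qed.

Lemma accuracy_numeric : 2^-1 ^+ 33 <= 12000^-1 :> R.
Proof. lra. Qed.

(** Here 4824 = 4 * 1206. In this range the symmetric difference is an integer below 1, so the
    rounded point is [S] itself. *)
Lemma small_numeric (E : R) : 16 * E <= 12000^-1 -> 4824 * (16 * E + 12000^-1) < 1.
Proof. lra. Qed.

(** This is where the constant [10^9] enters: [4824 * 32 < 10^9 / 800]. *)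
Lemma large_numeric (E : R) : 12000^-1 < 16 * E ->
  4824 * (16 * E + 12000^-1) <= E * 10 ^+ 9 / 800.
Proof. lra. Qed.

(** With [E = eps^2 |S| / 10^9], the energy bound puts the indicator of [S] within [16 E + 2^-33] of
    the span. Some scale has accuracy between [M] and [4 M], and the set recovered there is within
    [1206 * 4 M] of [S]. *)
Lemma mainP s phi : 0 < eps < 1 -> (1 < n)%N -> regular_graph c ->
  spectral_SSE_flow r d lambda c delta -> is_sparsest_value c phi ->
  10 ^+ 9 / eps ^+ 2 * phi <= d * lambda ->
  sized n r (nv s) -> inputs eps d lambda c delta (ra s) ->
  best (run main s) ((1 + eps) * phi).
Proof.
move=> e01 n1 reg [flow _ [mu smu hmu]] [[S0 cutS0 phiE] _] hC sz inp.
have [[csym _ c0] _] := reg; have /andP[e0 e1] := e01; have n0 : (0 < n)%N by apply: ltnW.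
have wd : weighted_graph delta by case: flow.
rewrite /main [cseq _]/=; do 6!rewrite run_seq.
set s1 := run init_scalars s; have cs1 : context s1 by apply: init_scalarsP.
have [v b2] := init_bestP n1 cs1; set s2 := run init_best s1 in b2 *.
have cs2 : context s2 by apply: context_run.
have [b3 z3] := componentP n1 reg cs2 b2; set s3 := run component s2 in b3 z3 *.
have cs3 : context s3 by apply: context_run.
set s6 := run subspace _; have cs6 : context s6 by do 3!(apply: context_run => //).
have b6 w : best s3 w -> best s6 w by move=> bw; do 3!(apply: best_run => //).
have [S [cutS S2 SE]] : exists S, [/\ is_cut S, (2 * #|S| <= n)%N & sparsity c S = phi].
  have := cardsC S0; rewrite card_ord => nE.
  have [le|lt] := leqP (2 * #|S0|) n; first by exists S0.
  exists (~: S0); split; last by rewrite sparsityC.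
    by move: cutS0; rewrite !is_cut_card; move: nE; clear; lia.
  by move: nE lt; clear; lia.
have /andP[k0 kn] : (0 < #|S| < n)%N by rewrite -is_cut_card.
set k : R := #|S|%:R; have kp : 0 < k by rewrite ltr0n.
have nk : 0 < n%:R - k by rewrite subr_gt0 ltr_nat.
have np : 0 < n%:R :> R by rewrite ltr0n.
have cutE : cut_capacity c S * n%:R = phi * (k * (n%:R - k)).
  rewrite -SE /sparsity natrB ?(ltnW kn) // -/k divfK; first exact: mulrC.
  by rewrite mulf_neq0 // gt_eqF.
have phi0 : 0 <= phi.
  by rewrite -(pmulr_lge0 _ (mulr_gt0 kp nk)) -cutE mulr_ge0 ?cut_capacity_ge0 // ltW.
(* If [phi = 0] nothing makes [d * lambda] positive; the component phase has already found the
   cut. *)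
have [phi00|phin0] := eqVneq phi 0.
  rewrite phi00 mulr0; apply: levels_best => //; apply: b6; apply: (z3 S) => //.
  by apply/eqP; rewrite -(mulIr_eq0 _ (mulIf (lt0r_neq0 np))) cutE phi00 mul0r.
have phip : 0 < phi by rewrite lt_neqAle eq_sym phin0.
have e2 : 0 < eps ^+ 2 by rewrite exprn_gt0.
have h0 : 0 < d * lambda.
  by apply: lt_le_trans hC; rewrite mulr_gt0 // divr_gt0 // exprn_gt0.
have [og gn close] := subspaceP n1 wd h0 smu hmu cs3; rewrite -/s6 in og gn close.
have rn : (0 < r <= n)%N.
  case: smu => sp [_ chE] [/andP[r0 rsz] _]; rewrite r0 /=.
  have := congr1 (fun p : {poly R} => size p) chE.
  by rewrite size_char_poly size_prod_XsubC => -[->].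
have /andP[r0 rn'] := rn.
have [_ lev] := levelsP e01 n1 csym c0 r0 cs6 (b6 _ b3) og gn.
rewrite -SE; pose m l : R := (2 * r)%:R * (2 * n%:R * 2^-1 ^+ l.+1) ^+ 2.
have mS l : m l = 4 * m l.+1.
  by rewrite /m [2^-1 ^+ l.+2]exprS; set a := 2^-1 ^+ l.+1; field.
(* The floor 1/12000 keeps the chosen scale above the finest one and absorbs the error of the
   computed subspace. *)
pose E := eps ^+ 2 * k / 10 ^+ 9; pose M : R := 16 * E + 12000^-1.
have E0 : 0 < E by rewrite divr_gt0 ?mulr_gt0 // exprn_gt0.
have k_n : k <= n%:R by rewrite ler_nat ltnW.
have Ek : E <= k / 10 ^+ 9.
  by apply: ler_wpM2r; rewrite ?invr_ge0 ?exprn_ge0 // ler_piMl ?(ltW kp) // exprn_ile1 // ltW.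
have m0 : M <= m 0%N.
  have r1 : 2 <= (2 * r)%:R :> R by rewrite ler_nat; move: r0; clear; lia.
  have n1' : 1 <= n%:R :> R by rewrite ler1n.
  have -> : m 0%N = (2 * r)%:R * n%:R ^+ 2 by rewrite /m expr1; field.
  apply: le_trans (_ : 2 * n%:R <= _).
    exact: level_numeric Ek kp k_n n1'.
  by apply: ler_pM => //; rewrite expr2 ler_peMl // ltW.
have mN : m (32 * n)%N < M by apply: lt_le_trans (finest_level n0 rn') _; rewrite lerDr mulr_ge0 // ltW.
have [l [lN Ml lM]] := pick_level mS m0 mN.
have energy : dot (laplacian delta *m ind S) (ind S) <= phi * k.
  rewrite laplacian_ind; apply: le_trans (flow_cut S flow) _.
  rewrite -(ler_pM2r np) cutE -mulrA ler_wpM2l // ler_pM2l //.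
  by rewrite lerBlDr lerDl ltW.
apply: (lev S l) => //; rewrite -/(m l).
  apply: le_trans (close (ind S) _) _; first by rewrite dot_ind.
  apply: le_trans Ml; rewrite /M; apply: lerD; last exact: accuracy_numeric.
  rewrite -mulrA ler_pM2l // ler_pdivrMr //; apply: le_trans energy _.
  apply: le_trans (_ : E * (10 ^+ 9 / eps ^+ 2 * phi) <= _); last by rewrite ler_pM2l.
  by rewrite /E le_eqVlt; apply/orP; left; apply/eqP; field; rewrite gt_eqF.
move=> T sdT; have sdM : (sd S T)%:R <= 4824 * M.
  by apply: le_trans sdT _; rewrite -(@ler_pM2l _ 1206) // in lM; rewrite (_ : 4824 = 1206 * 4) -?mulrA //; ring.
have EE : eps ^+ 2 * k = E * 10 ^+ 9 by rewrite /E divfK // expf_neq0 // pnatr_eq0.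
rewrite EE; have [small|big] := leP (16 * E) 12000^-1.
  have : (sd S T)%:R < 1 :> R by apply: le_lt_trans sdM _; exact: small_numeric.
  by rewrite ltrn1 ltnS leqn0 => /eqP->; rewrite divr_ge0 // mulr_ge0 ?exprn_ge0 // ltW.
by apply: le_trans sdM _; exact: large_numeric.
Qed.

End Correctness.

(** * Running time *)

Section Cost.

(** Bounds of the form [2^O(r) poly(n)], with one constant for the factor and both exponents. The
    class is closed under sums and products, which is all that the cost of a command uses. *)
Definition tame (F : nat -> nat -> nat) : Prop :=
  exists K, forall n r, (0 < n)%N -> (F n r <= K * 2 ^ (K * r) * n ^ K)%N.

Lemma tame_widen K K' n r : (K <= K')%N -> (0 < n)%N ->
  (2 ^ (K * r) * n ^ K <= 2 ^ (K' * r) * n ^ K')%N.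
Proof.
move=> KK n0; apply: leq_mul; last exact: leq_pexp2l.
by rewrite leq_exp2l // leq_mul2r KK orbT.
Qed.

Lemma tame_const k : tame (fun _ _ => k).
Proof.
exists k => n r n0; rewrite -mulnA -[X in (X <= _)%N]muln1 leq_mul2l; apply/orP; right.
by rewrite muln_gt0 !expn_gt0 n0.
Qed.

Lemma tame_le F G : (forall n r, (0 < n)%N -> (F n r <= G n r)%N) -> tame G -> tame F.
Proof. by move=> FG [K h]; exists K => n r n0; apply: leq_trans (FG n r n0) (h n r n0). Qed.

Lemma tame_size : tame (fun n _ => n).
Proof.
by exists 1%N => n r n0; rewrite mul1n expn1 leq_pmull // expn_gt0.
Qed.

Lemma tame_exp k : tame (fun _ r => 2 ^ (k * r))%N.
Proof.
exists k.+1 => n r n0; rewrite -mulnA; apply: leq_trans (_ : k.+1 * (2 ^ (k.+1 * r)) <= _)%N.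
  by apply: leq_trans (_ : 2 ^ (k.+1 * r) <= _)%N; rewrite ?leq_pmull // leq_exp2l // leq_mul2r leqnSn orbT.
by rewrite leq_mul2l /= leq_pmulr // expn_gt0 n0.
Qed.

Lemma tame_rank : tame (fun _ r => r).
Proof.
apply: tame_le (tame_exp 1) => n r _; rewrite mul1n; exact/ltnW/ltn_expl.
Qed.

Lemma tameD F G : tame F -> tame G -> tame (fun n r => F n r + G n r)%N.
Proof.
move=> [K hK] [L hL]; exists (K + L)%N => n r n0; rewrite mulnDl mulnDl.
apply: leq_add.
  apply: leq_trans (hK n r n0) _; rewrite -!mulnA leq_mul2l; apply/orP; right.
  by apply: tame_widen => //; exact: leq_addr.
apply: leq_trans (hL n r n0) _; rewrite -!mulnA leq_mul2l; apply/orP; right.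
by apply: tame_widen => //; exact: leq_addl.
Qed.

Lemma tameM F G : tame F -> tame G -> tame (fun n r => F n r * G n r)%N.
Proof.
move=> [K hK] [L hL]; exists (K * L + (K + L))%N => n r n0.
apply: leq_trans (leq_mul (hK n r n0) (hL n r n0)) _.
rewrite (_ : _ * _ = K * L * (2 ^ ((K + L) * r) * n ^ (K + L)))%N; last first.
  by rewrite mulnDl !expnD; ring.
rewrite -[leqRHS]mulnA; apply: leq_mul; first exact: leq_addr.
by apply: tame_widen => //; exact: leq_addl.
Qed.

(* Final values of the variables that bound the loops and sums. *)
Definition sizes (n r : nat) : nat -> nat :=
  nth 0%N [:: n; r; 2 * r; 32 * n; 2 ^ (8 * r).+1; 2 ^ 14 * (2 * r);
    4 ^ (2 ^ 14 * (2 * r)); 3 + n * n; 3 + 2 * (n * n)]%N.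

Lemma tame_sizes y : tame (fun n r => sizes n r y).
Proof.
have tn := tame_size; have tr := tame_rank; have tc := tame_const.
case: y => [//|]; case=> [//|]; case=> [|]; first exact: (tameM (tc 2)).
case=> [|]; first exact: (tameM (tc 32)).
case=> [|].
  apply: tame_le (tameM (tc 2) (tame_exp 8)) => n r _.
  by rewrite -[leqLHS]/(2 ^ (8 * r).+1)%N expnS.
case=> [|]; first by apply: (tameM (tc _)); exact: (tameM (tc 2)).
case=> [|].
  apply: tame_le (tame_exp (2 * (2 ^ 14 * 2))) => n r _.
  rewrite -[leqLHS]/(4 ^ (2 ^ 14 * (2 * r)))%N (_ : 4 = 2 ^ 2)%N // -expnM.
  by rewrite !mulnA.
case=> [|]; first by apply: (tameD (tc 3)); exact: tameM.
case=> [|]; first by apply: (tameD (tc 3)); apply: (tameM (tc 2)); exact: tameM.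
by move=> y; rewrite /sizes /= nth_nil; exact: tc.
Qed.

Lemma tame_ecost e : tame (fun n r => ecost (sizes n r) e).
Proof.
have tc := tame_const; elim: e => /=; try by move=> *; exact: tc.
- by move=> o e IHe f IHf; do !apply: tameD.
- by move=> x IHx y IHy e IHe f IHf; do !apply: tameD.
- by move=> x y e IHe f IHf; do !apply: tameD.
- by move=> y e IHe; apply: tameD => //; apply: tameM; [exact: tame_sizes|exact: tameD].
Qed.

Lemma tame_ccost c : tame (fun n r => ccost (sizes n r) c).
Proof.
have tc := tame_const; have te := tame_ecost; elim: c => /=; try by move=> *; exact: tc.
- by move=> a i e; do !apply: tameD.
- move=> a o y e; apply: tameD => //; apply: tameM; first exact: tame_sizes.
  by do !apply: tameD.
- by move=> c IHc c' IHc'; exact: tameD.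
- by move=> x y c IHc c' IHc'; do !apply: tameD.
- by move=> x y c IHc c' IHc'; do !apply: tameD.
- by move=> x y c IHc; apply: tameD => //; apply: tameM; [exact: tame_sizes|exact: tameD].
Qed.

End Cost.

(** * Computation of the loop bounds *)

Section Setup.
Context {R : realType}.
Implicit Types (s : @store R).

Lemma run_cseq (c : cmd) l s : run (cseq (c :: l)) s = run (cseq l) (run c s).
Proof. by case: l. Qed.

Lemma run_doubles x k s : nv (run (cseq (nseq k (double x))) s) x = (2 ^ k * nv s x)%N.
Proof.
elim: k s => [|k IH] s; first by rewrite mul1n.
by rewrite [nseq _ _]/= run_cseq IH /= updE eqxx expnSr addnn -muln2; ring.
Qed.

Lemma nassigned_doubles x k y : y != x -> y \notin nassigned (cseq (nseq k (double x))).
Proof.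
by move=> yx; elim: k => // -[|k] IH; rewrite /= inE // negb_or yx.
Qed.

Lemma run_loop_doubles x y k s : (0 < x < 20)%N ->
  nv (run (CFor 20 y (cseq (nseq k (double x)))) s) x = ((2 ^ k) ^ nv s y * nv s x)%N.
Proof.
move=> /andP[x0 x20]; set body := cseq _.
have mE v : mask 20 v x = v x by rewrite /mask (_ : (x == 20) || (x == 21) = false) //; lia.
pose J i (_ : nat -> nat -> R) (v : nat -> nat) := v x = ((2 ^ k) ^ i * nv s x)%N.
suff : J (nv s y) (ra (run (CFor 20 y body) s)) (mask 20 (nv (run (CFor 20 y body) s))).
  by rewrite /J mE.
apply: run_for.
- by rewrite !inE !negb_or /=; apply: nassigned_doubles; lia.
- by rewrite /J mE mul1n.
- move=> i s' _; rewrite /J !mE => Ji _ _ _.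
  by rewrite run_doubles Ji expnS mulnA.
Qed.

Lemma run_loop_add x s : (0 < x < 20)%N ->
  nv (run (CFor 20 0 (CNat x (NPlus (NVar x) (NVar 0)))) s) x = (nv s x + nv s 0 * nv s 0)%N.
Proof.
move=> /andP[x0 x20]; set body := CNat _ _.
have mE v : mask 20 v x = v x by rewrite /mask (_ : (x == 20) || (x == 21) = false) //; lia.
pose J i (_ : nat -> nat -> R) (v : nat -> nat) := v x = (nv s x + i * nv s 0)%N.
suff : J (nv s 0) (ra (run (CFor 20 0 body) s)) (mask 20 (nv (run (CFor 20 0 body) s))).
  by rewrite /J mE.
apply: run_for.
- by rewrite !inE /=; lia.
- by rewrite /J mE mul0n addn0.
- move=> i s' _; rewrite /J !mE => Ji _ _ fr.
  by rewrite /body /= updE eqxx Ji fr ?inE /=; lia.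
Qed.

Fixpoint run_list (cs : seq cmd) s : store :=
  if cs is c :: cs' then run_list cs' (run c s) else s.

Fixpoint list_cost (cs : seq cmd) s : nat :=
  if cs is c :: cs' then (ccost (nv s) c + list_cost cs' (run c s))%N else 0%N.

Definition code (cs : seq cmd) : program := foldr (fun c p => Seq (ccomp c) p) Skip cs.

Lemma codeP cs s m : all wf cs -> rel s 0 noidx m ->
  exists t m', [/\ exec (code cs) m t m', rel (run_list cs s) 0 noidx m' &
    (t <= list_cost cs s)%N].
Proof.
elim: cs s m => [|c cs IH] s m /=; first by exists 0%N, m; split=> //; exact: ExecSkip.
move=> /andP[wc wcs] sm; have [t1 [m1 [x1 r1 l1]]] := ccompP wc sm.
have [t2 [m2 [x2 r2 l2]]] := IH _ _ wcs r1.
by exists (t1 + t2)%N, m2; split=> //; [exact: ExecSeq x1 x2|exact: leq_add].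
Qed.

Variables n r : nat.

Definition agrees (k : nat) (v : nat -> nat) : Prop := forall y, (y < k)%N -> v y = sizes n r y.

Lemma agrees_step k c s : agrees k (nv s) -> nv (run c s) k = sizes n r k ->
  all (fun x => k <= x)%N (nassigned c) -> agrees k.+1 (nv (run c s)).
Proof.
move=> ag ck /allP h y; rewrite ltnS leq_eqVlt => /orP[/eqP->//|yk].
by rewrite run_nv ?ag //; apply/negP => /h; rewrite leqNgt yk.
Qed.

Lemma agrees_cost k c v : agrees k v -> all (fun x => x < k)%N (bounds c) ->
  ccost v c = ccost (sizes n r) c.
Proof. by move=> ag /allP h; apply: ccost_ext => y /h; exact: ag. Qed.

Definition sets_up (k : nat) (cs : seq cmd) s : Prop :=
  [/\ agrees (k + size cs) (nv (run_list cs s)), ra (run_list cs s) = ra s &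
    list_cost cs s = (\sum_(c <- cs) ccost (sizes n r) c)%N].

(** Each command defines variable [k] with loops bounded by variables below [k], which already have
    their final values; so its cost can be read off the final sizes. *)
Lemma sets_up_cons k c cs s : agrees k (nv s) ->
  all (fun x => k <= x)%N (nassigned c) -> all (fun x => x < k)%N (bounds c) ->
  rassigned c = [::] -> nv (run c s) k = sizes n r k ->
  (agrees k.+1 (nv (run c s)) -> sets_up k.+1 cs (run c s)) -> sets_up k (c :: cs) s.
Proof.
move=> ag na bo rc ck /(_ (agrees_step ag ck na))[h1 h2 h3]; split.
- by rewrite [size _]/= addnS -addSn.
- rewrite -[LHS]/(ra (run_list cs (run c s))) h2.
  by apply: funext => a; rewrite run_ra // rc.
- by rewrite big_cons -h3 -(agrees_cost ag bo).
Qed.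

Lemma setupP s : nv s 0 = n -> nv s 1 = r -> sets_up 2 setup s.
Proof.
move=> s0 s1; have a2 : agrees 2 (nv s) by case=> [|[|//]].
clear s0 s1; rewrite /setup.
apply: sets_up_cons; [exact: a2|by []|by []|by []| |].
  by rewrite /= updE /= (a2 1%N); rewrite ?/sizes //=; clear; lia.
move: (run _ s) => {}s {}a2.
apply: sets_up_cons; [exact: a2|by []|by []|by []| |].
  by rewrite run_cseq run_doubles /= updE /= (a2 0%N).
move: (run _ s) => {}s {}a2.
apply: sets_up_cons; [exact: a2|by []|by []|by []| |].
  by rewrite run_seq run_loop_doubles // -[LHS]/((2 ^ 8) ^ nv s 1 * 2)%N (a2 1%N) // -expnM -expnSr.
move: (run _ s) => {}s {}a2.
apply: sets_up_cons; [exact: a2|by []|by []|by []| |].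
  by rewrite run_cseq run_doubles -[LHS]/(2 ^ 14 * nv s 2)%N (a2 2).
move: (run _ s) => {}s {}a2.
apply: sets_up_cons; [exact: a2|by []|by []|by []| |].
  by rewrite run_seq run_loop_doubles // -[LHS]/((2 ^ 2) ^ nv s 5 * 1)%N (a2 5) // muln1.
move: (run _ s) => {}s {}a2.
apply: sets_up_cons; [exact: a2|by []|by []|by []| |].
  by rewrite run_seq run_loop_add // /= !updE /= (a2 0%N).
move: (run _ s) => {}s {}a2.
apply: sets_up_cons; [exact: a2|by []|by []|by []| |].
  by rewrite run_seq run_loop_add // /= !updE /= (a2 0%N) // (a2 7) // /sizes /=; clear; lia.
move: (run _ s) => {}s {}a2.
by split=> //; rewrite big_nil.
Qed.

End Setup.

Lemma tame_sum (cs : seq cmd) :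
  tame (fun n r => \sum_(c <- cs) ccost (sizes n r) c)%N.
Proof.
elim: cs => [|c cs IH].
  by apply: tame_le (tame_const 0) => n r _; rewrite big_nil.
apply: tame_le (tameD (tame_ccost c) IH) => n r _.
by rewrite big_cons.
Qed.

Theorem theorem5p4 (R : realType) :
  exists2 C : R, 0 < C &
  exists (P : program) (K : nat),
  forall (n r : nat) (eps d lambda phi : R) (c delta : 'M[R]_n),
    0 < eps < 1 ->
    regular_graph c ->
    spectral_SSE_flow r d lambda c delta ->
    is_sparsest_value c phi ->
    d * lambda >= C / eps ^+ 2 * phi ->
    exists (t : nat) (s : state),
      [/\ exec P (input r eps c d lambda delta) t s,
          (t <= K * 2 ^ (K * r) * n ^ K)%N,
          is_cut (output n s)
        & sparsity c (output n s) <= (1 + eps) * phi].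
Proof.
exists (10 ^+ 9); first by rewrite exprn_gt0.
exists (Seq prologue (Seq (code setup) (Seq (ccomp main) epilogue))).
have tn := tame_size; have tc := tame_const.
have [K HK] : tame (fun n r => 100 * (n * n) + (\sum_(c <- setup) ccost (sizes n r) c +
    (ccost (sizes n r) main + (10 * n + 100))))%N.
  apply: tameD; first by apply: tameM; [exact: tc|exact: tameM].
  apply: tameD; first exact: tame_sum.
  apply: tameD; first exact: tame_ccost.
  by apply: tameD; [apply: tameM|].
exists K => n r eps d lambda phi c delta e01 reg flow sp hC.
have n1 : (1 < n)%N.
  have [[S cutS _] _] := sp; move: cutS; rewrite is_cut_card => /andP[S0 Sn].
  exact: leq_ltn_trans S0 Sn.
have [t1 [m1 [s1 [[x1 l1 r1 v0 v1] [i1 i2 i3 i4 i5]]]]] :=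
  prologueP r eps d lambda c delta (ltnW n1).
have [ag raE costE] := setupP v0 v1.
have [t2 [m2 [x2 r2 l2]]] := codeP setup_wf r1.
set s2 := run_list setup s1 in ag raE r2.
have [t3 [m3 [x3 r3 l3]]] := ccompP main_wf r2.
have ag' y : (y < 9)%N -> nv s2 y = sizes n r y by exact: ag.
have sz : sized n r (nv s2) by split; rewrite ag'.
have inp : inputs eps d lambda c delta (ra s2) by rewrite raE; split.
have [[S [cutS indS spS]] le] := mainP e01 n1 reg flow sp hC sz inp.
have n3 : nv (run main s2) 0 = n by rewrite run_nv // ag'.
have [t4 [m4 [x4 l4 out]]] := epilogueP r3 n3.
have outE : output n m4 = S.
  by apply/setP => i; rewrite inE out // indS; case: (i \in S); rewrite ?ltr01 ?ltxx.
exists (t1 + (t2 + (t3 + t4)))%N, m4; split.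
- by apply: ExecSeq x1 _; apply: ExecSeq x2 _; apply: ExecSeq x3 _.
- apply: leq_trans (HK n r (ltnW n1)); apply: leq_add => //.
  apply: leq_add; first by rewrite -costE.
  apply: leq_add => //; apply: leq_trans l3 _.
  rewrite (@agrees_cost n r 9) //; by vm_compute.
- by rewrite outE.
- by rewrite outE -spS.
Qed.
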